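(* Consider the functor $\mathbb P\to\mathbf{vect}$ sending the unique point to $\mathbb Q$ and the arrows $\pm1$ to $\pm\mathrm{Id}:\mathbb Q\to\mathbb Q$, and the functor $\mathbb P\to\mathbf{lin}^{\pm}$ sending the unique point to $\mathcal Z_{/\mathsf e}$ and the arrows $\pm1$ to the linear endofunctors of $\mathcal Z_{/\mathsf e}$ given by the scalars $1\leftarrow1\to1$ with $2$-cell $+1$, respectively $-1$. The cardinality functor $|\cdot|:\mathbf{lin}^{\pm}\to\mathbf{vect}$ is the unique finite-homotopy-sum preserving functor $\mathbf{lin}^{\pm}\to\mathbf{vect}$ making the triangle formed with $\mathbb P\to\mathbf{lin}^{\pm}$ and $\mathbb P\to\mathbf{vect}$ commute (up to natural isomorphism).
   Context: Let $O(1)=\{+1,-1\}$ and let $\mathbb P=BO(1)$ be the one-object groupoid with automorphism group $O(1)$. All groupoids are finite (finitely many isomorphism classes, finite hom sets), and slices, pullbacks, fibres, quotients and colimits are homotopy ones. $\mathcal F$ is the $2$-category of finite groupoids, functors and natural isomorphisms, and $\mathcal Z=\mathcal F_{/\mathbb P}$ is the weak slice. An object of $\mathcal Z$ is a groupoid $S$ with a parity structure, i.e. a functor $f:S\to\mathbb P$; it assigns to each arrow $a$ a parity $\mathrm{par}(a)\in\{\pm1\}$ (even $=+1$, odd $=-1$). $\mathsf e:1\to\mathbb P$ is the unique parity structure on the terminal groupoid. A point is orientable if it has no odd automorphism; $S^\circ\subset S$ is the full subgroupoid of orientable points. A $\mathbb P$-span from $f:S\to\mathbb P$ to $g:T\to\mathbb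 P$ is a span of groupoids $S\xleftarrow{p}M\xrightarrow{q}T$ with a natural isomorphism $\rho:f p\Rightarrow g q$, i.e. signs $\rho_x\in\{\pm1\}$ with $\mathrm{par}(p(a))\,\rho_{x'}=\rho_x\,\mathrm{par}(q(a))$ for each $a:x\to x'$ in $M$. An equivalence $(M,p,q,\rho)\to(N,p',q',\delta)$ is an equivalence of groupoids $u:M\to N$ with natural isomorphisms $\sigma:p\Rightarrow p'u$, $\tau:q\Rightarrow q'u$ such that $\rho_x\,\mathrm{par}(\tau_x)=\mathrm{par}(\sigma_x)\,\delta_{u(x)}$. Composition is by homotopy pullback, the sign of $(m,a:q(m)\to p'(n),n)$ being $\rho_m\,\mathrm{par}(a)\,\rho'_n$. A $\mathbb P$-span defines a linear functor $\mathcal Z_{/f}\to\mathcal Z_{/g}$, namely pullback along $p$ followed by composition with $q$. The bicategory $\mathbf{lin}^\pm$ has as objects the slices $\mathcal Z_{/S}:=\mathcal Z_{/f}$ for $f:S\to\mathbb P$ in $\mathcal Z$, as morphisms the linear functors given by $\mathbb P$-spans, and as $2$-cells the equivalences of $\mathbb P$-spans. $\mathbf{vect}$ is the ($1$-)category of (finite-dimensional) rational vector spaces. Finite homotopy sums are colimits indexed by finite groupoids. A scalar is a $\mathbb P$-span from $\mathsf e$ to $\mathsf e$; its groupoid splits by sign as $S=S_\oplus\sqcup S_\ominus$, and its cardinality is $|S_\oplus|-|S_\ominus|$, where $|S|=\sum_{s\in\pi_0S}1/|\mathrm{Aut}(s)|$ for a finite groupoid. The two-sided fibre ${}_iM_j$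 of a $\mathbb P$-span $I\xleftarrow{p}M\xrightarrow{q}J$ is the scalar with objects $(m,a:i\to p(m),b:q(m)\to j)$ and sign $\mathrm{par}(a)\rho_m\mathrm{par}(b)$. The cardinality functor sends $\mathcal Z_{/T}$ to $\mathbb Q_{\pi_0T^\circ}$, the vector space with one basis vector for each orientable component of $T$ (with a fixed choice of base point in each), and sends a $\mathbb P$-span $I\leftarrow M\to J$ to the linear map $\mathbb Q_{\pi_0I^\circ}\to\mathbb Q_{\pi_0J^\circ}$ given by the $\pi_0(I^\circ)$-by-$\pi_0(J^\circ)$ matrix with entries $|{}_iM_j|/|\mathrm{Aut}(j)|$ (at the chosen base points $i,j$). *)

(* Defs.v *)
From HB Require Import structures.
From mathcomp Require Import all_boot all_order all_algebra.

Set Implicit Arguments.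
Unset Strict Implicit.
Unset Printing Implicit Defensive.
Import Order.TTheory GRing.Theory Num.Theory.


(* The objects may form an arbitrary type; finiteness is witnessed by finite
   hom sets and a finite list [cover] meeting every isomorphism class.
   Composition is written in diagrammatic order. *)
Record gpd := Gpd {
  ob :> Type;
  hom : ob -> ob -> finType;
  idm : forall x, hom x x;
  cmp : forall x y z, hom x y -> hom y z -> hom x z;
  invm : forall x y, hom x y -> hom y x;
  cmpA : forall w x y z (f : hom w x) (g : hom x y) (h : hom y z),
    cmp f (cmp g h) = cmp (cmp f g) h;
  cmp1f : forall x y (f : hom x y), cmp (idm x) f = f;
  cmpf1 : forall x y (f : hom x y), cmp f (idm y) = f;
  cmpfV : forall x y (f : hom x y), cmp f (invm f) = idm x;
  cmpVf : forall x y (f : hom x y), cmp (invm f) f = idm y;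
  cover : seq ob;
  coverP : forall x, has (fun y => 0 < #|hom x y|) cover }.

Arguments hom {_} _ _.
Arguments idm {_} _.
Arguments cmp {_ _ _ _} _ _.
Arguments invm {_ _ _} _.

Declare Scope gpd_scope.
Delimit Scope gpd_scope with gpd.
Notation "f ;; g" := (cmp f g) (at level 50, left associativity) : gpd_scope.
Local Open Scope gpd_scope.

Fixpoint skeleton_of (G : gpd) (s : seq G) : seq G :=
  if s is x :: s' then
    if has (fun y => 0 < #|hom x y|) s' then skeleton_of s'
    else x :: skeleton_of s'
  else [::].
Definition skeleton (G : gpd) : seq G := skeleton_of (cover G).

(* The sum of 1/|Aut s| over the components lying in P; for P invariant under
   isomorphism this is the cardinality of the full subgroupoid on P. *)
Definition gcard (G : gpd) (P : pred G) : rat :=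
  (\sum_(s <- skeleton G | P s) (#|hom s s|%:R)^-1)%R.

Record functor (G H : gpd) := Functor {
  fob :> G -> H;
  fmap : forall x y, hom x y -> hom (fob x) (fob y);
  fmap1 : forall x, fmap (idm x) = idm (fob x);
  fmapM : forall x y z (f : hom x y) (g : hom y z),
    fmap (f ;; g) = fmap f ;; fmap g }.
Arguments fmap {_ _} _ {_ _} _.

Record natiso (G H : gpd) (F F' : functor G H) := Natiso {
  nat_at :> forall x, hom (F x) (F' x);
  nat_law : forall x y (f : hom x y),
    fmap F f ;; nat_at y = nat_at x ;; fmap F' f }.

Section GpdTheory.
Variable G : gpd.
Implicit Types x y z : G.

Lemma cmpKV x y z (f : hom y x) (g : hom y z) : f ;; (invm f ;; g) = g.
Proof. by rewrite cmpA cmpfV cmp1f. Qed.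
Lemma cmpVK x y z (f : hom x y) (g : hom y z) : invm f ;; (f ;; g) = g.
Proof. by rewrite cmpA cmpVf cmp1f. Qed.
Lemma cmpI x y z (f : hom x y) : injective (fun g : hom y z => f ;; g).
Proof. by move=> g h /(congr1 (cmp (invm f))); rewrite !cmpVK. Qed.
Lemma cmp_swap2 w x y z v (p : hom w x) (t : hom x y) (q : hom w z) (r : hom z y)
    (h : hom w v) :
  p ;; t = q ;; r -> invm p ;; h = t ;; (invm r ;; (invm q ;; h)).
Proof.
by move=> e; apply: (@cmpI _ _ _ p); rewrite cmpKV cmpA e -cmpA !cmpKV.
Qed.
Lemma cmp_swap2' w x y z (q : hom w x) (p : hom x y) (t : hom y z) (r : hom w z) :
  q ;; p ;; t = r -> forall v (h : hom w v), invm p ;; (invm q ;; h) = t ;; (invm r ;; h).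
Proof.
move=> <- v h; apply: (@cmpI _ _ _ p); apply: (@cmpI _ _ _ q).
by rewrite !cmpKV !cmpA -(cmpA _ (invm _)) cmpKV.
Qed.
Lemma cmp_ext2 v w x y z (f : hom v w) (p : hom w x) (t : hom x y) (q : hom w z)
    (r : hom z y) : p ;; t = q ;; r -> f ;; p ;; t = f ;; q ;; r.
Proof. by move=> e; rewrite -!cmpA e. Qed.
Lemma cmp_ext3 u v w x y (f : hom u v) (p : hom v w) (q : hom w x) (t : hom x y)
    (r : hom v y) : p ;; q ;; t = r -> f ;; p ;; q ;; t = f ;; r.
Proof. by move=> <-; rewrite !cmpA. Qed.
Lemma isoP x y : reflect (inhabited (hom x y)) (0 < #|hom x y|).
Proof.
apply: (iffP card_gt0P) => [[f _]|[f]]; first by exists.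
by exists f.
Qed.
End GpdTheory.

Definition fid (G : gpd) : functor G G :=
  @Functor G G (fun x => x) (fun _ _ f => f) (fun _ => erefl) (fun _ _ _ _ _ => erefl).

Section Fcomp.
Variables (G H K : gpd) (F : functor G H) (F' : functor H K).
Lemma fcomp1 x : fmap F' (fmap F (idm x)) = idm (F' (F x)).
Proof. by rewrite !fmap1. Qed.
Lemma fcompM x y z (f : hom x y) (g : hom y z) :
  fmap F' (fmap F (f ;; g)) = fmap F' (fmap F f) ;; fmap F' (fmap F g).
Proof. by rewrite !fmapM. Qed.
Definition fcomp : functor G K :=
  @Functor G K (fun x => F' (F x)) (fun _ _ f => fmap F' (fmap F f)) fcomp1 fcompM.
End Fcomp.

Record equivalence (G H : gpd) (F : functor G H) : Prop := Equivalence {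
  eq_faithful : forall x y, injective (@fmap G H F x y);
  eq_full : forall x y (g : hom (F x) (F y)), exists f, fmap F f = g;
  eq_esurj : forall y, exists x, inhabited (hom (F x) y) }.


Lemma fmapV (G H : gpd) (F : functor G H) (x y : G) (f : hom x y) :
  fmap F (invm f) = invm (fmap F f).
Proof. by apply: (@cmpI _ _ _ _ (fmap F f)); rewrite -fmapM !cmpfV fmap1. Qed.

Lemma natV (G H : gpd) (F F' : functor G H) (a : natiso F F') (x y : G) (f : hom x y) :
  invm (a x) ;; fmap F f = fmap F' f ;; invm (a y).
Proof.
apply: (@cmpI _ _ _ _ (a x)); rewrite cmpKV cmpA -nat_law -cmpA cmpfV.
by rewrite cmpf1.
Qed.

Lemma has_flatten (T : Type) (a : pred T) (ss : seq (seq T)) :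
  has a (flatten ss) = has (has a) ss.
Proof. by elim: ss => //= s ss IH; rewrite has_cat IH. Qed.


Section Pullback.
Variables (M N T : gpd) (F : functor M T) (G : functor N T).

Record hpob := HP { hp1 : M; hp2 : N; hpm : hom (F hp1) (G hp2) }.
Implicit Types r s t : hpob.

Record hphom s t := HPArr {
  arr1 : hom (hp1 s) (hp1 t);
  arr2 : hom (hp2 s) (hp2 t);
  arr_sq : hpm s ;; fmap G arr2 == fmap F arr1 ;; hpm t }.

Definition hphom_code s t (f : hphom s t) :
    {fg : (hom (hp1 s) (hp1 t) * hom (hp2 s) (hp2 t))%type
       | hpm s ;; fmap G fg.2 == fmap F fg.1 ;; hpm t} :=
  exist _ (arr1 f, arr2 f) (arr_sq f).
Definition hphom_decode s t (c : {fg : (hom (hp1 s) (hp1 t) * hom (hp2 s) (hp2 t))%type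
       | hpm s ;; fmap G fg.2 == fmap F fg.1 ;; hpm t}) : hphom s t :=
  HPArr (valP c).
Lemma hphom_codeK s t : cancel (@hphom_code s t) (@hphom_decode s t).
Proof. by case=> f g e; rewrite /hphom_decode; congr HPArr; exact: bool_irrelevance. Qed.

HB.instance Definition _ s t := Finite.copy (hphom s t) (can_type (@hphom_codeK s t)).

Definition hparr s t (f : hom (hp1 s) (hp1 t)) (g : hom (hp2 s) (hp2 t))
    (e : hpm s ;; fmap G g = fmap F f ;; hpm t) : hphom s t := HPArr (introT eqP e).

Lemma hphomP s t (f : hphom s t) : hpm s ;; fmap G (arr2 f) = fmap F (arr1 f) ;; hpm t.
Proof. exact: (eqP (arr_sq f)). Qed.

Lemma hpidP s : hpm s ;; fmap G (idm (hp2 s)) = fmap F (idm (hp1 s)) ;; hpm s.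
Proof. by rewrite !fmap1 cmp1f cmpf1. Qed.
Lemma hpcmpP r s t (f : hphom r s) (g : hphom s t) :
  hpm r ;; fmap G ((arr2 f) ;; (arr2 g)) = fmap F ((arr1 f) ;; (arr1 g)) ;; hpm t.
Proof. by rewrite !fmapM cmpA hphomP -cmpA hphomP cmpA. Qed.
Lemma hpinvP s t (f : hphom s t) :
  hpm t ;; fmap G (invm (arr2 f)) = fmap F (invm (arr1 f)) ;; hpm s.
Proof.
rewrite !fmapV; apply: (@cmpI _ _ _ _ (fmap F (arr1 f))).
by rewrite cmpKV cmpA -hphomP -cmpA cmpfV cmpf1.
Qed.

Definition hpid s : hphom s s := hparr (hpidP s).
Definition hpcmp r s t (f : hphom r s) (g : hphom s t) : hphom r t := hparr (hpcmpP f g).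
Definition hpinv s t (f : hphom s t) : hphom t s := hparr (hpinvP f).

Lemma hp_ext s t (f g : hphom s t) :
  (arr1 f) = (arr1 g) -> (arr2 f) = (arr2 g) -> f = g.
Proof.
move=> e1 e2; apply: (can_inj (@hphom_codeK s t)).
by apply: val_inj; rewrite /= e1 e2.
Qed.

Lemma hpcmpA q r s t (f : hphom q r) (g : hphom r s) (h : hphom s t) :
  hpcmp f (hpcmp g h) = hpcmp (hpcmp f g) h.
Proof. by apply: hp_ext; rewrite /= cmpA. Qed.
Lemma hpcmp1f s t (f : hphom s t) : hpcmp (hpid s) f = f.
Proof. by apply: hp_ext; rewrite /= cmp1f. Qed.
Lemma hpcmpf1 s t (f : hphom s t) : hpcmp f (hpid t) = f.
Proof. by apply: hp_ext; rewrite /= cmpf1. Qed.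
Lemma hpcmpfV s t (f : hphom s t) : hpcmp f (hpinv f) = hpid s.
Proof. by apply: hp_ext; rewrite /= cmpfV. Qed.
Lemma hpcmpVf s t (f : hphom s t) : hpcmp (hpinv f) f = hpid t.
Proof. by apply: hp_ext; rewrite /= cmpVf. Qed.

Definition hpcover : seq hpob :=
  flatten [seq flatten [seq [seq HP a | a <- enum (hom (F m) (G n))]
                       | n <- cover N] | m <- cover M].

Lemma hpcoverP s : has (fun t => 0 < #|{: hphom s t}|) hpcover.
Proof.
case: s => m n a; rewrite has_flatten has_map.
apply: sub_has (coverP m) => m' /isoP[f] /=.
rewrite has_flatten has_map; apply: sub_has (coverP n) => n' /isoP[g] /=.
rewrite has_map; apply/hasP; exists (invm (fmap F f) ;; a ;; fmap G g).
  by rewrite mem_enum.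
apply/card_gt0P.
have e : hpm (HP a) ;; fmap G g =
         fmap F f ;; hpm (HP (invm (fmap F f) ;; a ;; fmap G g)).
  by rewrite /= -!cmpA cmpKV.
by exists (@hparr (HP a) (HP (invm (fmap F f) ;; a ;; fmap G g)) f g e).
Qed.

Definition hpull : gpd :=
  @Gpd hpob (fun s t => hphom s t) hpid hpcmp hpinv hpcmpA hpcmp1f hpcmpf1 hpcmpfV hpcmpVf
    hpcover hpcoverP.

End Pullback.


(* Groupoids with a parity structure.  O(1) is written additively as (bool, (+)),
   with [true] for -1 (odd), so that [par] is a functor to the one-object
   groupoid BO(1).  An object f : S -> BO(1) also stands for the slice over it. *)
Record pgpd := PGpd {
  pg :> gpd;
  par : forall x y : pg, hom x y -> bool;
  parM : forall (x y z : pg) (f : hom x y) (g : hom y z),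
    par (f ;; g) = par f (+) par g }.
Arguments par {_ _ _} _.

Lemma par1 (S : pgpd) (x : S) : par (idm x) = false.
Proof. by have := parM (idm x) (idm x); rewrite cmp1f; case: par. Qed.
Lemma parV (S : pgpd) (x y : S) (f : hom x y) : par (invm f) = par f.
Proof. by have := parM f (invm f); rewrite cmpfV par1; do 2 case: par. Qed.

Definition orientable (S : pgpd) (x : S) : bool := [forall a : hom x x, ~~ par a].

Record span (S T : pgpd) := Span {
  apex :> gpd;
  lleg : functor apex S;
  rleg : functor apex T;
  sgn : apex -> bool;
  sgn_law : forall (x y : apex) (a : hom x y),
    par (fmap lleg a) (+) sgn y = sgn x (+) par (fmap rleg a) }.
Arguments sgn {_ _} _ _.

Record sequiv (S T : pgpd) (M N : span S T) := SEquiv {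
  eqF :> functor M N;
  eqFP : equivalence eqF;
  eql : natiso (lleg M) (fcomp eqF (lleg N));
  eqr : natiso (rleg M) (fcomp eqF (rleg N));
  eqs : forall x : M, sgn M x (+) par (eqr x) = par (eql x) (+) sgn N (eqF x) }.

(* Equivalences of spans are themselves compared up to isomorphism: this is the
   equality of 2-cells in the bicategory, and the isomorphisms are the third
   layer of the homotopy type of spans. *)
Record siso (S T : pgpd) (M N : span S T) (u v : sequiv M N) := SIso {
  siN :> natiso u v;
  sil : forall x : M, eql u x ;; fmap (lleg N) (siN x) = eql v x;
  sir : forall x : M, eqr u x ;; fmap (rleg N) (siN x) = eqr v x }.

Definition span_id (S : pgpd) : span S S :=
  @Span S S S (fid S) (fid S) (fun _ => false) (fun x y a => addbF (par a)).

Section Hcomp.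
Variables (S T U : pgpd) (M : span S T) (N : span T U).
Let P := hpull (rleg M) (lleg N).

Definition hpr1 : functor P M :=
  @Functor P M (fun t => hp1 t) (fun _ _ f => (arr1 f)) (fun _ => erefl)
    (fun _ _ _ _ _ => erefl).
Definition hpr2 : functor P N :=
  @Functor P N (fun t => hp2 t) (fun _ _ f => (arr2 f)) (fun _ => erefl)
    (fun _ _ _ _ _ => erefl).
Definition hcomp_sgn (t : P) := sgn M (hp1 t) (+) par (hpm t) (+) sgn N (hp2 t).
Lemma hcomp_law (s t : P) (f : hom s t) :
  par (fmap (fcomp hpr1 (lleg M)) f) (+) hcomp_sgn t =
  hcomp_sgn s (+) par (fmap (fcomp hpr2 (rleg N)) f).
Proof.
have := congr1 par (hphomP f); rewrite !parM /hcomp_sgn /=.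
have := sgn_law (arr1 f); have := sgn_law (arr2 f).
by move: (par _) (par _) (par _) (par _) (sgn _ _) (sgn _ _) (sgn _ _)
  (sgn _ _) (par _) (par _); do 10 case.
Qed.
Definition hcomp : span S U := @Span S U P _ _ _ hcomp_law.
End Hcomp.
Notation "M ** N" := (hcomp M N) (at level 42, left associativity) : gpd_scope.

Definition glue (S T U : pgpd) (M : span S T) (N : span T U) (m : M) (n : N)
  (a : hom (rleg M m) (lleg N n)) : M ** N := HP a.
Arguments glue {S T U M N} m n a.

Definition garr (S T U : pgpd) (M : span S T) (N : span T U) (s t : M ** N)
  (f : hom (hp1 s) (hp1 t)) (g : hom (hp2 s) (hp2 t))
  (e : hpm s ;; fmap (lleg N) g = fmap (rleg M) f ;; hpm t) : hom s t := hparr e.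
Arguments garr {S T U M N} s t f g e.

Lemma glue_ext (S T U : pgpd) (M : span S T) (N : span T U) (s t : M ** N)
  (f g : hom s t) : (arr1 f) = (arr1 g) -> (arr2 f) = (arr2 g) -> f = g.
Proof. exact: hp_ext. Qed.

Lemma equivalence_comp (G H K : gpd) (F : functor G H) (F' : functor H K) :
  equivalence F -> equivalence F' -> equivalence (fcomp F F').
Proof.
move=> [i1 f1 e1] [i2 f2 e2]; split=> [x y f g /= /i2 /i1 //|x y g|z].
  by have [g' <-] := f2 _ _ g; have [f <-] := f1 _ _ g'; exists f.
have [y [b]] := e2 z; have [x [a]] := e1 y.
by exists x; split; exact: (fmap F' a ;; b).
Qed.

Section Vcomp.
Variables (S T : pgpd) (M N K : span S T) (u : sequiv M N) (v : sequiv N K).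
Let w := fcomp u v.
Lemma vcomp_l_law (x y : M) (f : hom x y) :
  fmap (lleg M) f ;; (eql u y ;; eql v (u y)) =
  (eql u x ;; eql v (u x)) ;; fmap (fcomp w (lleg K)) f.
Proof. by rewrite cmpA nat_law -!cmpA (nat_law (eql v)). Qed.
Lemma vcomp_r_law (x y : M) (f : hom x y) :
  fmap (rleg M) f ;; (eqr u y ;; eqr v (u y)) =
  (eqr u x ;; eqr v (u x)) ;; fmap (fcomp w (rleg K)) f.
Proof. by rewrite cmpA nat_law -!cmpA (nat_law (eqr v)). Qed.
Definition vcomp_l : natiso (lleg M) (fcomp w (lleg K)) := @Natiso _ _ (lleg M) (fcomp w (lleg K)) (fun x => eql u x ;; eql v (u x)) vcomp_l_law.
Definition vcomp_r : natiso (rleg M) (fcomp w (rleg K)) := @Natiso _ _ (rleg M) (fcomp w (rleg K)) (fun x => eqr u x ;; eqr v (u x)) vcomp_r_law.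
Lemma vcomp_s (x : M) :
  sgn M x (+) par (vcomp_r x) = par (vcomp_l x) (+) sgn K (w x).
Proof.
have := eqs u x; have := eqs v (u x); rewrite /= !parM.
by move: (par _) (par _) (par _) (par _) (sgn _ _) (sgn _ _) (sgn _ _); do 7 case.
Qed.
Definition vcomp : sequiv M K :=
  SEquiv (equivalence_comp (eqFP u) (eqFP v)) vcomp_s.
End Vcomp.

Section Lwhisk.
Variables (S T U : pgpd) (M : span S T) (N N' : span T U) (v : sequiv N N').
Definition lwhisk_ob (t : M ** N) : M ** N' :=
  glue (hp1 t) (v (hp2 t)) (hpm t ;; eql v (hp2 t)).
Lemma lwhisk_mapP (s t : M ** N) (f : hom s t) :
  hpm (lwhisk_ob s) ;; fmap (lleg N') (fmap v (arr2 f)) =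
  fmap (rleg M) (arr1 f) ;; hpm (lwhisk_ob t).
Proof. by rewrite /= -cmpA -(nat_law (eql v)) !cmpA hphomP. Qed.
Definition lwhisk_map (s t : M ** N) (f : hom s t) : hom (lwhisk_ob s) (lwhisk_ob t) :=
  garr (lwhisk_ob s) (lwhisk_ob t) (arr1 f) (fmap v (arr2 f)) (lwhisk_mapP f).
Lemma lwhisk_map1 t : lwhisk_map (idm t) = idm (lwhisk_ob t).
Proof. by apply: glue_ext => //=; rewrite fmap1. Qed.
Lemma lwhisk_mapM r s t (f : hom r s) (g : hom s t) :
  lwhisk_map (f ;; g) = lwhisk_map f ;; lwhisk_map g.
Proof. by apply: glue_ext => //=; rewrite fmapM. Qed.
Definition lwhiskF : functor (M ** N) (M ** N') := Functor lwhisk_map1 lwhisk_mapM.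
Lemma lwhiskFP : equivalence lwhiskF.
Proof.
have [vi vf ve] := eqFP v; split=> [s t f g e|s t g|[m n a]].
- apply: glue_ext; first exact: (congr1 (fun f => (arr1 f)) e).
  by apply: vi; exact: (congr1 (fun f => (arr2 f)) e).
- have [g2 e2] := vf _ _ (arr2 g); have := hphomP g; rewrite -e2 /= => e.
  have e' : hpm s ;; fmap (lleg N) g2 = fmap (rleg M) (arr1 g) ;; hpm t.
    move/(congr1 (fun z => z ;; invm (eql v (hp2 t)))): e.
    rewrite -!cmpA cmpfV cmpf1 => <-.
    by rewrite -[fmap _ (fmap _ _)](nat_law (eql v) g2) || rewrite (cmpA (eql v _)) -(nat_law (eql v)) -cmpA cmpfV cmpf1.
  by exists (garr s t (arr1 g) g2 e'); apply: (@glue_ext _ _ _ M N').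
- have [n' [b]] := ve n.
  pose a' := a ;; invm (fmap (lleg N') b) ;; invm (eql v n').
  exists (glue m n' a'); split.
  have e : hpm (lwhiskF (glue m n' a')) ;; fmap (lleg N') b =
           fmap (rleg M) (idm m) ;; a.
    by rewrite /= /a' fmap1 cmp1f -!cmpA (cmpA (invm (eql v _))) cmpVf cmp1f cmpVf cmpf1.
  exact: (garr (lwhiskF (glue m n' a')) (glue m n a : M ** N') (idm m) b e).
Qed.
Lemma lwhisk_l_law (s t : M ** N) (f : hom s t) :
  fmap (lleg (M ** N)) f ;; idm (lleg (M ** N) t) =
  idm (lleg (M ** N) s) ;; fmap (fcomp lwhiskF (lleg (M ** N'))) f.
Proof. by rewrite cmp1f cmpf1. Qed.
Lemma lwhisk_r_law (s t : M ** N) (f : hom s t) :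
  fmap (rleg (M ** N)) f ;; eqr v (hp2 t) =
  eqr v (hp2 s) ;; fmap (fcomp lwhiskF (rleg (M ** N'))) f.
Proof. exact: (nat_law (eqr v)). Qed.
Definition lwhisk_l : natiso (lleg (M ** N)) (fcomp lwhiskF (lleg (M ** N'))) :=
  @Natiso _ _ (lleg (M ** N)) (fcomp lwhiskF (lleg (M ** N'))) (fun _ => idm _) lwhisk_l_law.
Definition lwhisk_r : natiso (rleg (M ** N)) (fcomp lwhiskF (rleg (M ** N'))) :=
  @Natiso _ _ (rleg (M ** N)) (fcomp lwhiskF (rleg (M ** N'))) (fun t => eqr v (hp2 t)) lwhisk_r_law.
Lemma lwhisk_s (t : M ** N) :
  sgn (M ** N) t (+) par (lwhisk_r t) = par (lwhisk_l t) (+) sgn (M ** N') (lwhiskF t).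
Proof.
have := eqs v (hp2 t); rewrite /= /hcomp_sgn /= par1 !parM.
by move: (par _) (par _) (par _) (sgn _ _) (sgn _ _) (sgn _ _); do 6 case.
Qed.
Definition lwhisk : sequiv (M ** N) (M ** N') := SEquiv lwhiskFP lwhisk_s.
End Lwhisk.

Section Rwhisk.
Variables (S T U : pgpd) (M M' : span S T) (u : sequiv M M') (N : span T U).
Definition rwhisk_ob (t : M ** N) : M' ** N :=
  glue (u (hp1 t)) (hp2 t) (invm (eqr u (hp1 t)) ;; hpm t).
Lemma rwhisk_mapP (s t : M ** N) (f : hom s t) :
  hpm (rwhisk_ob s) ;; fmap (lleg N) (arr2 f) =
  fmap (rleg M') (fmap u (arr1 f)) ;; hpm (rwhisk_ob t).
Proof. by rewrite /= -cmpA hphomP !cmpA (natV (eqr u)). Qed.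
Definition rwhisk_map (s t : M ** N) (f : hom s t) : hom (rwhisk_ob s) (rwhisk_ob t) :=
  garr (rwhisk_ob s) (rwhisk_ob t) (fmap u (arr1 f)) (arr2 f) (rwhisk_mapP f).
Lemma rwhisk_map1 t : rwhisk_map (idm t) = idm (rwhisk_ob t).
Proof. by apply: glue_ext => //=; rewrite fmap1. Qed.
Lemma rwhisk_mapM r s t (f : hom r s) (g : hom s t) :
  rwhisk_map (f ;; g) = rwhisk_map f ;; rwhisk_map g.
Proof. by apply: glue_ext => //=; rewrite fmapM. Qed.
Definition rwhiskF : functor (M ** N) (M' ** N) := Functor rwhisk_map1 rwhisk_mapM.
Lemma rwhiskFP : equivalence rwhiskF.
Proof.
have [ui uf ue] := eqFP u; split=> [s t f g e|s t g|[m n a]].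
- apply: glue_ext; last exact: (congr1 (fun f => (arr2 f)) e).
  by apply: ui; exact: (congr1 (fun f => (arr1 f)) e).
- have [g1 e1] := uf _ _ (arr1 g); have := hphomP g; rewrite -e1 /= => e.
  have e' : hpm s ;; fmap (lleg N) (arr2 g) = fmap (rleg M) g1 ;; hpm t.
    move: e; rewrite cmpA -(natV (eqr u)) -!cmpA.
    exact: cmpI.
  by exists (garr s t g1 (arr2 g) e'); apply: (@glue_ext _ _ _ M' N).
- have [m' [b]] := ue m.
  pose a' := eqr u m' ;; fmap (rleg M') b ;; a.
  exists (glue m' n a'); split.
  have e : hpm (rwhiskF (glue m' n a')) ;; fmap (lleg N) (idm n) = fmap (rleg M') b ;; a.
    by rewrite /= /a' fmap1 cmpf1 -!cmpA cmpVK.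
  exact: (garr (rwhiskF (glue m' n a')) (glue m n a : M' ** N) b (idm n) e).
Qed.
Lemma rwhisk_l_law (s t : M ** N) (f : hom s t) :
  fmap (lleg (M ** N)) f ;; eql u (hp1 t) =
  eql u (hp1 s) ;; fmap (fcomp rwhiskF (lleg (M' ** N))) f.
Proof. exact: (nat_law (eql u)). Qed.
Lemma rwhisk_r_law (s t : M ** N) (f : hom s t) :
  fmap (rleg (M ** N)) f ;; idm (rleg (M ** N) t) =
  idm (rleg (M ** N) s) ;; fmap (fcomp rwhiskF (rleg (M' ** N))) f.
Proof. by rewrite cmp1f cmpf1. Qed.
Definition rwhisk_l : natiso (lleg (M ** N)) (fcomp rwhiskF (lleg (M' ** N))) :=
  @Natiso _ _ (lleg (M ** N)) (fcomp rwhiskF (lleg (M' ** N))) (fun t => eql u (hp1 t)) rwhisk_l_law.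
Definition rwhisk_r : natiso (rleg (M ** N)) (fcomp rwhiskF (rleg (M' ** N))) :=
  @Natiso _ _ (rleg (M ** N)) (fcomp rwhiskF (rleg (M' ** N))) (fun _ => idm _) rwhisk_r_law.
Lemma rwhisk_s (t : M ** N) :
  sgn (M ** N) t (+) par (rwhisk_r t) = par (rwhisk_l t) (+) sgn (M' ** N) (rwhiskF t).
Proof.
have := eqs u (hp1 t); rewrite /= /hcomp_sgn /= par1 !parM parV.
by move: (par _) (par _) (par _) (sgn _ _) (sgn _ _) (sgn _ _); do 6 case.
Qed.
Definition rwhisk : sequiv (M ** N) (M' ** N) := SEquiv rwhiskFP rwhisk_s.
End Rwhisk.

Section Assoc.
Variables (S T U V : pgpd) (M : span S T) (N : span T U) (K : span U V).
Let A := M ** N ** K.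
Let B := M ** (N ** K).
Definition assoc_ob (t : A) : B :=
  glue (hp1 (hp1 t)) (glue (hp2 (hp1 t)) (hp2 t) (hpm t) : N ** K) (hpm (hp1 t)).
Lemma assoc_mapP2 (s t : A) (f : hom s t) :
  hpm (hp2 (assoc_ob s)) ;; fmap (lleg K) (arr2 f) =
  fmap (rleg N) (arr2 (arr1 f)) ;; hpm (hp2 (assoc_ob t)).
Proof. exact: (hphomP f). Qed.
Definition assoc_map2 (s t : A) (f : hom s t) : hom (hp2 (assoc_ob s)) (hp2 (assoc_ob t)) :=
  garr (hp2 (assoc_ob s) : N ** K) (hp2 (assoc_ob t) : N ** K) (arr2 (arr1 f)) (arr2 f)
    (assoc_mapP2 f).
Lemma assoc_mapP (s t : A) (f : hom s t) :
  hpm (assoc_ob s) ;; fmap (lleg (N ** K)) (assoc_map2 f) =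
  fmap (rleg M) (arr1 (arr1 f)) ;; hpm (assoc_ob t).
Proof. exact: (hphomP (arr1 f)). Qed.
Definition assoc_map (s t : A) (f : hom s t) : hom (assoc_ob s) (assoc_ob t) :=
  garr (assoc_ob s) (assoc_ob t) (arr1 (arr1 f))
    (assoc_map2 f) (assoc_mapP f).
Lemma assoc_map1 t : assoc_map (idm t) = idm (assoc_ob t).
Proof. by apply: glue_ext => //; apply: glue_ext. Qed.
Lemma assoc_mapM r s t (f : hom r s) (g : hom s t) :
  assoc_map (f ;; g) = assoc_map f ;; assoc_map g.
Proof. by apply: glue_ext => //; apply: glue_ext. Qed.
Definition assocF : functor A B := Functor assoc_map1 assoc_mapM.
Lemma assocFP : equivalence assocF.
Proof.
split=> [s t f g e|s t g|[m [n k b] a]].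
- apply: glue_ext; last first.
    exact: (congr1 (fun h : hom (assoc_ob s) (assoc_ob t) => arr2 (arr2 h)) e).
  apply: glue_ext.
    exact: (congr1 (fun h : hom (assoc_ob s) (assoc_ob t) => arr1 h) e).
  exact: (congr1 (fun h : hom (assoc_ob s) (assoc_ob t) => arr1 (arr2 h)) e).
- have e1 : hpm (hp1 s) ;; fmap (lleg N) (arr1 (arr2 g)) =
            fmap (rleg M) (arr1 g) ;; hpm (hp1 t) := hphomP g.
  have e2 : hpm s ;; fmap (lleg K) (arr2 (arr2 g)) =
            fmap (rleg (M ** N)) (garr (hp1 s) (hp1 t) (arr1 g) (arr1 (arr2 g)) e1) ;; hpm t := hphomP (arr2 g).
  by exists (garr s t (garr (hp1 s) (hp1 t) _ _ e1) _ e2); apply: glue_ext => //; apply: glue_ext.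
- exists (glue (glue m n a : M ** N) k b).
  by split; exact: (idm (_ : B)).
Qed.
Lemma assoc_l_law (s t : A) (f : hom s t) :
  fmap (lleg A) f ;; idm (lleg A t) = idm (lleg A s) ;; fmap (fcomp assocF (lleg B)) f.
Proof. by rewrite cmp1f cmpf1. Qed.
Lemma assoc_r_law (s t : A) (f : hom s t) :
  fmap (rleg A) f ;; idm (rleg A t) = idm (rleg A s) ;; fmap (fcomp assocF (rleg B)) f.
Proof. by rewrite cmp1f cmpf1. Qed.
Definition assoc_l : natiso (lleg A) (fcomp assocF (lleg B)) :=
  @Natiso _ _ (lleg A) (fcomp assocF (lleg B)) (fun _ => idm _) assoc_l_law.
Definition assoc_r : natiso (rleg A) (fcomp assocF (rleg B)) :=
  @Natiso _ _ (rleg A) (fcomp assocF (rleg B)) (fun _ => idm _) assoc_r_law.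
Lemma assoc_s (t : A) :
  sgn A t (+) par (assoc_r t) = par (assoc_l t) (+) sgn B (assocF t).
Proof. by rewrite /= !par1 addbF /= /hcomp_sgn /= /hcomp_sgn !addbA. Qed.
Definition assoc : sequiv A B := SEquiv assocFP assoc_s.
End Assoc.

Section Lunit.
Variables (S T : pgpd) (M : span S T).
Let A := span_id S ** M.
Definition lunitF : functor A M := hpr2 (span_id S) M.
Lemma lunitFP : equivalence lunitF.
Proof.
split=> [s t f g e|s t g|m].
- have e2 : arr2 f = arr2 g := e.
  have e1 (h : hom s t) : arr1 h = hpm s ;; fmap (lleg M) (arr2 h) ;; invm (hpm t).
    by rewrite hphomP -cmpA cmpfV cmpf1.
  by apply: glue_ext => //; rewrite !e1 e2.
- pose f := hpm s ;; fmap (lleg M) g ;; invm (hpm t).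
  have e : hpm s ;; fmap (lleg M) g = fmap (rleg (span_id S)) f ;; hpm t.
    by rewrite /= /f -!cmpA cmpVf cmpf1.
  by exists (garr s t f g e).
- by exists (glue (lleg M m : span_id S) m (idm (lleg M m)));
     split; exact: idm.
Qed.
Lemma lunit_l_law (s t : A) (f : hom s t) :
  fmap (lleg A) f ;; hpm t = hpm s ;; fmap (fcomp lunitF (lleg M)) f.
Proof. by rewrite (hphomP f). Qed.
Lemma lunit_r_law (s t : A) (f : hom s t) :
  fmap (rleg A) f ;; idm (rleg A t) = idm (rleg A s) ;; fmap (fcomp lunitF (rleg M)) f.
Proof. by rewrite cmp1f cmpf1. Qed.
Definition lunit_l : natiso (lleg A) (fcomp lunitF (lleg M)) :=
  @Natiso _ _ (lleg A) (fcomp lunitF (lleg M)) (fun t => hpm t) lunit_l_law.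
Definition lunit_r : natiso (rleg A) (fcomp lunitF (rleg M)) :=
  @Natiso _ _ (rleg A) (fcomp lunitF (rleg M)) (fun _ => idm _) lunit_r_law.
Lemma lunit_s (t : A) :
  sgn A t (+) par (lunit_r t) = par (lunit_l t) (+) sgn M (lunitF t).
Proof. by rewrite /= par1 addbF. Qed.
Definition lunit : sequiv A M := SEquiv lunitFP lunit_s.
End Lunit.

Section Runit.
Variables (S T : pgpd) (M : span S T).
Let A := M ** span_id T.
Definition runitF : functor A M := hpr1 M (span_id T).
Lemma runitFP : equivalence runitF.
Proof.
split=> [s t f g e|s t f|m].
- have e1 : arr1 f = arr1 g := e.
  have e2 (h : hom s t) : arr2 h = invm (hpm s) ;; (fmap (rleg M) (arr1 h) ;; hpm t).
    by rewrite -hphomP cmpVK.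
  by apply: glue_ext => //; rewrite !e2 e1.
- pose g := invm (hpm s) ;; (fmap (rleg M) f ;; hpm t).
  have e : hpm s ;; fmap (lleg (span_id T)) g = fmap (rleg M) f ;; hpm t.
    by rewrite /= /g cmpKV.
  by exists (garr s t f g e).
- by exists (glue m (rleg M m : span_id T) (idm (rleg M m)));
     split; exact: idm.
Qed.
Lemma runit_l_law (s t : A) (f : hom s t) :
  fmap (lleg A) f ;; idm (lleg A t) = idm (lleg A s) ;; fmap (fcomp runitF (lleg M)) f.
Proof. by rewrite cmp1f cmpf1. Qed.
Lemma runit_r_law (s t : A) (f : hom s t) :
  fmap (rleg A) f ;; invm (hpm t) = invm (hpm s) ;; fmap (fcomp runitF (rleg M)) f.
Proof.
apply: (@cmpI _ _ _ _ (hpm s)); rewrite cmpKV cmpA.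
by rewrite [X in X ;; _](hphomP f) -cmpA cmpfV cmpf1.
Qed.
Definition runit_l : natiso (lleg A) (fcomp runitF (lleg M)) :=
  @Natiso _ _ (lleg A) (fcomp runitF (lleg M)) (fun _ => idm _) runit_l_law.
Definition runit_r : natiso (rleg A) (fcomp runitF (rleg M)) :=
  @Natiso _ _ (rleg A) (fcomp runitF (rleg M)) (fun t => invm (hpm t)) runit_r_law.
Lemma runit_s (t : A) :
  sgn A t (+) par (runit_r t) = par (runit_l t) (+) sgn M (runitF t).
Proof. by rewrite /= par1 /= /hcomp_sgn /= addbF parV addbK. Qed.
Definition runit : sequiv A M := SEquiv runitFP runit_s.
End Runit.


(* A functor from a finite groupoid I to the bicategory is a pseudofunctor; the
   constraint [dcmp] is indexed by a commuting triangle.  Since I is a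
   groupoid, the spans [dmap a] are invertible, their legs are equivalences, and
   there is at most one [siso] between parallel equivalences into them; hence
   [dassoc], [dunitl] and [dunitr] are equalities of 2-cells rather than extra
   data, and are subject to no further coherence. *)
Record diagram (I : gpd) := Diagram {
  dob :> I -> pgpd;
  dmap : forall i j, hom i j -> span (dob i) (dob j);
  dcmp : forall i j k (a : hom i j) (b : hom j k) (c : hom i k),
    a ;; b = c -> sequiv (dmap a ** dmap b) (dmap c);
  dunit : forall i, sequiv (span_id (dob i)) (dmap (idm i));
  dassoc : forall i j k l (a : hom i j) (b : hom j k) (c : hom k l),
    siso (vcomp (rwhisk (dcmp (erefl (a ;; b))) (dmap c)) (dcmp (erefl (a ;; b ;; c))))
         (vcomp (assoc _ _ _)
            (vcomp (lwhisk (dmap a) (dcmp (erefl (b ;; c)))) (dcmp (cmpA a b c))));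
  dunitl : forall i j (a : hom i j),
    siso (vcomp (rwhisk (dunit i) (dmap a)) (dcmp (cmp1f a))) (lunit (dmap a));
  dunitr : forall i j (a : hom i j),
    siso (vcomp (lwhisk (dmap a) (dunit j)) (dcmp (cmpf1 a))) (runit (dmap a)) }.
Arguments dmap {_} _ {_ _} _.
Arguments dcmp {_} _ {_ _ _ _ _ _} _.
Arguments dassoc {_} _ {_ _ _ _} _ _ _.

(* A cocone with vertex T.  [ccoh] compares the two ways of absorbing a pair of
   composable arrows; it is subject to [cocone_law] below.  There are no unit
   constraints: as all cells involved are invertible, they are determined by the
   remaining data. *)
Record cocone_data (I : gpd) (D : diagram I) (T : pgpd) := CoconeData {
  cob :> forall i, span (D i) T;
  cact : forall i j (a : hom i j), sequiv (dmap D a ** cob j) (cob i);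
  ccoh : forall i j k (a : hom i j) (b : hom j k) (c : hom i k) (e : a ;; b = c),
    siso (vcomp (assoc _ _ _) (vcomp (lwhisk (dmap D a) (cact b)) (cact a)))
         (vcomp (rwhisk (dcmp D e) (cob k)) (cact c)) }.
Arguments cact {_ _ _} _ {_ _} _.
Arguments ccoh {_ _ _} _ {_ _ _ _ _ _} _.

Section GlueEq.
Variables (S T U : pgpd) (M : span S T) (N : span T U) (m : M) (n : N).
Variables (a b : hom (rleg M m) (lleg N n)) (e : a = b).
Lemma glue_eqP : a ;; fmap (lleg N) (idm n) = fmap (rleg M) (idm m) ;; b.
Proof. by rewrite !fmap1 cmp1f cmpf1. Qed.
Definition glue_eq : hom (glue m n a : M ** N) (glue m n b : M ** N) :=
  garr (glue m n a) (glue m n b) (idm m) (idm n) glue_eqP.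
End GlueEq.

(* The coherence of [ccoh] for three composable arrows a, b, c: at a point
   (x, y, z, m) of the iterated composite, the two ways of passing from
   a.(b.(c.m)) to ((ab)c).m agree. *)
Section CoconeLaw.
Variables (I : gpd) (D : diagram I) (T : pgpd) (X : cocone_data D T).
Variables (i j k l : I) (a : hom i j) (b : hom j k) (c : hom k l).
Variables (x : dmap D a) (y : dmap D b) (z : dmap D c) (m : X l).
Variables (f : hom (rleg _ x) (lleg _ y)) (g : hom (rleg _ y) (lleg _ z))
  (h : hom (rleg _ z) (lleg _ m)).

Let ab := dcmp D (erefl (a ;; b)).
Let bc := dcmp D (erefl (b ;; c)).
Let ab_c := dcmp D (erefl (a ;; b ;; c)).
Let a_bc := dcmp D (cmpA a b c).
Let xy : dmap D a ** dmap D b := glue x y f.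
Let yz : dmap D b ** dmap D c := glue y z g.
Let zm : dmap D c ** X l := glue z m h.
Let xy_z : dmap D (a ;; b) ** dmap D c := glue (ab xy) z (invm (eqr ab xy) ;; g).
Let x_yz : dmap D a ** dmap D (b ;; c) := glue x (bc yz) (f ;; eql bc yz).
Let yz_m : dmap D (b ;; c) ** X l := glue (bc yz) m (invm (eqr bc yz) ;; h).
Let y_zm : dmap D b ** X k := glue y (cact X c zm) (g ;; eql (cact X c) zm).

Let s1 : dmap D (a ;; b ;; c) ** X l :=
  glue (ab_c xy_z) m (invm (eqr ab_c xy_z) ;; h).
Let t1 : dmap D (a ;; b ;; c) ** X l :=
  glue (a_bc x_yz) m (invm (eqr a_bc x_yz) ;; (invm (eqr bc yz) ;; h)).
Lemma cocone_assocP :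
  hpm s1 ;; fmap (lleg (X l)) (idm m) =
  fmap (rleg _) (dassoc D a b c (glue xy z g)) ;; hpm t1.
Proof.
have : idm _ ;; eqr ab_c xy_z ;; fmap (rleg _) (dassoc D a b c (glue xy z g)) =
       idm _ ;; (eqr bc yz ;; eqr a_bc x_yz) := sir (dassoc D a b c) (glue xy z g).
rewrite !cmp1f => /cmp_swap2 e; rewrite fmap1 cmpf1; exact: e.
Qed.
Definition cocone_assoc : hom s1 t1 :=
  garr s1 t1 (dassoc D a b c (glue xy z g)) (idm m) cocone_assocP.

Let s2 : dmap D a ** X j := glue x (cact X b y_zm) (f ;; eql (cact X b) y_zm).
Let t2 : dmap D a ** X j :=
  glue x (cact X (b ;; c) yz_m) (f ;; eql bc yz ;; eql (cact X (b ;; c)) yz_m).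
Lemma cocone_innerP :
  hpm s2 ;; fmap (lleg (X j)) (ccoh X (erefl (b ;; c)) (glue yz m h)) =
  fmap (rleg (dmap D a)) (idm x) ;; hpm t2.
Proof.
have : idm _ ;; (idm _ ;; eql (cact X b) y_zm) ;;
    fmap (lleg _) (ccoh X (erefl (b ;; c)) (glue yz m h)) =
    eql bc yz ;; eql (cact X (b ;; c)) yz_m := sil (ccoh X (erefl (b ;; c))) (glue yz m h).
rewrite !cmp1f => e; rewrite fmap1 cmp1f; exact: (cmp_ext2 f e).
Qed.
Definition cocone_inner : hom s2 t2 :=
  garr s2 t2 (idm x) (ccoh X (erefl (b ;; c)) (glue yz m h)) cocone_innerP.

Definition cocone_law_at : Prop :=
  ccoh X (erefl (a ;; b)) (glue xy (cact X c zm) (g ;; eql (cact X c) zm))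
    ;; fmap (cact X (a ;; b))
         (glue_eq (cmpA (invm (eqr ab xy)) g (eql (cact X c) zm)))
    ;; ccoh X (erefl (a ;; b ;; c)) (glue xy_z m h)
    ;; fmap (cact X (a ;; b ;; c)) cocone_assoc
  = fmap (cact X a) cocone_inner
    ;; ccoh X (cmpA a b c) (glue x_yz m (invm (eqr bc yz) ;; h)).
End CoconeLaw.

Definition cocone_law (I : gpd) (D : diagram I) (T : pgpd) (X : cocone_data D T) : Prop :=
  forall i j k l (a : hom i j) (b : hom j k) (c : hom k l)
    (x : dmap D a) (y : dmap D b) (z : dmap D c) (m : X l)
    (f : hom (rleg _ x) (lleg _ y)) (g : hom (rleg _ y) (lleg _ z))
    (h : hom (rleg _ z) (lleg _ m)), cocone_law_at f g h.

Record cocone (I : gpd) (D : diagram I) (T : pgpd) := Cocone {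
  cdata :> cocone_data D T;
  claw : cocone_law cdata }.

(* A factorization of the cocone Y through the cocone X: a span N between the
   vertices, with equivalences of X i ** N with Y i, coherently natural in i. *)
Record factor_data (I : gpd) (D : diagram I) (C T : pgpd)
    (X : cocone D C) (Y : cocone D T) := FactorData {
  fmed :> span C T;
  fw : forall i, sequiv (X i ** fmed) (Y i);
  fnat : forall i j (a : hom i j),
    siso (vcomp (rwhisk (cact X a) fmed) (fw i))
         (vcomp (assoc _ _ _) (vcomp (lwhisk (dmap D a) (fw j)) (cact Y a))) }.
Arguments fw {_ _ _ _ _ _} _ _.
Arguments fnat {_ _ _ _ _ _} _ {_ _} _.

Section FactorLaw.
Variables (I : gpd) (D : diagram I) (C T : pgpd) (X : cocone D C) (Y : cocone D T).
Variable F : factor_data X Y.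
Variables (i j k : I) (a : hom i j) (b : hom j k).
Variables (x : dmap D a) (y : dmap D b) (m : X k) (n : F).
Variables (f : hom (rleg _ x) (lleg _ y)) (g : hom (rleg _ y) (lleg _ m))
  (h : hom (rleg _ m) (lleg _ n)).

Let ab := dcmp D (erefl (a ;; b)).
Let xy : dmap D a ** dmap D b := glue x y f.
Let ym : dmap D b ** X k := glue y m g.
Let mn : X k ** F := glue m n h.
Let y_mn : dmap D b ** Y k := glue y (fw F k mn) (g ;; eql (fw F k) mn).
Let x_ym : dmap D a ** X j := glue x (cact X b ym) (f ;; eql (cact X b) ym).
Let xy_m : dmap D (a ;; b) ** X k := glue (ab xy) m (invm (eqr ab xy) ;; g).
Let ym_n : X j ** F := glue (cact X b ym) n (invm (eqr (cact X b) ym) ;; h).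

Let s1 : X i ** F :=
  glue (cact X a x_ym) n (invm (eqr (cact X a) x_ym) ;; (invm (eqr (cact X b) ym) ;; h)).
Let t1 : X i ** F :=
  glue (cact X (a ;; b) xy_m) n (invm (eqr (cact X (a ;; b)) xy_m) ;; h).
Lemma factor_cohP :
  hpm s1 ;; fmap (lleg F) (idm n) =
  fmap (rleg (X i)) (ccoh X (erefl (a ;; b)) (glue xy m g)) ;; hpm t1.
Proof.
have : idm _ ;; (eqr (cact X b) ym ;; eqr (cact X a) x_ym) ;;
    fmap (rleg _) (ccoh X (erefl (a ;; b)) (glue xy m g)) =
    idm _ ;; eqr (cact X (a ;; b)) xy_m := sir (ccoh X (erefl (a ;; b))) (glue xy m g).
rewrite !cmp1f => e; rewrite fmap1 cmpf1; exact: (cmp_swap2' e h).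
Qed.
Definition factor_coh : hom s1 t1 :=
  garr s1 t1 (ccoh X (erefl (a ;; b)) (glue xy m g)) (idm n) factor_cohP.

Let s2 : dmap D a ** Y j :=
  glue x (fw F j ym_n) (f ;; eql (cact X b) ym ;; eql (fw F j) ym_n).
Let t2 : dmap D a ** Y j := glue x (cact Y b y_mn) (f ;; eql (cact Y b) y_mn).
Lemma factor_innerP :
  hpm s2 ;; fmap (lleg (Y j)) (fnat F b (glue ym n h)) =
  fmap (rleg (dmap D a)) (idm x) ;; hpm t2.
Proof.
have : eql (cact X b) ym ;; eql (fw F j) ym_n ;;
    fmap (lleg _) (fnat F b (glue ym n h)) =
    idm _ ;; (idm _ ;; eql (cact Y b) y_mn) := sil (fnat F b) (glue ym n h).
rewrite !cmp1f => e; rewrite fmap1 cmp1f; exact: (cmp_ext3 f e).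
Qed.
Definition factor_inner : hom s2 t2 :=
  garr s2 t2 (idm x) (fnat F b (glue ym n h)) factor_innerP.

Definition factor_law_at : Prop :=
  fmap (fw F i) factor_coh
    ;; fnat F (a ;; b) (glue xy_m n h)
  = fnat F a (glue x_ym n (invm (eqr (cact X b) ym) ;; h))
    ;; fmap (cact Y a) factor_inner
    ;; ccoh Y (erefl (a ;; b)) (glue xy (fw F k mn) (g ;; eql (fw F k) mn))
    ;; fmap (cact Y (a ;; b)) (glue_eq (cmpA (invm (eqr ab xy)) g (eql (fw F k) mn))).
End FactorLaw.

Definition factor_law (I : gpd) (D : diagram I) (C T : pgpd)
    (X : cocone D C) (Y : cocone D T) (F : factor_data X Y) : Prop :=
  forall i j k (a : hom i j) (b : hom j k)
    (x : dmap D a) (y : dmap D b) (m : X k) (n : F)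
    (f : hom (rleg _ x) (lleg _ y)) (g : hom (rleg _ y) (lleg _ m))
    (h : hom (rleg _ m) (lleg _ n)), factor_law_at f g h.

Record factor (I : gpd) (D : diagram I) (C T : pgpd)
    (X : cocone D C) (Y : cocone D T) := Factor {
  fdata :> factor_data X Y;
  flaw : factor_law fdata }.

Record factor_map_data (I : gpd) (D : diagram I) (C T : pgpd)
    (X : cocone D C) (Y : cocone D T) (F G : factor X Y) := FactorMapData {
  fmu :> sequiv F G;
  fmw : forall i, siso (fw F i) (vcomp (lwhisk (X i) fmu) (fw G i)) }.
Arguments fmw {_ _ _ _ _ _ _ _} _ _.

Section FactorMapLaw.
Variables (I : gpd) (D : diagram I) (C T : pgpd) (X : cocone D C) (Y : cocone D T).
Variables (F G : factor X Y) (u : factor_map_data F G).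
Variables (i j : I) (a : hom i j) (x : dmap D a) (m : X j) (n : F).
Variables (f : hom (rleg _ x) (lleg _ m)) (g : hom (rleg _ m) (lleg _ n)).

Let xm : dmap D a ** X j := glue x m f.
Let mn : X j ** F := glue m n g.
Let mun : X j ** G := glue m (u n) (g ;; eql u n).

Let s : dmap D a ** Y j := glue x (fw F j mn) (f ;; eql (fw F j) mn).
Let t : dmap D a ** Y j := glue x (fw G j mun) (f ;; eql (fw G j) mun).
Lemma factor_map_innerP :
  hpm s ;; fmap (lleg (Y j)) (fmw u j mn) = fmap (rleg (dmap D a)) (idm x) ;; hpm t.
Proof.
have /= := sil (fmw u j) mn.
by rewrite fmap1 !cmp1f -!cmpA => ->.
Qed.
Definition factor_map_inner : hom s t :=
  garr s t (idm x) (fmw u j mn) factor_map_innerP.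

Definition factor_map_law_at : Prop :=
  fnat F a (glue xm n g) ;; fmap (cact Y a) factor_map_inner
  = fmw u i (glue (cact X a xm) n (invm (eqr (cact X a) xm) ;; g))
    ;; fmap (fw G i) (glue_eq (esym (cmpA (invm (eqr (cact X a) xm)) g (eql u n))))
    ;; fnat G a (glue xm (u n) (g ;; eql u n)).
End FactorMapLaw.

Record factor_map (I : gpd) (D : diagram I) (C T : pgpd)
    (X : cocone D C) (Y : cocone D T) (F G : factor X Y) := FactorMap {
  fmdata :> factor_map_data F G;
  fmlaw : forall i j (a : hom i j) (x : dmap D a) (m : X j) (n : F)
    (f : hom (rleg _ x) (lleg _ m)) (g : hom (rleg _ m) (lleg _ n)),
    factor_map_law_at fmdata f g }.

Section FactorMapIso.
Variables (I : gpd) (D : diagram I) (C T : pgpd) (X : cocone D C) (Y : cocone D T).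
Variables (F G : factor X Y) (u v : factor_map F G) (th : siso u v).

Section At.
Variables (i : I) (m : X i) (n : F) (f : hom (rleg _ m) (lleg _ n)).
Let s : X i ** G := glue m (u n) (f ;; eql u n).
Let t : X i ** G := glue m (v n) (f ;; eql v n).
Lemma factor_map_isoP :
  hpm s ;; fmap (lleg G) (th n) = fmap (rleg (X i)) (idm m) ;; hpm t.
Proof. by rewrite fmap1 cmp1f /= -cmpA (sil th). Qed.
Definition factor_map_iso_arr : hom s t := garr s t (idm m) (th n) factor_map_isoP.
End At.

Definition is_factor_map_iso : Prop :=
  forall i (m : X i) (n : F) (f : hom (rleg _ m) (lleg _ n)),
    fmw u i (glue m n f) ;; fmap (fw G i) (factor_map_iso_arr f) = fmw v i (glue m n f).
End FactorMapIso.

(* X is a homotopy colimit cocone: the 2-groupoid of factorizations through X of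
   any cocone Y is contractible.  It is the homotopy fibre over Y of composition
   with X, from the 2-groupoid of spans C -> T to that of cocones with vertex T.
   (Truncating spans at equivalences up to isomorphism would be too coarse: a
   groupoid over BG is not determined by the action of G on its fibre up to
   isomorphism of functors.) *)
Definition is_hocolim (I : gpd) (D : diagram I) (C : pgpd) (X : cocone D C) : Prop :=
  forall (T : pgpd) (Y : cocone D T),
    [/\ inhabited (factor X Y),
        forall F G : factor X Y, inhabited (factor_map F G)
      & forall (F G : factor X Y) (u v : factor_map F G),
          exists2 th : siso u v, is_factor_map_iso th
            & forall th' : siso u v, is_factor_map_iso th' -> forall n, th' n = th n].


Local Open Scope ring_scope.

(* The object and arrow parts of a functor to vect; [functorial] is functoriality
   with values in a 1-category, equivalent spans being sent to equal maps. *)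
Record prefunctor := Prefunctor {
  vob :> pgpd -> vectType rat;
  vmap : forall S T, span S T -> 'Hom(vob S, vob T) }.
Arguments vmap _ {_ _} _.

Record functorial (F : prefunctor) : Prop := Functorial {
  vmap_equiv : forall S T (M N : span S T), sequiv M N -> vmap F M = vmap F N;
  vmap_id : forall S, vmap F (span_id S) = \1%VF;
  vmap_comp : forall S T U (M : span S T) (N : span T U),
    vmap F (M ** N) = (vmap F N \o vmap F M)%VF }.

Definition preserves_hosums (F : prefunctor) : Prop :=
  forall (I : gpd) (D : diagram I) (C : pgpd) (X : cocone D C), is_hocolim X ->
  forall (W : vectType rat) (g : forall i, 'Hom(F (D i), W)),
    (forall i j (a : hom i j), (g j \o vmap F (dmap D a))%VF = g i) ->
    exists! h : 'Hom(F C, W), forall i, (h \o vmap F (X i))%VF = g i.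

Definition lin_iso (V W : vectType rat) (h : 'Hom(V, W)) : Prop :=
  exists g : 'Hom(W, V), (g \o h)%VF = \1%VF /\ (h \o g)%VF = \1%VF.

Definition naturally_isomorphic (F G : prefunctor) : Prop :=
  exists2 eta : forall S, 'Hom(F S, G S), forall S, lin_iso (eta S)
    & forall S T (M : span S T), (eta T \o vmap F M)%VF = (vmap G M \o eta S)%VF.

Lemma unit_coverP (x : unit) : has (fun=> 0 < #|{: unit}|)%N [:: tt].
Proof. by rewrite /= card_unit. Qed.

Definition unit_gpd : gpd :=
  @Gpd unit (fun _ _ => unit : finType) (fun _ => tt) (fun _ _ _ _ _ => tt)
    (fun _ _ _ => tt) (fun _ _ _ _ _ _ _ => erefl)
    (fun _ _ f => let: tt := f in erefl) (fun _ _ f => let: tt := f in erefl)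
    (fun _ _ _ => erefl) (fun _ _ _ => erefl) [:: tt] unit_coverP.

Definition unit_pgpd : pgpd := @PGpd unit_gpd (fun _ _ _ => false) (fun _ _ _ _ _ => erefl).

(* The scalar 1 <- 1 -> 1 with 2-cell (-1)^b. *)
Definition scalar (b : bool) : span unit_pgpd unit_pgpd :=
  @Span unit_pgpd unit_pgpd unit_gpd (fid _) (fid _) (fun _ => b) (fun _ _ _ => esym (addbF b)).

(* The triangle under BO(1) commutes up to natural isomorphism: its two sides send
   the point to F Z_{/e} and to Q, and the arrow b to the maps compared below. *)
Definition triangle (F : prefunctor) : Prop :=
  exists2 h : 'Hom(rat^o, F unit_pgpd), lin_iso h
    & forall b : bool,
        (vmap F (scalar b) \o h)%VF = (h \o ((-1) ^+ b *: \1%VF))%VF.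

Definition scalar_card (M : span unit_pgpd unit_pgpd) : rat :=
  gcard (fun m : M => ~~ sgn M m) - gcard (fun m : M => sgn M m).

Section Points.
Variables (S : pgpd) (s : S).
Let pt : functor unit_gpd S :=
  @Functor unit_gpd S (fun _ => s) (fun _ _ _ => idm s) (fun _ => erefl)
    (fun _ _ _ _ _ => esym (cmp1f (idm s))).
Definition point : span unit_pgpd S :=
  @Span unit_pgpd S unit_gpd (fid _) pt (fun _ => false) (fun _ _ _ => esym (par1 s)).
Definition copoint : span S unit_pgpd :=
  @Span S unit_pgpd unit_gpd pt (fid _) (fun _ => false)
    (fun _ _ _ => etrans (addbF _) (par1 s)).
End Points.

(* Its objects are the triples (m, i -> p m, q m -> j), up to unit components. *)
Definition fibre2 (S T : pgpd) (M : span S T) (i : S) (j : T) : span unit_pgpd unit_pgpd :=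
  point i ** M ** copoint j.

Definition base_points (S : pgpd) : seq S := [seq s <- skeleton S | orientable s].
Definition base_point (S : pgpd) (k : 'I_(size (base_points S))) : S :=
  tnth (in_tuple (base_points S)) k.

Definition card_mx (S T : pgpd) (M : span S T) :
    'M[rat]_(size (base_points S), size (base_points T)) :=
  \matrix_(k, l) (scalar_card (fibre2 M (base_point k) (base_point l))
                  / #|hom (base_point l) (base_point l)|%:R).

(* Vectors are rows, so the matrix of a map acts on the right. *)
Definition cardinality : prefunctor :=
  @Prefunctor (fun S => 'rV[rat]_(size (base_points S)))
    (fun S T M => linfun (mulmxr (card_mx M))).

(* Main.v *)
(* Cardinality is computed by the signed counts [entry M i j]; [gsum w] is the sum
   of w(x)/|Aut x| over the components of a groupoid, and it turns homotopy
   pullbacks into iterated sums, whence functoriality.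

   Homotopy sums.  Let X be a homotopy colimit of D, indexed by I, with vertex C.
   The universal property is tested against three kinds of cocones: the sum over
   a : i -> i0 of the spans D a, with vertex D i0 [represented]; the spans X i with
   i recorded, with vertex C x I [graded]; and the multiples t i x X i for a finite
   I-set t, with vertex C [copies].  They yield P i0 : C -> D i0 and Phi : C -> C x I.
   Both Phi ** counting t and P i0 ** X i0 factor copies of X when t = hom(-, i0),
   and both Phi ** counting t and the identity do when t is a point, so they are
   equivalent.  The entries of [counting t] at (c, j) are |t j| times those of the
   identity, and the sum of |hom(j, i0)|/|Aut i0| over the components of I is 1;
   hence the sum of |X i0| |P i0|/|Aut i0| is the identity, and a compatible family
   g extends only to, and indeed to, the sum of g i0 |P i0|/|Aut i0|.

   Uniqueness.  Every S is the homotopy colimit over itself of its points, so a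
   functor as in the statement is determined on objects by its value at the unit.
   A span from the unit to T with apex M factors through M with trivial parity,
   which again is the colimit of its points; so its image is the combination of
   the points rleg x of T with weights (-1)^(sgn x)/|Aut x|, the sets of arrows in M
   being counted by writing a finite set as a colimit over a discrete groupoid. *)

Require Import Defs.
From mathcomp Require Import all_boot all_order all_algebra.
From HB Require Import structures.
From Stdlib Require ClassicalEpsilon.
Import Defs.

Set Implicit Arguments.
Unset Strict Implicit.
Unset Printing Implicit Defensive.
Import Order.TTheory GRing.Theory Num.Theory.

Local Open Scope ring_scope.
Local Open Scope gpd_scope.

(** * Sums over groupoids *)

(** The vertex C of a homotopy colimit is known only through its universal property, which produces
    spans out of C. The inverse of the canonical map is therefore not read off from a model of C but
    assembled from images of factorizations. The spans [P i0] alone do not show that their weighted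
    sum is the identity: this compares maps out of C whose multiplicity at X i varies with i. [Phi]
    keeps the index, so that such a multiplicity t becomes a count over C x I, depending linearly on
    the numbers |t j|. The division by |Aut i0| averages over I and is where rational coefficients
    enter.

    The cost lies in coherence: factorizations can be compared only when they factor the same
    cocone, cells and laws included. Hence each test cocone, each test factorization and the
    composite of two factorizations carries its law. Three devices keep these laws short: equations
    between gluing arrows are hypotheses, cells in a discrete groupoid agree automatically, and
    cells over a faithful leg are compared after that leg. *)

Section Gsum.
Variable G : gpd.
Implicit Types (x y z : G) (L : seq G) (w : G -> rat).

Definition iso x y := (0 < #|hom x y|)%N.

Lemma iso_sym x y : iso x y = iso y x.
Proof. by apply/isoP/isoP=> -[f]; split; apply: invm. Qed.

Lemma iso_trans y x z : iso x y -> iso y z -> iso x z.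
Proof. by move=> /isoP[f] /isoP[g]; apply/isoP; split; apply: cmp f g. Qed.

Definition cmp_left x y z (f : hom x y) : hom y z -> hom x z := cmp f.

Lemma cmp_left_bij x y z (f : hom x y) : bijective (@cmp_left x y z f).
Proof.
by exists (cmp (invm f)) => g; rewrite /cmp_left ?cmpVK ?cmpKV.
Qed.

Definition cmp_right x y z (g : hom y z) : hom x y -> hom x z := cmp^~ g.

Lemma cmp_right_bij x y z (g : hom y z) : bijective (@cmp_right x y z g).
Proof.
by exists (cmp^~ (invm g)) => f; rewrite /cmp_right -cmpA ?cmpfV ?cmpVf cmpf1.
Qed.

Lemma card_hom_left x y z : hom x y -> #|hom x z| = #|hom y z|.
Proof. by move=> f; have /bij_eq_card := @cmp_left_bij _ _ z f. Qed.

Lemma card_hom_right x y z : hom y z -> #|hom x y| = #|hom x z|.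
Proof. by move=> g; have /bij_eq_card := @cmp_right_bij x _ _ g. Qed.

Lemma card_aut_neq0 x : #|hom x x|%:R != 0 :> rat.
Proof. by rewrite pnatr_eq0 -lt0n; apply/isoP; split; apply: idm. Qed.

Lemma all_skeleton_of (p : pred G) L : all p L -> all p (skeleton_of L).
Proof.
by elim: L => //= x L IH /andP[px pL]; case: ifP => _ /=; rewrite ?px IH.
Qed.

Lemma has_iso x y L : iso x y -> has (iso x) L = has (iso y) L.
Proof.
move=> xy; apply: eq_has => z; apply/idP/idP; apply: iso_trans => //.
by rewrite iso_sym.
Qed.

Lemma has_skeleton_of x L : has (iso x) L -> has (iso x) (skeleton_of L).
Proof.
elim: L => //= y L IH; case: ifP => yL /= /orP[xy|xL].
- by apply: IH; rewrite (has_iso _ xy).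
- exact: IH.
- by rewrite xy.
- by rewrite IH ?orbT.
Qed.

Lemma has_skeleton x : has (iso x) (skeleton G).
Proof. exact: has_skeleton_of (coverP x). Qed.

Lemma pairwise_skeleton : pairwise (fun x y => ~~ iso x y) (skeleton G).
Proof.
rewrite /skeleton; elim: (cover G) => //= x L IH; case: ifP => //= xL.
rewrite IH andbT; apply: all_skeleton_of; rewrite all_predC.
exact: negbT xL.
Qed.

Definition invariant w := forall x y, hom x y -> w x = w y.

Definition gsum w : rat := \sum_(s <- skeleton G) w s / #|hom s s|%:R.

Lemma eq_gsum w w' : w =1 w' -> gsum w = gsum w'.
Proof. by move=> e; apply: eq_bigr => s _; rewrite e. Qed.

Lemma gsum_sum (J : Type) (r : seq J) (P : pred J) (w : J -> G -> rat) :
  gsum (fun x => \sum_(j <- r | P j) w j x) = \sum_(j <- r | P j) gsum (w j).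
Proof. by rewrite exchange_big; apply: eq_bigr => s _; rewrite mulr_suml. Qed.

Lemma gsumZ c w : gsum (fun x => c * w x) = c * gsum w.
Proof. by rewrite mulr_sumr; apply: eq_bigr => s _; rewrite mulrA. Qed.

Lemma gsumZr c w : gsum (fun x => w x * c) = gsum w * c.
Proof. by rewrite mulrC -gsumZ; apply: eq_gsum => x; rewrite mulrC. Qed.

(** Exactly one member s of the skeleton is isomorphic to x, and for it |hom s x| = |Aut s|; the
    other hom sets are empty. Values lie in a module because the formula is also applied to linear
    maps. *)
Lemma skeleton_sum (V : lmodType rat) (w : G -> V) x :
  (forall s, hom s x -> w s = w x) ->
  \sum_(s <- skeleton G) (#|hom s x|%:R / #|hom s s|%:R) *: w s = w x.
Proof.
move=> winv; have := has_skeleton x; have := pairwise_skeleton.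
elim: (skeleton G) => //= s L IH /andP[sL pL]; rewrite big_cons.
have noniso y : ~~ iso x y -> (#|hom y x|%:R / #|hom y y|%:R) *: w y = 0.
  by rewrite iso_sym /iso lt0n negbK => /eqP ->; rewrite mul0r scale0r.
have [xs _|xs /= xL] := boolP (iso x s); last by rewrite noniso // add0r IH.
(* A further member isomorphic to x would be isomorphic to s, against [sL]. *)
have -> : \sum_(t <- L) (#|hom t x|%:R / #|hom t t|%:R) *: w t = 0.
  elim: L sL {IH pL} => [|t L IH] /=; first by rewrite big_nil.
  move=> /andP[st sL]; rewrite big_cons IH // addr0 noniso //.
  by apply: contraNN st; apply: iso_trans; rewrite iso_sym.
have /isoP[f] := xs; rewrite -(card_hom_right s (invm f)).
by rewrite divff ?card_aut_neq0 // scale1r addr0 winv //; exact: invm f.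
Qed.

Lemma gsum_hom w x : invariant w -> gsum (fun s => w s * #|hom s x|%:R) = w x.
Proof.
move=> winv; rewrite -[RHS](@skeleton_sum rat^o w x) => [|s f]; last exact: winv f.
by apply: eq_bigr => s _; rewrite -mulrA mulrC.
Qed.

(** An invariant function is a combination of the functions |hom s -|, so a linear functional is
    pinned down by its value 1 on these. Change of variables and the Fubini formulas all follow from
    this, and no skeleton has to be compared with another. *)
Lemma gsum_uniq (Lam : (G -> rat) -> rat) :
  (forall w w', w =1 w' -> Lam w = Lam w') ->
  (forall L (c : G -> rat) (w : G -> G -> rat),
    Lam (fun x => \sum_(s <- L) c s * w s x) = \sum_(s <- L) c s * Lam (w s)) ->
  (forall s, Lam (fun x => #|hom s x|%:R) = 1) ->
  forall w, invariant w -> Lam w = gsum w.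
Proof.
move=> ext lin one w winv.
rewrite (ext _ (fun x => \sum_(s <- skeleton G) (w s / #|hom s s|%:R) * #|hom s x|%:R)).
  by rewrite lin; apply: eq_bigr => s _; rewrite one mulr1.
move=> x; rewrite -{1}(gsum_hom x winv); apply: eq_bigr => s _.
by rewrite mulrAC.
Qed.

Lemma invmK x y (f : hom x y) : invm (invm f) = f.
Proof. by apply: (@cmpI _ _ _ _ (invm f)); rewrite cmpfV cmpVf. Qed.

Lemma card_hom_sym x y : #|hom x y| = #|hom y x|.
Proof.
by apply: (@bij_eq_card _ _ (@invm G x y)); exists (@invm G y x) => f; rewrite invmK.
Qed.

Lemma gsum_card_hom s : gsum (fun x => #|hom s x|%:R) = 1.
Proof.
rewrite -[RHS](gsum_hom (w := fun=> 1) s) //.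
by apply: eq_gsum => x; rewrite mul1r card_hom_sym.
Qed.

(** The groupoid of arrows out of s is contractible, with [idm s] as a point; by invariance every
    arrow a : s -> x contributes [v s (idm s)]. *)
Lemma gsum_delta s (v : forall x, hom s x -> rat) :
  (forall x y (a : hom s x) (f : hom x y), v x a = v y (a ;; f)) ->
  gsum (fun x => \sum_(a : hom s x) v x a) = v s (idm s).
Proof.
move=> vinv.
transitivity (gsum (fun x => v s (idm s) * #|hom s x|%:R)).
  apply: eq_gsum => x; rewrite mulr_natr -sumr_const; apply: eq_bigr => a _.
  by rewrite (vinv _ _ _ a) cmp1f.
by rewrite gsumZ gsum_card_hom mulr1.
Qed.
End Gsum.

Lemma gsum_equivalence (G H : gpd) (F : functor G H) (w : H -> rat) :
  equivalence F -> invariant w -> gsum (fun x => w (F x)) = gsum w.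
Proof.
move=> eF winv.
apply: (@gsum_uniq H (fun w => gsum (fun x => w (F x)))) => //.
- by move=> v v' e; apply: eq_gsum => x.
- move=> L c v; rewrite gsum_sum; apply: eq_bigr => s _; exact: gsumZ.
(* With F x isomorphic to s and F fully faithful, |hom s (F y)| = |hom x y|. *)
move=> s; have [x [f]] := eq_esurj eF s; rewrite -[RHS](gsum_card_hom x).
apply: eq_gsum => y; congr (_%:R); rewrite -(card_hom_left _ f); apply/esym.
apply: (@bij_eq_card _ _ (@fmap _ _ F x y)).
apply: inj_card_bij; first exact: eq_faithful.
rewrite -(card_codom (@eq_faithful _ _ _ eF x y)).
apply: subset_leq_card; apply/subsetP => g _.
by have [g' <-] := eq_full eF g; apply: codom_f.
Qed.

Lemma gsum_hpull (M N T : gpd) (F : functor M T) (G : functor N T)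
    (w : hpull F G -> rat) : invariant w ->
  gsum w = gsum (fun m : M => gsum (fun n : N =>
    \sum_(a : hom (F m) (G n)) w (HP a))).
Proof.
move=> winv; apply/esym.
apply: (@gsum_uniq (hpull F G) (fun w => gsum (fun m : M => gsum (fun n : N =>
    \sum_(a : hom (F m) (G n)) w (HP a))))) => //.
- move=> v v' e; apply: eq_gsum => m; apply: eq_gsum => n.
  by apply: eq_bigr => a _.
- move=> L c v; under eq_gsum => m.
    under eq_gsum => n do rewrite exchange_big /=.
    rewrite gsum_sum; over.
  rewrite gsum_sum; apply: eq_bigr => s _.
  rewrite -gsumZ; apply: eq_gsum => m.
  by rewrite -gsumZ; apply: eq_gsum => n; rewrite mulr_sumr.
case=> m0 n0 a0.
rewrite -[RHS](gsum_card_hom m0); apply: eq_gsum => m.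
transitivity (gsum (fun n => #|hom m0 m|%:R * #|hom n0 n|%:R : rat)).
  apply: eq_gsum => n; rewrite -natr_sum -natrM; congr (_%:R).
  (* A pair (f, g) of arrows out of m0 and n0 is an arrow from (m0, n0, a0) to (m, n, a) for exactly
     one a, so the hom sets for the various a partition the product. *)
  rewrite -card_prod -sum1_card.
  rewrite (partition_big (fun fg : (hom m0 m * hom n0 n)%type =>
     invm (fmap F fg.1) ;; (a0 ;; fmap G fg.2)) xpredT) //=.
  apply: eq_bigr => a _; rewrite sum1_card.
  have code_bij : bijective (@hphom_code _ _ _ F G (HP a0) (HP a)).
    exists (@hphom_decode _ _ _ F G _ _); first exact: hphom_codeK.
    by case=> -[f g] e; apply: val_inj.
  apply: etrans (bij_eq_card code_bij) _; rewrite card_sig.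
  apply: eq_card => fg; rewrite !inE /=.
  by apply/eqP/eqP=> [->|<-]; rewrite ?cmpKV ?cmpVK.
under eq_gsum => n do rewrite mulrC.
by rewrite gsumZr gsum_card_hom mul1r.
Qed.

Lemma gsum_exchange (G H : gpd) (w : G -> H -> rat) :
  gsum (fun x => gsum (w x)) = gsum (fun y => gsum (w^~ y)).
Proof.
rewrite /gsum; under eq_bigr do rewrite mulr_suml.
rewrite exchange_big; apply: eq_bigr => y _; rewrite mulr_suml.
by apply: eq_bigr => x _; rewrite mulrAC.
Qed.

(** * Functoriality and the triangle *)

(** Over a fixed m the two-sided fibre is a set of pairs (a, b), counted here with signs; the
    automorphisms of m are taken care of by [gsum]. *)
Definition entry_at (S T : pgpd) (M : span S T) (i : S) (j : T) (m : M) : rat :=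
  \sum_(a : hom i (lleg M m)) \sum_(b : hom (rleg M m) j)
    (-1) ^+ (par a (+) sgn M m (+) par b).

Definition entry (S T : pgpd) (M : span S T) (i : S) (j : T) : rat :=
  gsum (entry_at i j : M -> rat).

Section Entry.
Variables (S T : pgpd) (M : span S T).
Implicit Types (i : S) (j : T) (m : M).

Lemma entry_at_invariant i j : invariant (entry_at i j : M -> rat).
Proof.
move=> m m' f; rewrite /entry_at.
rewrite [RHS](reindex _ (onW_bij _ (@cmp_right_bij _ i _ _ (fmap (lleg M) f)))).
apply: eq_bigr => a _.
rewrite [LHS](reindex _ (onW_bij _ (@cmp_left_bij _ _ _ j (fmap (rleg M) f)))).
apply: eq_bigr => b _; rewrite /cmp_left /cmp_right !parM.
have := sgn_law f; move: (par _) (par _) (par _) (par _) (sgn _ _) (sgn _ _).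
by do 6 case.
Qed.

Lemma entry_right i j j' (f : hom j j') : entry M i j' = entry M i j * (-1) ^+ par f.
Proof.
rewrite -gsumZr; apply: eq_gsum => m; rewrite /entry_at mulr_suml.
apply: eq_bigr => a _; rewrite mulr_suml.
rewrite (reindex _ (onW_bij _ (@cmp_right_bij _ (rleg M m) _ _ f))).
by apply: eq_bigr => b _; rewrite /cmp_right parM -signr_addb !addbA.
Qed.

Lemma sign_odd_eq0 (x : rat) : x = (-1) ^+ true * x -> x = 0.
Proof.
by rewrite expr1 mulN1r => /eqP; rewrite -addr_eq0 -mulr2n mulrn_eq0 => /eqP.
Qed.

(** An odd automorphism of j permutes the arrows into j and reverses their signs, so the entry
    equals its opposite. This is why matrices indexed by orientable components alone compose
    correctly. *)
Lemma entry_right_eq0 i j : ~~ orientable j -> entry M i j = 0.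
Proof.
rewrite negb_forall => /existsP[a]; rewrite negbK => odd_a.
by apply: sign_odd_eq0; rewrite -[in RHS]odd_a mulrC -entry_right.
Qed.
End Entry.

Lemma gsum_sign (G : gpd) (s : G -> bool) :
  gcard (fun x => ~~ s x) - gcard s = gsum (fun x => (-1) ^+ s x).
Proof.
rewrite /gcard /gsum (bigID s xpredT) /= addrC -sumrN.
rewrite [X in X + _ = _]big_mkcond [X in _ + X = _]big_mkcond.
rewrite [X in _ = X + _]big_mkcond [X in _ = _ + X]big_mkcond /=.
by rewrite -!big_split /=; apply: eq_bigr => x _; case: (s x); rewrite /= ?mulN1r ?mul1r ?addr0 ?add0r.
Qed.

Lemma sgn_invariant (M : span unit_pgpd unit_pgpd) :
  invariant (fun x : M => (-1) ^+ sgn M x : rat).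
Proof. by move=> x y f; have := sgn_law f; rewrite /= addbF => ->. Qed.

Lemma gsum_unit (w : unit_gpd -> rat) : gsum w = w tt.
Proof.
rewrite /gsum (_ : skeleton unit_gpd = [:: tt]) //.
by rewrite big_seq1 card_unit divr1.
Qed.

Lemma scalar_card_gsum (M : span unit_pgpd unit_pgpd) :
  scalar_card M = gsum (fun x : M => (-1) ^+ sgn M x).
Proof. exact: gsum_sign. Qed.

Lemma scalar_card_fibre2 (S T : pgpd) (M : span S T) i j :
  scalar_card (fibre2 M i j) = entry M i j.
Proof.
rewrite scalar_card_gsum gsum_hpull; last exact: (@sgn_invariant (fibre2 M i j)).
rewrite (@gsum_hpull unit_gpd M); last first.
  move=> x y f; rewrite !gsum_unit /=.
  rewrite [LHS](reindex _ (onW_bij _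
    (@cmp_left_bij _ _ _ j (fmap (rleg M) (arr2 f))))).
  apply: eq_bigr => b _; rewrite /hcomp_sgn /= /hcomp_sgn /= !addbF /cmp_left.
  have := congr1 par (hphomP f); rewrite /= !parM par1 addFb.
  have := sgn_law (arr2 f).
  by move: (sgn _ _) (sgn _ _) (par _) (par _) (par _) (par _) (par _); do 7 case.
rewrite gsum_unit; apply: eq_gsum => m; apply: eq_bigr => a _.
by rewrite gsum_unit; apply: eq_bigr => b _; rewrite /hcomp_sgn /= /hcomp_sgn /= addbF.
Qed.

Lemma card_mxE (S T : pgpd) (M : span S T) k l :
  card_mx M k l = entry M (base_point k) (base_point l)
                  / #|hom (base_point l) (base_point l)|%:R.
Proof. by rewrite mxE scalar_card_fibre2. Qed.

(** Composition with [eql] and [eqr] identifies the pairs (a, b) on the two sides, and [eqs] says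
    precisely that their signs agree. *)
Lemma entry_sequiv (S T : pgpd) (M N : span S T) : sequiv M N ->
  forall i j, entry M i j = entry N i j.
Proof.
move=> u i j; rewrite /entry -(gsum_equivalence (eqFP u)); last first.
  exact: entry_at_invariant.
apply: eq_gsum => m; rewrite /entry_at.
rewrite [RHS](reindex _ (onW_bij _ (@cmp_right_bij _ i _ _ (eql u m)))).
apply: eq_bigr => a _.
rewrite [LHS](reindex _ (onW_bij _ (@cmp_left_bij _ _ _ j (eqr u m)))).
apply: eq_bigr => b _; rewrite /cmp_left /cmp_right !parM.
have := eqs u m; move: (par _) (par _) (par _) (par _) (sgn _ _) (sgn _ _).
by do 6 case.
Qed.

(** A point of the fibre is a factorization of an arrow i -> j; its middle object is integrated away
    by [gsum_delta]. *)
Lemma entry_id (S : pgpd) (i j : S) :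
  entry (span_id S) i j = \sum_(a : hom i j) (-1) ^+ par a.
Proof.
rewrite /entry /entry_at (@gsum_delta S i
  (fun s a => \sum_(b : hom s j) (-1) ^+ (par a (+) false (+) par b))).
  by apply: eq_bigr => b _; rewrite par1.
move=> x y a f; rewrite [LHS](reindex _ (onW_bij _ (@cmp_left_bij _ _ _ j f))).
by apply: eq_bigr => b _; rewrite /cmp_left !parM !addbF addbA.
Qed.

(** The gluing arrow rleg m -> lleg n contributes an entry of the identity span, which [entry_id]
    read backwards spreads over an intermediate j of T. The sign then splits between M and N, and
    the integrals are exchanged. *)
Lemma entry_comp (S T U : pgpd) (M : span S T) (N : span T U) i k :
  entry (M ** N) i k = gsum (fun j => entry M i j * entry N j k).
Proof.
rewrite {1}/entry gsum_hpull; last exact: (@entry_at_invariant _ _ (M ** N) i k).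
transitivity (gsum (fun m : M => gsum (fun n : N => gsum (fun j : T =>
   entry_at i j m * entry_at j k n)))).
  apply: eq_gsum => m; apply: eq_gsum => n; rewrite /entry_at /=.
  pose c (m : M) (n : N) := (\sum_(a : hom i (lleg M m)) \sum_(b : hom (rleg N n) k)
     (-1) ^+ (par a (+) sgn M m (+) sgn N n (+) par b) : rat).
  transitivity (c m n * \sum_(t : hom (rleg M m) (lleg N n)) (-1) ^+ par t).
    rewrite mulr_sumr; apply: eq_bigr => t _; rewrite /c mulr_suml.
    apply: eq_bigr => a _; rewrite mulr_suml; apply: eq_bigr => b _.
    rewrite -signr_addb /hcomp_sgn /=.
    by move: (par _) (par _) (par _) (sgn _ _) (sgn _ _); do 5 case.
  rewrite -entry_id -gsumZ; apply: eq_gsum => j; rewrite /entry_at /= /c.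
  rewrite !big_distrlr; apply: eq_bigr => a _ /=.
  under [RHS]eq_bigr => d _ do rewrite big_distrlr.
  rewrite [RHS]exchange_big; apply: eq_bigr => b _ /=.
  rewrite mulrC big_distrlr; apply: eq_bigr => d _; apply: eq_bigr => e _ /=.
  rewrite -!signr_addb.
  by move: (par _) (par _) (par _) (par _) (sgn _ _) (sgn _ _); do 6 case.
transitivity (gsum (fun m : M => gsum (fun j : T => entry_at i j m * entry N j k))).
  apply: eq_gsum => m; rewrite gsum_exchange; apply: eq_gsum => j.
  by rewrite gsumZ.
by rewrite gsum_exchange; apply: eq_gsum => j; rewrite gsumZr.
Qed.

Lemma sum_base_point (S : pgpd) (w : S -> rat) :
  \sum_(k < size (base_points S)) w (base_point k) =
  \sum_(s <- skeleton S | orientable s) w s.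
Proof. by rewrite -[RHS]big_filter [RHS]big_tnth. Qed.

Lemma base_point_noniso (S : pgpd) (k l : 'I_(size (base_points S))) :
  (k < l)%N -> ~~ iso (base_point k) (base_point l).
Proof.
move=> lt_kl.
have noniso := elimT (pairwiseP (base_point k))
  (pairwise_filter (@orientable S) (pairwise_skeleton S)).
rewrite /base_point !(tnth_nth (base_point k)).
exact: noniso (ltn_ord k) (ltn_ord l) lt_kl.
Qed.

Lemma base_point_iso (S : pgpd) (k l : 'I_(size (base_points S))) :
  iso (base_point k) (base_point l) -> k = l.
Proof.
move=> kl; apply: val_inj; case: (ltngtP k l) => // /base_point_noniso.
  by rewrite kl.
by rewrite iso_sym kl.
Qed.

Lemma orientable_base_point (S : pgpd) (k : 'I_(size (base_points S))) :
  orientable (base_point k).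
Proof.
by move: k; apply/all_tnthP; rewrite in_tupleE filter_all.
Qed.

Lemma card_mx_comp (S T U : pgpd) (M : span S T) (N : span T U) :
  card_mx (M ** N) = (card_mx M *m card_mx N)%R.
Proof.
apply/matrixP=> k l; rewrite card_mxE entry_comp mxE /gsum.
under [RHS]eq_bigr do rewrite !card_mxE.
rewrite (@sum_base_point T (fun j => entry M (base_point k) j / #|hom j j|%:R *
   (entry N j (base_point l) / #|hom (base_point l) (base_point l)|%:R))).
(* The matrix product sees only the orientable j; the other components of T contribute 0 to the
   integral. *)
rewrite mulr_suml [LHS](bigID (@orientable T)) /= [X in _ + X]big1 ?addr0.
  by apply: eq_bigr => j _; rewrite [RHS]mulrA; congr (_ / _); rewrite mulrAC.
by move=> j nj; rewrite entry_right_eq0 // !mul0r.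
Qed.

Lemma card_mx_id (S : pgpd) : card_mx (span_id S) = 1%:M%R.
Proof.
apply/matrixP=> k l; rewrite card_mxE entry_id mxE.
have [<-|] := eqVneq k l; last first.
  move=> nkl; rewrite big_pred0 ?mul0r // => a; apply/negP => _.
  by case/eqP: nkl; apply: base_point_iso; apply/isoP; split.
under eq_bigr => a _.
  rewrite (negbTE (forallP (orientable_base_point k) a)); over.
by rewrite sumr_const divff ?card_aut_neq0.
Qed.

Lemma card_mx_equiv (S T : pgpd) (M N : span S T) :
  sequiv M N -> card_mx M = card_mx N.
Proof.
by move=> u; apply/matrixP=> k l; rewrite !card_mxE (entry_sequiv u).
Qed.

Lemma functorial_cardinality : functorial cardinality.
Proof.
split=> [S T M N u|S|S T U M N] /=.
- by rewrite (card_mx_equiv u).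
- by apply/lfunP=> v; rewrite lfunE /= id_lfunE card_mx_id mulmx1.
- by apply/lfunP=> v; rewrite comp_lfunE !lfunE /= card_mx_comp mulmxA.
Qed.

Lemma lfun_of_linear (V W : vectType rat) (f : V -> W) :
  linear f -> exists h : 'Hom(V, W), h =1 f.
Proof.
move=> linf; pose f' : {linear V -> W} := HB.pack f (GRing.isLinear.Build _ _ _ _ f linf).
by exists (linfun f') => x; rewrite lfunE.
Qed.

Lemma entry_scalar (b : bool) : entry (scalar b) tt tt = (-1) ^+ b.
Proof. by rewrite /entry gsum_unit /entry_at /= !big_const card_unit /= addbF !addr0. Qed.

Lemma base_points_unit : size (base_points unit_pgpd) = 1%N.
Proof.
rewrite /base_points (_ : skeleton unit_pgpd = [:: tt]) //=.
by rewrite (_ : orientable _ = true) //; apply/forallP.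
Qed.

Lemma triangle_cardinality : triangle cardinality.
Proof.
(* The number of base points of the unit is 1 only up to a proof, so the isomorphism with Q is given
   by formulas that make sense for rows of any length: constant rows, and the sum of the entries. *)
have [h hE] : exists h : 'Hom(rat^o, cardinality unit_pgpd),
    forall c, h c = c *: const_mx 1.
  by apply: lfun_of_linear => a x y; rewrite scalerDl scalerA.
have [g gE] : exists g : 'Hom(cardinality unit_pgpd, rat^o),
    forall v, g v = \sum_k (v : 'rV_(size (base_points unit_pgpd))) ord0 k.
  apply: lfun_of_linear => a x y; rewrite scaler_sumr -big_split.
  by apply: eq_bigr => k _; rewrite !mxE.
have ord_eq (k l : 'I_(size (base_points unit_pgpd))) : k = l.
  by apply: base_point_iso; apply/isoP; split.
exists h.
  exists g; split; apply/lfunP=> v; rewrite comp_lfunE id_lfunE ?hE gE.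
    under eq_bigr do rewrite !mxE mulr1.
    by rewrite sumr_const card_ord base_points_unit.
  apply/rowP=> k; rewrite !mxE mulr1 (bigD1 k) //= big1 ?addr0 // => l.
  by rewrite (ord_eq l k) eqxx.
move=> b; apply/lfunP=> c; rewrite !comp_lfunE !lfunE /= hE.
apply/rowP=> k; rewrite hE !mxE (bigD1 k) //= big1 ?addr0; last first.
  by move=> l; rewrite (ord_eq l k) eqxx.
rewrite card_mxE !mxE /=.
by case: (base_point k); rewrite entry_scalar card_unit id_lfunE !mulr1 mulrC.
Qed.

(** * Diagrams of points *)

Lemma unit_eq (a b : unit) : a = b.
Proof. by case: a; case: b. Qed.

Section Cancel.
Variable G : gpd.
Implicit Types x y z : G.
Lemma cmpIr x y z (g : hom y z) : injective (fun f : hom x y => f ;; g).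
Proof. by move=> f h /(congr1 (fun k => k ;; invm g)); rewrite -!cmpA !cmpfV !cmpf1. Qed.
Lemma cmpK x y z (f : hom x y) (g : hom y z) : f ;; g ;; invm g = f.
Proof. by rewrite -cmpA cmpfV cmpf1. Qed.
Lemma cmpKr x y z (f : hom x y) (g : hom z y) : f ;; invm g ;; g = f.
Proof. by rewrite -cmpA cmpVf cmpf1. Qed.
Lemma cmpVE x y z (f : hom x y) (g : hom y z) (h : hom x z) :
  f ;; g = h -> g = invm f ;; h.
Proof. by move=> <-; rewrite cmpVK. Qed.
Lemma cmpEV x y z (f : hom x y) (g : hom y z) (h : hom x z) :
  f ;; g = h -> f = h ;; invm g.
Proof. by move=> <-; rewrite cmpK. Qed.
Lemma invM x y z (f : hom x y) (g : hom y z) : invm (f ;; g) = invm g ;; invm f.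
Proof. by apply: (@cmpI _ _ _ _ (f ;; g)); rewrite cmpfV -cmpA cmpKV cmpfV. Qed.
Lemma inv1 x : invm (idm x) = idm x.
Proof. by rewrite -[LHS]cmp1f cmpfV. Qed.
Lemma cmp_paste3 t u v v' w x y z (p : hom u v) (q : hom v w) (r : hom w z) (k : hom v' z)
    (m : hom w x) (r' : hom x y) (m' : hom z y) (f : hom t v') :
  r ;; m' = m ;; r' ->
  p ;; (q ;; r ;; invm k) = p ;; q ;; m ;; r' ;; invm (f ;; k ;; m') ;; f.
Proof.
move=> e; rewrite -(cmpA _ m) -e !invM -!cmpA cmpVf cmpf1.
by rewrite (cmpA m') cmpfV cmp1f.
Qed.
End Cancel.

Section Lift.
Variables (G H : gpd) (F : functor G H) (eF : equivalence F).
Lemma lift_subproof x y (g : hom (F x) (F y)) : exists f, fmap F f == g.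
Proof. by have [f <-] := eq_full eF g; exists f. Qed.
Definition lift x y (g : hom (F x) (F y)) : hom x y := xchoose (lift_subproof g).
Lemma liftK x y (g : hom (F x) (F y)) : fmap F (lift g) = g.
Proof. exact: eqP (xchooseP (lift_subproof g)). Qed.
End Lift.

(* In a category whose arrows have right inverses these are two-sided. *)
Section RightInverse.
Variables (ob : Type) (hom : ob -> ob -> Type) (idm : forall x, hom x x).
Variables (cmp : forall x y z, hom x y -> hom y z -> hom x z).
Variables (invm : forall x y, hom x y -> hom y x).
Hypothesis cmpA : forall w x y z (f : hom w x) (g : hom x y) (h : hom y z),
  cmp f (cmp g h) = cmp (cmp f g) h.
Hypothesis cmp1f : forall x y (f : hom x y), cmp (idm x) f = f.
Hypothesis cmpf1 : forall x y (f : hom x y), cmp f (idm y) = f.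
Hypothesis cmpfV : forall x y (f : hom x y), cmp f (invm f) = idm x.
Lemma right_inverse_left x y (f : hom x y) : cmp (invm f) f = idm y.
Proof.
rewrite -[cmp (invm f) f]cmpf1 -(cmpfV (invm f)) cmpA -(cmpA (invm f)).
by rewrite cmpfV cmpf1.
Qed.
End RightInverse.

Lemma unit_hpull_equivalence (M N : functor unit_gpd unit_gpd)
  (F : functor (hpull M N) unit_gpd) : equivalence F.
Proof.
split=> [x y f g _|x y g|[]].
- by apply: hp_ext; apply: unit_eq.
- exists (@hparr _ _ _ M N x y tt tt (unit_eq _ _)); exact: unit_eq.
- by exists (@HP _ _ _ M N tt tt tt).
Qed.

Definition to_unit (G : gpd) : functor G unit_gpd :=
  @Functor G unit_gpd (fun _ => tt) (fun _ _ _ => tt) (fun _ => erefl)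
    (fun _ _ _ _ _ => erefl).

Definition to_unit_iso (G : gpd) (F F' : functor G unit_gpd) : natiso F F' :=
  @Natiso G unit_gpd F F' (fun _ => tt) (fun _ _ _ => unit_eq _ _).

Definition scalar_comp (b c d : bool) (e : b (+) c = d) :
    sequiv (scalar b ** scalar c) (scalar d).
Proof.
apply: (@SEquiv _ _ (scalar b ** scalar c) (scalar d) (to_unit _)
  (unit_hpull_equivalence _) (to_unit_iso _ _) (to_unit_iso _ _)).
by move=> x; rewrite /= /hcomp_sgn /= !addbF.
Defined.

Lemma fid_equivalence (G : gpd) : equivalence (fid G).
Proof.
by split=> [x y f g|x y g|y] //; [exists g | exists y; split; exact: idm].
Qed.

Definition scalar_unit (b : bool) (e : b = false) : sequiv (span_id unit_pgpd) (scalar b).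
Proof.
apply: (@SEquiv _ _ (span_id unit_pgpd) (scalar b) (fid unit_gpd) (fid_equivalence _)
  (to_unit_iso _ _) (to_unit_iso _ _)).
by move=> x; rewrite /= e.
Defined.

Definition scalar_siso (M : span unit_pgpd unit_pgpd) (b : bool)
    (u v : sequiv M (scalar b)) : siso u v :=
  @SIso _ _ M (scalar b) u v (to_unit_iso u v) (fun _ => unit_eq _ _) (fun _ => unit_eq _ _).

Section PointDiagram.
Variable S : pgpd.

(** The parity functor of S followed by the functor from BO(1) in the statement. Any two
    equivalences into a [scalar] are isomorphic, which provides all coherences. *)
Definition point_diagram : diagram S :=
  @Diagram S (fun _ => unit_pgpd) (fun s t a => scalar (par a))
   (fun s t u a b c e => scalar_comp (etrans (esym (parM a b)) (congr1 par e)))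
   (fun s => scalar_unit (par1 s))
   (fun _ _ _ _ _ _ _ => scalar_siso _ _) (fun _ _ _ => scalar_siso _ _)
   (fun _ _ _ => scalar_siso _ _).

Section PointAct.
Variables (s t : S) (a : hom s t).
Let M := scalar (par a) ** point t.
Lemma point_act_equivalence : @equivalence M (point s) (to_unit _).
Proof.
split=> [x y f g _|x y g|[]].
- by apply: glue_ext; apply: unit_eq.
- exists (@hparr _ _ _ _ _ x y tt tt (unit_eq _ _)); exact: unit_eq.
- by exists (@HP _ _ _ (rleg (scalar (par a))) (lleg (point t)) tt tt tt).
Qed.
Lemma point_act_r_law (x y : M) (f : hom x y) :
  fmap (rleg M) f ;; invm a = invm a ;; fmap (fcomp (to_unit _) (rleg (point s))) f.
Proof. by rewrite /= cmp1f cmpf1. Qed.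
(** The component has to go from t to s, whence the inverse; its parity cancels the sign of
    [scalar (par a)]. *)
Definition point_act_r : natiso (rleg M) (fcomp (to_unit _) (rleg (point s))) :=
  @Natiso _ _ (rleg M) (fcomp (to_unit _) (rleg (point s))) (fun _ => invm a) point_act_r_law.
Definition point_act : sequiv M (point s).
Proof.
apply: (@SEquiv _ _ M (point s) (to_unit _) point_act_equivalence
  (to_unit_iso _ _) point_act_r).
by move=> x; rewrite /= /hcomp_sgn /= !addbF parV addbb.
Defined.
End PointAct.

Definition point_coh (s t u : S) (a : hom s t) (b : hom t u) (c : hom s u) (e : a ;; b = c) :
  siso (vcomp (assoc _ _ _) (vcomp (lwhisk (scalar (par a)) (point_act b)) (point_act a)))
       (vcomp (rwhisk (dcmp point_diagram e) (point u)) (point_act c)).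
Proof.
set u1 := vcomp (assoc _ _ _) _; set v1 := vcomp (rwhisk _ _) _.
apply: (@SIso _ _ _ (point s) u1 v1 (to_unit_iso u1 v1)) => x; first exact: unit_eq.
by rewrite /= -e invM !cmp1f cmpf1.
Defined.

Definition point_cocone_data : cocone_data point_diagram S :=
  @CoconeData S point_diagram S (@point S) point_act point_coh.

Definition point_cocone : cocone point_diagram S :=
  @Cocone S point_diagram S point_cocone_data
   (fun _ _ _ _ _ _ _ _ _ _ _ _ _ _ => unit_eq _ _).
End PointDiagram.

(** * Composition of factorizations *)

Lemma cmp_paste4 (H : gpd) (t u v w x y z : H) (a : hom t u) (b : hom u v) (g : hom v w)
    (p : hom w y) (q : hom v x) (g' : hom x y) (n : hom y z) :
  g ;; p = q ;; g' -> a ;; (b ;; g) ;; (p ;; n) = a ;; b ;; q ;; g' ;; n.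
Proof. by move=> e; rewrite -!cmpA (cmpA g) e -!cmpA. Qed.

Lemma cmp_paste5 (H : gpd) (t u v w x y z u' w' : H) (e6 : hom t u) (s1 : hom u v) (s2 : hom t w)
    (sY : hom w x) (e1 : hom x v) (n : hom v y) (n1 : hom x u') (n2 : hom w w') (e4 : hom w' u')
    (e2 : hom u' z) (c : hom z y) :
  sY ;; n1 = n2 ;; e4 -> e1 ;; n = n1 ;; e2 ;; c -> e6 ;; s1 = s2 ;; sY ;; e1 ->
  e6 ;; (s1 ;; n) = s2 ;; n2 ;; (e4 ;; e2) ;; c.
Proof.
by move=> e f g; rewrite cmpA g -!cmpA f -!cmpA !(cmpA sY) e -!cmpA.
Qed.

(* In [gx], [gm], [co] and [nt] the gluing arrows are arbitrary arrows satisfying the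
   expected equations: the coherences of a composite can then be pasted without
   transporting along associativity. *)
Section GlueMap.
Variables (S T U : pgpd) (M : span S T) (N : span T U) (H : gpd) (Q : functor (M ** N) H).
Implicit Types (m : M) (n : N).

Definition gx m n (f : hom (rleg M m) (lleg N n)) : H := Q (glue m n f).

Definition gm m m' n n' (f : hom (rleg M m) (lleg N n)) (f' : hom (rleg M m') (lleg N n'))
    (u : hom m m') (v : hom n n') (e : f ;; fmap (lleg N) v = fmap (rleg M) u ;; f') :
    hom (gx f) (gx f') := fmap Q (garr (glue m n f) (glue m' n' f') u v e).

Lemma gm_ext m m' n n' (f : hom (rleg M m) (lleg N n)) (f' : hom (rleg M m') (lleg N n'))
    (u u' : hom m m') (v v' : hom n n') (e : f ;; fmap (lleg N) v = fmap (rleg M) u ;; f')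
    (e' : f ;; fmap (lleg N) v' = fmap (rleg M) u' ;; f') :
  u = u' -> v = v' -> gm e = gm e'.
Proof. by move=> eu ev; congr (fmap _ _); apply: glue_ext. Qed.

Lemma gm1 m n (f : hom (rleg M m) (lleg N n))
    (e : f ;; fmap (lleg N) (idm n) = fmap (rleg M) (idm m) ;; f) : gm e = idm (gx f).
Proof. by rewrite -fmap1; congr (fmap _ _); apply: glue_ext. Qed.

Lemma gmM_sq m1 m2 m3 n1 n2 n3 (f1 : hom (rleg M m1) (lleg N n1)) (f2 : hom (rleg M m2) (lleg N n2))
    (f3 : hom (rleg M m3) (lleg N n3)) (u : hom m1 m2) (v : hom n1 n2) (u' : hom m2 m3) (v' : hom n2 n3)
    (e : f1 ;; fmap (lleg N) v = fmap (rleg M) u ;; f2)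
    (e' : f2 ;; fmap (lleg N) v' = fmap (rleg M) u' ;; f3) :
  f1 ;; fmap (lleg N) (v ;; v') = fmap (rleg M) (u ;; u') ;; f3.
Proof. by rewrite !fmapM cmpA e -cmpA e' cmpA. Qed.

Lemma gmM m1 m2 m3 n1 n2 n3 (f1 : hom (rleg M m1) (lleg N n1)) (f2 : hom (rleg M m2) (lleg N n2))
    (f3 : hom (rleg M m3) (lleg N n3)) (u : hom m1 m2) (v : hom n1 n2) (u' : hom m2 m3) (v' : hom n2 n3)
    (e : f1 ;; fmap (lleg N) v = fmap (rleg M) u ;; f2)
    (e' : f2 ;; fmap (lleg N) v' = fmap (rleg M) u' ;; f3) :
  gm e ;; gm e' = gm (gmM_sq e e').
Proof. by rewrite /gm -fmapM; congr (fmap _ _); apply: glue_ext. Qed.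

Lemma gm_eqP m n (f f' : hom (rleg M m) (lleg N n)) (e : f = f') :
  f ;; fmap (lleg N) (idm n) = fmap (rleg M) (idm m) ;; f'.
Proof. by rewrite !fmap1 cmpf1 cmp1f. Qed.
Definition gm_eq m n (f f' : hom (rleg M m) (lleg N n)) (e : f = f') : hom (gx f) (gx f') :=
  gm (gm_eqP e).

Lemma gm_eq1 m n (f : hom (rleg M m) (lleg N n)) (e : f = f) : gm_eq e = idm (gx f).
Proof. exact: gm1. Qed.
End GlueMap.
Arguments gx {S T U M N H} Q {m n} f.
Arguments gm {S T U M N H} Q {m m' n n' f f' u v} e.
Arguments gm_eq {S T U M N H} Q {m n f f'} e.

Section CoconeFlex.
Variables (I : gpd) (D : diagram I) (T : pgpd) (X : cocone_data D T).

Lemma co_subproof i j k (a : hom i j) (b : hom j k) (c : hom i k) (e : a ;; b = c)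
    (x : dmap D a) (y : dmap D b) (m : X k) (f : hom (rleg _ x) (lleg _ y))
    (g : hom (rleg _ y) (lleg _ m)) (g1 : hom (rleg _ (dcmp D e (glue x y f))) (lleg _ m)) :
  eqr (dcmp D e) (glue x y f) ;; g1 = g -> invm (eqr (dcmp D e) (glue x y f)) ;; g = g1.
Proof. by move=> <-; rewrite cmpVK. Qed.

Definition co i j k (a : hom i j) (b : hom j k) (c : hom i k) (e : a ;; b = c)
    (x : dmap D a) (y : dmap D b) (m : X k) (f : hom (rleg _ x) (lleg _ y))
    (g : hom (rleg _ y) (lleg _ m)) (f1 : hom (rleg _ x) (lleg _ (gx (cact X b) g)))
    (g1 : hom (rleg _ (dcmp D e (glue x y f))) (lleg _ m))
    (e1 : f ;; eql (cact X b) (glue y m g) = f1)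
    (e2 : eqr (dcmp D e) (glue x y f) ;; g1 = g) :
    hom (gx (cact X a) f1) (gx (cact X c) g1) :=
  locked (gm_eq (cact X a) (esym e1) ;; (ccoh X e (glue (glue x y f) m g)
    ;; gm_eq (cact X c) (co_subproof e2))).

Lemma co_strict i j k (a : hom i j) (b : hom j k) (c : hom i k) (e : a ;; b = c)
    (x : dmap D a) (y : dmap D b) (m : X k) (f : hom (rleg _ x) (lleg _ y))
    (g : hom (rleg _ y) (lleg _ m))
    (e1 : f ;; eql (cact X b) (glue y m g) = f ;; eql (cact X b) (glue y m g))
    (e2 : eqr (dcmp D e) (glue x y f) ;; (invm (eqr (dcmp D e) (glue x y f)) ;; g) = g) :
  co e1 e2 = ccoh X e (glue (glue x y f) m g).
Proof. by rewrite /co -lock !gm_eq1 cmp1f cmpf1. Qed.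

Lemma co_natural_sq i j k (a : hom i j) (b : hom j k) (c : hom i k) (e : a ;; b = c)
    (x x' : dmap D a) (y y' : dmap D b) (m m' : X k)
    (f : hom (rleg _ x) (lleg _ y)) (f' : hom (rleg _ x') (lleg _ y'))
    (g : hom (rleg _ y) (lleg _ m)) (g' : hom (rleg _ y') (lleg _ m'))
    (f1 : hom (rleg _ x) (lleg _ (gx (cact X b) g))) (f1' : hom (rleg _ x') (lleg _ (gx (cact X b) g')))
    (g1 : hom (rleg _ (dcmp D e (glue x y f))) (lleg _ m))
    (g1' : hom (rleg _ (dcmp D e (glue x' y' f'))) (lleg _ m'))
    (e1 : f ;; eql (cact X b) (glue y m g) = f1) (e1' : f' ;; eql (cact X b) (glue y' m' g') = f1')
    (e2 : eqr (dcmp D e) (glue x y f) ;; g1 = g) (e2' : eqr (dcmp D e) (glue x' y' f') ;; g1' = g')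
    (u : hom x x') (v : hom y y') (w : hom m m')
    (euv : f ;; fmap (lleg _) v = fmap (rleg _) u ;; f')
    (evw : g ;; fmap (lleg _) w = fmap (rleg _) v ;; g')
    (e3 : f1 ;; fmap (lleg _) (gm (cact X b) evw) = fmap (rleg _) u ;; f1')
    (e4 : g1 ;; fmap (lleg _) w = fmap (rleg _) (gm (dcmp D e) euv) ;; g1') :
  gm (cact X a) e3 ;; co e1' e2' = co e1 e2 ;; gm (cact X c) e4.
Proof.
subst f1 f1'.
have e5 : g ;; fmap (lleg _) w =
  fmap (rleg (dmap D a ** dmap D b)) (garr (glue x y f) (glue x' y' f') u v euv) ;; g' := evw.
pose k1 : hom (glue (glue x y f) m g : dmap D a ** dmap D b ** X k) (glue (glue x' y' f') m' g') :=
  garr (glue (glue x y f) m g) (glue (glue x' y' f') m' g') (garr (glue x y f) (glue x' y' f') u v euv) w e5.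
have := nat_law (ccoh X e) k1.
have <- : gm (cact X a) e3 = fmap (vcomp (assoc _ _ _) (vcomp (lwhisk (dmap D a) (cact X b)) (cact X a))) k1.
  congr (fmap _ _); apply: glue_ext => //.
  by rewrite /=; congr (fmap _ _); apply: glue_ext.
move=> E; rewrite /co -!lock !gm_eq1 !cmp1f cmpA E -!cmpA; congr (_ ;; _).
apply: etrans (esym (fmapM (cact X c) (rwhisk_map (dcmp D e) k1) _)) (etrans _ (fmapM _ _ _)).
congr (fmap _ _); apply: glue_ext => /=; last by rewrite cmp1f cmpf1.
by rewrite cmp1f cmpf1; congr (fmap _ _); apply: glue_ext.
Qed.

Lemma co_l i j k (a : hom i j) (b : hom j k) (c : hom i k) (e : a ;; b = c)
    (x : dmap D a) (y : dmap D b) (m : X k) (f : hom (rleg _ x) (lleg _ y))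
    (g : hom (rleg _ y) (lleg _ m)) (f1 : hom (rleg _ x) (lleg _ (gx (cact X b) g)))
    (g1 : hom (rleg _ (dcmp D e (glue x y f))) (lleg _ m))
    (e1 : f ;; eql (cact X b) (glue y m g) = f1)
    (e2 : eqr (dcmp D e) (glue x y f) ;; g1 = g) :
  eql (cact X a) (glue x _ f1) ;; fmap (lleg _) (co e1 e2) =
  eql (dcmp D e) (glue x y f) ;; eql (cact X c) (glue _ m g1).
Proof.
have Eg1 := cmpVE e2; move: e1 e2; subst g1 => e1; subst f1 => e2; rewrite co_strict.
have := sil (ccoh X e) (glue (glue x y f) m g).
by rewrite -[eql (vcomp (assoc _ _ _) _) _]/(idm _ ;; (idm _ ;; _)) !cmp1f.
Qed.

Lemma co_r i j k (a : hom i j) (b : hom j k) (c : hom i k) (e : a ;; b = c)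
    (x : dmap D a) (y : dmap D b) (m : X k) (f : hom (rleg _ x) (lleg _ y))
    (g : hom (rleg _ y) (lleg _ m)) (f1 : hom (rleg _ x) (lleg _ (gx (cact X b) g)))
    (g1 : hom (rleg _ (dcmp D e (glue x y f))) (lleg _ m))
    (e1 : f ;; eql (cact X b) (glue y m g) = f1)
    (e2 : eqr (dcmp D e) (glue x y f) ;; g1 = g) :
  eqr (cact X b) (glue y m g) ;; eqr (cact X a) (glue x _ f1) ;; fmap (rleg _) (co e1 e2) =
  eqr (cact X c) (glue _ m g1).
Proof.
have Eg1 := cmpVE e2; move: e1 e2; subst g1 => e1; subst f1 => e2; rewrite co_strict.
have : idm _ ;; (eqr (cact X b) (glue y m g) ;;
    eqr (cact X a) (glue x _ (f ;; eql (cact X b) (glue y m g))))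
    ;; fmap (rleg (X i)) (ccoh X e (glue (glue x y f) m g)) =
    idm _ ;; eqr (cact X c) (glue _ m (invm (eqr (dcmp D e) (glue x y f)) ;; g)) :=
  sir (ccoh X e) (glue (glue x y f) m g).
by rewrite !cmp1f.
Qed.
End CoconeFlex.

Lemma gm_r (S T U : pgpd) (M : span S T) (N : span T U) (K : span S U) (w : sequiv (M ** N) K)
    (m m' : M) (n n' : N) (f : hom (rleg M m) (lleg N n)) (f' : hom (rleg M m') (lleg N n'))
    (u : hom m m') (v : hom n n') (e : f ;; fmap (lleg N) v = fmap (rleg M) u ;; f') :
  eqr w (glue m n f) ;; fmap (rleg K) (gm w e) = fmap (rleg N) v ;; eqr w (glue m' n' f').
Proof. exact: esym (nat_law (eqr w) (garr (glue m n f) (glue m' n' f') u v e)). Qed.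

Lemma gm_l (S T U : pgpd) (M : span S T) (N : span T U) (K : span S U) (w : sequiv (M ** N) K)
    (m m' : M) (n n' : N) (f : hom (rleg M m) (lleg N n)) (f' : hom (rleg M m') (lleg N n'))
    (u : hom m m') (v : hom n n') (e : f ;; fmap (lleg N) v = fmap (rleg M) u ;; f') :
  eql w (glue m n f) ;; fmap (lleg K) (gm w e) = fmap (lleg M) u ;; eql w (glue m' n' f').
Proof. exact: esym (nat_law (eql w) (garr (glue m n f) (glue m' n' f') u v e)). Qed.

(** The components of [eqr w] are invertible, so the gluing arrow c at the image under w is
    determined by h, and a square for h descends to a square for c. *)
Lemma sq_r (S T U V : pgpd) (M : span S T) (N : span T U) (K : span S U) (L : span U V)
    (w : sequiv (M ** N) K) (m m' : M) (n n' : N) (q q' : L)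
    (f : hom (rleg M m) (lleg N n)) (f' : hom (rleg M m') (lleg N n'))
    (u : hom m m') (v : hom n n') (e : f ;; fmap (lleg N) v = fmap (rleg M) u ;; f')
    (h : hom (rleg N n) (lleg L q)) (h' : hom (rleg N n') (lleg L q'))
    (c : hom (rleg K (gx w f)) (lleg L q)) (c' : hom (rleg K (gx w f')) (lleg L q')) (t : hom q q') :
  eqr w (glue m n f) ;; c = h -> eqr w (glue m' n' f') ;; c' = h' ->
  h ;; fmap (lleg L) t = fmap (rleg N) v ;; h' ->
  c ;; fmap (lleg L) t = fmap (rleg K) (gm w e) ;; c'.
Proof.
move=> ec ec' eh; apply: (@cmpI _ _ _ _ (eqr w (glue m n f))).
by rewrite cmpA ec eh cmpA gm_r -cmpA ec'.
Qed.

Lemma sq_l (R S T U : pgpd) (J : span R S) (M : span S T) (N : span T U) (K : span S U)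
    (w : sequiv (M ** N) K) (x x' : J) (m m' : M) (n n' : N)
    (f : hom (rleg M m) (lleg N n)) (f' : hom (rleg M m') (lleg N n'))
    (u : hom m m') (v : hom n n') (e : f ;; fmap (lleg N) v = fmap (rleg M) u ;; f')
    (g : hom (rleg J x) (lleg M m)) (g' : hom (rleg J x') (lleg M m'))
    (k : hom (rleg J x) (lleg K (gx w f))) (k' : hom (rleg J x') (lleg K (gx w f'))) (t : hom x x') :
  g ;; eql w (glue m n f) = k -> g' ;; eql w (glue m' n' f') = k' ->
  g ;; fmap (lleg M) u = fmap (rleg J) t ;; g' ->
  k ;; fmap (lleg K) (gm w e) = fmap (rleg J) t ;; k'.
Proof. by move=> <- <- eg; rewrite -cmpA gm_l !cmpA eg. Qed.

Section FactorFlex.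
Variables (I : gpd) (D : diagram I) (C T : pgpd) (X : cocone D C) (Y : cocone D T).
Variable F : factor_data X Y.

Lemma nt_subproof i j (a : hom i j) (x : dmap D a) (m : X j) (n : F)
    (f : hom (rleg _ x) (lleg _ m)) (h : hom (rleg _ m) (lleg _ n))
    (c : hom (rleg _ (gx (cact X a) f)) (lleg _ n)) :
  eqr (cact X a) (glue x m f) ;; c = h -> c = invm (eqr (cact X a) (glue x m f)) ;; h.
Proof. by move=> <-; rewrite cmpVK. Qed.

Definition nt i j (a : hom i j) (x : dmap D a) (m : X j) (n : F)
    (f : hom (rleg _ x) (lleg _ m)) (h : hom (rleg _ m) (lleg _ n))
    (c : hom (rleg _ (gx (cact X a) f)) (lleg _ n))
    (f' : hom (rleg _ x) (lleg _ (gx (fw F j) h)))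
    (e1 : eqr (cact X a) (glue x m f) ;; c = h)
    (e2 : f ;; eql (fw F j) (glue m n h) = f') :
    hom (gx (fw F i) c) (gx (cact Y a) f') :=
  locked (gm_eq (fw F i) (nt_subproof e1) ;; (fnat F a (glue (glue x m f) n h)
    ;; gm_eq (cact Y a) e2)).

Lemma nt_strict i j (a : hom i j) (x : dmap D a) (m : X j) (n : F)
    (f : hom (rleg _ x) (lleg _ m)) (h : hom (rleg _ m) (lleg _ n))
    (e1 : eqr (cact X a) (glue x m f) ;; (invm (eqr (cact X a) (glue x m f)) ;; h) = h)
    (e2 : f ;; eql (fw F j) (glue m n h) = f ;; eql (fw F j) (glue m n h)) :
  nt e1 e2 = fnat F a (glue (glue x m f) n h).
Proof. by rewrite /nt -lock !gm_eq1 cmp1f cmpf1. Qed.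

Lemma nt_l i j (a : hom i j) (x : dmap D a) (m : X j) (n : F)
    (f : hom (rleg _ x) (lleg _ m)) (h : hom (rleg _ m) (lleg _ n))
    (c : hom (rleg _ (gx (cact X a) f)) (lleg _ n))
    (f' : hom (rleg _ x) (lleg _ (gx (fw F j) h)))
    (e1 : eqr (cact X a) (glue x m f) ;; c = h)
    (e2 : f ;; eql (fw F j) (glue m n h) = f') :
  eql (cact X a) (glue x m f) ;; eql (fw F i) (glue _ n c) ;; fmap (lleg _) (nt e1 e2) =
  eql (cact Y a) (glue x _ f').
Proof.
have Ec := cmpVE e1; move: e1 e2; subst c => e1 e2; subst f'; rewrite nt_strict.
have := sil (fnat F a) (glue (glue x m f) n h).
by rewrite -[eql (vcomp (assoc _ _ _) _) _]/(idm _ ;; (idm _ ;; _)) !cmp1f.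
Qed.

Lemma nt_r i j (a : hom i j) (x : dmap D a) (m : X j) (n : F)
    (f : hom (rleg _ x) (lleg _ m)) (h : hom (rleg _ m) (lleg _ n))
    (c : hom (rleg _ (gx (cact X a) f)) (lleg _ n))
    (f' : hom (rleg _ x) (lleg _ (gx (fw F j) h)))
    (e1 : eqr (cact X a) (glue x m f) ;; c = h)
    (e2 : f ;; eql (fw F j) (glue m n h) = f') :
  eqr (fw F i) (glue _ n c) ;; fmap (rleg _) (nt e1 e2) =
  eqr (fw F j) (glue m n h) ;; eqr (cact Y a) (glue x _ f').
Proof.
have Ec := cmpVE e1; move: e1 e2; subst c => e1 e2; subst f'; rewrite nt_strict.
have : idm _ ;; eqr (fw F i) (glue _ n (invm (eqr (cact X a) (glue x m f)) ;; h))
    ;; fmap (rleg (Y i)) (fnat F a (glue (glue x m f) n h)) =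
    idm _ ;; (eqr (fw F j) (glue m n h) ;;
    eqr (cact Y a) (glue x _ (f ;; eql (fw F j) (glue m n h)))) :=
  sir (fnat F a) (glue (glue x m f) n h).
by rewrite !cmp1f.
Qed.

Lemma nt_natural i j (a : hom i j) (x x' : dmap D a) (m m' : X j) (n n' : F)
    (f : hom (rleg _ x) (lleg _ m)) (h : hom (rleg _ m) (lleg _ n))
    (c : hom (rleg _ (gx (cact X a) f)) (lleg _ n))
    (k : hom (rleg _ x) (lleg _ (gx (fw F j) h)))
    (f' : hom (rleg _ x') (lleg _ m')) (h' : hom (rleg _ m') (lleg _ n'))
    (c' : hom (rleg _ (gx (cact X a) f')) (lleg _ n'))
    (k' : hom (rleg _ x') (lleg _ (gx (fw F j) h')))
    (e1 : eqr (cact X a) (glue x m f) ;; c = h)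
    (e2 : f ;; eql (fw F j) (glue m n h) = k)
    (e1' : eqr (cact X a) (glue x' m' f') ;; c' = h')
    (e2' : f' ;; eql (fw F j) (glue m' n' h') = k')
    (u : hom x x') (v : hom m m') (w : hom n n')
    (euv : f ;; fmap (lleg _) v = fmap (rleg _) u ;; f')
    (evw : h ;; fmap (lleg _) w = fmap (rleg _) v ;; h')
    (e3 : c ;; fmap (lleg _) w = fmap (rleg _) (gm (cact X a) euv) ;; c')
    (e4 : k ;; fmap (lleg _) (gm (fw F j) evw) = fmap (rleg _) u ;; k') :
  gm (fw F i) e3 ;; nt e1' e2' = nt e1 e2 ;; gm (cact Y a) e4.
Proof.
subst k k'.
have e5 : h ;; fmap (lleg _) w =
  fmap (rleg (dmap D a ** X j)) (garr (glue x m f) (glue x' m' f') u v euv) ;; h' := evw.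
pose k1 : hom (glue (glue x m f) n h : dmap D a ** X j ** F) (glue (glue x' m' f') n' h') :=
  garr (glue (glue x m f) n h) (glue (glue x' m' f') n' h')
    (garr (glue x m f) (glue x' m' f') u v euv) w e5.
have := nat_law (fnat F a) k1.
have <- : gm (cact Y a) e4 =
  fmap (vcomp (assoc _ _ _) (vcomp (lwhisk (dmap D a) (fw F j)) (cact Y a))) k1.
  congr (fmap _ _); apply: glue_ext => //.
  by rewrite /=; congr (fmap _ _); apply: glue_ext.
move=> E; rewrite /nt -!lock !gm_eq1 !cmpf1 -cmpA -E !cmpA; congr (_ ;; _).
apply: etrans (esym (fmapM _ _ _)) (etrans _ (fmapM (fw F i) _ (rwhisk_map (cact X a) k1))).
congr (fmap _ _); apply: glue_ext => /=; last by rewrite cmp1f cmpf1.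
by rewrite cmp1f cmpf1; congr (fmap _ _); apply: glue_ext.
Qed.

Definition factor_flex_law : Prop :=
  forall i j k (a : hom i j) (b : hom j k) (x : dmap D a) (y : dmap D b) (m : X k) (n : F)
    (f : hom (rleg _ x) (lleg _ y)) (g : hom (rleg _ y) (lleg _ m)) (h : hom (rleg _ m) (lleg _ n))
    (f1 : hom (rleg _ x) (lleg _ (gx (cact X b) g)))
    (g1 : hom (rleg _ (dcmp D (erefl (a ;; b)) (glue x y f))) (lleg _ m))
    (h1 : hom (rleg _ (gx (cact X b) g)) (lleg _ n))
    (c1 : hom (rleg _ (gx (cact X a) f1)) (lleg _ n))
    (c2 : hom (rleg _ (gx (cact X (a ;; b)) g1)) (lleg _ n))
    (f1' : hom (rleg _ x) (lleg _ (gx (fw F j) h1)))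
    (g' : hom (rleg _ y) (lleg _ (gx (fw F k) h)))
    (g1' : hom (rleg _ (dcmp D (erefl (a ;; b)) (glue x y f))) (lleg _ (gx (fw F k) h)))
    (f2 : hom (rleg _ x) (lleg _ (gx (cact Y b) g')))
    (ef1 : f ;; eql (cact X b) (glue y m g) = f1)
    (eg1 : eqr (dcmp D (erefl (a ;; b))) (glue x y f) ;; g1 = g)
    (eh1 : eqr (cact X b) (glue y m g) ;; h1 = h)
    (ec1 : eqr (cact X a) (glue x _ f1) ;; c1 = h1)
    (ec2 : eqr (cact X (a ;; b)) (glue _ m g1) ;; c2 = h)
    (ef1' : f1 ;; eql (fw F j) (glue _ n h1) = f1')
    (eg' : g ;; eql (fw F k) (glue m n h) = g')
    (eg1' : g1 ;; eql (fw F k) (glue m n h) = g1')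
    (ef2 : f ;; eql (cact Y b) (glue y _ g') = f2)
    (eg1'' : eqr (dcmp D (erefl (a ;; b))) (glue x y f) ;; g1' = g')
    (e1 : c1 ;; fmap (lleg _) (idm n) = fmap (rleg _) (co ef1 eg1) ;; c2)
    (e2 : f1' ;; fmap (lleg _) (nt eh1 eg') = fmap (rleg _) (idm x) ;; f2),
  gm (fw F i) e1 ;; nt ec2 eg1' =
  nt ec1 ef1' ;; gm (cact Y a) e2 ;; co ef2 eg1''.

(** At the strict gluing arrows all comparison arrows hidden in [co] and [nt] are identities, except
    the one for associativity that [factor_law_at] writes out as [glue_eq]. *)
Lemma factor_law_atP i j k (a : hom i j) (b : hom j k) (x : dmap D a) (y : dmap D b) (m : X k)
    (n : F) (f : hom (rleg _ x) (lleg _ y)) (g : hom (rleg _ y) (lleg _ m))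
    (h : hom (rleg _ m) (lleg _ n))
    (f1 := f ;; eql (cact X b) (glue y m g))
    (g1 := invm (eqr (dcmp D (erefl (a ;; b))) (glue x y f)) ;; g)
    (h1 := invm (eqr (cact X b) (glue y m g)) ;; h)
    (g' := g ;; eql (fw F k) (glue m n h))
    (eg1 : eqr (dcmp D (erefl (a ;; b))) (glue x y f) ;; g1 = g)
    (eh1 : eqr (cact X b) (glue y m g) ;; h1 = h)
    (ec1 : eqr (cact X a) (glue x _ f1) ;; (invm (eqr (cact X a) (glue x _ f1)) ;; h1) = h1)
    (ec2 : eqr (cact X (a ;; b)) (glue _ m g1) ;;
           (invm (eqr (cact X (a ;; b)) (glue _ m g1)) ;; h) = h)
    (eg1'' : eqr (dcmp D (erefl (a ;; b))) (glue x y f) ;; (g1 ;; eql (fw F k) (glue m n h)) = g')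
    (e1 : invm (eqr (cact X a) (glue x _ f1)) ;; h1 ;; fmap (lleg _) (idm n) =
          fmap (rleg _) (co (erefl f1) eg1) ;; (invm (eqr (cact X (a ;; b)) (glue _ m g1)) ;; h))
    (e2 : f1 ;; eql (fw F j) (glue _ n h1) ;; fmap (lleg _) (nt eh1 (erefl g')) =
          fmap (rleg _) (idm x) ;; (f ;; eql (cact Y b) (glue y _ g'))) :
  (gm (fw F i) e1 ;; nt ec2 (erefl _) =
   nt ec1 (erefl _) ;; gm (cact Y a) e2 ;; co (erefl _) eg1'') <-> factor_law_at f g h.
Proof.
have -> : gm (fw F i) e1 = fmap (fw F i) (factor_coh f g h).
  by congr (fmap _ _); apply: glue_ext => //=; rewrite co_strict.
have -> : gm (cact Y a) e2 = fmap (cact Y a) (factor_inner f g h).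
  by congr (fmap _ _); apply: glue_ext => //=; rewrite nt_strict.
rewrite !nt_strict /factor_law_at /co -lock gm_eq1 cmp1f.
set q := gm_eq _ _; set q' := fmap (cact Y (a ;; b)) _.
have -> : q' = q by congr (fmap _ _); apply: glue_ext.
by rewrite !(@cmpA (Y i)).
Qed.

(** The freedom is only apparent: each equation can be solved for its gluing arrow because the
    components of [eqr] are invertible, and substitution gives back the strict law. *)
Lemma factor_lawP : factor_law F <-> factor_flex_law.
Proof.
split=> L i j k a b x y m n f g h.
  move=> f1 g1 h1 c1 c2 f1' g' g1' f2 ef1 eg1 eh1 ec1 ec2 ef1' eg' eg1' ef2 eg1'' e1 e2.
  have Eg1 := cmpVE eg1; have Eh := cmpVE eh1; have Ec1 := cmpVE ec1; have Ec2 := cmpVE ec2.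
  move: ef1 eg1 eh1 ec1 ec2 ef1' eg' eg1' ef2 eg1'' e1 e2; subst c1 c2 h1 g1.
  move=> ef1; subst f1 => eg1 eh1 ec1 ec2 ef1' eg' eg1'; subst f1' g' g1' => ef2; subst f2.
  by move=> eg1'' e1 e2; apply/factor_law_atP; exact: L.
pose f1 := f ;; eql (cact X b) (glue y m g).
pose g1 := invm (eqr (dcmp D (erefl (a ;; b))) (glue x y f)) ;; g.
pose h1 := invm (eqr (cact X b) (glue y m g)) ;; h.
pose g' := g ;; eql (fw F k) (glue m n h).
have eg1 : eqr (dcmp D (erefl (a ;; b))) (glue x y f) ;; g1 = g by rewrite cmpKV.
have eh1 : eqr (cact X b) (glue y m g) ;; h1 = h by rewrite cmpKV.
have ec1 : eqr (cact X a) (glue x _ f1) ;; (invm (eqr (cact X a) (glue x _ f1)) ;; h1) = h1.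
  by rewrite cmpKV.
have ec2 : eqr (cact X (a ;; b)) (glue _ m g1) ;;
           (invm (eqr (cact X (a ;; b)) (glue _ m g1)) ;; h) = h by rewrite cmpKV.
have eg1'' : eqr (dcmp D (erefl (a ;; b))) (glue x y f) ;;
             (g1 ;; eql (fw F k) (glue m n h)) = g' by rewrite cmpA eg1.
have e1 : invm (eqr (cact X a) (glue x _ f1)) ;; h1 ;; fmap (lleg _) (idm n) =
          fmap (rleg _) (co (erefl f1) eg1) ;; (invm (eqr (cact X (a ;; b)) (glue _ m g1)) ;; h).
  by rewrite co_strict; exact: factor_cohP.
have e2 : f1 ;; eql (fw F j) (glue _ n h1) ;; fmap (lleg _) (nt eh1 (erefl g')) =
          fmap (rleg _) (idm x) ;; (f ;; eql (cact Y b) (glue y _ g')).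
  by rewrite nt_strict; exact: factor_innerP.
apply/(factor_law_atP ec1 ec2 eg1'' e1 e2); exact: L.
Qed.
End FactorFlex.

Section AssocV.
Variables (S T U V : pgpd) (M : span S T) (N : span T U) (K : span U V).
Let A := M ** N ** K.
Let B := M ** (N ** K).
(** The inverse associator is given explicitly, rather than as a quasi-inverse of [assocF], so that
    the equivalences [cw] of a composite factorization compute on glued points. *)
Definition assocV_ob (t : B) : A :=
  @glue _ _ _ (M ** N) K (glue (hp1 t) (hp1 (hp2 t)) (hpm t)) (hp2 (hp2 t)) (hpm (hp2 t)).
Definition assocV_map (s t : B) (f : hom s t) : hom (assocV_ob s) (assocV_ob t) :=
  garr (assocV_ob s) (assocV_ob t)
    (garr (hp1 (assocV_ob s) : M ** N) (hp1 (assocV_ob t)) (arr1 f) (arr1 (arr2 f)) (hphomP f))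
    (arr2 (arr2 f)) (hphomP (arr2 f)).
Lemma assocV_map1 t : assocV_map (idm t) = idm (assocV_ob t).
Proof. by apply: glue_ext => //; apply: glue_ext. Qed.
Lemma assocV_mapM r s t (f : hom r s) (g : hom s t) :
  assocV_map (f ;; g) = assocV_map f ;; assocV_map g.
Proof. by apply: glue_ext => //; apply: glue_ext. Qed.
Definition assocVF : functor B A := Functor assocV_map1 assocV_mapM.
Lemma assocVFP : equivalence assocVF.
Proof.
split=> [s t f g e|s t g|[[m n a] k b]].
- apply: glue_ext; first exact: (congr1 (fun h : hom (assocV_ob s) (assocV_ob t) => arr1 (arr1 h)) e).
  apply: glue_ext.
    exact: (congr1 (fun h : hom (assocV_ob s) (assocV_ob t) => arr2 (arr1 h)) e).
  exact: (congr1 (fun h : hom (assocV_ob s) (assocV_ob t) => arr2 h) e).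
- have e2 : hpm (hp2 s) ;; fmap (lleg K) (arr2 g) =
            fmap (rleg N) (arr2 (arr1 g)) ;; hpm (hp2 t) := hphomP g.
  have e1 : hpm s ;; fmap (lleg (N ** K)) (garr (hp2 s) (hp2 t) (arr2 (arr1 g)) (arr2 g) e2) =
            fmap (rleg M) (arr1 (arr1 g)) ;; hpm t := hphomP (arr1 g).
  by exists (garr s t _ _ e1); apply: glue_ext => //; apply: glue_ext.
- exists (glue m (glue n k b : N ** K) a : B).
  by split; exact: (idm (_ : A)).
Qed.
Lemma assocV_l_law (s t : B) (f : hom s t) :
  fmap (lleg B) f ;; idm (lleg B t) = idm (lleg B s) ;; fmap (fcomp assocVF (lleg A)) f.
Proof. by rewrite cmp1f cmpf1. Qed.
Lemma assocV_r_law (s t : B) (f : hom s t) :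
  fmap (rleg B) f ;; idm (rleg B t) = idm (rleg B s) ;; fmap (fcomp assocVF (rleg A)) f.
Proof. by rewrite cmp1f cmpf1. Qed.
Definition assocV_l : natiso (lleg B) (fcomp assocVF (lleg A)) :=
  @Natiso _ _ (lleg B) (fcomp assocVF (lleg A)) (fun _ => idm _) assocV_l_law.
Definition assocV_r : natiso (rleg B) (fcomp assocVF (rleg A)) :=
  @Natiso _ _ (rleg B) (fcomp assocVF (rleg A)) (fun _ => idm _) assocV_r_law.
Lemma assocV_s (t : B) :
  sgn B t (+) par (assocV_r t) = par (assocV_l t) (+) sgn A (assocVF t).
Proof. by rewrite /= !par1 addbF /= /hcomp_sgn /= /hcomp_sgn !addbA. Qed.
Definition assocV : sequiv B A := SEquiv assocVFP assocV_s.
End AssocV.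

Section FactorComp.
Variables (I : gpd) (D : diagram I) (C T U : pgpd).
Variables (X : cocone D C) (Y : cocone D T) (Z : cocone D U).
Variables (F : factor X Y) (G : factor Y Z).
Let P := F ** G.

Definition cw i : sequiv (X i ** P) (Z i) :=
  vcomp (assocV (X i) F G) (vcomp (rwhisk (fw F i) G) (fw G i)).

Lemma cw_r i (m : X i) (p : F) (r : G) (h : hom (rleg _ m) (lleg _ p)) (d : hom (rleg _ p) (lleg _ r)) :
  eqr (cw i) (@glue _ _ _ (X i) P m (@glue _ _ _ F G p r d) h) =
  eqr (fw G i) (glue (fw F i (glue m p h)) r (invm (eqr (fw F i) (glue m p h)) ;; d)).
Proof. exact: etrans (cmp1f _) (cmp1f _). Qed.

Section CompNat.
Variables (i j : I) (a : hom i j).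
Section At.
Variables (x : dmap D a) (m : X j) (p : F) (r : G).
Variables (f : hom (rleg _ x) (lleg _ m)) (h : hom (rleg _ m) (lleg _ p))
  (d : hom (rleg _ p) (lleg _ r)).
Variables (c : hom (rleg _ (gx (cact X a) f)) (lleg _ p)).
Variables (f' : hom (rleg _ x) (lleg _ (gx (fw F j) h))).
Variables (hG : hom (rleg _ (gx (fw F j) h)) (lleg G r)).
Variables (cG : hom (rleg _ (gx (fw F i) c)) (lleg G r)).
Variables (cG' : hom (rleg _ (gx (cact Y a) f')) (lleg G r)).
Variables (k : hom (rleg _ x) (lleg _ (gx (fw G j) hG))).
Variables (e1 : eqr (cact X a) (glue x m f) ;; c = h)
    (e2 : f ;; eql (fw F j) (glue m p h) = f')
    (eh : eqr (fw F j) (glue m p h) ;; hG = d)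
    (ec : eqr (fw F i) (glue _ p c) ;; cG = d)
    (e3 : eqr (cact Y a) (glue x _ f') ;; cG' = hG)
    (e4 : f' ;; eql (fw G j) (glue _ r hG) = k).
Lemma cn_sq : cG ;; fmap (lleg G) (idm r) = fmap (rleg (Y i)) (nt e1 e2) ;; cG'.
Proof.
rewrite fmap1 cmpf1; apply: (@cmpI _ _ _ _ (eqr (fw F i) (glue _ p c))).
by rewrite ec cmpA nt_r -cmpA e3 eh.
Qed.
(** The cell of F, pushed through [fw G i], followed by the cell of G at the image points: the
    pasting of the two naturality squares over a. *)
Definition cn : hom (gx (fw G i) cG) (gx (cact Z a) k) :=
  gm (fw G i) cn_sq ;; nt e3 e4.
End At.

Lemma cn_natural (x x' : dmap D a) (m m' : X j) (p p' : F) (r r' : G)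
  (f : hom (rleg _ x) (lleg _ m)) (h : hom (rleg _ m) (lleg _ p)) (d : hom (rleg _ p) (lleg _ r))
  (c : hom (rleg _ (gx (cact X a) f)) (lleg _ p))
  (l : hom (rleg _ x) (lleg _ (gx (fw F j) h)))
  (hG : hom (rleg _ (gx (fw F j) h)) (lleg G r))
  (cG : hom (rleg _ (gx (fw F i) c)) (lleg G r))
  (dG : hom (rleg _ (gx (cact Y a) l)) (lleg G r))
  (k : hom (rleg _ x) (lleg _ (gx (fw G j) hG)))
  (e1 : eqr (cact X a) (glue x m f) ;; c = h)
  (e2 : f ;; eql (fw F j) (glue m p h) = l)
  (eh : eqr (fw F j) (glue m p h) ;; hG = d)
  (ec : eqr (fw F i) (glue _ p c) ;; cG = d)
  (e3 : eqr (cact Y a) (glue x _ l) ;; dG = hG)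
  (e4 : l ;; eql (fw G j) (glue _ r hG) = k)
  (f' : hom (rleg _ x') (lleg _ m')) (h' : hom (rleg _ m') (lleg _ p'))
  (d' : hom (rleg _ p') (lleg _ r'))
  (c' : hom (rleg _ (gx (cact X a) f')) (lleg _ p'))
  (l' : hom (rleg _ x') (lleg _ (gx (fw F j) h')))
  (hG' : hom (rleg _ (gx (fw F j) h')) (lleg G r'))
  (cG' : hom (rleg _ (gx (fw F i) c')) (lleg G r'))
  (dG' : hom (rleg _ (gx (cact Y a) l')) (lleg G r'))
  (k' : hom (rleg _ x') (lleg _ (gx (fw G j) hG')))
  (e1' : eqr (cact X a) (glue x' m' f') ;; c' = h')
  (e2' : f' ;; eql (fw F j) (glue m' p' h') = l')
  (eh' : eqr (fw F j) (glue m' p' h') ;; hG' = d')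
  (ec' : eqr (fw F i) (glue _ p' c') ;; cG' = d')
  (e3' : eqr (cact Y a) (glue x' _ l') ;; dG' = hG')
  (e4' : l' ;; eql (fw G j) (glue _ r' hG') = k')
  (u : hom x x') (v : hom m m') (w : hom p p') (s : hom r r')
  (euv : f ;; fmap (lleg _) v = fmap (rleg _) u ;; f')
  (evw : h ;; fmap (lleg _) w = fmap (rleg _) v ;; h')
  (ews : d ;; fmap (lleg _) s = fmap (rleg _) w ;; d')
  (e5 : c ;; fmap (lleg _) w = fmap (rleg _) (gm (cact X a) euv) ;; c')
  (e6 : cG ;; fmap (lleg _) s = fmap (rleg _) (gm (fw F i) e5) ;; cG')
  (e7 : hG ;; fmap (lleg _) s = fmap (rleg _) (gm (fw F j) evw) ;; hG')
  (e8 : k ;; fmap (lleg _) (gm (fw G j) e7) = fmap (rleg _) u ;; k') :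
  gm (fw G i) e6 ;; cn e1' e2' eh' ec' e3' e4' = cn e1 e2 eh ec e3 e4 ;; gm (cact Z a) e8.
Proof.
have eF : l ;; fmap (lleg _) (gm (fw F j) evw) = fmap (rleg _) u ;; l' := sq_l _ e2 e2' euv.
have eD : dG ;; fmap (lleg _) s = fmap (rleg _) (gm (cact Y a) eF) ;; dG'.
  exact: sq_r e3 e3' e7.
rewrite /cn cmpA gmM -cmpA -(nt_natural e3 e4 e3' e4' (w := s) eD) cmpA gmM.
congr (_ ;; _); apply: gm_ext; last by rewrite cmp1f cmpf1.
exact: nt_natural.
Qed.

Definition cn_at (t : dmap D a ** X j ** P) :
    hom (vcomp (rwhisk (cact X a) P) (cw i) t)
        (vcomp (assoc _ _ _) (vcomp (lwhisk (dmap D a) (cw j)) (cact Z a)) t) :=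
  match t with HP (HP x m f) (HP p r d) h =>
   @cn x m p r f h d (invm (eqr (cact X a) (glue x m f)) ;; h)
     (f ;; eql (fw F j) (glue m p h)) (invm (eqr (fw F j) (glue m p h)) ;; d)
     (invm (eqr (fw F i) (glue _ p (invm (eqr (cact X a) (glue x m f)) ;; h))) ;; d)
     (invm (eqr (cact Y a) (glue x _ (f ;; eql (fw F j) (glue m p h)))) ;;
        (invm (eqr (fw F j) (glue m p h)) ;; d))
     (f ;; eql (cw j) (@glue _ _ _ (X j) P m (@glue _ _ _ F G p r d) h))
     (cmpKV _ _) (erefl _) (cmpKV _ _) (cmpKV _ _) (cmpKV _ _)
     (etrans (esym (cmpA _ _ _)) (congr1 (fun q => f ;; q) (esym (cmp1f _)))) end.

Lemma cn_at_natural (t t' : dmap D a ** X j ** P) (f : hom t t') :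
  fmap (vcomp (rwhisk (cact X a) P) (cw i)) f ;; cn_at t' =
  cn_at t ;; fmap (vcomp (assoc _ _ _) (vcomp (lwhisk (dmap D a) (cw j)) (cact Z a))) f.
Proof.
case: t t' f => [[x m f] [p r d] h] [[x' m' f'] [p' r' d'] h'] k.
pose u : hom x x' := arr1 (arr1 k); pose v : hom m m' := arr2 (arr1 k).
pose w : hom p p' := arr1 (arr2 k); pose s : hom r r' := arr2 (arr2 k).
pose h0 : hom (rleg (X j) m) (lleg F p) := h; pose h0' : hom (rleg (X j) m') (lleg F p') := h'.
have euv : f ;; fmap (lleg _) v = fmap (rleg _) u ;; f' := hphomP (arr1 k).
have evw : h0 ;; fmap (lleg _) w = fmap (rleg _) v ;; h0' := hphomP k.
have ews : d ;; fmap (lleg _) s = fmap (rleg _) w ;; d' := hphomP (arr2 k).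
pose c := invm (eqr (cact X a) (glue x m f)) ;; h0.
pose c' := invm (eqr (cact X a) (glue x' m' f')) ;; h0'.
have e5 : c ;; fmap (lleg _) w = fmap (rleg _) (gm (cact X a) euv) ;; c'.
  by apply: sq_r (evw); rewrite cmpKV.
pose cG := invm (eqr (fw F i) (glue _ p c)) ;; d.
pose cG' := invm (eqr (fw F i) (glue _ p' c')) ;; d'.
have e6 : cG ;; fmap (lleg _) s = fmap (rleg _) (gm (fw F i) e5) ;; cG'.
  by apply: sq_r (ews); rewrite cmpKV.
pose hG := invm (eqr (fw F j) (glue m p h0)) ;; d.
pose hG' := invm (eqr (fw F j) (glue m' p' h0')) ;; d'.
have e7 : hG ;; fmap (lleg _) s = fmap (rleg _) (gm (fw F j) evw) ;; hG'.
  by apply: sq_r (ews); rewrite cmpKV.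
pose l := f ;; eql (fw F j) (glue m p h0); pose l' := f' ;; eql (fw F j) (glue m' p' h0').
have el : l ;; fmap (lleg _) (gm (fw F j) evw) = fmap (rleg _) u ;; l' by apply: sq_l (euv).
pose k1 := f ;; eql (cw j) (@glue _ _ _ (X j) P m (@glue _ _ _ F G p r d) h0).
pose k1' := f' ;; eql (cw j) (@glue _ _ _ (X j) P m' (@glue _ _ _ F G p' r' d') h0').
pose ek : l ;; eql (fw G j) (glue _ r hG) = k1 :=
  etrans (esym (cmpA _ _ _)) (congr1 (fun q => f ;; q) (esym (cmp1f _))).
pose ek' : l' ;; eql (fw G j) (glue _ r' hG') = k1' :=
  etrans (esym (cmpA _ _ _)) (congr1 (fun q => f' ;; q) (esym (cmp1f _))).
have e8 : k1 ;; fmap (lleg _) (gm (fw G j) e7) = fmap (rleg _) u ;; k1' := sq_l _ ek ek' el.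
have E := cn_natural (cmpKV _ _) (erefl l) (cmpKV _ _) (cmpKV _ _) (cmpKV _ _) ek
   (cmpKV _ _) (erefl l') (cmpKV _ _) (cmpKV _ _) (cmpKV _ _) ek' ews e6 e8.
have L1 : gm (fw G i) e6 = fmap (vcomp (rwhisk (cact X a) P) (cw i)) k.
  congr (fmap _ _); apply: glue_ext => //.
  by rewrite /=; congr (fmap _ _); apply: glue_ext => //; rewrite /=; congr (fmap _ _); apply: glue_ext.
have L2 : gm (cact Z a) e8 =
    fmap (vcomp (assoc _ _ _) (vcomp (lwhisk (dmap D a) (cw j)) (cact Z a))) k.
  congr (fmap _ _); apply: glue_ext => //.
  by rewrite /=; congr (fmap _ _); apply: glue_ext => //; rewrite /=; congr (fmap _ _); apply: glue_ext.
by rewrite -L1 -L2; exact: E.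
Qed.

Definition cn_iso := @Natiso _ _ (vcomp (rwhisk (cact X a) P) (cw i))
  (vcomp (assoc _ _ _) (vcomp (lwhisk (dmap D a) (cw j)) (cact Z a))) cn_at cn_at_natural.

Lemma cn_l x m p r (f : hom (rleg _ x) (lleg _ m)) (h : hom (rleg _ m) (lleg _ p))
    (d : hom (rleg F p) (lleg G r)) c l hG cG dG k
    (e1 : eqr (cact X a) (glue x m f) ;; c = h)
    (e2 : f ;; eql (fw F j) (glue m p h) = l)
    (eh : eqr (fw F j) (glue m p h) ;; hG = d)
    (ec : eqr (fw F i) (glue _ p c) ;; cG = d)
    (e3 : eqr (cact Y a) (glue x _ l) ;; dG = hG)
    (e4 : l ;; eql (fw G j) (glue _ r hG) = k) :
  eql (cact X a) (glue x m f) ;; (eql (fw F i) (glue _ p c) ;; eql (fw G i) (glue _ r cG))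
    ;; fmap (lleg _) (cn e1 e2 eh ec e3 e4) = eql (cact Z a) (glue x _ k).
Proof.
rewrite /cn fmapM -(nt_l e3 e4) -(nt_l e1 e2); apply: cmp_paste4; exact: gm_l.
Qed.

Lemma cn_r x m p r (f : hom (rleg _ x) (lleg _ m)) (h : hom (rleg _ m) (lleg _ p))
    (d : hom (rleg F p) (lleg G r)) c l hG cG dG k
    (e1 : eqr (cact X a) (glue x m f) ;; c = h)
    (e2 : f ;; eql (fw F j) (glue m p h) = l)
    (eh : eqr (fw F j) (glue m p h) ;; hG = d)
    (ec : eqr (fw F i) (glue _ p c) ;; cG = d)
    (e3 : eqr (cact Y a) (glue x _ l) ;; dG = hG)
    (e4 : l ;; eql (fw G j) (glue _ r hG) = k) :
  eqr (fw G i) (glue _ r cG) ;; fmap (rleg _) (cn e1 e2 eh ec e3 e4) =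
  eqr (fw G j) (glue _ r hG) ;; eqr (cact Z a) (glue x _ k).
Proof.
by rewrite /cn fmapM cmpA gm_r fmap1 cmp1f (nt_r e3 e4).
Qed.

Definition cn_siso : siso (vcomp (rwhisk (cact X a) P) (cw i))
  (vcomp (assoc _ _ _) (vcomp (lwhisk (dmap D a) (cw j)) (cact Z a))).
Proof.
apply: (@SIso _ _ _ _ _ _ cn_iso) => -[[x m f] [p r d] h].
all: pose h0 : hom (rleg (X j) m) (lleg F p) := h.
all: pose c := invm (eqr (cact X a) (glue x m f)) ;; h0.
all: pose cG := invm (eqr (fw F i) (glue _ p c)) ;; d.
all: pose hG := invm (eqr (fw F j) (glue m p h0)) ;; d.
all: pose k := f ;; eql (cw j) (@glue _ _ _ (X j) P m (@glue _ _ _ F G p r d) h0).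
all: pose t := @glue _ _ _ (dmap D a ** X j) P (glue x m f) (@glue _ _ _ F G p r d) h.
  suff E : eql (cact X a) (glue x m f) ;;
      (idm _ ;; (eql (fw F i) (glue _ p c) ;; eql (fw G i) (glue _ r cG)))
    ;; fmap (lleg _) (cn_at t) = idm _ ;; (idm _ ;; eql (cact Z a) (glue x _ k)) by exact: E.
  by rewrite !cmp1f; exact: cn_l.
rewrite -[eqr (vcomp (rwhisk _ _) _) _]/(idm _ ;; eqr (cw i) (rwhisk_ob (cact X a) t)).
rewrite -[eqr (vcomp (assoc _ _ _) _) _]/(idm _ ;; (eqr (cw j) (@glue _ _ _ (X j) P m (@glue _ _ _ F G p r d) h0) ;; eqr (cact Z a) (glue x _ k))).
apply: etrans (congr1 (fun q => q ;; _) (cmp1f _)) _; apply: etrans _ (esym (cmp1f _)).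
apply: etrans (congr1 (fun q => q ;; _) (cw_r c d)) _.
apply: etrans _ (esym (congr1 (fun q => q ;; _) (cw_r h0 d))).
exact: cn_r.
Defined.
End CompNat.

Definition comp_factor_data : factor_data X Z := @FactorData _ _ _ _ X Z P cw (@cn_siso).

Lemma gm_cw i (m m' : X i) (p p' : F) (r r' : G)
    (h : hom (rleg _ m) (lleg _ p)) (d : hom (rleg _ p) (lleg _ r))
    (h' : hom (rleg _ m') (lleg _ p')) (d' : hom (rleg _ p') (lleg _ r'))
    (v : hom m m') (w : hom (@glue _ _ _ F G p r d) (@glue _ _ _ F G p' r' d'))
    (e : h ;; fmap (lleg F) (arr1 w) = fmap (rleg _) v ;; h')
    (e3 : invm (eqr (fw F i) (glue m p h)) ;; d ;; fmap (lleg G) (arr2 w) =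
          fmap (rleg _) (gm (fw F i) e) ;; (invm (eqr (fw F i) (glue m' p' h')) ;; d')) :
  @gm _ _ _ (X i) P _ (cw i) m m' (@glue _ _ _ F G p r d) (@glue _ _ _ F G p' r' d') h h' v w e =
  gm (fw G i) e3.
Proof.
pose n := @glue _ _ _ F G p r d; pose n' := @glue _ _ _ F G p' r' d'.
have E : rwhisk_map (fw F i) (assocV_map (@garr _ _ _ (X i) P
    (@glue _ _ _ (X i) P m n h) (@glue _ _ _ (X i) P m' n' h') v w e)) =
  garr (glue (fw F i (glue m p h)) r _) (glue (fw F i (glue m' p' h')) r' _) _ _ e3.
  apply: glue_ext => //; rewrite /=; congr (fmap _ _); exact: glue_ext.
exact: (congr1 (fun z => fmap (fw G i) z) E).
Qed.

Section NtComp.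
Variables (i j : I) (a : hom i j).
Lemma nt_comp (x : dmap D a) (m : X j) (p : F) (r : G)
    (f : hom (rleg _ x) (lleg _ m)) (h : hom (rleg _ m) (lleg _ p)) (d : hom (rleg _ p) (lleg _ r))
    (c : hom (rleg _ (gx (cact X a) f)) (lleg _ p))
    (e1 : eqr (cact X a) (glue x m f) ;; c = h) :
    let l := f ;; eql (fw F j) (glue m p h) in
    let hG := invm (eqr (fw F j) (glue m p h)) ;; d in
    let cG := invm (eqr (fw F i) (glue _ p c)) ;; d in
    let dG := invm (eqr (cact Y a) (glue x _ l)) ;; hG in
    forall (k : hom (rleg _ x) (lleg _ (gx (fw G j) hG)))
    (e2 : f ;; eql (cw j) (@glue _ _ _ (X j) P m (@glue _ _ _ F G p r d) h) = k)
    (eh : eqr (fw F j) (glue m p h) ;; hG = d)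
    (ec : eqr (fw F i) (glue _ p c) ;; cG = d)
    (e3 : eqr (cact Y a) (glue x _ l) ;; dG = hG)
    (e4 : l ;; eql (fw G j) (glue _ r hG) = k),
  @nt _ _ _ _ _ _ comp_factor_data i j a x m (@glue _ _ _ F G p r d) f h c k e1 e2 =
  cn e1 (erefl l) eh ec e3 e4.
Proof.
have Ec := cmpVE e1; move: e1; subst c => e1 l hG cG dG k e2; subst k => eh ec e3 e4.
rewrite nt_strict.
(* Hom sets have decidable equality, so the equations between gluing arrows have unique proofs. *)
rewrite (eq_irrelevance e1 (cmpKV _ _)) (eq_irrelevance eh (cmpKV _ _)).
rewrite (eq_irrelevance ec (cmpKV _ _)) (eq_irrelevance e3 (cmpKV _ _)).
rewrite (eq_irrelevance e4 (etrans (esym (cmpA _ _ _)) (congr1 (fun q => f ;; q) (esym (cmp1f _))))).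
by [].
Qed.
End NtComp.

Section CompLaw.
Variables (i j k : I) (a : hom i j) (b : hom j k).
Variables (x : dmap D a) (y : dmap D b) (m : X k) (p : F) (r : G).
Variables (f : hom (rleg _ x) (lleg _ y)) (g : hom (rleg _ y) (lleg _ m))
  (h : hom (rleg _ m) (lleg _ p)) (d : hom (rleg _ p) (lleg _ r)).
Variables (f1 : hom (rleg _ x) (lleg _ (gx (cact X b) g)))
  (g1 : hom (rleg _ (dcmp D (erefl (a ;; b)) (glue x y f))) (lleg _ m))
  (h1 : hom (rleg _ (gx (cact X b) g)) (lleg _ p))
  (c1 : hom (rleg _ (gx (cact X a) f1)) (lleg _ p))
  (c2 : hom (rleg _ (gx (cact X (a ;; b)) g1)) (lleg _ p)).
Variables (hGk : hom (rleg _ (gx (fw F k) h)) (lleg G r))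
  (hGj : hom (rleg _ (gx (fw F j) h1)) (lleg G r))
  (cG1 : hom (rleg _ (gx (fw F i) c1)) (lleg G r))
  (cG2 : hom (rleg _ (gx (fw F i) c2)) (lleg G r)).
Variables (l1 : hom (rleg _ x) (lleg _ (gx (fw F j) h1)))
  (lb : hom (rleg _ y) (lleg _ (gx (fw F k) h)))
  (lab : hom (rleg _ (dcmp D (erefl (a ;; b)) (glue x y f))) (lleg _ (gx (fw F k) h))).
Variables (dG1 : hom (rleg _ (gx (cact Y a) l1)) (lleg G r))
  (dGb : hom (rleg _ (gx (cact Y b) lb)) (lleg G r))
  (dGab : hom (rleg _ (gx (cact Y (a ;; b)) lab)) (lleg G r)).
Variables (k1 : hom (rleg _ x) (lleg _ (gx (fw G j) hGj)))
  (kb : hom (rleg _ y) (lleg _ (gx (fw G k) hGk)))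
  (kab : hom (rleg _ (dcmp D (erefl (a ;; b)) (glue x y f))) (lleg _ (gx (fw G k) hGk))).
Variables (f2 : hom (rleg _ x) (lleg _ (gx (cact Z b) kb))).
Variables (ef1 : f ;; eql (cact X b) (glue y m g) = f1)
  (eg1 : eqr (dcmp D (erefl (a ;; b))) (glue x y f) ;; g1 = g)
  (eh1 : eqr (cact X b) (glue y m g) ;; h1 = h)
  (ec1 : eqr (cact X a) (glue x _ f1) ;; c1 = h1)
  (ec2 : eqr (cact X (a ;; b)) (glue _ m g1) ;; c2 = h).
Variables (ehk : eqr (fw F k) (glue m p h) ;; hGk = d)
  (ehj : eqr (fw F j) (glue _ p h1) ;; hGj = d)
  (ecG1 : eqr (fw F i) (glue _ p c1) ;; cG1 = d)
  (ecG2 : eqr (fw F i) (glue _ p c2) ;; cG2 = d).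
Variables (el1 : f1 ;; eql (fw F j) (glue _ p h1) = l1)
  (elb : g ;; eql (fw F k) (glue m p h) = lb)
  (elab : g1 ;; eql (fw F k) (glue m p h) = lab).
Variables (ed1 : eqr (cact Y a) (glue x _ l1) ;; dG1 = hGj)
  (edb : eqr (cact Y b) (glue y _ lb) ;; dGb = hGk)
  (edab : eqr (cact Y (a ;; b)) (glue _ _ lab) ;; dGab = hGk).
Variables (ek1 : l1 ;; eql (fw G j) (glue _ r hGj) = k1)
  (ekb : lb ;; eql (fw G k) (glue _ r hGk) = kb)
  (ekab : lab ;; eql (fw G k) (glue _ r hGk) = kab).
Variables (ef2 : f ;; eql (cact Z b) (glue y _ kb) = f2)
  (egab : eqr (dcmp D (erefl (a ;; b))) (glue x y f) ;; kab = kb).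
Variables (e5 : c1 ;; fmap (lleg _) (idm p) = fmap (rleg _) (co ef1 eg1) ;; c2)
  (e6 : cG1 ;; fmap (lleg _) (idm r) = fmap (rleg _) (gm (fw F i) e5) ;; cG2)
  (e8 : k1 ;; fmap (lleg _) (cn eh1 elb ehk ehj edb ekb) = fmap (rleg _) (idm x) ;; f2).
(** Three squares are pasted: the law of F pushed through [fw G i], the law of G, and the naturality
    of the cell of G over a with respect to the cell of F over b. The arrows [f2F], [c1G] and [f1G]
    glue the intermediate points, which lie over Y. *)
Lemma cn_law :
  gm (fw G i) e6 ;; cn ec2 elab ehk ecG2 edab ekab =
  cn ec1 el1 ehj ecG1 ed1 ek1 ;; gm (cact Z a) e8 ;; co ef2 egab.
Proof.
pose f2F := f ;; eql (cact Y b) (glue y _ lb).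
have eF2 : l1 ;; fmap (lleg _) (nt eh1 elb) = fmap (rleg _) (idm x) ;; f2F.
  by rewrite fmap1 cmp1f /f2F -(nt_l eh1 elb) -el1 -ef1 !cmpA.
have eYab : eqr (dcmp D (erefl (a ;; b))) (glue x y f) ;; lab = lb.
  by rewrite -elab -elb cmpA eg1.
have LF := (factor_lawP F).1 (@flaw _ _ _ _ _ _ F) _ _ _ _ _ _ _ _ _ _ _ _ _ _ _ _ _ _ _ _ _
  ef1 eg1 eh1 ec1 ec2 el1 elb elab (erefl f2F) eYab e5 eF2.
pose c1G := invm (eqr (cact Y a) (glue x _ f2F)) ;; dGb.
have ec1G : eqr (cact Y a) (glue x _ f2F) ;; c1G = dGb by rewrite cmpKV.
pose f1G := f2F ;; eql (fw G j) (glue _ r dGb).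
have e1G : c1G ;; fmap (lleg _) (idm r) = fmap (rleg _) (co (erefl f2F) eYab) ;; dGab.
  rewrite fmap1 cmpf1.
  apply: (@cmpI _ _ _ _ (eqr (cact Y b) (glue y _ lb) ;; eqr (cact Y a) (glue x _ f2F))).
  by rewrite -[LHS]cmpA ec1G edb cmpA co_r edab.
have e2G : f1G ;; fmap (lleg _) (nt edb ekb) = fmap (rleg _) (idm x) ;; f2.
  by rewrite fmap1 cmp1f /f1G /f2F -ef2 -(nt_l edb ekb) !cmpA.
have LG := (factor_lawP G).1 (@flaw _ _ _ _ _ _ G) _ _ _ _ _ _ _ _ _ _ _ _ _ _ _ _ _ _ _ _ _
  (erefl f2F) eYab edb ec1G edab (erefl f1G) ekb ekab ef2 egab e1G e2G.
have sY : dG1 ;; fmap (lleg _) (idm r) = fmap (rleg _) (gm (cact Y a) eF2) ;; c1G.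
  have B := sq_r eF2 ed1 ec1G; exact: (B _ (cn_sq eh1 elb ehk ehj edb)).
have e4 : k1 ;; fmap (lleg _) (gm (fw G j) (cn_sq eh1 elb ehk ehj edb)) =
    fmap (rleg _) (idm x) ;; f1G.
  have B := sq_l (cn_sq eh1 elb ehk ehj edb) ek1 (erefl f1G); exact: (B _ eF2).
have N := nt_natural ed1 ek1 ec1G (erefl f1G) sY e4.
have -> : gm (cact Z a) e8 = gm (cact Z a) e4 ;; gm (cact Z a) e2G.
  by rewrite gmM; apply: gm_ext; rewrite ?cmp1f.
rewrite /cn; apply: (cmp_paste5 N LG); rewrite !gmM; apply: gm_ext; last by rewrite !cmp1f.
exact: LF.
Qed.
End CompLaw.

Lemma comp_factor_law : factor_law comp_factor_data.
Proof.
apply/factor_lawP => i j k a b x y m [p r d] f g h0 f1 g1 h10 c10 c20 k10 kb0 kab0 f20.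
pose h : hom (rleg (X k) m) (lleg F p) := h0.
pose h1 : hom (rleg (X j) (gx (cact X b) g)) (lleg F p) := h10.
pose c1 : hom (rleg (X i) (gx (cact X a) f1)) (lleg F p) := c10.
pose c2 : hom (rleg (X i) (gx (cact X (a ;; b)) g1)) (lleg F p) := c20.
pose hGk := invm (eqr (fw F k) (glue m p h)) ;; d.
pose hGj := invm (eqr (fw F j) (glue _ p h1)) ;; d.
pose cG1 := invm (eqr (fw F i) (glue _ p c1)) ;; d.
pose cG2 := invm (eqr (fw F i) (glue _ p c2)) ;; d.
pose l1 := f1 ;; eql (fw F j) (glue _ p h1).
pose lb := g ;; eql (fw F k) (glue m p h).
pose lab := g1 ;; eql (fw F k) (glue m p h).
pose k1 : hom (rleg _ x) (lleg (Z j) (gx (fw G j) hGj)) := k10.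
pose kb : hom (rleg _ y) (lleg (Z k) (gx (fw G k) hGk)) := kb0.
pose kab : hom (rleg _ _) (lleg (Z k) (gx (fw G k) hGk)) := kab0.
pose f2 : hom (rleg _ x) (lleg (Z j) (gx (cact Z b) kb)) := f20.
move=> ef1 eg1 eh1 ec1 ec2 ek10 ekb0 ekab0 ef2 egab e1 e2.
have ek1 : l1 ;; eql (fw G j) (glue _ r hGj) = k1.
  exact: etrans (esym (cmpA _ _ _)) (etrans (congr1 (cmp f1) (esym (cmp1f _))) ek10).
have ekb : lb ;; eql (fw G k) (glue _ r hGk) = kb.
  exact: etrans (esym (cmpA _ _ _)) (etrans (congr1 (cmp g) (esym (cmp1f _))) ekb0).
have ekab : lab ;; eql (fw G k) (glue _ r hGk) = kab.
  exact: etrans (esym (cmpA _ _ _)) (etrans (congr1 (cmp g1) (esym (cmp1f _))) ekab0).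
have ehk : eqr (fw F k) (glue m p h) ;; hGk = d by rewrite cmpKV.
have ehj : eqr (fw F j) (glue _ p h1) ;; hGj = d by rewrite cmpKV.
have ecG1 : eqr (fw F i) (glue _ p c1) ;; cG1 = d by rewrite cmpKV.
have ecG2 : eqr (fw F i) (glue _ p c2) ;; cG2 = d by rewrite cmpKV.
have ed1 := cmpKV (eqr (cact Y a) (glue x _ l1)) hGj.
have edb := cmpKV (eqr (cact Y b) (glue y _ lb)) hGk.
have edab := cmpKV (eqr (cact Y (a ;; b)) (glue _ _ lab)) hGk.
have Nb := @nt_comp j k b y m p r g h d h1 eh1 kb ekb0 ehk ehj edb ekb.
have N1 := @nt_comp i j a x _ p r f1 h1 d c1 ec1 k1 ek10 ehj ecG1 ed1 ek1.
have Nab := @nt_comp i k (a ;; b) _ m p r g1 h d c2 ec2 kab ekab0 ehk ecG2 edab ekab.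
pose e5 : c1 ;; fmap (lleg _) (idm p) = fmap (rleg _) (co ef1 eg1) ;; c2 := e1.
have e6 : cG1 ;; fmap (lleg _) (idm r) = fmap (rleg _) (gm (fw F i) e5) ;; cG2.
  by apply: (sq_r e5 ecG1 ecG2); rewrite !fmap1 cmpf1 cmp1f.
have e8 : k1 ;; fmap (lleg _) (cn eh1 (erefl lb) ehk ehj edb ekb) = fmap (rleg _) (idm x) ;; f2.
  by rewrite -Nb; exact: e2.
have L1 := @gm_cw i _ _ p p r r c1 d c2 d _ (idm (@glue _ _ _ F G p r d : P)) e5 e6.
have L2 : gm (cact Z a) e2 = gm (cact Z a) e8 by apply: gm_ext.
have L := @cn_law i j k a b x y m p r f g h d f1 g1 h1 c1 c2 hGk hGj cG1 cG2 l1 lb lab _ _ _ k1 kb kab f2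
  ef1 eg1 eh1 ec1 ec2 ehk ehj ecG1 ecG2 (erefl l1) (erefl lb) (erefl lab) ed1 edb edab ek1 ekb ekab
  ef2 egab e5 e6 e8.
rewrite -Nab -N1 -L1 -L2 in L.
exact: L.
Qed.

Definition comp_factor : factor X Z := Factor comp_factor_law.
End FactorComp.

(** * Building cocones and factorizations *)

Section CoconeLawFlex.
Variables (I : gpd) (D : diagram I) (T : pgpd) (X : cocone_data D T).

Definition cocone_flex_law : Prop :=
  forall i j k l (a : hom i j) (b : hom j k) (c : hom k l)
    (x : dmap D a) (y : dmap D b) (z : dmap D c) (m : X l)
    (f : hom (rleg _ x) (lleg _ y)) (g : hom (rleg _ y) (lleg _ z)) (h : hom (rleg _ z) (lleg _ m)),
  let xy := dcmp D (erefl (a ;; b)) (glue x y f) in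
  let yz := dcmp D (erefl (b ;; c)) (glue y z g) in
  let g2 := invm (eqr (dcmp D (erefl (a ;; b))) (glue x y f)) ;; g in
  let f2 := f ;; eql (dcmp D (erefl (b ;; c))) (glue y z g) in
  forall (g0 : hom (rleg _ y) (lleg _ (gx (cact X c) h)))
    (f0 : hom (rleg _ x) (lleg _ (gx (cact X b) g0)))
    (g1 : hom (rleg _ xy) (lleg _ (gx (cact X c) h)))
    (h1 : hom (rleg _ (dcmp D (erefl (a ;; b ;; c)) (glue xy z g2))) (lleg _ m))
    (h2 : hom (rleg _ yz) (lleg _ m))
    (f3 : hom (rleg _ x) (lleg _ (gx (cact X (b ;; c)) h2)))
    (h3 : hom (rleg _ (dcmp D (cmpA a b c) (glue x yz f2))) (lleg _ m))
    (eg0 : g ;; eql (cact X c) (glue z m h) = g0)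
    (ef0 : f ;; eql (cact X b) (glue y _ g0) = f0)
    (eg1 : eqr (dcmp D (erefl (a ;; b))) (glue x y f) ;; g1 = g0)
    (eg1' : g2 ;; eql (cact X c) (glue z m h) = g1)
    (eh1 : eqr (dcmp D (erefl (a ;; b ;; c))) (glue xy z g2) ;; h1 = h)
    (eh2 : eqr (dcmp D (erefl (b ;; c))) (glue y z g) ;; h2 = h)
    (ef3 : f2 ;; eql (cact X (b ;; c)) (glue yz m h2) = f3)
    (eh3 : eqr (dcmp D (cmpA a b c)) (glue x yz f2) ;; h3 = h2)
    (e1 : h1 ;; fmap (lleg _) (idm m) =
          fmap (rleg _) (dassoc D a b c (glue (glue x y f) z g)) ;; h3)
    (e2 : f0 ;; fmap (lleg _) (co eg0 eh2) = fmap (rleg _) (idm x) ;; f3),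
  co ef0 eg1 ;; co eg1' eh1 ;; gm (cact X (a ;; b ;; c)) e1 =
  gm (cact X a) e2 ;; co ef3 eh3.

Lemma cocone_law_atP i j k l (a : hom i j) (b : hom j k) (c : hom k l)
    (x : dmap D a) (y : dmap D b) (z : dmap D c) (m : X l)
    (f : hom (rleg _ x) (lleg _ y)) (g : hom (rleg _ y) (lleg _ z)) (h : hom (rleg _ z) (lleg _ m))
    (xy := dcmp D (erefl (a ;; b)) (glue x y f))
    (yz := dcmp D (erefl (b ;; c)) (glue y z g))
    (g2 := invm (eqr (dcmp D (erefl (a ;; b))) (glue x y f)) ;; g)
    (f2 := f ;; eql (dcmp D (erefl (b ;; c))) (glue y z g))
    (g0 := g ;; eql (cact X c) (glue z m h))
    (f0 := f ;; eql (cact X b) (glue y _ g0))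
    (g1 := g2 ;; eql (cact X c) (glue z m h))
    (h1 := invm (eqr (dcmp D (erefl (a ;; b ;; c))) (glue xy z g2)) ;; h)
    (h2 := invm (eqr (dcmp D (erefl (b ;; c))) (glue y z g)) ;; h)
    (f3 := f2 ;; eql (cact X (b ;; c)) (glue yz m h2))
    (h3 := invm (eqr (dcmp D (cmpA a b c)) (glue x yz f2)) ;; h2)
    (eg1 : eqr (dcmp D (erefl (a ;; b))) (glue x y f) ;; g1 = g0)
    (eh1 : eqr (dcmp D (erefl (a ;; b ;; c))) (glue xy z g2) ;; h1 = h)
    (eh2 : eqr (dcmp D (erefl (b ;; c))) (glue y z g) ;; h2 = h)
    (eh3 : eqr (dcmp D (cmpA a b c)) (glue x yz f2) ;; h3 = h2)
    (e1 : h1 ;; fmap (lleg _) (idm m) =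
          fmap (rleg _) (dassoc D a b c (glue (glue x y f) z g)) ;; h3)
    (e2 : f0 ;; fmap (lleg _) (co (erefl g0) eh2) = fmap (rleg _) (idm x) ;; f3) :
  (co (erefl f0) eg1 ;; co (erefl g1) eh1 ;; gm (cact X (a ;; b ;; c)) e1 =
   gm (cact X a) e2 ;; co (erefl f3) eh3) <-> cocone_law_at f g h.
Proof.
have -> : gm (cact X (a ;; b ;; c)) e1 = fmap (cact X (a ;; b ;; c)) (cocone_assoc f g h).
  by congr (fmap _ _); apply: glue_ext.
have -> : gm (cact X a) e2 = fmap (cact X a) (cocone_inner f g h).
  by congr (fmap _ _); apply: glue_ext => //=; rewrite co_strict.
rewrite !co_strict /cocone_law_at /co -lock gm_eq1 cmp1f.
set q := gm_eq _ _; set q' := fmap (cact X (a ;; b)) _.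
have -> : q' = q by congr (fmap _ _); apply: glue_ext.
by [].
Qed.

(** As for [factor_lawP], the equations determine the free gluing arrows. *)
Lemma cocone_lawP : cocone_law X <-> cocone_flex_law.
Proof.
split=> L i j k l a b c x y z m f g h.
  cbv zeta=> g0 f0 g1 h1 h2 f3 h3 eg0 ef0 eg1 eg1' eh1 eh2 ef3 eh3 e1 e2.
  have E1 := cmpVE eh1; have E2 := cmpVE eh2; have E3 := cmpVE eh3.
  move: eg0 ef0 eg1 eg1' eh1 eh2 ef3 eh3 e1 e2; subst h1 h3 h2.
  move=> eg0; subst g0 => ef0; subst f0 => eg1 eg1'.
  move: eg1; subst g1 => eg1 eh1 eh2 ef3; subst f3 => eh3 e1 e2.
  by apply/cocone_law_atP; exact: L.
pose g0 := g ;; eql (cact X c) (glue z m h).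
pose g2 := invm (eqr (dcmp D (erefl (a ;; b))) (glue x y f)) ;; g.
pose f2 := f ;; eql (dcmp D (erefl (b ;; c))) (glue y z g).
have eg1 : eqr (dcmp D (erefl (a ;; b))) (glue x y f) ;; (g2 ;; eql (cact X c) (glue z m h)) = g0.
  by rewrite cmpA cmpKV.
have eh1 := cmpKV (eqr (dcmp D (erefl (a ;; b ;; c))) (glue _ z g2)) h.
have eh2 := cmpKV (eqr (dcmp D (erefl (b ;; c))) (glue y z g)) h.
have eh3 := cmpKV (eqr (dcmp D (cmpA a b c)) (glue x _ f2))
  (invm (eqr (dcmp D (erefl (b ;; c))) (glue y z g)) ;; h).
apply/(cocone_law_atP eg1 eh1 (eh2 := eh2) eh3).
- exact: cocone_assocP.
- by rewrite co_strict; exact: cocone_innerP.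
- by move=> e1 e2; exact: L.
Qed.
End CoconeLawFlex.

Section CoconeBuild.
Variables (I : gpd) (D : diagram I) (T : pgpd).
Variable X : forall i, span (D i) T.
Variable cact : forall i j (a : hom i j), sequiv (dmap D a ** X j) (X i).
Arguments cact {i j} a.
Variable cc : forall i j k (a : hom i j) (b : hom j k) (c : hom i k) (e : a ;; b = c)
    (x : dmap D a) (y : dmap D b) (m : X k) (f : hom (rleg _ x) (lleg _ y))
    (g : hom (rleg _ y) (lleg _ m)),
  hom (gx (cact a) (f ;; eql (cact b) (glue y m g)))
      (gx (cact c) (invm (eqr (dcmp D e) (glue x y f)) ;; g)).
Hypothesis cc_natural : forall i j k (a : hom i j) (b : hom j k) (c : hom i k) (e : a ;; b = c)
    (x x' : dmap D a) (y y' : dmap D b) (m m' : X k)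
    (f : hom (rleg _ x) (lleg _ y)) (f' : hom (rleg _ x') (lleg _ y'))
    (g : hom (rleg _ y) (lleg _ m)) (g' : hom (rleg _ y') (lleg _ m'))
    (u : hom x x') (v : hom y y') (w : hom m m')
    (euv : f ;; fmap (lleg _) v = fmap (rleg _) u ;; f')
    (evw : g ;; fmap (lleg _) w = fmap (rleg _) v ;; g')
    (e3 : f ;; eql (cact b) (glue y m g) ;; fmap (lleg _) (gm (cact b) evw) =
          fmap (rleg _) u ;; (f' ;; eql (cact b) (glue y' m' g')))
    (e4 : invm (eqr (dcmp D e) (glue x y f)) ;; g ;; fmap (lleg _) w =
          fmap (rleg _) (gm (dcmp D e) euv) ;; (invm (eqr (dcmp D e) (glue x' y' f')) ;; g')),
  gm (cact a) e3 ;; cc e f' g' = cc e f g ;; gm (cact c) e4.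
Hypothesis cc_l : forall i j k (a : hom i j) (b : hom j k) (c : hom i k) (e : a ;; b = c)
    (x : dmap D a) (y : dmap D b) (m : X k) (f : hom (rleg _ x) (lleg _ y))
    (g : hom (rleg _ y) (lleg _ m)),
  eql (cact a) (glue x _ (f ;; eql (cact b) (glue y m g))) ;; fmap (lleg _) (cc e f g) =
  eql (dcmp D e) (glue x y f) ;; eql (cact c) (glue _ m (invm (eqr (dcmp D e) (glue x y f)) ;; g)).
Hypothesis cc_r : forall i j k (a : hom i j) (b : hom j k) (c : hom i k) (e : a ;; b = c)
    (x : dmap D a) (y : dmap D b) (m : X k) (f : hom (rleg _ x) (lleg _ y))
    (g : hom (rleg _ y) (lleg _ m)),
  eqr (cact b) (glue y m g) ;; eqr (cact a) (glue x _ (f ;; eql (cact b) (glue y m g)))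
    ;; fmap (rleg _) (cc e f g) =
  eqr (cact c) (glue _ m (invm (eqr (dcmp D e) (glue x y f)) ;; g)).

Section Coh.
Variables (i j k : I) (a : hom i j) (b : hom j k) (c : hom i k) (e : a ;; b = c).
Let u := vcomp (assoc _ _ _) (vcomp (lwhisk (dmap D a) (cact b)) (cact a)).
Let v := vcomp (rwhisk (dcmp D e) (X k)) (cact c).
Definition cc_at (t : dmap D a ** dmap D b ** X k) : hom (u t) (v t) :=
  match t with HP (HP x y f) m g => cc e f g end.
Lemma cc_at_natural t t' (k0 : hom t t') : fmap u k0 ;; cc_at t' = cc_at t ;; fmap v k0.
Proof.
case: t t' k0 => [[x y f] m g0] [[x' y' f'] m' g0'] q.
pose g : hom (rleg (dmap D b) y) (lleg (X k) m) := g0.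
pose g' : hom (rleg (dmap D b) y') (lleg (X k) m') := g0'.
pose p : hom x x' := arr1 (arr1 q); pose r : hom y y' := arr2 (arr1 q).
pose w : hom m m' := arr2 q.
have epr : f ;; fmap (lleg _) r = fmap (rleg _) p ;; f' := hphomP (arr1 q).
have erw : g ;; fmap (lleg _) w = fmap (rleg _) r ;; g' := hphomP q.
have e3 : f ;; eql (cact b) (glue y m g) ;; fmap (lleg _) (gm (cact b) erw) =
          fmap (rleg _) p ;; (f' ;; eql (cact b) (glue y' m' g')).
  by rewrite -cmpA gm_l !cmpA epr.
have e4 : invm (eqr (dcmp D e) (glue x y f)) ;; g ;; fmap (lleg _) w =
          fmap (rleg _) (gm (dcmp D e) epr) ;; (invm (eqr (dcmp D e) (glue x' y' f')) ;; g').
  by apply: (sq_r _ (cmpKV _ g) (cmpKV _ g')).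
have E := cc_natural e3 e4.
have L1 : gm (cact a) e3 = fmap u q.
  congr (fmap _ _); apply: glue_ext => //.
  by rewrite /=; congr (fmap _ _); apply: glue_ext.
have L2 : gm (cact c) e4 = fmap v q.
  congr (fmap _ _); apply: glue_ext => //.
  by rewrite /=; congr (fmap _ _); apply: glue_ext.
by rewrite -L1 -L2; exact: E.
Qed.
Definition cc_iso : natiso u v := @Natiso _ _ u v cc_at cc_at_natural.
Definition cc_siso : siso u v.
Proof.
apply: (@SIso _ _ _ _ u v cc_iso) => -[[x y f] m g].
  apply: etrans (etrans (cc_l e f g) _).
    by apply: (congr1 (fun q => q ;; _)); exact: etrans (cmp1f _) (cmp1f _).
  by [].
apply: etrans (etrans (cc_r e f g) _).
  by apply: (congr1 (fun q => q ;; _)); exact: cmp1f.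
exact: esym (cmp1f _).
Defined.
End Coh.

(** Cells need to be supplied only at glued triples and for strict gluing arrows, which is the form
    in which the test cocones have them. *)
Definition build_cocone_data : cocone_data D T := @CoconeData I D T X (@cact) (@cc_siso).
End CoconeBuild.

Section FactorBuild.
Variables (I : gpd) (D : diagram I) (C T : pgpd) (X : cocone D C) (Y : cocone D T).
Variable N : span C T.
Variable w : forall i, sequiv (X i ** N) (Y i).
Variable nn : forall i j (a : hom i j) (x : dmap D a) (m : X j) (n : N)
    (f : hom (rleg _ x) (lleg _ m)) (h : hom (rleg _ m) (lleg _ n)),
  hom (gx (w i) (invm (eqr (cact X a) (glue x m f)) ;; h))
      (gx (cact Y a) (f ;; eql (w j) (glue m n h))).
Hypothesis nn_natural : forall i j (a : hom i j) (x x' : dmap D a) (m m' : X j) (n n' : N)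
    (f : hom (rleg _ x) (lleg _ m)) (h : hom (rleg _ m) (lleg _ n))
    (f' : hom (rleg _ x') (lleg _ m')) (h' : hom (rleg _ m') (lleg _ n'))
    (u : hom x x') (v : hom m m') (s : hom n n')
    (euv : f ;; fmap (lleg _) v = fmap (rleg _) u ;; f')
    (evs : h ;; fmap (lleg _) s = fmap (rleg _) v ;; h')
    (e3 : invm (eqr (cact X a) (glue x m f)) ;; h ;; fmap (lleg _) s =
          fmap (rleg _) (gm (cact X a) euv) ;; (invm (eqr (cact X a) (glue x' m' f')) ;; h'))
    (e4 : f ;; eql (w j) (glue m n h) ;; fmap (lleg _) (gm (w j) evs) =
          fmap (rleg _) u ;; (f' ;; eql (w j) (glue m' n' h'))),
  gm (w i) e3 ;; nn f' h' = nn f h ;; gm (cact Y a) e4.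
Hypothesis nn_l : forall i j (a : hom i j) (x : dmap D a) (m : X j) (n : N)
    (f : hom (rleg _ x) (lleg _ m)) (h : hom (rleg _ m) (lleg _ n)),
  eql (cact X a) (glue x m f) ;; eql (w i) (glue _ n (invm (eqr (cact X a) (glue x m f)) ;; h))
    ;; fmap (lleg _) (nn f h) = eql (cact Y a) (glue x _ (f ;; eql (w j) (glue m n h))).
Hypothesis nn_r : forall i j (a : hom i j) (x : dmap D a) (m : X j) (n : N)
    (f : hom (rleg _ x) (lleg _ m)) (h : hom (rleg _ m) (lleg _ n)),
  eqr (w i) (glue _ n (invm (eqr (cact X a) (glue x m f)) ;; h)) ;; fmap (rleg _) (nn f h) =
  eqr (w j) (glue m n h) ;; eqr (cact Y a) (glue x _ (f ;; eql (w j) (glue m n h))).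

Section Nat.
Variables (i j : I) (a : hom i j).
Let u := vcomp (rwhisk (cact X a) N) (w i).
Let v := vcomp (assoc _ _ _) (vcomp (lwhisk (dmap D a) (w j)) (cact Y a)).
Definition nn_at (t : dmap D a ** X j ** N) : hom (u t) (v t) :=
  match t with HP (HP x m f) n h => nn f h end.
Lemma nn_at_natural t t' (k : hom t t') : fmap u k ;; nn_at t' = nn_at t ;; fmap v k.
Proof.
case: t t' k => [[x m f] n h0] [[x' m' f'] n' h0'] q.
pose h : hom (rleg (X j) m) (lleg N n) := h0.
pose h' : hom (rleg (X j) m') (lleg N n') := h0'.
pose p : hom x x' := arr1 (arr1 q); pose r : hom m m' := arr2 (arr1 q).
pose s : hom n n' := arr2 q.
have epr : f ;; fmap (lleg _) r = fmap (rleg _) p ;; f' := hphomP (arr1 q).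
have ers : h ;; fmap (lleg _) s = fmap (rleg _) r ;; h' := hphomP q.
have e3 : invm (eqr (cact X a) (glue x m f)) ;; h ;; fmap (lleg _) s =
          fmap (rleg _) (gm (cact X a) epr) ;; (invm (eqr (cact X a) (glue x' m' f')) ;; h').
  by apply: (sq_r _ (cmpKV _ h) (cmpKV _ h')).
have e4 : f ;; eql (w j) (glue m n h) ;; fmap (lleg _) (gm (w j) ers) =
          fmap (rleg _) p ;; (f' ;; eql (w j) (glue m' n' h')).
  by rewrite -cmpA gm_l !cmpA epr.
have E := nn_natural e3 e4.
have L1 : gm (w i) e3 = fmap u q.
  congr (fmap _ _); apply: glue_ext => //.
  by rewrite /=; congr (fmap _ _); apply: glue_ext.
have L2 : gm (cact Y a) e4 = fmap v q.
  congr (fmap _ _); apply: glue_ext => //.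
  by rewrite /=; congr (fmap _ _); apply: glue_ext.
by rewrite -L1 -L2; exact: E.
Qed.
Definition nn_iso : natiso u v := @Natiso _ _ u v nn_at nn_at_natural.
Definition nn_siso : siso u v.
Proof.
apply: (@SIso _ _ _ _ u v nn_iso) => -[[x m f] n h].
  apply: etrans (etrans (nn_l f h) _); first by [].
  exact: esym (etrans (cmp1f _) (cmp1f _)).
apply: etrans (etrans (nn_r f h) _).
  by apply: (congr1 (fun q => q ;; _)); exact: cmp1f.
exact: esym (cmp1f _).
Defined.
End Nat.

Definition build_factor_data : factor_data X Y := @FactorData _ _ _ _ X Y N w (@nn_siso).
End FactorBuild.

(** * Every parity groupoid is a homotopy colimit of points *)

Lemma cmp_ladder (G : gpd) (x y z x' y' z' : G) (a : hom x y) (b : hom y z) (a' : hom x' y')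
    (b' : hom y' z') (k1 : hom x x') (k2 : hom y y') (k3 : hom z z') :
  k1 ;; a' = a ;; k2 -> b ;; k3 = k2 ;; b' -> k1 ;; (a' ;; b') = a ;; b ;; k3.
Proof. by move=> e1 e2; rewrite cmpA e1 -!cmpA e2. Qed.

Section PointCocone.
Variables (S T : pgpd) (Y : cocone (point_diagram S) T).

Definition pglue s t (a : hom s t) (y : Y t) : dmap (point_diagram S) a ** Y t :=
  @glue _ _ _ (dmap (point_diagram S) a) (Y t) tt y tt.

Definition pgarr s t (a : hom s t) (y y' : Y t) (f : hom y y') : hom (pglue a y) (pglue a y') :=
  garr (pglue a y) (pglue a y') tt f (unit_eq _ _).

(** Over the diagram of points the apexes of the diagram are the unit, so Y amounts to a
    contravariant pseudofunctor on S with values in groupoids over T: [act] is transport, [mu] its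
    composition constraint and [psi] the comparison of right legs. Parity enters only through
    [act_sgn]. *)
Definition act s t (a : hom s t) (y : Y t) : Y s := cact Y a (pglue a y).

Definition actf s t (a : hom s t) (y y' : Y t) (f : hom y y') : hom (act a y) (act a y') :=
  fmap (cact Y a) (pgarr a f).

Definition mu s t u (a : hom s t) (b : hom t u) (c : hom s u) (e : a ;; b = c) (y : Y u) :
    hom (act a (act b y)) (act c y) :=
  ccoh Y e (@glue _ _ _ (dmap (point_diagram S) a ** dmap (point_diagram S) b) (Y u)
    (@glue _ _ _ (dmap (point_diagram S) a) (dmap (point_diagram S) b) tt tt tt) y tt).

Definition psi s t (a : hom s t) (y : Y t) : hom (rleg (Y t) y) (rleg (Y s) (act a y)) :=
  eqr (cact Y a) (pglue a y).

Lemma pgarr_ext s t (a : hom s t) (x y : dmap (point_diagram S) a ** Y t)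
  (f g : hom x y) : arr2 f = arr2 g -> f = g.
Proof. by move=> e; apply: glue_ext => //; apply: unit_eq. Qed.

Lemma actf1 s t (a : hom s t) (y : Y t) : actf a (idm y) = idm (act a y).
Proof.
rewrite -fmap1; congr (fmap _ _); exact: pgarr_ext.
Qed.

Lemma actfM s t (a : hom s t) (x y z : Y t) (f : hom x y) (g : hom y z) :
  actf a (f ;; g) = actf a f ;; actf a g.
Proof.
rewrite -fmapM; congr (fmap _ _); exact: pgarr_ext.
Qed.

Lemma actfV s t (a : hom s t) (x y : Y t) (f : hom x y) :
  actf a (invm f) = invm (actf a f).
Proof. by apply: (@cmpI _ _ _ _ (actf a f)); rewrite -actfM !cmpfV actf1. Qed.

Lemma actf_inj s t (a : hom s t) (x y : Y t) : injective (@actf s t a x y).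
Proof. by move=> f g /(eq_faithful (eqFP (cact Y a))) /(congr1 (fun k => arr2 k)). Qed.

Definition act_lift s t (a : hom s t) (x y : Y t) (g : hom (act a x) (act a y)) : hom x y :=
  arr2 (lift (eqFP (cact Y a)) g).

Lemma act_liftK s t (a : hom s t) (x y : Y t) (g : hom (act a x) (act a y)) :
  actf a (act_lift g) = g.
Proof.
rewrite -[RHS](liftK (eqFP (cact Y a))); congr (fmap _ _); exact: pgarr_ext.
Qed.

Lemma act_esurj s t (a : hom s t) (y : Y s) : exists z, inhabited (hom (act a z) y).
Proof.
have [[x z h] [f]] := eq_esurj (eqFP (cact Y a)) y.
case: x h f => h f; exists z; split.
by case: h f => f; exact: f.
Qed.

Lemma mu_natural s t u (a : hom s t) (b : hom t u) (c : hom s u) (e : a ;; b = c)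
    (y z : Y u) (f : hom y z) :
  actf a (actf b f) ;; mu e z = mu e y ;; actf c f.
Proof.
pose D := point_diagram S.
pose xy : dmap D a ** dmap D b := @glue _ _ _ (dmap D a) (dmap D b) tt tt tt.
pose g (y : Y u) : dmap D a ** dmap D b ** Y u := @glue _ _ _ (dmap D a ** dmap D b) (Y u) xy y tt.
pose k : hom (g y) (g z) := garr (g y) (g z) (idm xy) f (unit_eq _ _).
have h1 : lwhisk_map (cact Y b) (assoc_map k) = pgarr a (actf b f).
  apply: (@pgarr_ext s t a); rewrite /= /actf.
  have -> // : assoc_map2 k = pgarr b f by apply: pgarr_ext.
have h2 : rwhisk_map (dcmp D e) k = pgarr c f by apply: (@pgarr_ext s u c).
have := nat_law (ccoh Y e) k; rewrite -[X in X ;; _]/(fmap (cact Y a) _).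
rewrite -[X in _ = _ ;; X]/(fmap (cact Y c) _) [X in fmap (cact Y a) X]h1.
by rewrite [X in fmap (cact Y c) X]h2.
Qed.

Lemma psi_natural s t (a : hom s t) (y z : Y t) (f : hom y z) :
  fmap (rleg (Y t)) f ;; psi a z = psi a y ;; fmap (rleg (Y s)) (actf a f).
Proof. exact: (nat_law (eqr (cact Y a)) (pgarr a f)). Qed.

Lemma mu_psi s t u (a : hom s t) (b : hom t u) (c : hom s u) (e : a ;; b = c) (y : Y u) :
  psi b y ;; psi a (act b y) ;; fmap (rleg (Y s)) (mu e y) = psi c y.
Proof.
pose D := point_diagram S.
have : idm _ ;; (psi b y ;; psi a (act b y)) ;; fmap (rleg (Y s)) (mu e y) =
       idm _ ;; psi c y :=
  sir (ccoh Y e) (@glue _ _ _ (dmap D a ** dmap D b) (Y u)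
    (@glue _ _ _ (dmap D a) (dmap D b) tt tt tt) y tt).
by rewrite !cmp1f.
Qed.

Lemma act_sgn s t (a : hom s t) (y : Y t) :
  sgn (Y s) (act a y) = par a (+) sgn (Y t) y (+) par (psi a y).
Proof.
have := eqs (cact Y a) (pglue a y); rewrite /= /hcomp_sgn /= addbF.
by move=> ->.
Qed.

Lemma mu_assoc s t u v (a : hom s t) (b : hom t u) (c : hom u v)
    (ab : hom s u) (bc : hom t v) (abc : hom s v)
    (e1 : a ;; b = ab) (e2 : ab ;; c = abc) (e3 : b ;; c = bc) (e4 : a ;; bc = abc) (y : Y v) :
  mu e1 (act c y) ;; mu e2 y = actf a (mu e3 y) ;; mu e4 y.
Proof.
subst ab bc abc; rewrite (eq_irrelevance e4 (cmpA a b c)).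
(* The arrows in the cocone law carry proofs as components; they are abstracted, since their second
   components already determine them. *)
have [g [k [k' E]]] : exists (g : hom (pglue (a ;; b) (act c y)) (pglue (a ;; b) (act c y)))
    (k : hom (pglue (a ;; b ;; c) y) (pglue (a ;; b ;; c) y))
    (k' : hom (pglue a (act b (act c y))) (pglue a (act (b ;; c) y))),
    [/\ arr2 g = idm _, arr2 k = idm _, arr2 k' = mu (erefl (b ;; c)) y
      & mu (erefl (a ;; b)) (act c y) ;; fmap (cact Y (a ;; b)) g
        ;; mu (erefl (a ;; b ;; c)) y ;; fmap (cact Y (a ;; b ;; c)) k
      = fmap (cact Y a) k' ;; mu (cmpA a b c) y].
  by do 3 eexists; split; last exact: (@claw _ _ _ Y s t u v a b c tt tt tt y tt tt tt).
case: E => e1 e2 e3 E.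
have eg : g = idm _ by apply: pgarr_ext.
have ek : k = idm _ by apply: pgarr_ext.
have ek' : k' = pgarr a (mu (erefl (b ;; c)) y) by apply: pgarr_ext.
by move: E; rewrite eg ek ek' !fmap1 !cmpf1.
Qed.

(** A cocone carries no unit constraint. It is recovered by lifting [mu] for id ;; id = id through
    transport along the identity, which is fully faithful. *)
Definition un s (y : Y s) : hom (act (idm s) y) y := act_lift (mu (cmp1f (idm s)) y).

Lemma actf_un_id s (y : Y s) : actf (idm s) (un y) = mu (cmp1f (idm s)) y.
Proof. exact: act_liftK. Qed.

Lemma un_natural s (y z : Y s) (f : hom y z) :
  actf (idm s) f ;; un z = un y ;; f.
Proof.
apply: (@actf_inj _ _ (idm s)); rewrite !actfM !actf_un_id.
exact: mu_natural.
Qed.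

(** The usual derivation of the unit triangle: once an invertible [mu] is cancelled, associativity
    of [mu] with an identity in the middle is all that remains. [un_act] is the mirror image. *)
Lemma actf_un s t (a : hom s t) (e : a ;; idm t = a) (y : Y t) :
  actf a (un y) = mu e y.
Proof.
apply: (@cmpI _ _ _ _ (mu e (act (idm t) y))); rewrite -mu_natural actf_un_id.
by rewrite (mu_assoc e e (cmp1f (idm t)) e).
Qed.

Lemma un_act s t (a : hom s t) (e : idm s ;; a = a) (y : Y t) : un (act a y) = mu e y.
Proof.
apply: (@actf_inj _ _ (idm s)); rewrite actf_un_id.
apply: (@cmpIr _ _ _ _ (mu e y)).
by rewrite (mu_assoc (cmp1f (idm s)) e e e).
Qed.

Lemma psi_un s (y : Y s) : psi (idm s) y ;; fmap (rleg (Y s)) (un y) = idm _.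
Proof.
apply: (@cmpIr _ _ _ _ (psi (idm s) y)); rewrite cmp1f -cmpA psi_natural.
by rewrite actf_un_id cmpA mu_psi.
Qed.

(* The Grothendieck construction of the cocone. *)
Definition tot_ob := {s : S & Y s}.
Definition tot_hom (p q : tot_ob) : finType :=
  {a : hom (tag p) (tag q) & hom (tagged p) (act a (tagged q))}.
Definition tarr s t (y : Y s) (z : Y t) (a : hom s t) (f : hom y (act a z)) :
  tot_hom (Tagged (cob Y) y) (Tagged (cob Y) z) := Tagged (fun a => hom y (act a z)) f.

Definition tot_id p : tot_hom p p := existT _ (idm (tag p)) (invm (un (tagged p))).
Definition tot_cmp p q r (f : tot_hom p q) (g : tot_hom q r) : tot_hom p r :=
  existT _ (tag f ;; tag g)
    (tagged f ;; actf (tag f) (tagged g) ;; mu (erefl (tag f ;; tag g)) (tagged r)).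
Definition tot_inv p q (f : tot_hom p q) : tot_hom q p :=
  existT _ (invm (tag f))
    (invm (actf (invm (tag f)) (tagged f) ;; mu (cmpVf (tag f)) (tagged q) ;; un (tagged q))).

(** The base arrow of a composite is the expected one only up to a proof; as [mu] is indexed by
    commuting triangles, it absorbs this proof and no transport appears in the category laws. *)
Lemma tot_cmpE s t u (x : Y s) (y : Y t) (z : Y u) (a : hom s t) (b : hom t u) (c : hom s u)
   (e : a ;; b = c) (f : hom x (act a y)) (g : hom y (act b z)) :
  tot_cmp (tarr f) (tarr g) = tarr (f ;; actf a g ;; mu e z).
Proof. by subst c. Qed.

Lemma tot_cmpA p q r t (f : tot_hom p q) (g : tot_hom q r) (h : tot_hom r t) :
  tot_cmp f (tot_cmp g h) = tot_cmp (tot_cmp f g) h.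
Proof.
case: p q r t f g h => [p x] [q y] [r z] [t w] [/= a f] [/= b g] [/= c h].
apply: etrans (tot_cmpE (cmpA a b c) f (g ;; actf b h ;; mu (erefl (b ;; c)) w)) _.
apply: etrans (esym (tot_cmpE (erefl (a ;; b ;; c))
  (f ;; actf a g ;; mu (erefl (a ;; b)) z) h)).
congr tarr; rewrite !actfM -!(@cmpA (Y p)); congr (_ ;; (_ ;; _)).
rewrite (@cmpA (Y p) _ _ _ _ (mu _ _)) -mu_natural -!(@cmpA (Y p)).
by congr (_ ;; _); rewrite -(mu_assoc (erefl (a ;; b)) (erefl (a ;; b ;; c))).
Qed.

Lemma tot_cmp1f p q (f : tot_hom p q) : tot_cmp (tot_id p) f = f.
Proof.
case: p q f => [p x] [q y] [/= a f].
rewrite (tot_cmpE (cmp1f a) (invm (un x)) f).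
by rewrite -[RHS]/(tarr f); congr tarr; rewrite -(un_act (cmp1f a)) -cmpA un_natural cmpVK.
Qed.

Lemma tot_cmpf1 p q (f : tot_hom p q) : tot_cmp f (tot_id q) = f.
Proof.
case: p q f => [p x] [q y] [/= a f].
rewrite (tot_cmpE (cmpf1 a) f (invm (un y))).
by rewrite -[RHS]/(tarr f); congr tarr; rewrite actfV (actf_un (cmpf1 a)) cmpKr.
Qed.

Lemma tot_cmpfV p q (f : tot_hom p q) : tot_cmp f (tot_inv f) = tot_id p.
Proof.
case: p q f => [p x] [q y] [/= a f].
rewrite (tot_cmpE (cmpfV a) f).
rewrite -[RHS]/(tarr (invm (un x))); congr tarr.
apply: (@cmpIr _ _ _ _ (un x)); rewrite cmpVf; rewrite actfV.
set k := actf a _; apply: (@cmpIr _ _ _ _ f); rewrite cmp1f -!cmpA -un_natural.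
rewrite (cmpA (mu _ x)) -mu_natural.
suff -> : actf a (actf (invm a) f) ;; mu (cmpfV a) (act a y) ;; un (act a y) = k.
  by rewrite cmpVf cmpf1.
rewrite /k !actfM -!cmpA; congr (_ ;; _).
rewrite (un_act (cmp1f a)) (actf_un (cmpf1 a)).
exact: mu_assoc.
Qed.

Definition tot_cover : seq tot_ob :=
  flatten [seq [seq (Tagged (cob Y) y : tot_ob) | y <- cover (Y s)] | s <- cover S].

Lemma tot_coverP p : has (fun q => 0 < #|tot_hom p q|)%N tot_cover.
Proof.
case: p => t y; rewrite has_flatten has_map.
apply: sub_has (coverP t) => s /isoP[f] /=; rewrite has_map.
(* Up to isomorphism y is transported from a point z over the representative s, and z can then be
   replaced by a representative in Y s. *)
have [z [g]] := act_esurj f y.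
apply: sub_has (coverP z) => z' /isoP[h] /=.
by apply/card_gt0P; exists (tarr (invm g ;; actf f h)).
Qed.

Definition tot_gpd : gpd :=
  @Gpd tot_ob tot_hom tot_id tot_cmp tot_inv tot_cmpA tot_cmp1f tot_cmpf1 tot_cmpfV
   (right_inverse_left tot_cmpA tot_cmpf1 tot_cmpfV) tot_cover tot_coverP.

Definition tot_l : functor tot_gpd S :=
  @Functor tot_gpd S (fun p => tag p) (fun p q f => tag f) (fun _ => erefl)
    (fun _ _ _ _ _ => erefl).

Lemma tot_r1 (p : tot_gpd) :
  fmap (rleg (Y (tag p))) (tagged (tot_id p)) ;; invm (psi (tag (tot_id p)) (tagged p)) = idm _.
Proof.
rewrite /= fmapV -invM -[RHS]inv1; congr invm; exact: psi_un.
Qed.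

Lemma tot_rM (p q r : tot_gpd) (f : hom p q) (g : hom q r) :
  fmap (rleg (Y (tag p))) (tagged (f ;; g)) ;; invm (psi (tag (f ;; g)) (tagged r)) =
  (fmap (rleg (Y (tag p))) (tagged f) ;; invm (psi (tag f) (tagged q))) ;;
  (fmap (rleg (Y (tag q))) (tagged g) ;; invm (psi (tag g) (tagged r))).
Proof.
rewrite /= !fmapM -(mu_psi (erefl (tag f ;; tag g)) (tagged r)) !invM -!cmpA.
congr (_ ;; _); rewrite cmpKV.
apply: (@cmpI _ _ _ _ (psi (tag f) (tagged q))); rewrite cmpKV.
by rewrite cmpA -psi_natural -!cmpA cmpKV.
Qed.

Definition tot_r : functor tot_gpd T :=
  @Functor tot_gpd T (fun p => rleg (Y (tag p)) (tagged p))
   (fun p q f => fmap (rleg (Y (tag p))) (tagged f) ;; invm (psi (tag f) (tagged q)))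
   tot_r1 tot_rM.

Lemma tot_sgn (p q : tot_gpd) (f : hom p q) :
  par (fmap tot_l f) (+) sgn (Y (tag q)) (tagged q) =
  sgn (Y (tag p)) (tagged p) (+) par (fmap tot_r f).
Proof.
have := sgn_law (tagged f); have := act_sgn (tag f) (tagged q); rewrite /= parM parV.
by move=> ->; move: (par _) (par _) (par _) (sgn _ _) (sgn _ _); do 5 case.
Qed.

Definition tot : span S T := Span tot_sgn.

Section TotFactor.
Variable s : S.
Let M := point s ** tot.
Definition tot_glue t (y : Y t) (a : hom s t) : M :=
  @glue _ _ _ (point s) tot tt (Tagged (cob Y) y) a.
(** The homotopy fibre of a Grothendieck construction is equivalent to the strict fibre: a point y
    over t with a : s -> t is transported back along a. *)
Definition tot_w_ob (x : M) : Y s := act (hpm x) (tagged (hp2 x)).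
Lemma tot_w_eq (x x' : M) (f : hom x x') : hpm x ;; tag (arr2 f) = hpm x'.
Proof. exact: etrans (hphomP f) (cmp1f _). Qed.
Definition tot_w_map (x x' : M) (f : hom x x') : hom (tot_w_ob x) (tot_w_ob x') :=
  actf (hpm x) (tagged (arr2 f)) ;; mu (tot_w_eq f) (tagged (hp2 x')).
Lemma tot_w1 (x : M) : tot_w_map (idm x) = idm (tot_w_ob x).
Proof.
rewrite /tot_w_map /= actfV; set e := tot_w_eq _.
by rewrite (actf_un e) cmpVf.
Qed.
Lemma tot_wM (x y z : M) (f : hom x y) (g : hom y z) :
  tot_w_map (f ;; g) = tot_w_map f ;; tot_w_map g.
Proof.
rewrite /tot_w_map /= !actfM -!cmpA; congr (_ ;; _).
rewrite (cmpA (mu _ _)) -mu_natural -!cmpA; congr (_ ;; _).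
exact: esym (mu_assoc _ _ _ _ _).
Qed.
Definition tot_wF : functor M (Y s) := Functor tot_w1 tot_wM.

Lemma tot_wFP : equivalence tot_wF.
Proof.
split=> [x x' f g e|[[] [t y] a] [[] [t' y'] a'] g|y].
- apply: glue_ext; first exact: unit_eq.
  move: (tot_w_eq f) (tot_w_eq g) e; rewrite /= /tot_w_map.
  move: (tot_w_eq f) (tot_w_eq g); move: (arr2 f) (arr2 g) => [b k] [b' k'] /= e e' _ _.
  have eb : b = b' by apply: (@cmpI _ _ _ _ (hpm x)); rewrite e e'.
  subst b'; rewrite (eq_irrelevance e' e) => /cmpIr /actf_inj ->.
  by [].
- have e : a ;; (invm a ;; a') = a' by rewrite cmpKV.
  pose k := act_lift ((g : hom (act a y) (act a' y')) ;; invm (mu e y')).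
  have sq : a ;; fmap (lleg tot) (@tarr t t' y y' (invm a ;; a') k) =
            fmap (rleg (point s)) tt ;; a' by rewrite /= e cmp1f.
  exists (garr (tot_glue y a) (tot_glue y' a') tt (@tarr t t' y y' (invm a ;; a') k) sq).
  rewrite /= /tot_w_map /= act_liftK; set e' := tot_w_eq _.
  by rewrite (eq_irrelevance e' e) cmpKr.
- exists (tot_glue y (idm s)); split; exact: un y.
Qed.

Lemma tot_w_r_law (x x' : M) (f : hom x x') :
  fmap (rleg M) f ;; psi (hpm x') (tagged (hp2 x')) =
  psi (hpm x) (tagged (hp2 x)) ;; fmap (fcomp tot_wF (rleg (Y s))) f.
Proof.
rewrite /= /tot_w_map fmapM -(mu_psi (tot_w_eq f)) -!cmpA cmpVK !cmpA.
by rewrite psi_natural.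
Qed.
Definition tot_w_r : natiso (rleg M) (fcomp tot_wF (rleg (Y s))) :=
  @Natiso _ _ (rleg M) (fcomp tot_wF (rleg (Y s)))
    (fun x => psi (hpm x) (tagged (hp2 x))) tot_w_r_law.
Definition tot_w : sequiv M (Y s).
Proof.
apply: (@SEquiv _ _ M (Y s) tot_wF tot_wFP (to_unit_iso _ _) tot_w_r) => x.
by rewrite /= act_sgn /hcomp_sgn /=.
Defined.
End TotFactor.

Definition pcan s t (a : hom s t) (x : dmap (point_diagram S) a ** Y t) :
    hom (act a (hp2 x)) (cact Y a x) :=
  fmap (cact Y a) (garr (pglue a (hp2 x)) x tt (idm (hp2 x)) (unit_eq _ _)).

Lemma pcan_natural s t (a : hom s t) (x y : dmap (point_diagram S) a ** Y t) (f : hom x y) :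
  pcan x ;; fmap (cact Y a) f = actf a (arr2 f) ;; pcan y.
Proof.
apply: etrans (esym (fmapM _ _ _)) (etrans _ (fmapM _ _ _)); congr (fmap _ _); apply: pgarr_ext.
by rewrite /= cmp1f cmpf1.
Qed.

Lemma pcan_psi s t (a : hom s t) (x : dmap (point_diagram S) a ** Y t) :
  psi a (hp2 x) ;; fmap (rleg (Y s)) (pcan x) = eqr (cact Y a) x.
Proof.
have := nat_law (eqr (cact Y a))
  (garr (pglue a (hp2 x)) x tt (idm (hp2 x)) (unit_eq _ _)).
by rewrite /= fmap1 cmp1f.
Qed.

Lemma pcan_glue s t (a : hom s t) (y : Y t) : pcan (pglue a y) = idm _.
Proof. by rewrite -fmap1; congr (fmap _ _); apply: pgarr_ext. Qed.

(** The right leg of [point_act a] is [invm a], and absorbing it into a gluing arrow inverts once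
    more. *)
Lemma tot_nat_eq (s t u : S) (a : hom s t) (h : hom t u) : a ;; h = invm (invm a) ;; h.
Proof. by rewrite invmK. Qed.

Section TotNat.
Variables (s t : S) (a : hom s t) (x : dmap (point_diagram S) a) (m : point_cocone S t) (n : tot).
Variables (f : hom (rleg _ x) (lleg _ m)) (h : hom (rleg _ m) (lleg tot n)).
Definition tot_nat :
    hom (@gx _ _ _ (point_cocone S s) tot _ (tot_w s) (cact (point_cocone S) a (glue x m f)) n
           (invm (eqr (cact (point_cocone S) a) (glue x m f)) ;; h))
        (gx (cact Y a) (f ;; eql (tot_w t) (glue m n h))) :=
  locked (invm (mu (tot_nat_eq a h) (tagged n)) ;;
    pcan (@glue _ _ _ (dmap (point_diagram S) a) (Y t) x _ (f ;; eql (tot_w t) (glue m n h)))).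
Lemma tot_nat_r :
  eqr (tot_w s) (@glue _ _ _ (point_cocone S s) tot (cact (point_cocone S) a (glue x m f)) n (invm (eqr (cact (point_cocone S) a) (glue x m f)) ;; h))
    ;; fmap (rleg (Y s)) tot_nat =
  eqr (tot_w t) (glue m n h) ;; eqr (cact Y a) (glue x _ (f ;; eql (tot_w t) (glue m n h))).
Proof.
pose p : hom (rleg tot n) (rleg (Y t) (act h (tagged n))) := psi h (tagged n).
pose q : hom (rleg tot n) (rleg (Y s) (act (invm (invm a) ;; h) (tagged n))) :=
  psi (invm (invm a) ;; h) (tagged n).
pose z := @glue _ _ _ (dmap (point_diagram S) a) (Y t) x (act h (tagged n)) tt.
have E : q ;; fmap (rleg (Y s)) (invm (mu (tot_nat_eq a h) (tagged n)) ;; pcan z) = p ;; eqr (cact Y a) z.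
  by rewrite /q fmapM fmapV -(mu_psi (tot_nat_eq a h)) -pcan_psi -!(@cmpA T) cmpKV.
rewrite /tot_nat -lock; move: E; rewrite /z.
by have -> : tt = f ;; eql (tot_w t) (glue m n h) by exact: unit_eq.
Qed.
End TotNat.

Lemma tot_nat_natural s t (a : hom s t) (x x' : dmap (point_diagram S) a) (m m' : point_cocone S t)
    (n n' : tot) (f : hom (rleg _ x) (lleg _ m)) (h : hom (rleg _ m) (lleg tot n))
    (f' : hom (rleg _ x') (lleg _ m')) (h' : hom (rleg _ m') (lleg tot n'))
    (u : hom x x') (v : hom m m') (g : hom n n')
    (euv : f ;; fmap (lleg _) v = fmap (rleg _) u ;; f')
    (evs : h ;; fmap (lleg _) g = fmap (rleg _) v ;; h')
    (e3 : invm (eqr (cact (point_cocone S) a) (glue x m f)) ;; h ;; fmap (lleg _) g =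
          fmap (rleg _) (gm (cact (point_cocone S) a) euv) ;;
          (invm (eqr (cact (point_cocone S) a) (glue x' m' f')) ;; h'))
    (e4 : f ;; eql (tot_w t) (glue m n h) ;; fmap (lleg _) (gm (tot_w t) evs) =
          fmap (rleg _) u ;; (f' ;; eql (tot_w t) (glue m' n' h'))) :
  gm (tot_w s) e3 ;; tot_nat f' h' = tot_nat f h ;; gm (cact Y a) e4.
Proof.
pose c : hom s (tag n) := invm (invm a) ;; h; pose c' : hom s (tag n') := invm (invm a) ;; h'.
have ec : c ;; tag g = c' by rewrite /c -cmpA [X in _ ;; X](evs) cmp1f.
have eh : h ;; tag g = h' := etrans evs (cmp1f _).
have L1 : gm (tot_w s) e3 = actf c (tagged g) ;; mu ec (tagged n').
  by rewrite [LHS]/(tot_w_map _) /tot_w_map; congr (_ ;; mu _ _); exact: eq_irrelevance.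
have L2 : gm (tot_w t) evs = actf h (tagged g) ;; mu eh (tagged n').
  by rewrite [LHS]/(tot_w_map _) /tot_w_map; congr (_ ;; mu _ _); exact: eq_irrelevance.
have E := pcan_natural (garr (@glue _ _ _ (dmap (point_diagram S) a) (Y t) x _ (f ;; eql (tot_w t) (glue m n h)))
  (@glue _ _ _ (dmap (point_diagram S) a) (Y t) x' _ (f' ;; eql (tot_w t) (glue m' n' h'))) u _ e4).
have N : gm (tot_w s) e3 ;; invm (mu (tot_nat_eq a h') (tagged n')) =
    invm (mu (tot_nat_eq a h) (tagged n)) ;; actf a (gm (tot_w t) evs).
  rewrite L1 L2; apply: cmpVE; rewrite cmpA; apply/esym/cmpEV; rewrite actfM.
  by rewrite -cmpA -(mu_assoc (tot_nat_eq a h) ec eh (tot_nat_eq a h')) !cmpA -mu_natural.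
by rewrite /tot_nat -!lock; exact: cmp_ladder N E.
Qed.

Definition tot_factor_data : factor_data (point_cocone S) Y :=
  build_factor_data tot_nat_natural (fun _ _ _ _ _ _ _ _ => unit_eq _ _) tot_nat_r.

(** The bracket is the image under [tot_w] of an identity of the total groupoid, seen as an arrow
    between the positions c and d. These are equal only up to a proof, and passing from one to the
    other merely changes the triangle of [mu]. *)
Lemma mu_transport s t u (a : hom s t) (b : hom t u) (c : hom s u) (d : hom s u)
    (e : a ;; b = c) (e' : a ;; b = d) (ecd : c ;; idm u = d) (y : Y u) :
  mu e y ;; (actf c (invm (un y)) ;; mu ecd y) = mu e' y.
Proof.
have E : c = d by rewrite -ecd cmpf1.
case: d / E e' ecd => e' ecd; rewrite actfV (actf_un ecd) cmpVf cmpf1.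
by rewrite (eq_irrelevance e e').
Qed.

Lemma tot_nt s t u (a : hom s t) (y : Y u) (h : hom t u) (c : hom s u) (e : a ;; h = c)
    (n := Tagged (cob Y) y : tot)
    (f' : hom (tt : unit_pgpd) (lleg (Y t) (act h y)))
    (e1 : eqr (cact (point_cocone S) a)
      (@glue _ _ _ (dmap (point_diagram S) a) (point_cocone S t) tt tt tt) ;; c = h)
    (e2 : (tt : hom (tt : unit_pgpd) tt) ;;
      eql (fw tot_factor_data t) (@glue _ _ _ (point_cocone S t) tot tt n h) = f') :
  @nt _ _ _ _ (point_cocone S) Y tot_factor_data s t a tt tt n tt h c f' e1 e2 =
  invm (mu e y) ;; pcan (@glue _ _ _ (dmap (point_diagram S) a) (Y t) tt (act h y) f').
Proof.
have E : c = invm (invm a) ;; h := cmpVE e1.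
move: e e1; subst c f' => e e1; rewrite nt_strict.
have -> : fnat tot_factor_data a (@glue _ _ _ (dmap (point_diagram S) a ** point_cocone S t) tot
    (@glue _ _ _ (dmap (point_diagram S) a) (point_cocone S t) tt tt tt) n h) =
  @tot_nat s t a tt tt n tt h by [].
by rewrite /tot_nat -lock (eq_irrelevance e (tot_nat_eq a h)).
Qed.

Lemma tot_factor_law : factor_law tot_factor_data.
Proof.
apply/factor_lawP => i j k a b [] [] [] [t y] [] [] h [] [] h1 c1 c2 f1' g' g1' f2.
move=> ef1 eg1 eh1 ec1 ec2 ef1' eg' eg1' ef2 eg1'' e1 e2.
case: g' f2 g1' f1' eg' eg1' ef2 ef1' eg1'' e2 => [] [] [] [] eg' eg1' ef2 ef1' eg1'' e2.
have b1 : b ;; h = h1 := etrans (congr1 (cmp b) (esym eh1)) (cmpKV b h1).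
have b2 : a ;; b ;; h = c2  := etrans (congr1 (cmp (a ;; b)) (esym ec2)) (cmpKV (a ;; b) c2).
have b3 : a ;; h1 = c1  := etrans (congr1 (cmp a) (esym ec1)) (cmpKV a c1).
have b4 : a ;; h1 = c2 by rewrite -b1 cmpA.
have ecd : c1 ;; idm t = c2 by rewrite -b3 -b4 cmpf1.
(* All three cells are inverses of constraints [mu], so the law reduces to [mu_assoc]. *)
have N1 : nt ec1 ef1' = invm (mu b3 y).
  by apply: etrans (tot_nt b3 ec1 ef1') _; rewrite (pcan_glue a (act h1 y)) cmpf1.
have N2 : nt ec2 eg1' = invm (mu b2 y).
  by apply: etrans (tot_nt b2 ec2 eg1') _; rewrite (pcan_glue (a ;; b) (act h y)) cmpf1.
have Nb : nt eh1 eg' = invm (mu b1 y).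
  by apply: etrans (tot_nt b1 eh1 eg') _; rewrite (pcan_glue b (act h y)) cmpf1.
have L1 : gm (fw tot_factor_data i) e1 = actf c1 (invm (un y)) ;; mu ecd y.
  by rewrite [LHS]/(tot_w_map _) /tot_w_map; congr (_ ;; mu _ _); exact: eq_irrelevance.
have L2 : gm (cact Y a) e2 = actf a (invm (mu b1 y)).
  by congr (fmap _ _); apply: pgarr_ext; exact: Nb.
have L3 : co ef2 eg1'' = mu (erefl (a ;; b)) (act h y) by exact: co_strict.
have Q : actf c1 (invm (un y)) ;; mu ecd y = invm (mu b3 y) ;; mu b4 y.
  exact: cmpVE (mu_transport b3 b4 ecd y).
have M := mu_assoc (erefl (a ;; b)) b2 b1 b4 y.
have G : actf c1 (invm (un y)) ;; mu ecd y ;; invm (mu b2 y) =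
    invm (mu b3 y) ;; actf a (invm (mu b1 y)) ;; mu (erefl (a ;; b)) (act h y).
  by rewrite Q actfV (cmpEV M) !cmpA cmpKr.
by rewrite -L1 -N2 -N1 -L2 -L3 in G; exact: G.
Qed.

Definition tot_factor : factor (point_cocone S) Y := Factor tot_factor_law.
End PointCocone.

(** * Comparison of two factorizations through the cocone of points *)

Section PointFactor.
Variables (S T : pgpd) (Y : cocone (point_diagram S) T) (F : factor (point_cocone S) Y).

Definition fglue s (n : F) (a : hom s (lleg F n)) : point s ** F :=
  @glue _ _ _ (point s) F tt n a.
(** As [fw F s] is an equivalence, the pairs (n, a) with a : s -> lleg n present Y s. Every
    factorization thus looks like a Grothendieck construction, with lleg F in the role of the
    projection to S. *)
Definition fo s (n : F) (a : hom s (lleg F n)) : Y s := fw F s (fglue a).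

Lemma fa_sq s (n n' : F) (g : hom n n') (a : hom s (lleg F n)) (a' : hom s (lleg F n'))
    (e : a ;; fmap (lleg F) g = a') :
  a ;; fmap (lleg F) g = idm s ;; a'.
Proof. by rewrite e cmp1f. Qed.

Definition farr s (n n' : F) (g : hom n n') (a : hom s (lleg F n)) (a' : hom s (lleg F n'))
    (e : a ;; fmap (lleg F) g = a') : hom (fglue a) (fglue a') :=
  garr (fglue a) (fglue a') tt g (fa_sq e).

Definition fa s (n n' : F) (g : hom n n') (a : hom s (lleg F n)) (a' : hom s (lleg F n'))
    (e : a ;; fmap (lleg F) g = a') : hom (fo a) (fo a') := fmap (fw F s) (farr e).

Lemma farr_ext s (x y : point s ** F) (f g : hom x y) : arr2 f = arr2 g -> f = g.
Proof. by move=> e; apply: glue_ext => //; apply: unit_eq. Qed.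

Lemma fa1 s (n : F) (a : hom s (lleg F n)) (e : a ;; fmap (lleg F) (idm n) = a) :
  fa e = idm (fo a).
Proof. by rewrite -fmap1; congr (fmap _ _); apply: farr_ext. Qed.

Lemma faM s (n n' n'' : F) (g : hom n n') (g' : hom n' n'') (a : hom s (lleg F n))
    (a' : hom s (lleg F n')) (a'' : hom s (lleg F n''))
    (e : a ;; fmap (lleg F) g = a') (e' : a' ;; fmap (lleg F) g' = a'')
    (e'' : a ;; fmap (lleg F) (g ;; g') = a'') :
  fa e ;; fa e' = fa e''.
Proof. by rewrite /fa -fmapM; congr (fmap _ _); apply: farr_ext. Qed.

Lemma fa_inj s (n n' : F) (g g' : hom n n') (a : hom s (lleg F n)) (a' : hom s (lleg F n'))
    (e : a ;; fmap (lleg F) g = a') (e' : a ;; fmap (lleg F) g' = a') :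
  fa e = fa e' -> g = g'.
Proof. by move=> /(eq_faithful (eqFP (fw F s))) /(congr1 (fun k => arr2 k)). Qed.

Definition fa_lift s (n n' : F) (a : hom s (lleg F n)) (a' : hom s (lleg F n'))
    (k : hom (fo a) (fo a')) : hom n n' := arr2 (lift (eqFP (fw F s)) k).

Lemma fa_lift_eq s (n n' : F) (a : hom s (lleg F n)) (a' : hom s (lleg F n'))
    (k : hom (fo a) (fo a')) : a ;; fmap (lleg F) (fa_lift k) = a'.
Proof. exact: etrans (hphomP (lift (eqFP (fw F s)) k)) (cmp1f _). Qed.

Lemma fa_liftK s (n n' : F) (a : hom s (lleg F n)) (a' : hom s (lleg F n'))
    (k : hom (fo a) (fo a')) (e : a ;; fmap (lleg F) (fa_lift k) = a') : fa e = k.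
Proof.
by rewrite -[RHS](liftK (eqFP (fw F s))); congr (fmap _ _); apply: farr_ext.
Qed.

Lemma fo_esurj s (y : Y s) : exists n, exists a : hom s (lleg F n), inhabited (hom (fo a) y).
Proof. by have [[[] n a] [f]] := eq_esurj (eqFP (fw F s)) y; exists n, a; split. Qed.

Definition fr s (n : F) (a : hom s (lleg F n)) : hom (rleg F n) (rleg (Y s) (fo a)) :=
  eqr (fw F s) (fglue a).

Lemma fr_natural s (n n' : F) (g : hom n n') (a : hom s (lleg F n)) (a' : hom s (lleg F n'))
    (e : a ;; fmap (lleg F) g = a') :
  fmap (rleg F) g ;; fr a' = fr a ;; fmap (rleg (Y s)) (fa e).
Proof. exact: (nat_law (eqr (fw F s)) (farr e)). Qed.

Lemma fo_sgn s (n : F) (a : hom s (lleg F n)) :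
  sgn (Y s) (fo a) = par a (+) sgn F n (+) par (fr a).
Proof.
have E := eqs (fw F s) (fglue a).
by move: E; rewrite /= /hcomp_sgn /= => <-.
Qed.

Lemma fb_eq s t (n : F) (b : hom s t) (a : hom t (lleg F n)) (c : hom s (lleg F n))
  (e : b ;; a = c) : c ;; fmap (lleg F) (idm n) = invm (invm b) ;; a.
Proof. by rewrite fmap1 cmpf1 invmK e. Qed.

Definition fb2 s t (n : F) (b : hom s t) (a : hom t (lleg F n)) :
  hom (fo (invm (invm b) ;; a)) (act b (fo a)) :=
  fnat F b (@glue _ _ _ (dmap (point_diagram S) b ** point_cocone S t) F
    (@glue _ _ _ (dmap (point_diagram S) b) (point_cocone S t) tt tt tt) n a).

(** Restricting a along b and transporting the presented point along b agree; this is the cell of F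
    with its triangle left free. *)
Definition fb s t (n : F) (b : hom s t) (a : hom t (lleg F n)) (c : hom s (lleg F n))
  (e : b ;; a = c) : hom (fo c) (act b (fo a)) := locked (fa (fb_eq e) ;; fb2 b a).

Lemma fb2_natural s t (n n' : F) (g : hom n n') (b : hom s t)
    (a : hom t (lleg F n)) (a' : hom t (lleg F n')) (e : a ;; fmap (lleg F) g = a')
    (e2 : invm (invm b) ;; a ;; fmap (lleg F) g = invm (invm b) ;; a') :
  fa e2 ;; fb2 b a' = fb2 b a ;; actf b (fa e).
Proof.
pose x n (a : hom t (lleg F n)) : dmap (point_diagram S) b ** point_cocone S t ** F :=
 @glue _ _ _ (dmap (point_diagram S) b ** point_cocone S t) F
    (@glue _ _ _ (dmap (point_diagram S) b) (point_cocone S t) tt tt tt) n a.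
pose k : hom (x n a) (x n' a') := garr (x n a) (x n' a') (idm _) g
  (etrans e (esym (cmp1f a'))).
have E := nat_law (fnat F b) k.
have e1 : rwhisk_map (cact (point_cocone S) b) k = farr e2 by apply: (@farr_ext s).
have e2' : assoc_map2 k = farr e by apply: (@farr_ext t).
have e3 : lwhisk_map (fw F t) (assoc_map k) = pgarr b (fa e).
  apply: (@pgarr_ext S T Y s t b); by rewrite /fa -e2'.
by rewrite /fa -e1 /actf -e3; exact: E.
Qed.

Lemma fb_natural s t (n n' : F) (g : hom n n') (b : hom s t)
    (a : hom t (lleg F n)) (a' : hom t (lleg F n')) (e : a ;; fmap (lleg F) g = a')
    (c : hom s (lleg F n)) (c' : hom s (lleg F n')) (e1 : b ;; a = c) (e2 : b ;; a' = c')
    (e3 : c ;; fmap (lleg F) g = c') :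
  fa e3 ;; fb e2 = fb e1 ;; actf b (fa e).
Proof.
have e4 : invm (invm b) ;; a ;; fmap (lleg F) g = invm (invm b) ;; a'.
  by rewrite -cmpA e.
rewrite /fb -!lock -cmpA -(fb2_natural e e4) !cmpA; congr (_ ;; _).
have e5 : c ;; fmap (lleg F) g = invm (invm b) ;; a' by rewrite e3 -e2 invmK.
have e6 : c ;; fmap (lleg F) (g ;; idm n') = invm (invm b) ;; a' by rewrite cmpf1.
have e7 : c ;; fmap (lleg F) (idm n ;; g) = invm (invm b) ;; a' by rewrite cmp1f.
rewrite (faM _ _ e6) (faM _ _ e7); congr (fmap _ _); apply: farr_ext.
by rewrite /= cmpf1 cmp1f.
Qed.

Lemma fb2_r s t (n : F) (b : hom s t) (a : hom t (lleg F n)) :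
  fr (invm (invm b) ;; a) ;; fmap (rleg (Y s)) (fb2 b a) = fr a ;; psi b (fo a).
Proof.
have E : idm _ ;; fr (invm (invm b) ;; a) ;; fmap (rleg (Y s)) (fb2 b a) =
   idm _ ;; (fr a ;; psi b (fo a)) := sir (fnat F b)
   (@glue _ _ _ (dmap (point_diagram S) b ** point_cocone S t) F
    (@glue _ _ _ (dmap (point_diagram S) b) (point_cocone S t) tt tt tt) n a).
by move: E; rewrite !cmp1f.
Qed.

Lemma fb_r s t (n : F) (b : hom s t) (a : hom t (lleg F n)) (c : hom s (lleg F n))
    (e : b ;; a = c) :
  fr c ;; fmap (rleg (Y s)) (fb e) = fr a ;; psi b (fo a).
Proof.
by rewrite /fb -lock fmapM cmpA -fr_natural fmap1 cmp1f fb2_r.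
Qed.

Lemma fb_law s t u (n : F) (b1 : hom s t) (b2 : hom t u) (b : hom s u) (a : hom u (lleg F n))
    (c2 : hom t (lleg F n)) (c : hom s (lleg F n))
    (e : b1 ;; b2 = b) (e1 : b2 ;; a = c2) (e2 : b1 ;; c2 = c) (e3 : b ;; a = c) :
  fb e2 ;; actf b1 (fb e1) ;; mu e (fo a) = fb e3.
Proof.
subst b.
pose c2' := invm (invm b2) ;; a.
(* The arrows in the factorization law are replaced by arbitrary ones with the same second
   components, so that they can be rewritten into normal form. *)
suff L : forall (k : hom (fglue (invm (invm b1) ;; c2')) (fglue (invm (invm (b1 ;; b2)) ;; a)))
    (k' : hom (pglue b1 (fo c2')) (pglue b1 (act b2 (fo a))))
    (g : hom (pglue (b1 ;; b2) (fo a)) (pglue (b1 ;; b2) (fo a))),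
    arr2 k = idm n -> arr2 k' = fb2 b2 a -> arr2 g = idm _ ->
    fmap (fw F s) k ;; fb2 (b1 ;; b2) a =
    fb2 b1 c2' ;; fmap (cact Y b1) k' ;; mu (erefl (b1 ;; b2)) (fo a) ;; fmap (cact Y (b1 ;; b2)) g ->
    fb e2 ;; actf b1 (fb e1) ;; mu erefl (fo a) = fb e3.
  have := @flaw _ _ _ _ _ _ F s t u b1 b2 tt tt tt n tt tt a.
  rewrite /factor_law_at; set k := factor_coh _ _ _; set k' := factor_inner _ _ _.
  set g := glue_eq _; exact (L k k' g erefl erefl erefl).
move=> k k' g ek ek' eg.
have e0 : invm (invm b1) ;; c2' ;; fmap (lleg F) (idm n) = invm (invm (b1 ;; b2)) ;; a.
  by rewrite fmap1 cmpf1 /c2' !invmK cmpA.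
have -> : k = farr e0 by apply: farr_ext.
have -> : k' = pgarr b1 (fb2 b2 a) by apply: pgarr_ext.
have -> : g = idm _ by apply: pgarr_ext.
rewrite fmap1 cmpf1 -/(fa _) -/(actf _ _) => E.
have e4 : invm (invm b1) ;; c2 ;; fmap (lleg F) (idm n) = invm (invm b1) ;; c2'.
  by rewrite fmap1 cmpf1 -e1 /c2' !invmK.
rewrite /fb -!lock actfM cmpA -(cmpA (fa _) (fb2 _ _)) -(fb2_natural (fb_eq e1) e4).
rewrite -!(@cmpA (Y s)) (@cmpA (Y s) _ _ _ _ (fb2 b1 c2')) -E.
rewrite !(@cmpA (Y s)); congr (_ ;; _).
rewrite /fa -!fmapM; congr (fmap _ _); apply: farr_ext.
by rewrite /= !cmp1f.
Qed.

End PointFactor.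

Section FactorMapFlex.
Variables (I : gpd) (D : diagram I) (C T : pgpd) (X : cocone D C) (Y : cocone D T).
Variables (F G : factor X Y) (u : factor_map_data F G).

Definition mw i (m : X i) (n : F) (c : hom (rleg _ m) (lleg F n)) (c' : hom (rleg _ m) (lleg G (u n)))
    (e : c ;; eql u n = c') : hom (gx (fw F i) c) (gx (fw G i) c') :=
  fmw u i (glue m n c) ;; gm_eq (fw G i) e.

Lemma mw_glue_eq i (m : X i) (n : F) (c : hom (rleg _ m) (lleg F n)) (c' : hom (rleg _ m) (lleg G (u n)))
    (e : c ;; eql u n = c') : mw e = fmw u i (glue m n c) ;; fmap (fw G i) (glue_eq e).
Proof.
have <- // : gm_eq (fw G i) e = fmap (fw G i) (glue_eq e).
by congr (fmap _ _); apply: glue_ext.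
Qed.

Definition factor_map_flex_law : Prop :=
  forall i j (a : hom i j) (x : dmap D a) (m : X j) (n : F)
    (f : hom (rleg _ x) (lleg _ m)) (g : hom (rleg _ m) (lleg F n))
    (c : hom (rleg _ (gx (cact X a) f)) (lleg F n)) (d : hom (rleg _ x) (lleg _ (gx (fw F j) g)))
    (g' : hom (rleg _ m) (lleg G (u n))) (c' : hom (rleg _ (gx (cact X a) f)) (lleg G (u n)))
    (d' : hom (rleg _ x) (lleg _ (gx (fw G j) g')))
    (e1 : eqr (cact X a) (glue x m f) ;; c = g) (e2 : f ;; eql (fw F j) (glue m n g) = d)
    (e1' : eqr (cact X a) (glue x m f) ;; c' = g') (e2' : f ;; eql (fw G j) (glue m (u n) g') = d')
    (eg : g ;; eql u n = g') (ec : c ;; eql u n = c')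
    (q : d ;; fmap (lleg _) (mw eg) = fmap (rleg _) (idm x) ;; d'),
  nt e1 e2 ;; gm (cact Y a) q = mw ec ;; nt e1' e2'.

Lemma factor_map_innerE i j (a : hom i j) (x : dmap D a) (m : X j) (n : F)
    (f : hom (rleg _ x) (lleg _ m)) (g : hom (rleg _ m) (lleg F n))
    (q : f ;; eql (fw F j) (glue m n g) ;; fmap (lleg _) (mw (erefl (g ;; eql u n))) =
      fmap (rleg _) (idm x) ;; (f ;; eql (fw G j) (glue m (u n) (g ;; eql u n)))) :
  gm (cact Y a) q = fmap (cact Y a) (factor_map_inner u f g).
Proof. by congr (fmap _ _); apply: glue_ext => //=; rewrite /mw gm_eq1 cmpf1. Qed.

Lemma factor_map_flexP : factor_map_flex_law <->
  forall i j (a : hom i j) (x : dmap D a) (m : X j) (n : F)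
    (f : hom (rleg _ x) (lleg _ m)) (g : hom (rleg _ m) (lleg F n)), factor_map_law_at u f g.
Proof.
split=> L i j a x m n f g.
  have e1 := cmpKV (eqr (cact X a) (glue x m f)) g.
  have e1' := cmpKV (eqr (cact X a) (glue x m f)) (g ;; eql u n).
  have q : f ;; eql (fw F j) (glue m n g) ;; fmap (lleg _) (mw (erefl (g ;; eql u n))) =
    fmap (rleg _) (idm x) ;; (f ;; eql (fw G j) (glue m (u n) (g ;; eql u n))).
    by rewrite /mw gm_eq1 cmpf1; exact: factor_map_innerP.
  have := L i j a x m n f g _ _ _ _ _ e1 (erefl _) e1' (erefl _) (erefl _)
    (esym (cmpA (invm (eqr (cact X a) (glue x m f))) g (eql u n))) q.
  by rewrite !nt_strict factor_map_innerE mw_glue_eq.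
move=> c d g' c' d' e1 e2 e1' e2' eg ec q.
have Ec := cmpVE e1; have Ec' := cmpVE e1'.
move: e1 e2 e1' e2' eg ec q; subst c c' => e1 e2 e1' e2' eg; subst d g' d' => ec q.
rewrite !nt_strict (eq_irrelevance ec (esym (cmpA (invm (eqr (cact X a) (glue x m f))) g (eql u n)))).
by rewrite factor_map_innerE mw_glue_eq; exact: L.
Qed.
End FactorMapFlex.

Lemma nt_fb (S T : pgpd) (Y : cocone (point_diagram S) T) (F : factor (point_cocone S) Y)
    s t (b : hom s t) (n : F) (a : hom t (lleg F n)) (c : hom s (lleg F n)) (e : b ;; a = c)
    (e1 : eqr (cact (point_cocone S) b)
      (@glue _ _ _ (dmap (point_diagram S) b) (point_cocone S t) tt tt tt) ;; c = a)
    (e2 : (tt : hom (tt : unit_pgpd) tt) ;;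
      eql (fw F t) (@glue _ _ _ (point_cocone S t) F tt n a) = tt) :
  @nt _ _ _ _ (point_cocone S) Y F s t b tt tt n tt a c tt e1 e2 = fb e.
Proof.
have E : c = invm (invm b) ;; a := cmpVE e1.
move: e e1 e2; subst c => e e1 e2.
have -> : fb e = fb2 b a.
  have E : farr (fb_eq e) = idm (fglue (invm (invm b) ;; a)) by apply: farr_ext.
  by rewrite /fb -lock /fa E fmap1 cmp1f.
exact: nt_strict.
Qed.

Section PointFactorMap.
Variables (S T : pgpd) (Y : cocone (point_diagram S) T).
Variables (F G : factor (point_cocone S) Y).

(** The universal point (n, id) over lleg n presents an element of Y, which G presents as well, up
    to isomorphism. Essential surjectivity only asserts that such a presentation exists, so one is
    chosen for each n. *)
Definition match_data (n : F) : Type :=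
  {m : G & {a : hom (lleg F n) (lleg G m) & hom (fo (idm (lleg F n))) (fo a)}}.

Lemma match_inhabited (n : F) : inhabited (match_data n).
Proof.
have [m [a [f]]] := fo_esurj G (fo (idm (lleg F n))).
by split; exists m, a; exact: invm f.
Qed.

Definition matched (n : F) : match_data n :=
  ClassicalEpsilon.epsilon (match_inhabited n) (fun _ => True).
Definition um (n : F) : G := tag (matched n).
Definition ua (n : F) : hom (lleg F n) (lleg G (um n)) := tag (tagged (matched n)).
Definition uw (n : F) : hom (fo (idm (lleg F n))) (fo (ua n)) := tagged (tagged (matched n)).

(** A Yoneda argument: the matching at (n, id) is moved to every (n, a) by transport along a. The
    compatibility [W_act] with further transport drives everything below. *)
Definition W s (n : F) (a : hom s (lleg F n)) (c : hom s (lleg G (um n)))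
    (e : a ;; ua n = c) : hom (fo a) (fo c) :=
  locked (fb (cmpf1 a) ;; actf a (uw n) ;; invm (fb e)).

Lemma W_act s t (b : hom s t) (n : F) (a : hom t (lleg F n)) (c : hom t (lleg G (um n)))
    (e : a ;; ua n = c) (a' : hom s (lleg F n)) (c' : hom s (lleg G (um n)))
    (e' : a' ;; ua n = c') (ea : b ;; a = a') (ec : b ;; c = c') :
  fb ea ;; actf b (W e) = W e' ;; fb ec.
Proof.
subst a'.
have L1 := fb_law (erefl (b ;; a)) (cmpf1 a) (erefl (b ;; a)) (cmpf1 (b ;; a)).
have L2 := fb_law (erefl (b ;; a)) e ec e'.
rewrite /W -!lock -L1 -L2 !actfM actfV; apply: cmp_paste3; exact: mu_natural.
Qed.

Lemma um_map_eq (n n' : F) (g : hom n n') : idm _ ;; fmap (lleg F) g = fmap (lleg F) g.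
Proof. exact: cmp1f. Qed.

(** The only arrow for which W is natural at the universal point; it exists because [fw G] is
    full. *)
Definition um_map (n n' : F) (g : hom n n') : hom (um n) (um n') :=
  fa_lift (invm (W (cmp1f (ua n))) ;; fa (um_map_eq g) ;;
           W (erefl (fmap (lleg F) g ;; ua n'))).

Lemma um_map_sq (n n' : F) (g : hom n n') :
  ua n ;; fmap (lleg G) (um_map g) = fmap (lleg F) g ;; ua n'.
Proof. exact: fa_lift_eq. Qed.

Lemma um_mapE (n n' : F) (g : hom n n') (e : ua n ;; fmap (lleg G) (um_map g) = fmap (lleg F) g ;; ua n') :
  W (cmp1f (ua n)) ;; fa e = fa (um_map_eq g) ;; W (erefl (fmap (lleg F) g ;; ua n')).
Proof. by rewrite fa_liftK -cmpA cmpKV. Qed.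

Lemma W_natural s (n n' : F) (g : hom n n') (a : hom s (lleg F n)) (a' : hom s (lleg F n'))
    (e : a ;; fmap (lleg F) g = a') (c : hom s (lleg G (um n))) (c' : hom s (lleg G (um n')))
    (ec : a ;; ua n = c) (ec' : a' ;; ua n' = c')
    (e' : c ;; fmap (lleg G) (um_map g) = c') :
  fa e ;; W ec' = W ec ;; fa e'.
Proof.
have e1 : a ;; (fmap (lleg F) g ;; ua n') = c' by rewrite cmpA e.
apply: (@cmpIr _ _ _ _ (fb e1)); rewrite -!cmpA.
rewrite -(W_act (erefl (fmap (lleg F) g ;; ua n')) ec' e e1).
rewrite (fb_natural (um_map_sq g) ec e1 e').
rewrite cmpA (fb_natural (um_map_eq g) (cmpf1 a) e e) cmpA.
rewrite -(W_act (cmp1f (ua n)) ec (cmpf1 a) ec) -!cmpA -!actfM.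
by rewrite um_mapE.
Qed.

Lemma um_map_eq2 s (n n' : F) (g : hom n n') (a : hom s (lleg F n)) (a' : hom s (lleg F n'))
    (e : a ;; fmap (lleg F) g = a') (c : hom s (lleg G (um n))) (c' : hom s (lleg G (um n')))
    (ec : a ;; ua n = c) (ec' : a' ;; ua n' = c') :
  c ;; fmap (lleg G) (um_map g) = c'.
Proof. by rewrite -ec -cmpA um_map_sq cmpA e ec'. Qed.

(** Naturality of W at a single a already determines the arrow, as [fw G] is faithful. Functoriality
    and fullness of [um_map] are deduced from this uniqueness. *)
Lemma um_map_uniq s (n n' : F) (g : hom n n') (g' : hom (um n) (um n'))
    (a : hom s (lleg F n)) (a' : hom s (lleg F n'))
    (e : a ;; fmap (lleg F) g = a') (c : hom s (lleg G (um n))) (c' : hom s (lleg G (um n')))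
    (ec : a ;; ua n = c) (ec' : a' ;; ua n' = c')
    (e' : c ;; fmap (lleg G) g' = c') :
  W ec ;; fa e' = fa e ;; W ec' -> g' = um_map g.
Proof.
by rewrite (W_natural e ec ec' (um_map_eq2 e ec ec')) => /cmpI /fa_inj.
Qed.

Lemma um_map1 (n : F) : um_map (idm n) = idm (um n).
Proof.
have e1 : idm _ ;; fmap (lleg F) (idm n) = idm _ by rewrite fmap1 cmp1f.
have e2 : ua n ;; fmap (lleg G) (idm (um n)) = ua n by rewrite fmap1 cmpf1.
apply/esym/(um_map_uniq (e := e1) (ec := cmp1f _) (ec' := cmp1f _) (e' := e2)).
by rewrite !fa1 cmp1f cmpf1.
Qed.

Lemma um_mapM (x y z : F) (f : hom x y) (g : hom y z) :
  um_map (f ;; g) = um_map f ;; um_map g.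
Proof.
have e1 : idm _ ;; fmap (lleg F) (f ;; g) = fmap (lleg F) f ;; fmap (lleg F) g.
  by rewrite fmapM cmp1f.
have e2 := um_map_eq2 (um_map_eq f) (cmp1f (ua x)) (erefl _).
have e3 := um_map_eq2 (erefl (fmap (lleg F) f ;; fmap (lleg F) g)) (erefl _) (erefl _).
have e4 : ua x ;; fmap (lleg G) (um_map f ;; um_map g) =
          fmap (lleg F) f ;; fmap (lleg F) g ;; ua z.
  by rewrite fmapM cmpA e2 e3.
apply/esym/(um_map_uniq (e := e1) (ec := cmp1f _) (ec' := erefl _) (e' := e4)).
rewrite -(faM e2 e3 e4) -(faM (um_map_eq f) (erefl _) e1).
rewrite (@cmpA (Y _)) -(W_natural (um_map_eq f) (cmp1f _) _ e2) -!(@cmpA (Y (lleg F x))).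
by rewrite -(W_natural (erefl _) (erefl _) _ e3).
Qed.

Definition um_functor : functor F G := Functor um_map1 um_mapM.

Lemma um_equivalence : equivalence um_functor.
Proof.
split=> [n n' g g' /= egg'|n n' g'|m].
- have eg : fmap (lleg F) g = fmap (lleg F) g'.
    apply: (@cmpIr _ _ _ _ (ua n')).
    by rewrite -!um_map_sq egg'.
  have e' : idm _ ;; fmap (lleg F) g' = fmap (lleg F) g by rewrite eg cmp1f.
  apply: (fa_inj (e := um_map_eq g) (e' := e')).
  apply: (@cmpIr _ _ _ _ (W (erefl (fmap (lleg F) g ;; ua n')))).
  have e2 := um_map_eq2 (um_map_eq g) (cmp1f (ua n)) (erefl _).
  have e2' := um_map_eq2 e' (cmp1f (ua n)) (erefl _).
  rewrite (W_natural _ (cmp1f _) _ e2) (W_natural _ (cmp1f _) _ e2'); congr (_ ;; _).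
  by congr (fmap _ _); apply: farr_ext.
(* The left leg of the wanted arrow must be [la] for its square with [ua] to commute, and [k] is g'
   carried back to points presented by F. *)
- pose la := ua n ;; fmap (lleg G) g' ;; invm (ua n').
  have ela : la ;; ua n' = ua n ;; fmap (lleg G) g' by rewrite cmpKr.
  pose k := W (cmp1f (ua n)) ;; fa (erefl (ua n ;; fmap (lleg G) g')) ;; invm (W ela).
  exists (fa_lift k); apply/esym.
  apply: (um_map_uniq (e := fa_lift_eq k) (ec := cmp1f _) (ec' := ela) (e' := erefl _)).
  by rewrite fa_liftK cmpKr.
- have [n [a [f]]] := fo_esurj F (fo (idm (lleg G m))).
  exists n; split; exact: (fa_lift (invm (W (erefl (a ;; ua n))) ;; f)).
Qed.

Lemma ua_law (n n' : F) (g : hom n n') :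
  fmap (lleg F) g ;; ua n' = ua n ;; fmap (fcomp um_functor (lleg G)) g.
Proof. by rewrite /= um_map_sq. Qed.
Definition um_l : natiso (lleg F) (fcomp um_functor (lleg G)) :=
  @Natiso _ _ (lleg F) (fcomp um_functor (lleg G)) ua ua_law.

(** This component is forced by compatibility of W with right legs at the universal point; [W_r]
    extends it to all a. *)
Definition ur (n : F) : hom (rleg F n) (rleg G (um n)) :=
  locked (fr (idm (lleg F n)) ;; fmap (rleg (Y _)) (W (cmp1f (ua n))) ;; invm (fr (ua n))).

Lemma W_r s (n : F) (a : hom s (lleg F n)) (c : hom s (lleg G (um n))) (e : a ;; ua n = c) :
  fr a ;; fmap (rleg (Y s)) (W e) = ur n ;; fr c.
Proof.
apply: (@cmpIr _ _ _ _ (fmap (rleg (Y s)) (fb e))).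
rewrite -!(@cmpA T) -fmapM -(W_act (cmp1f (ua n)) e (cmpf1 a) e) fmapM cmpA fb_r.
rewrite fb_r -(@cmpA T) -psi_natural !(@cmpA T); congr (_ ;; _).
by rewrite /ur -lock cmpKr.
Qed.

Lemma ur_law (n n' : F) (g : hom n n') :
  fmap (rleg F) g ;; ur n' = ur n ;; fmap (fcomp um_functor (rleg G)) g.
Proof.
have e := um_map_eq2 (um_map_eq g) (cmp1f (ua n)) (erefl _).
apply: (@cmpIr _ _ _ _ (fr (fmap (lleg F) g ;; ua n'))).
rewrite -!(@cmpA T) (fr_natural e) -(W_r (erefl _)) !(@cmpA T).
rewrite (fr_natural (um_map_eq g)) -(W_r (cmp1f _)) -!(@cmpA T) -!fmapM.
by rewrite (W_natural _ (cmp1f _) _ e).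
Qed.
Definition um_r : natiso (rleg F) (fcomp um_functor (rleg G)) :=
  @Natiso _ _ (rleg F) (fcomp um_functor (rleg G)) ur ur_law.

Definition um_sequiv : sequiv F G.
Proof.
apply: (@SEquiv _ _ F G um_functor um_equivalence um_l um_r) => n.
(* Signs of F and G are compared through Y, where W at the universal point is an arrow and changes
   the sign by the parity of its right leg. *)
have := congr1 par (W_r (cmp1f (ua n))); rewrite !parM.
have := sgn_law (W (cmp1f (ua n))); rewrite !fo_sgn par1 /=.
by move: (par _) (par _) (par _) (par _) (par _) (sgn _ _) (sgn _ _); do 7 case.
Defined.

Section FactorW.
Variable s : S.
Let u : sequiv (point s ** F) (Y s) := fw F s.
Let v : sequiv (point s ** F) (Y s) := vcomp (lwhisk (point s) um_sequiv) (fw G s).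
Definition w_at (x : point s ** F) : hom (u x) (v x) :=
  match x with HP tt n a => W (erefl (a ;; ua n)) end.
Lemma w_law (x y : point s ** F) (f : hom x y) : fmap u f ;; w_at y = w_at x ;; fmap v f.
Proof.
move: x y f => [[] n a] [[] n' a'] f.
pose g : hom n n' := arr2 f.
have e : a ;; fmap (lleg F) g = a' := etrans (hphomP f) (cmp1f _).
have e' := um_map_eq2 e (erefl (a ;; ua n)) (erefl _).
have -> : f = farr e by apply: farr_ext.
have L : fa e ;; W (erefl (a' ;; ua n')) = W (erefl (a ;; ua n)) ;; fa e'.
  exact: W_natural.
have K : lwhisk_map um_sequiv (farr e : hom (fglue a) (fglue a')) = farr e' by apply: farr_ext.
rewrite -[fmap v _]/(fmap (fw G s) (lwhisk_map um_sequiv (farr e : hom (fglue a) (fglue a')))) K.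
exact: L.
Qed.
Definition w_iso : natiso u v := @Natiso _ _ u v w_at w_law.
Definition w_siso : siso u v.
Proof.
apply: (@SIso _ _ _ _ u v w_iso) => -[[] n a]; first exact: unit_eq.
exact: W_r.
Defined.
End FactorW.

Definition um_data : factor_map_data F G := @FactorMapData _ _ _ _ _ _ F G um_sequiv w_siso.

Lemma um_law : factor_map_flex_law um_data.
Proof.
move=> i j a [] [] n [] g c [] g' c' [] e1 e2 e1' e2' eg ec q.
have ea : a ;; g = c := etrans (congr1 (cmp a) (esym e1)) (cmpKV a c).
have ea' : a ;; g' = c' := etrans (congr1 (cmp a) (esym e1')) (cmpKV a c').
have mwE s (h : hom s (lleg F n)) h' (e : h ;; ua n = h') : @mw _ _ _ _ _ _ _ _ um_data s tt n h h' e = W e.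
  by subst h'; rewrite /mw gm_eq1 cmpf1.
have L1 : gm (cact Y a) q = actf a (W eg) by congr (fmap _ _); apply: pgarr_ext; exact: mwE.
have L2 : nt e1 e2 = fb ea := nt_fb ea e1 e2.
have L3 : nt e1' e2' = fb ea' := nt_fb ea' e1' e2'.
have E := W_act eg ec ea ea'.
by rewrite -L1 -L2 -L3 -(mwE _ _ _ ec) in E; exact: E.
Qed.

Definition um_factor_map : factor_map F G :=
  FactorMap ((factor_map_flexP um_data).1 um_law).
End PointFactorMap.

Section PointFactorIso.
Variables (S T : pgpd) (Y : cocone (point_diagram S) T).
Variables (F G : factor (point_cocone S) Y).

Definition fm_at s (u : factor_map F G) (n : F) (a : hom s (lleg F n)) :
    hom (fo a) (fo (a ;; eql u n)) := fmw u s (fglue a).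

Lemma fm_r s (u : factor_map F G) (n : F) (a : hom s (lleg F n)) :
  fr a ;; fmap (rleg (Y s)) (fm_at u a) = eqr u n ;; fr (a ;; eql u n).
Proof. exact: sir (fmw u s) (fglue a). Qed.

Lemma fm_eq s (u : factor_map F G) (n n' : F) (g : hom n n')
    (a : hom s (lleg F n)) (a' : hom s (lleg F n')) (e : a ;; fmap (lleg F) g = a') :
  a ;; eql u n ;; fmap (lleg G) (fmap u g) = a' ;; eql u n'.
Proof. by rewrite -e -!cmpA (nat_law (eql u)). Qed.

Lemma fm_natural s (u : factor_map F G) (n n' : F) (g : hom n n')
    (a : hom s (lleg F n)) (a' : hom s (lleg F n')) (e : a ;; fmap (lleg F) g = a') :
  fa e ;; fm_at u a' = fm_at u a ;; fa (fm_eq u e).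
Proof.
have E : lwhisk_map u (farr e : hom (fglue a) (fglue a')) = farr (fm_eq u e).
  by apply: farr_ext.
have := nat_law (fmw u s) (farr e : hom (fglue a) (fglue a')).
by rewrite /fa -E; apply.
Qed.

Lemma fm_act s t (u : factor_map F G) (b : hom s t) (n : F) (a : hom t (lleg F n))
    (c : hom s (lleg F n)) (e : b ;; a = c) (e' : b ;; (a ;; eql u n) = c ;; eql u n) :
  fb e ;; actf b (fm_at u a) = fm_at u c ;; fb e'.
Proof.
have L := (factor_map_flexP u).2 (@fmlaw _ _ _ _ _ _ F G u) s t b tt tt n tt a c tt (a ;; eql u n)
  (c ;; eql u n) tt.
have e1 := etrans (congr1 (cmp (invm b)) (esym e)) (cmpVK b a).
have e1' := etrans (congr1 (cmp (invm b)) (esym e')) (cmpVK b (a ;; eql u n)).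
have mwE r (h : hom r (lleg F n)) : @mw _ _ _ _ _ _ _ _ u r tt n h _ (erefl _) = fm_at u h.
  by rewrite /mw gm_eq1 cmpf1.
have {}L := L e1 (unit_eq _ _) e1' (unit_eq _ _) (erefl _) (erefl _) (unit_eq _ _).
move: L; set k := gm _ _; have -> : k = actf b (fm_at u a).
  by congr (fmap _ _); apply: pgarr_ext; exact: mwE.
move=> L; have F1 := nt_fb e e1 (unit_eq _ _); have F2 := nt_fb e' e1' (unit_eq _ _).
apply: etrans (congr1 (fun z => z ;; _) (esym F1)) (etrans L _).
exact: etrans (congr1 (fun z => z ;; _) (mwE _ _)) (congr1 (cmp _) F2).
Qed.

Section Iso.
Variables u v : factor_map F G.

(** Compatibility with the cells of u and v at the universal point prescribes the image of this
    arrow under [fw G], hence the arrow itself. *)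
Definition th_at (n : F) : hom (u n) (v n) :=
  fa_lift (invm (fm_at u (idm (lleg F n))) ;; fm_at v (idm (lleg F n))).

Lemma th_l (n : F) : eql u n ;; fmap (lleg G) (th_at n) = eql v n.
Proof.
have : idm _ ;; eql u n ;; fmap (lleg G) (th_at n) = idm _ ;; eql v n.
  exact: fa_lift_eq.
by rewrite !cmp1f.
Qed.

Lemma th_sq s (n : F) (a : hom s (lleg F n)) :
  a ;; eql u n ;; fmap (lleg G) (th_at n) = a ;; eql v n.
Proof. by rewrite -cmpA th_l. Qed.

(** The equation holds at the universal point by construction, and [fm_act] transports it along
    a. *)
Lemma fm_th s (n : F) (a : hom s (lleg F n)) : fm_at u a ;; fa (th_sq a) = fm_at v a.
Proof.
have e (w : factor_map F G) : a ;; (idm (lleg F n) ;; eql w n) = a ;; eql w n by rewrite cmp1f.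
apply: (@cmpIr _ _ _ _ (fb (e v))).
rewrite -(fm_act (cmpf1 a) (e v)) -(@cmpA (Y s)) (fb_natural (th_sq (idm _)) (e u) (e v)).
rewrite (@cmpA (Y s)) -(fm_act (cmpf1 a) (e u)) -(@cmpA (Y s)) -actfM.
by rewrite fa_liftK cmpKV.
Qed.

Lemma fm_th_uniq (n : F) (k : hom (u n) (v n)) s (a : hom s (lleg F n))
    (e : a ;; eql u n ;; fmap (lleg G) k = a ;; eql v n) :
  fm_at u a ;; fa e = fm_at v a -> k = th_at n.
Proof. by rewrite -(fm_th a) => /cmpI /fa_inj. Qed.

Lemma th_law (n n' : F) (g : hom n n') : fmap u g ;; th_at n' = th_at n ;; fmap v g.
Proof.
pose a := idm (lleg F n); pose a' := a ;; fmap (lleg F) g.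
have e0 : a ;; eql u n ;; fmap (lleg G) (fmap u g ;; th_at n') = a' ;; eql v n'.
  by rewrite fmapM cmpA (fm_eq u (erefl a')) th_sq.
have e1 : a ;; eql u n ;; fmap (lleg G) (th_at n ;; fmap v g) = a' ;; eql v n'.
  by rewrite fmapM cmpA th_sq (fm_eq v (erefl a')).
apply: (fa_inj (e := e0) (e' := e1)); apply: (@cmpI _ _ _ _ (fm_at u a)).
rewrite -(faM (fm_eq u (erefl a')) (th_sq a') e0) -(faM (th_sq a) (fm_eq v (erefl a')) e1).
rewrite !(@cmpA (Y (lleg F n))) fm_th -!fm_natural -(@cmpA (Y (lleg F n))).
by rewrite fm_th.
Qed.

Definition th_iso : natiso u v := @Natiso _ _ u v th_at th_law.
Lemma th_r (n : F) : eqr u n ;; fmap (rleg G) (th_at n) = eqr v n.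
Proof.
pose a := idm (lleg F n); apply: (@cmpIr _ _ _ _ (fr (a ;; eql v n))).
rewrite -fm_r -(fm_th a) fmapM (@cmpA T) fm_r -!(@cmpA T).
by rewrite (fr_natural (th_sq a)).
Qed.
Definition th : siso u v := @SIso _ _ _ _ u v th_iso th_l th_r.

Lemma th_factor_map_iso : is_factor_map_iso th.
Proof.
move=> s [] n a.
suff L (k : hom (fglue (a ;; eql u n)) (fglue (a ;; eql v n))) : arr2 k = th_at n ->
    fm_at u a ;; fmap (fw G s) k = fm_at v a.
  exact (L (factor_map_iso_arr th (i := s) (m := tt) a) erefl).
move=> ek; rewrite -(fm_th a); congr (_ ;; _).
by rewrite /fa; congr (fmap _ _); apply: farr_ext.
Qed.

Lemma th_unique (th' : siso u v) : is_factor_map_iso th' -> forall n, th' n = th n.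
Proof.
move=> iso_th n; pose a := idm (lleg F n).
have e : a ;; eql u n ;; fmap (lleg G) (th' n) = a ;; eql v n.
  by rewrite -cmpA (sil th').
apply: (fm_th_uniq (e := e)).
have E : fm_at u a ;; fmap (fw G _) (factor_map_iso_arr th' (i := lleg F n) (m := tt) a) =
  fm_at v a := iso_th _ tt n a.
have E2 : factor_map_iso_arr th' (i := lleg F n) (m := tt) a = farr e :> hom (fglue _) (fglue _).
  by apply: farr_ext.
by rewrite E2 in E.
Qed.
End Iso.
End PointFactorIso.

(** The Grothendieck construction gives existence. Equivalences between factorizations, and
    isomorphisms between these, are prescribed at the universal points and extended by transport. *)
Lemma point_cocone_hocolim (S : pgpd) : is_hocolim (point_cocone S).
Proof.
move=> T Y; split=> [|F G|F G u v]; first by split; exact: tot_factor.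
  by split; exact: um_factor_map.
exists (th u v); [exact: th_factor_map_iso | exact: th_unique].
Qed.

(** * Uniqueness *)

Section LfunSum.
Variables (U V W : vectType rat) (J : Type) (r : seq J) (P : pred J).
Lemma comp_lfun_suml (f : J -> 'Hom(V, W)) (g : 'Hom(U, V)) :
  ((\sum_(j <- r | P j) f j) \o g)%VF = \sum_(j <- r | P j) (f j \o g)%VF.
Proof.
apply/lfunP=> x; rewrite comp_lfunE !sum_lfunE.
by apply: eq_bigr => j _; rewrite comp_lfunE.
Qed.
Lemma comp_lfun_sumr (f : 'Hom(V, W)) (g : J -> 'Hom(U, V)) :
  (f \o (\sum_(j <- r | P j) g j)%R)%VF = \sum_(j <- r | P j) (f \o g j)%VF.
Proof.
apply/lfunP=> x; rewrite comp_lfunE !sum_lfunE linear_sum.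
by apply: eq_bigr => j _; rewrite comp_lfunE.
Qed.
End LfunSum.

Definition contractible (G : gpd) : Prop :=
  inhabited G /\ forall x y : G, exists f : hom x y, forall g, g = f.

Lemma contractible_equivalence (G H : gpd) (F : functor G H) :
  contractible G -> contractible H -> equivalence F.
Proof.
move=> [[x0] cG] [_ cH]; split=> [x y f g _|x y g|y].
- by have [h hP] := cG x y; rewrite (hP f) (hP g).
- have [f _] := cG x y; exists f.
  by have [h hP] := cH (F x) (F y); rewrite (hP g) (hP (fmap F f)).
- by exists x0; have [h _] := cH (F x0) y; split.
Qed.

Lemma contractible_unit : contractible unit_gpd.
Proof. by split=> [|x y]; [split; exact: tt | exists tt => g; apply: unit_eq]. Qed.

Definition triv (G : gpd) : pgpd :=
  @PGpd G (fun _ _ _ => false) (fun _ _ _ _ _ => erefl).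

Definition to_point (G : gpd) : functor G unit_pgpd := to_unit G.

(* The transfer span and the graph of the right leg of M, through which M factors. *)
Definition transfer (G : gpd) : span unit_pgpd (triv G) :=
  @Span unit_pgpd (triv G) G (to_point G) (fid G) (fun _ => false) (fun _ _ _ => erefl).

Section Graph.
Variables (T : pgpd) (M : span unit_pgpd T).
Lemma graph_sgn_law (x y : M) (a : hom x y) :
  false (+) sgn M y = sgn M x (+) par (fmap (rleg M) a).
Proof. exact: (sgn_law a). Qed.
Definition graph : span (triv M) T :=
  @Span (triv M) T M (fid M) (rleg M) (sgn M) graph_sgn_law.

Let A := transfer M ** graph.
Definition graph_functor : functor A M := hpr2 (transfer M) graph.
Lemma graph_equivalence : equivalence graph_functor.
Proof.
split=> [s t f g e|s t g|m].
- have e2 : arr2 f = arr2 g := e.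
  have e1 (h : hom s t) : arr1 h = hpm s ;; arr2 h ;; invm (hpm t).
    by rewrite [X in X ;; _](hphomP h) cmpK.
  by apply: glue_ext => //; rewrite !e1 e2.
- pose f := hpm s ;; g ;; invm (hpm t).
  have e : hpm s ;; fmap (lleg graph) g = fmap (rleg (transfer M)) f ;; hpm t.
    by rewrite /= /f cmpKr.
  by exists (garr s t f g e).
- by exists (@glue _ _ _ (transfer M) graph m m (idm m)); split; exact: idm.
Qed.
Lemma graph_r_law (s t : A) (f : hom s t) :
  fmap (rleg A) f ;; idm (rleg A t) = idm (rleg A s) ;; fmap (fcomp graph_functor (rleg M)) f.
Proof. by rewrite cmp1f cmpf1. Qed.
Definition graph_r : natiso (rleg A) (fcomp graph_functor (rleg M)) :=
  @Natiso _ _ (rleg A) (fcomp graph_functor (rleg M)) (fun _ => idm _) graph_r_law.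
Definition graph_sequiv : sequiv A M.
Proof.
apply: (@SEquiv _ _ A M graph_functor graph_equivalence (to_unit_iso _ _) graph_r) => t.
by rewrite /= /hcomp_sgn /= par1 addbF.
Defined.
End Graph.

Section PointGraph.
Variables (T : pgpd) (M : span unit_pgpd T) (x : M).
Let A := @point (triv M) x ** graph M.
Let B := scalar (sgn M x) ** point (rleg M x).
Definition point_graph_base : B := @glue _ _ _ (scalar (sgn M x)) (point (rleg M x)) tt tt tt.
Definition point_graph_functor : functor A B :=
  @Functor A B (fun _ => point_graph_base) (fun _ _ _ => idm _) (fun _ => erefl)
    (fun _ _ _ _ _ => esym (cmp1f _)).
Lemma point_graph_contractible : contractible A.
Proof.
split; first by split; exact: (@glue _ _ _ (@point (triv M) x) (graph M) tt x (idm x)).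
move=> s t; pose g := invm (hpm s) ;; hpm t.
have e : hpm s ;; fmap (lleg (graph M)) g = idm _ ;; hpm t by rewrite cmp1f /= cmpKV.
exists (garr s t tt g e) => f; apply: glue_ext; first exact: unit_eq.
by apply: (@cmpI _ _ _ _ (hpm s)); rewrite [LHS](hphomP f) /g cmpKV cmp1f.
Qed.
Lemma point_graph_contractible_target : contractible B.
Proof.
split; first by split; exact: point_graph_base.
move=> s t; exists (@hparr _ _ _ (rleg (scalar (sgn M x))) (lleg (point (rleg M x))) s t tt tt
  (unit_eq _ _)) => f.
by apply: glue_ext; apply: unit_eq.
Qed.
Lemma point_graph_r_law (s t : A) (f : hom s t) :
  fmap (rleg A) f ;; fmap (rleg M) (invm (hpm t)) =
  fmap (rleg M) (invm (hpm s)) ;; fmap (fcomp point_graph_functor (rleg B)) f.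
Proof.
rewrite /= [RHS]cmpf1 -fmapM; congr (fmap _ _).
apply: (@cmpI _ _ _ _ (hpm s)); rewrite cmpfV cmpA [X in X ;; _](hphomP f).
by rewrite cmpK.
Qed.
Definition point_graph_r : natiso (rleg A) (fcomp point_graph_functor (rleg B)) :=
  @Natiso _ _ (rleg A) (fcomp point_graph_functor (rleg B))
    (fun t => fmap (rleg M) (invm (hpm t))) point_graph_r_law.
(** The apex of A is the groupoid of arrows out of x, hence contractible, and the constant functor
    is an equivalence. The right leg is corrected by the arrow back to x, whose parity accounts for
    the variation of [sgn] along it. *)
Definition point_graph_sequiv : sequiv A B.
Proof.
apply: (@SEquiv _ _ A B point_graph_functor
  (contractible_equivalence _ point_graph_contractible point_graph_contractible_target)
  (to_unit_iso _ _) point_graph_r) => t.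
have := graph_sgn_law (hpm t : hom x (hp2 t)).
rewrite /= /hcomp_sgn /= fmapV parV => ->.
by move: (sgn _ _) (par _); do 2 case.
Defined.
End PointGraph.

Section TransferCopoint.
Variables (G : gpd) (x : G).
Let A := transfer G ** @copoint (triv G) x.
Lemma transfer_copoint_contractible : contractible A.
Proof.
split; first by split; exact: (@glue _ _ _ (transfer G) (@copoint (triv G) x) x tt (idm x)).
move=> s t; pose g := hpm s ;; invm (hpm t).
have e : hpm s ;; fmap (lleg (@copoint (triv G) x)) (tt : hom (hp2 s) (hp2 t)) =
  fmap (rleg (transfer G)) g ;; hpm t := etrans (cmpf1 _) (esym (cmpKr _ _)).
exists (garr s t g tt e) => f; apply: glue_ext; last exact: unit_eq.
apply: (@cmpIr _ _ _ _ (hpm t)); rewrite -[LHS](hphomP f) /g cmpKr.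
exact: cmpf1.
Qed.
Definition transfer_copoint_sequiv : sequiv A (scalar false).
Proof.
apply: (@SEquiv _ _ A (scalar false) (to_unit A)
  (contractible_equivalence _ transfer_copoint_contractible contractible_unit)
  (to_unit_iso _ _) (to_unit_iso _ _)) => t.
by [].
Defined.
End TransferCopoint.

Section Disc.
Variable A : finType.
(** A hom set is cut out of the unit by a boolean condition, so it is finite and has at most one
    element; every equation between arrows is then automatic. *)
Definition disc_hom (x y : A) : finType := {_ : unit | x == y}.
Definition disc_arr (x y : A) (e : x = y) : disc_hom x y := exist _ tt (introT eqP e).
Lemma disc_homP (x y : A) (f : disc_hom x y) : x = y.
Proof. exact: eqP (valP f). Qed.
Lemma disc_hom_uniq (x y : A) (f g : disc_hom x y) : f = g.
Proof. by apply: val_inj; apply: unit_eq. Qed.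
Lemma disc_coverP (x : A) : has (fun y => 0 < #|disc_hom x y|)%N (enum A).
Proof.
apply/hasP; exists x; rewrite ?mem_enum //.
by apply/card_gt0P; exists (disc_arr (erefl x)).
Qed.
Definition disc : gpd :=
  @Gpd A disc_hom (fun x => disc_arr (erefl x))
    (fun x y z f g => disc_arr (etrans (disc_homP f) (disc_homP g)))
    (fun x y f => disc_arr (esym (disc_homP f)))
    (fun _ _ _ _ _ _ _ => disc_hom_uniq _ _) (fun _ _ _ => disc_hom_uniq _ _)
    (fun _ _ _ => disc_hom_uniq _ _) (fun _ _ _ => disc_hom_uniq _ _)
    (fun _ _ _ => disc_hom_uniq _ _) (enum A) disc_coverP.

Lemma card_disc_hom (x y : disc) : #|hom x y| = (x == y) :> nat.
Proof.
have [<-|neq] := eqVneq (x : A) y.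
  apply/eqP/fintype1P; exists (disc_arr (erefl x)) => f; exact: disc_hom_uniq.
by apply: eq_card0 => f; case/eqP: neq; exact: disc_homP f.
Qed.

Lemma gsum_disc (w : disc -> rat) : gsum w = \sum_(x : A) w x.
Proof.
apply/esym.
apply: (@gsum_uniq disc (fun w => \sum_(x : A) w x)) => [v v' e|L c v|s|x y /disc_homP -> //].
- by apply: eq_bigr => x _.
- by rewrite exchange_big; apply: eq_bigr => s _; rewrite mulr_sumr.
rewrite (bigD1 (s : A)) //= card_disc_hom eqxx big1 ?addr0 // => x.
by rewrite card_disc_hom eq_sym => /negbTE ->.
Qed.

Definition disc_span : span unit_pgpd unit_pgpd :=
  @Span unit_pgpd unit_pgpd disc (to_point disc) (to_point disc) (fun _ => false)
   (fun _ _ _ => erefl).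
End Disc.

Section PointCopoint.
Variables (G : gpd) (s x : G).
Let A := @point (triv G) s ** @copoint (triv G) x.
Lemma point_copoint_eq (t t' : A) (f : hom t t') : hpm t = hpm t' :> hom s x.
Proof. exact: etrans (esym (cmpf1 _)) (etrans (hphomP f) (cmp1f _)). Qed.
Definition point_copoint_functor : functor A (disc (hom s x)) :=
  @Functor A (disc (hom s x)) (fun t => hpm t)
    (fun t t' f => disc_arr (point_copoint_eq f))
    (fun _ => disc_hom_uniq _ _) (fun _ _ _ _ _ => disc_hom_uniq _ _).
Lemma point_copoint_equivalence : equivalence point_copoint_functor.
Proof.
split=> [t t' f g _|[[] [] a] [[] [] b] g|a].
- by apply: glue_ext; apply: unit_eq.
- have e : a ;; idm x = idm s ;; b by rewrite cmpf1 cmp1f; exact: (disc_homP g).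
  exists (@hparr _ _ _ (rleg (@point (triv G) s)) (lleg (@copoint (triv G) x))
     (HP a) (HP b) tt tt e); exact: disc_hom_uniq.
- exists (@glue _ _ _ (@point (triv G) s) (@copoint (triv G) x) tt tt a).
  by split; exact: (disc_arr (erefl a)).
Qed.
Definition point_copoint_sequiv : sequiv A (disc_span (hom s x)).
Proof.
by apply: (@SEquiv _ _ A (disc_span (hom s x)) point_copoint_functor
  point_copoint_equivalence (to_unit_iso _ _) (to_unit_iso _ _)) => t.
Defined.
End PointCopoint.

Definition unit_scalar_sequiv : sequiv (@point unit_pgpd tt) (scalar false).
Proof.
by apply: (@SEquiv _ _ (@point unit_pgpd tt) (scalar false) (fid unit_gpd)
  (fid_equivalence _) (to_unit_iso _ _) (to_unit_iso _ _)).
Defined.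

Section DiscPointCopoint.
Variables (A : finType) (x : disc A).
Let B := @point (triv (disc A)) x ** @copoint (triv (disc A)) x.
Lemma disc_point_copoint_contractible : contractible B.
Proof.
split.
  by split; exact: (@glue _ _ _ (@point (triv (disc A)) x) (@copoint (triv (disc A)) x) tt tt (idm x)).
move=> s t.
exists (@hparr _ _ _ (rleg (@point (triv (disc A)) x)) (lleg (@copoint (triv (disc A)) x))
  s t tt tt (disc_hom_uniq _ _)) => f.
by apply: glue_ext; apply: unit_eq.
Qed.
Definition disc_point_copoint_sequiv : sequiv B (scalar false).
Proof.
by apply: (@SEquiv _ _ B (scalar false) (to_unit B)
  (contractible_equivalence _ disc_point_copoint_contractible contractible_unit)
  (to_unit_iso _ _) (to_unit_iso _ _)) => t.
Defined.
End DiscPointCopoint.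

Section GoodPrefunctor.
Variable F : prefunctor.
Hypotheses (fF : functorial F) (pF : preserves_hosums F) (tF : triangle F).

Lemma vmap_scalar (b : bool) : vmap F (scalar b) = (-1) ^+ b *: \1%VF :> 'Hom(F unit_pgpd, F unit_pgpd).
Proof.
have [h [g [gh hg]] hE] := tF.
rewrite -[LHS]comp_lfun1r -hg comp_lfunA hE -comp_lfunA -comp_lfunZl comp_lfun1l.
by rewrite -comp_lfunZr hg.
Qed.

Lemma vmap_point_par (S : pgpd) (s t : S) (a : hom s t) :
  vmap F (point s) = (-1) ^+ par a *: vmap F (point t).
Proof.
rewrite -(vmap_equiv fF (point_act a)) (vmap_comp fF) vmap_scalar.
by rewrite -comp_lfunZr comp_lfun1r.
Qed.

(** Scalars act on F of the unit by signs, so a cocone on the image of the diagram of points is a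
    family subject to exactly this sign rule. *)
Lemma point_universal (S : pgpd) (W : vectType rat) (g : S -> 'Hom(F unit_pgpd, W)) :
  (forall s t (a : hom s t), g s = (-1) ^+ par a *: g t) ->
  exists! h : 'Hom(F S, W), forall s, (h \o vmap F (point s))%VF = g s.
Proof.
move=> gP; apply: (@pF _ _ _ _ (@point_cocone_hocolim S) W g) => s t a.
by rewrite /= vmap_scalar -comp_lfunZr comp_lfun1r -gP.
Qed.

(** M factors through its apex with trivial parity; as that has no points, 0 is the only map out of
    its image. *)
Lemma vmap_empty (T : pgpd) (M : span unit_pgpd T) : (M -> False) -> vmap F M = 0.
Proof.
move=> empty; rewrite -(vmap_equiv fF (graph_sequiv M)) (vmap_comp fF).
have [|h [_ hP]] := @point_universal (triv M) (F T) (fun _ => 0) => [s|]; first by case: (empty s).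
rewrite -(hP (vmap F (graph M))) => [|s]; last by case: (empty s).
by rewrite (hP 0) ?comp_lfun0l // => s; case: (empty s).
Qed.

Lemma vmap_point_graph (T : pgpd) (M : span unit_pgpd T) (x : M) :
  (vmap F (graph M) \o vmap F (@point (triv M) x))%VF =
  (-1) ^+ sgn M x *: vmap F (point (rleg M x)).
Proof.
rewrite -(vmap_comp fF) (vmap_equiv fF (point_graph_sequiv x)) (vmap_comp fF).
by rewrite vmap_scalar -comp_lfunZr comp_lfun1r.
Qed.

(** The hypothesis is isolated because it is established in two rounds: directly when the apex is
    discrete, and in general by counting hom sets with the result of the first round. In the proof a
    decomposition of the identity of F (triv M) is inserted between the transfer and the graph. *)
Lemma vmap_span_if (T : pgpd) (M : span unit_pgpd T) :
  (forall s x : M, vmap F (@point (triv M) s ** @copoint (triv M) x) = #|hom s x|%:R *: \1%VF) ->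
  vmap F M = \sum_(x <- skeleton M)
    (#|hom x x|%:R^-1 * (-1) ^+ sgn M x) *: vmap F (point (rleg M x)).
Proof.
move=> FM; rewrite -(vmap_equiv fF (graph_sequiv M)) (vmap_comp fF).
pose v (x : M) := vmap F (@point (triv M) x).
pose c (x : M) := vmap F (@copoint (triv M) x).
have v_inv (s x : M) : hom s x -> v s = v x.
  by move=> a; rewrite /v (vmap_point_par (a : hom (s : triv M) x)) scale1r.
(* It suffices to compare on points: [c x] after [v s] is multiplication by |hom s x|, and
   [skeleton_sum] restores [v s]. *)
have id_v : \1%VF = \sum_(x <- skeleton M) #|hom x x|%:R^-1 *: (v x \o c x)%VF.
  have [s t a|h [_ hP]] := @point_universal (triv M) (F (triv M)) v.
    by rewrite (v_inv s t) //= scale1r.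
  rewrite -(hP \1%VF) => [|s]; last by rewrite comp_lfun1l.
  apply: hP => s; rewrite comp_lfun_suml -[RHS](@skeleton_sum M _ v s) => [|x /v_inv //].
  apply: eq_bigr => x _; rewrite -comp_lfunZl -comp_lfunA -(vmap_comp fF) FM.
  rewrite -comp_lfunZr comp_lfun1r scalerA mulrC; congr ((_ / _) *: _).
  by rewrite card_hom_sym.
rewrite -[vmap F (transfer M)]comp_lfun1l id_v comp_lfun_suml comp_lfun_sumr.
apply: eq_bigr => x _; rewrite -comp_lfunZl -comp_lfunA -(vmap_comp fF).
rewrite (vmap_equiv fF (transfer_copoint_sequiv _)) vmap_scalar scale1r comp_lfun1r.
by rewrite -comp_lfunZr vmap_point_graph scalerA.
Qed.

(** The first round: over a discrete groupoid the span from s to x is contractible when s = x and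
    empty otherwise. *)
Lemma vmap_disc_span (A : finType) : vmap F (disc_span A) = #|A|%:R *: \1%VF.
Proof.
rewrite vmap_span_if => [|s x].
  under eq_bigr do rewrite mulr1 (vmap_equiv fF unit_scalar_sequiv) vmap_scalar scale1r.
  rewrite -scaler_suml; congr (_ *: _).
  transitivity (gsum (fun _ : disc A => 1)).
    by apply: eq_bigr => x _; rewrite mul1r.
  by rewrite gsum_disc sumr_const.
rewrite card_disc_hom; case: eqVneq => [->|neq]; last first.
  rewrite scale0r; apply: vmap_empty => t.
  by case/eqP: neq; exact: disc_homP (hpm t).
by rewrite scale1r (vmap_equiv fF (disc_point_copoint_sequiv x)) vmap_scalar scale1r.
Qed.

Lemma vmap_span (T : pgpd) (M : span unit_pgpd T) :
  vmap F M = \sum_(x <- skeleton M)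
    (#|hom x x|%:R^-1 * (-1) ^+ sgn M x) *: vmap F (point (rleg M x)).
Proof.
apply: vmap_span_if => s x.
by rewrite (vmap_equiv fF (point_copoint_sequiv s x)) vmap_disc_span.
Qed.
End GoodPrefunctor.

(** A map h at the unit extends along points by the universal property. Naturality is tested on
    points too, where it concerns spans out of the unit; by [vmap_span] these are the same
    combinations of points under F and under G. *)
Lemma comparison (F G : prefunctor) (fF : functorial F) (pF : preserves_hosums F)
    (tF : triangle F) (fG : functorial G) (pG : preserves_hosums G) (tG : triangle G)
    (h : 'Hom(F unit_pgpd, G unit_pgpd)) :
  exists eta : forall S, 'Hom(F S, G S),
    (forall S s, (eta S \o vmap F (@point S s))%VF = (vmap G (point s) \o h)%VF) /\
    forall S T (M : span S T), (eta T \o vmap F M)%VF = (vmap G M \o eta S)%VF.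
Proof.
have ex S : exists e : 'Hom(F S, G S),
    forall s, (e \o vmap F (@point S s))%VF = (vmap G (point s) \o h)%VF.
  have [s t a|e [eP _]] := @point_universal F pF tF S _ (fun s => (vmap G (point s) \o h)%VF).
    by rewrite (vmap_point_par fG tG a) -comp_lfunZl.
  by exists e.
pose eta S := proj1_sig (ClassicalEpsilon.constructive_indefinite_description _ (ex S)).
have etaP S s : (eta S \o vmap F (@point S s))%VF = (vmap G (point s) \o h)%VF.
  exact: proj2_sig (ClassicalEpsilon.constructive_indefinite_description _ (ex S)) s.
exists eta; split=> // S T M.
have [s t a|e [_ eU]] := @point_universal F pF tF S _
    (fun s => (vmap G M \o (vmap G (point s) \o h))%VF).
  by rewrite (vmap_point_par fG tG a) -comp_lfunZl -comp_lfunZr.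
rewrite -(eU (vmap G M \o eta S)%VF) => [|s]; last by rewrite -comp_lfunA etaP.
apply/esym/eU => s; rewrite -comp_lfunA -(vmap_comp fF) comp_lfunA -(vmap_comp fG).
rewrite (vmap_span fF pF tF) (vmap_span fG pG tG) comp_lfun_sumr comp_lfun_suml.
by apply: eq_bigr => x _; rewrite -comp_lfunZr etaP comp_lfunZl.
Qed.

Lemma comparison_uniq (F G : prefunctor) (fF : functorial F) (pF : preserves_hosums F)
    (tF : triangle F) S (e e' : 'Hom(F S, G S)) :
  (forall s, (e \o vmap F (@point S s))%VF = (e' \o vmap F (point s))%VF) -> e = e'.
Proof.
move=> ee'; have [s t a|h [_ hU]] := @point_universal F pF tF S _
    (fun s => (e' \o vmap F (point s))%VF).
  by rewrite (vmap_point_par fF tF a) -comp_lfunZr.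
by rewrite -(hU e) // -(hU e').
Qed.

Lemma triangle_iso (F : prefunctor) : triangle F ->
  exists h : 'Hom(rat^o, F unit_pgpd), exists g : 'Hom(F unit_pgpd, rat^o),
    (g \o h)%VF = \1%VF /\ (h \o g)%VF = \1%VF.
Proof. by case=> h [g ?] _; exists h, g. Qed.

(** Both values at the unit are identified with Q. The extensions of this identification and of its
    inverse are mutually inverse, since they are so on points. *)
Lemma good_naturally_isomorphic (F G : prefunctor) :
  functorial F -> preserves_hosums F -> triangle F ->
  functorial G -> preserves_hosums G -> triangle G -> naturally_isomorphic F G.
Proof.
move=> fF pF tF fG pG tG.
have [hF [gF [ghF hgF]]] := triangle_iso tF; have [hG [gG [ghG hgG]]] := triangle_iso tG.
have [eta [etaP eta_nat]] := comparison fF pF tF fG pG tG (hG \o gF)%VF.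
have [zeta [zetaP _]] := comparison fG pG tG fF pF tF (hF \o gG)%VF.
exists eta => // S; exists (zeta S); split.
  apply: (@comparison_uniq F F fF pF tF) => s; rewrite -comp_lfunA etaP comp_lfunA zetaP.
  by rewrite -!comp_lfunA (comp_lfunA gG) ghG !comp_lfun1l hgF comp_lfun1r.
apply: (@comparison_uniq G G fG pG tG) => s; rewrite -comp_lfunA zetaP comp_lfunA etaP.
by rewrite -!comp_lfunA (comp_lfunA gF) ghF !comp_lfun1l hgG comp_lfun1r.
Qed.

(** * Test cocones for the preservation of homotopy sums *)

Section Prod.
Variables G H : gpd.
Definition prod_ob := (G * H)%type.
Definition prod_hom (p q : prod_ob) : finType := (hom p.1 q.1 * hom p.2 q.2)%type.
Lemma prod_coverP (p : prod_ob) :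
  has (fun q => 0 < #|prod_hom p q|)%N [seq (x, y) | x <- cover G, y <- cover H].
Proof.
rewrite has_flatten has_map; apply: sub_has (coverP p.1) => x /isoP[f] /=.
rewrite has_map; apply: sub_has (coverP p.2) => y /isoP[g] /=.
by apply/card_gt0P; exists (f, g).
Qed.
Definition gprod : gpd.
Proof.
apply: (@Gpd prod_ob prod_hom (fun p => (idm p.1, idm p.2))
  (fun p q r f g => (f.1 ;; g.1, f.2 ;; g.2)) (fun p q f => (invm f.1, invm f.2))
  _ _ _ _ _ _ prod_coverP) => [p q r s f g h|p q f|p q f|p q f|p q f].
- by rewrite /= !cmpA.
- by case: f => a b; rewrite /= !cmp1f.
- by case: f => a b; rewrite /= !cmpf1.
- by rewrite /= !cmpfV.
- by rewrite /= !cmpVf.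
Defined.
Definition psnd : functor gprod H :=
  @Functor gprod H (fun p => p.2) (fun p q f => f.2) (fun _ => erefl) (fun _ _ _ _ _ => erefl).
End Prod.

Definition prodp (C : pgpd) (I : gpd) : pgpd :=
  @PGpd (gprod C I) (fun x y f => par f.1) (fun x y z f g => parM f.1 g.1).

(* The cocone X x {i}, with vertex C x I. *)
Section Graded.
Variables (I : gpd) (D : diagram I) (C : pgpd) (X : cocone D C).
Definition graded_r i : functor (X i) (prodp C I).
Proof.
apply: (@Functor (X i) (prodp C I) (fun x => (rleg (X i) x, i))
  (fun x y f => (fmap (rleg (X i)) f, idm i))) => [x|x y z f g] /=.
  by rewrite fmap1.
by rewrite fmapM; congr (_, _); rewrite cmp1f.
Defined.
Definition graded_at i : span (D i) (prodp C I) :=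
  @Span (D i) (prodp C I) (X i) (lleg (X i)) (graded_r i) (sgn (X i)) (@sgn_law _ _ (X i)).

Section Act.
Variables (i j : I) (a : hom i j).
Let M := dmap D a ** graded_at j.
Definition graded_functor : functor M (graded_at i) := cact X a.
Definition graded_l : natiso (lleg M) (fcomp graded_functor (lleg (graded_at i))) := eql (cact X a).
Lemma graded_r_law (s t : M) (f : hom s t) :
  fmap (rleg M) f ;; ((eqr (cact X a) t, invm a) : hom (rleg M t) (rleg (graded_at i) (graded_functor t))) =
  ((eqr (cact X a) s, invm a) : hom (rleg M s) (rleg (graded_at i) (graded_functor s)))
    ;; fmap (fcomp graded_functor (rleg (graded_at i))) f.
Proof.
have E := nat_law (eqr (cact X a)) f.
by congr (_, _); [exact: E | rewrite /= cmp1f cmpf1].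
Qed.
(** The second component moves the recorded index from j to i; its parity is trivial, so the signs
    of X are unaffected. *)
Definition graded_rr : natiso (rleg M) (fcomp graded_functor (rleg (graded_at i))) :=
  @Natiso _ _ (rleg M) (fcomp graded_functor (rleg (graded_at i))) (fun t => (eqr (cact X a) t, invm a)) graded_r_law.
Definition graded_act : sequiv M (graded_at i) :=
  @SEquiv _ _ M (graded_at i) graded_functor (eqFP (cact X a)) graded_l graded_rr (eqs (cact X a)).
End Act.

Definition graded_data : cocone_data D (prodp C I).
Proof.
apply: (@build_cocone_data I D (prodp C I) graded_at graded_act
  (fun i j k a b c e x y m f g => ccoh X e (glue (glue x y f) m g))) =>
  [i j k a b c e x x' y y' m m' f f' g g' u v w euv evw e3 e4|i j k a b c e x y m f g|
   i j k a b c e x y m f g].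
- have := co_natural_sq (erefl _) (erefl _) (cmpKV _ g) (cmpKV _ g') e3 e4.
  by rewrite !co_strict; apply.
- have := co_l (erefl (f ;; eql (cact X b) (glue y m g))) (cmpKV (eqr (dcmp D e) (glue x y f)) g).
  by rewrite co_strict.
- have := co_r (erefl (f ;; eql (cact X b) (glue y m g))) (cmpKV (eqr (dcmp D e) (glue x y f)) g).
  rewrite co_strict => E; congr (_, _); first exact: E.
  have L : invm b ;; invm a ;; idm i = invm c by rewrite -e invM cmpf1.
  exact: L.
Defined.

(** Only the right leg has been modified, so the coherence cells of X are reused and its law carries
    over. *)
Lemma graded_co i j k (a : hom i j) (b : hom j k) (c : hom i k) (e : a ;; b = c)
    (x : dmap D a) (y : dmap D b) (m : X k) (f : hom (rleg _ x) (lleg _ y))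
    (g : hom (rleg _ y) (lleg _ m)) (f1 : hom (rleg _ x) (lleg _ (gx (cact X b) g)))
    (g1 : hom (rleg _ (dcmp D e (glue x y f))) (lleg _ m))
    (e1 : f ;; eql (cact X b) (glue y m g) = f1)
    (e2 : eqr (dcmp D e) (glue x y f) ;; g1 = g) :
  @co I D _ graded_data i j k a b c e x y m f g f1 g1 e1 e2 = @co I D _ X i j k a b c e x y m f g f1 g1 e1 e2.
Proof.
have Eg1 := cmpVE e2; move: e1 e2; subst g1 => e1; subst f1 => e2.
by rewrite (co_strict (X := X)); exact: (@co_strict I D _ graded_data).
Qed.

Lemma graded_law : cocone_law graded_data.
Proof.
apply/cocone_lawP => i j k l a b c x y z m f g h; cbv zeta.
move=> g0 f0 g1 h1 h2 f3 h3 eg0 ef0 eg1 eg1' eh1 eh2 ef3 eh3 e1 e2.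
have e2' : f0 ;; fmap (lleg (X j)) (@co I D _ X _ _ _ _ _ _ _ _ _ _ _ _ _ _ eg0 eh2) =
      fmap (rleg _) (idm x) ;; f3.
  by apply: etrans e2; congr (_ ;; fmap _ _); exact: esym (graded_co _ _).
have L := (cocone_lawP X).1 (@claw _ _ _ X) i j k l a b c x y z m f g h g0 f0 g1 h1 h2 f3 h3
  eg0 ef0 eg1 eg1' eh1 eh2 ef3 eh3 e1 e2'.
have E1 := graded_co ef0 eg1; have E2 := graded_co eg1' eh1; have E3 := graded_co ef3 eh3.
have E4 : gm (cact graded_data a) e2 = gm (cact X a) e2'.
  by congr (fmap _ _); apply: glue_ext => //; exact: graded_co.
apply: etrans (etrans L (esym _)).
  by apply: (congr1 (fun q => q ;; _)); congr (_ ;; _).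
by congr (_ ;; _).
Qed.
Definition graded : cocone D (prodp C I) := Cocone graded_law.
End Graded.

(** The action is contravariant, in accordance with [cact], which takes points of X j to points of X
    i for a : i -> j. *)
Record iset (I : gpd) := ISet {
  ist :> I -> finType;
  iact : forall i j, hom i j -> ist j -> ist i;
  iact1 : forall i t, iact (idm i) t = t;
  iactM : forall i j k (a : hom i j) (b : hom j k) t, iact (a ;; b) t = iact a (iact b t) }.
Arguments iact {I} _ {i j} _ _.

Section Copies.
Variables (I : gpd) (D : diagram I) (C : pgpd) (X : cocone D C) (t : iset I).

Lemma iactI i j (a : hom i j) : injective (iact t a).
Proof. by move=> x y /(congr1 (iact t (invm a))); rewrite -!iactM cmpVf !iact1. Qed.

Definition cp i : span (D i) C :=
  @Span (D i) C (gprod (disc (t i)) (X i)) (fcomp (psnd (disc (t i)) (X i)) (lleg (X i)))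
    (fcomp (psnd (disc (t i)) (X i)) (rleg (X i))) (fun s => sgn (X i) s.2)
    (fun s u f => sgn_law f.2).

Section Act.
Variables (i j : I) (a : hom i j).
Let M := dmap D a ** cp j.
Let L := dmap D a ** X j.
Definition cp_drop (s : M) : L := glue (hp1 s) (hp2 s).2 (hpm s).
Definition cp_dropm (s u : M) (f : hom s u) : hom (cp_drop s) (cp_drop u) :=
  garr (cp_drop s) (cp_drop u) (arr1 f) (arr2 f).2 (hphomP f).
Definition cp_ob (s : M) : cp i := (iact t a (hp2 s).1, cact X a (cp_drop s)).
Definition cp_map (s u : M) (f : hom s u) : hom (cp_ob s) (cp_ob u) :=
  (disc_arr (congr1 (iact t a) (disc_homP (arr2 f).1)), fmap (cact X a) (cp_dropm f)).
Lemma cp_map1 s : cp_map (idm s) = idm (cp_ob s).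
Proof.
congr (_, _); first exact: disc_hom_uniq.
by rewrite -[idm (cact X a _)](fmap1 (cact X a)); congr (fmap _ _); apply: glue_ext.
Qed.
Lemma cp_mapM s u v (f : hom s u) (g : hom u v) : cp_map (f ;; g) = cp_map f ;; cp_map g.
Proof.
congr (_, _); first exact: disc_hom_uniq.
by apply: etrans (fmapM (cact X a) _ _); congr (fmap _ _); apply: glue_ext.
Qed.
Definition cp_functor : functor M (cp i) := Functor cp_map1 cp_mapM.
Lemma cp_equivalence : equivalence cp_functor.
Proof.
have [fa fu es] := eqFP (cact X a).
split=> [s u f g e|s u g|y].
- have e2 : fmap (cact X a) (cp_dropm f) = fmap (cact X a) (cp_dropm g) := congr1 snd e.
  have {}e2 := fa _ _ _ _ e2.
  apply: glue_ext; first exact: (congr1 (fun q : hom (cp_drop s) (cp_drop u) => arr1 q) e2).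
  apply: injective_projections; first exact: disc_hom_uniq.
  exact: (congr1 (fun q : hom (cp_drop s) (cp_drop u) => arr2 q) e2).
- have [f ef] := fu (cp_drop s) (cp_drop u) g.2.
  have eg : (hp2 s).1 = (hp2 u).1 := iactI (disc_homP g.1).
  have e : hpm s ;; fmap (lleg (cp j)) (disc_arr eg, arr2 f) = fmap (rleg (dmap D a)) (arr1 f) ;; hpm u.
    exact: hphomP f.
  exists (garr s u (arr1 f) (disc_arr eg, arr2 f) e).
  apply: injective_projections; first exact: disc_hom_uniq.
  by rewrite -ef; congr (fmap _ _); apply: glue_ext.
- have [x [f]] := es y.2.
  exists (glue (hp1 x) ((iact t (invm a) y.1, hp2 x) : cp j) (hpm x)); split.
  have e : iact t a (iact t (invm a) y.1) = y.1 by rewrite -iactM cmpfV iact1.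
  by case: x f => x1 x2 xm f; exact: (disc_arr e, f).
Qed.
Lemma cp_l_law (s u : M) (f : hom s u) :
  fmap (lleg M) f ;; eql (cact X a) (cp_drop u) =
  eql (cact X a) (cp_drop s) ;; fmap (fcomp cp_functor (lleg (cp i))) f.
Proof. exact: (nat_law (eql (cact X a)) (cp_dropm f)). Qed.
Definition cp_l : natiso (lleg M) (fcomp cp_functor (lleg (cp i))) :=
  @Natiso _ _ (lleg M) (fcomp cp_functor (lleg (cp i))) (fun s => eql (cact X a) (cp_drop s)) cp_l_law.
Lemma cp_r_law (s u : M) (f : hom s u) :
  fmap (rleg M) f ;; eqr (cact X a) (cp_drop u) =
  eqr (cact X a) (cp_drop s) ;; fmap (fcomp cp_functor (rleg (cp i))) f.
Proof. exact: (nat_law (eqr (cact X a)) (cp_dropm f)). Qed.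
Definition cp_r : natiso (rleg M) (fcomp cp_functor (rleg (cp i))) :=
  @Natiso _ _ (rleg M) (fcomp cp_functor (rleg (cp i))) (fun s => eqr (cact X a) (cp_drop s)) cp_r_law.
Definition cp_act : sequiv M (cp i) :=
  @SEquiv _ _ M (cp i) cp_functor cp_equivalence cp_l cp_r (fun s => eqs (cact X a) (cp_drop s)).
End Act.

Lemma cp_cohP i j k (a : hom i j) (b : hom j k) (c : hom i k) (e : a ;; b = c) (u : t k) :
  iact t a (iact t b u) = iact t c u.
Proof. by rewrite -e iactM. Qed.

Definition cp_data : cocone_data D C.
Proof.
apply: (@build_cocone_data I D C cp cp_act
  (fun i j k a b c e x y m f g =>
     (disc_arr (cp_cohP e m.1), ccoh X e (glue (glue x y f) m.2 g)))) =>
  [i j k a b c e x x' y y' m m' f f' g g' u v w euv evw e3 e4|i j k a b c e x y m f g|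
   i j k a b c e x y m f g].
- apply: injective_projections; first exact: disc_hom_uniq.
  have E3 : f ;; eql (cact X b) (glue y m.2 g) ;; fmap (lleg (X j)) (@gm _ _ _ _ _ _ (cact X b) _ _ _ _ _ _ v w.2 evw) =
     fmap (rleg _) u ;; (f' ;; eql (cact X b) (glue y' m'.2 g')).
    by rewrite -[LHS]cmpA gm_l !cmpA euv.
  have := @co_natural_sq I D C X i j k a b c e x x' y y' m.2 m'.2 f f' g g' _ _ _ _
    (erefl _) (erefl _) (cmpKV _ g) (cmpKV _ g') u v w.2 euv evw E3 e4.
  rewrite !co_strict => E; apply: etrans (etrans E _); last first.
    by congr (_ ;; _); congr (fmap _ _); apply: glue_ext.
  apply: (congr1 (fun q => q ;; _)); congr (fmap _ _); apply: glue_ext => //.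
  by congr (fmap _ _); apply: glue_ext.
- have := co_l (erefl (f ;; eql (cact X b) (@glue _ _ _ (dmap D b) (X k) y m.2 g)))
    (cmpKV (eqr (dcmp D e) (glue x y f)) g).
  by rewrite co_strict.
- have := co_r (erefl (f ;; eql (cact X b) (@glue _ _ _ (dmap D b) (X k) y m.2 g)))
    (cmpKV (eqr (dcmp D e) (glue x y f)) g).
  by rewrite co_strict.
Defined.

(** The first component lives in a discrete groupoid and carries no information; the second is the
    cell of X. *)
Lemma cp_co2 i j k (a : hom i j) (b : hom j k) (c : hom i k) (e : a ;; b = c)
    (x : dmap D a) (y : dmap D b) (m : cp k) (f : hom (rleg _ x) (lleg _ y))
    (g : hom (rleg _ y) (lleg (cp k) m)) (f1 : hom (rleg _ x) (lleg _ (gx (cact cp_data b) g)))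
    (g1 : hom (rleg _ (dcmp D e (glue x y f))) (lleg (cp k) m))
    (e1 : f ;; eql (cact cp_data b) (glue y m g) = f1)
    (e2 : eqr (dcmp D e) (glue x y f) ;; g1 = g) :
  (@co I D _ cp_data i j k a b c e x y m f g f1 g1 e1 e2).2 =
  @co I D _ X i j k a b c e x y m.2 f g f1 g1 e1 e2.
Proof.
have Eg1 := cmpVE e2; move: e1 e2; subst g1 => e1; subst f1 => e2.
by rewrite (co_strict (X := X)) (@co_strict I D _ cp_data).
Qed.

Lemma cp_law : cocone_law cp_data.
Proof.
apply/cocone_lawP => i j k l a b c x y z m f g h; cbv zeta.
move=> g0 f0 g1 h1 h2 f3 h3 eg0 ef0 eg1 eg1' eh1 eh2 ef3 eh3 e1 e2.
apply: injective_projections; first exact: disc_hom_uniq.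
have e2' : f0 ;; fmap (lleg (X j)) (@co I D _ X _ _ _ _ _ _ _ _ _ m.2 _ _ _ _ eg0 eh2) =
      fmap (rleg _) (idm x) ;; f3.
  by rewrite -(cp_co2 eg0 eh2); exact: e2.
have L := (cocone_lawP X).1 (@claw _ _ _ X) i j k l a b c x y z m.2 f g h g0 f0 g1 h1 h2 f3 h3
  eg0 ef0 eg1 eg1' eh1 eh2 ef3 eh3 e1 e2'.
have E1 := cp_co2 ef0 eg1; have E2 := cp_co2 eg1' eh1; have E3 := cp_co2 ef3 eh3.
have E4 : (gm (cact cp_data a) e2).2 = gm (cact X a) e2'.
  by congr (fmap _ _); apply: glue_ext => //; exact: cp_co2.
have E5 : (gm (cact cp_data (a ;; b ;; c)) e1).2 = @gm _ _ _ _ _ _ (cact X (a ;; b ;; c)) _ _ m.2 m.2 _ _ _ (idm m.2) e1.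
  by congr (fmap _ _); apply: glue_ext.
apply: etrans (etrans L (esym _)).
  by congr (_ ;; _ ;; _).
by congr (_ ;; _).
Qed.
Definition copies : cocone D C := Cocone cp_law.

Lemma copies_co2 i j k (a : hom i j) (b : hom j k) (c : hom i k) (e : a ;; b = c)
    (x : dmap D a) (y : dmap D b) (m : copies k) (f : hom (rleg _ x) (lleg _ y))
    (g : hom (rleg _ y) (lleg (copies k) m)) (f1 : hom (rleg _ x) (lleg _ (gx (cact copies b) g)))
    (g1 : hom (rleg _ (dcmp D e (glue x y f))) (lleg (copies k) m))
    (e1 : f ;; eql (cact copies b) (glue y m g) = f1)
    (e2 : eqr (dcmp D e) (glue x y f) ;; g1 = g) :
  (@co I D _ copies i j k a b c e x y m f g f1 g1 e1 e2).2 =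
  @co I D _ X i j k a b c e x y m.2 f g f1 g1 e1 e2.
Proof.
have Eg1 := cmpVE e2; move: e1 e2; subst g1 => e1; subst f1 => e2.
by rewrite (co_strict (X := X)) (co_strict (X := copies)).
Qed.
End Copies.

Lemma gm_eq_l (S T U : pgpd) (M : span S T) (N : span T U) (K : span S U) (w : sequiv (M ** N) K)
    m n (f f' : hom (rleg M m) (lleg N n)) (e : f = f') :
  eql w (glue m n f) ;; fmap (lleg K) (gm_eq w e) = eql w (glue m n f').
Proof. by subst f'; rewrite gm_eq1 fmap1 cmpf1. Qed.

Lemma gm_eq_r (S T U : pgpd) (M : span S T) (N : span T U) (K : span S U) (w : sequiv (M ** N) K)
    m n (f f' : hom (rleg M m) (lleg N n)) (e : f = f') :
  eqr w (glue m n f) ;; fmap (rleg K) (gm_eq w e) = eqr w (glue m n f').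
Proof. by subst f'; rewrite gm_eq1 fmap1 cmpf1. Qed.

Lemma cmp_flip (G : gpd) (x y z w : G) (p : hom x y) (q : hom y z) (r : hom x w) (t : hom w z) :
  p ;; q = r ;; t -> q ;; invm t = invm p ;; r.
Proof. by move=> /cmpVE ->; rewrite cmpA cmpK. Qed.

Section CoEq.
Variables (I : gpd) (D : diagram I) (T : pgpd) (X : cocone_data D T).
(** Cells are compatible with replacing gluing arrows by equal ones. The arrow v is free because in
    the applications it is a component of a factorization cell, identified with [gm_eq] by a
    separate equation. *)
Lemma co_eq i j k (a : hom i j) (b : hom j k) (c : hom i k) (e : a ;; b = c)
    (x : dmap D a) (y : dmap D b) (m : X k) (f : hom (rleg _ x) (lleg _ y))
    (g g' : hom (rleg _ y) (lleg _ m)) (f1 : hom (rleg _ x) (lleg _ (gx (cact X b) g)))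
    (f2 : hom (rleg _ x) (lleg _ (gx (cact X b) g')))
    (g1 g1' : hom (rleg _ (dcmp D e (glue x y f))) (lleg _ m)) (eg : g = g') (eg1 : g1 = g1')
    (e1 : f ;; eql (cact X b) (glue y m g) = f1) (e1' : f ;; eql (cact X b) (glue y m g') = f2)
    (e2 : eqr (dcmp D e) (glue x y f) ;; g1 = g) (e2' : eqr (dcmp D e) (glue x y f) ;; g1' = g')
    (v : hom (gx (cact X b) g) (gx (cact X b) g')) (ev : v = gm_eq (cact X b) eg)
    (e3 : f1 ;; fmap (lleg _) v = fmap (rleg _) (idm x) ;; f2) :
  gm (cact X a) e3 ;; co e1' e2' = co e1 e2 ;; gm_eq (cact X c) eg1.
Proof.
move: e3; subst v => e3; move: e1' e2' e3; subst f1 g' => e1' e2' e3.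
move: e2' e3; subst f2 g1' => e2' e3; rewrite (eq_irrelevance e2' e2) (gm_eq1 (cact X c)) cmpf1.
rewrite -[RHS]cmp1f; apply: (congr1 (fun q => q ;; _)).
by apply: etrans _ (gm1 (cact X a) (gm_eqP (erefl _))); apply: gm_ext => //; exact: gm_eq1.
Qed.
End CoEq.

Section Elements.
Variables (I : gpd) (t : iset I).
(** The arrows of the category of elements of t. *)
Definition elt_hom (s u : {j : I & t j}) : finType :=
  {b : hom (projT1 s) (projT1 u) | iact t b (projT2 u) == projT2 s}.
Definition elt_arr (s u : {j : I & t j}) (b : hom (projT1 s) (projT1 u))
  (e : iact t b (projT2 u) = projT2 s) : elt_hom s u := exist _ b (introT eqP e).
Lemma elt_idP (s : {j : I & t j}) : iact t (idm (projT1 s)) (projT2 s) = projT2 s.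
Proof. exact: iact1. Qed.
Lemma elt_cmpP (s u v : {j : I & t j}) (f : elt_hom s u) (g : elt_hom u v) :
  iact t (val f ;; val g) (projT2 v) = projT2 s.
Proof. by rewrite iactM (eqP (valP g)) (eqP (valP f)). Qed.
Lemma elt_invP (s u : {j : I & t j}) (f : elt_hom s u) :
  iact t (invm (val f)) (projT2 s) = projT2 u.
Proof. by apply: (@iactI _ t _ _ (val f)); rewrite -iactM cmpfV iact1 (eqP (valP f)). Qed.
Definition elt_cover : seq {j : I & t j} :=
  [seq existT (fun j => t j : Type) j u | j <- cover I, u <- enum (t j)].
Lemma elt_coverP (s : {j : I & t j}) : has (fun u => 0 < #|elt_hom s u|)%N elt_cover.
Proof.
case: s => j u; rewrite has_flatten has_map; apply: sub_has (coverP j) => j' /isoP[b] /=.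
rewrite has_map; apply/hasP; exists (iact t (invm b) u); first by rewrite mem_enum.
have e : iact t b (iact t (invm b) u) = u by rewrite -iactM cmpfV iact1.
by apply/card_gt0P; exists (@elt_arr (existT (fun j => t j : Type) j u) (existT (fun j => t j : Type) j' (iact t (invm b) u)) b e).
Qed.
Definition elts : gpd.
Proof.
apply: (@Gpd {j : I & t j} elt_hom (fun s => elt_arr (elt_idP s))
  (fun s u v f g => elt_arr (elt_cmpP f g)) (fun s u f => elt_arr (elt_invP f))
  _ _ _ _ _ _ elt_coverP) => [s u v w f g h|s u f|s u f|s u f|s u f]; apply: val_inj => /=.
- exact: cmpA.
- exact: cmp1f.
- exact: cmpf1.
- exact: cmpfV.
- exact: cmpVf.
Defined.
End Elements.

Section Counting.
Variables (I : gpd) (t : iset I) (C : pgpd).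
Definition counting_l : functor (gprod C (elts t)) (prodp C I) :=
  @Functor (gprod C (elts t)) (prodp C I) (fun s => (s.1, projT1 s.2))
    (fun s u f => (f.1, val f.2)) (fun _ => erefl) (fun _ _ _ _ _ => erefl).
Definition counting_r : functor (gprod C (elts t)) C :=
  @Functor (gprod C (elts t)) C (fun s => s.1)
    (fun s u f => f.1) (fun _ => erefl) (fun _ _ _ _ _ => erefl).
(** The projection of the category of elements to I is a covering with fibres t i, so this span
    forgets the index and multiplies by |t i|. *)
Definition counting : span (prodp C I) C :=
  @Span (prodp C I) C (gprod C (elts t)) counting_l counting_r (fun _ => false)
    (fun s u f => addbF (par f.1)).

Variables (D : diagram I) (X : cocone D C).
Let Y := graded X.
Section W.
Variable i : I.
Let M := Y i ** counting.
(** The I-part i -> j of the gluing arrow carries the element of t j back to t i; its C-part fills a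
    contractible choice. *)
Definition tw_ob (s : M) : copies X t i := (iact t (hpm s).2 (projT2 (hp2 s).2), hp1 s).
Lemma tw_eq (s u : M) (f : hom s u) : (tw_ob s).1 = (tw_ob u).1.
Proof.
have e : (hpm s).2 ;; val (arr2 f).2 = idm i ;; (hpm u).2 := congr1 snd (hphomP f).
by rewrite cmp1f in e; rewrite /tw_ob /= -e iactM (eqP (valP (arr2 f).2)).
Qed.
Definition tw_map (s u : M) (f : hom s u) : hom (tw_ob s) (tw_ob u) :=
  (disc_arr (tw_eq f), arr1 f).
Lemma tw_map1 s : tw_map (idm s) = idm (tw_ob s).
Proof. by congr (_, _); exact: disc_hom_uniq. Qed.
Lemma tw_mapM s u v (f : hom s u) (g : hom u v) : tw_map (f ;; g) = tw_map f ;; tw_map g.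
Proof. by congr (_, _); exact: disc_hom_uniq. Qed.
Definition tw_functor : functor M (copies X t i) := Functor tw_map1 tw_mapM.
Lemma tw_equivalence : equivalence tw_functor.
Proof.
split=> [s u f g e|s u g|[v x]].
- have e1 : arr1 f = arr1 g := congr1 (fun q : hom (tw_ob s) (tw_ob u) => q.2) e.
  apply: glue_ext => //; have E : fmap (lleg counting) (arr2 f) = fmap (lleg counting) (arr2 g).
    by apply: (@cmpI _ _ _ _ (hpm s)); rewrite (hphomP f) (hphomP g) e1.
  apply: injective_projections; first exact: (congr1 (fun q : hom (_ : prodp C I) _ => q.1) E).
  by apply: val_inj; exact: (congr1 (fun q : hom (_ : prodp C I) _ => q.2) E).
- have eg : iact t (hpm s).2 (projT2 (hp2 s).2) = iact t (hpm u).2 (projT2 (hp2 u).2) := disc_homP g.1.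
  pose q := invm (hpm s) ;; (fmap (rleg (Y i)) g.2 ;; hpm u).
  have eq : iact t q.2 (projT2 (hp2 u).2) = projT2 (hp2 s).2.
    have -> : q.2 = invm (hpm s).2 ;; (hpm u).2.
      by have L : invm (hpm s).2 ;; (idm i ;; (hpm u).2) = invm (hpm s).2 ;; (hpm u).2 by rewrite cmp1f.
    by rewrite iactM -eg -iactM cmpVf iact1.
  pose q2 : hom (hp2 s) (hp2 u) := (q.1, elt_arr eq).
  have e : hpm s ;; fmap (lleg counting) q2 = fmap (rleg (Y i)) g.2 ;; hpm u.
    have -> : fmap (lleg counting) q2 = q by apply: injective_projections.
    by rewrite /q cmpKV.
  exists (garr s u g.2 q2 e); apply: injective_projections => //; exact: disc_hom_uniq.
- exists (@glue _ _ _ (Y i) counting x (rleg (X i) x, existT (fun j => t j : Type) i v) (idm (rleg (Y i) x))); split.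
  exact: (disc_arr (iact1 v), idm x).
Qed.
Lemma tw_l_law (s u : M) (f : hom s u) :
  fmap (lleg M) f ;; idm (lleg M u) = idm (lleg M s) ;; fmap (fcomp tw_functor (lleg (copies X t i))) f.
Proof. by rewrite cmp1f cmpf1. Qed.
Definition tw_l : natiso (lleg M) (fcomp tw_functor (lleg (copies X t i))) :=
  @Natiso _ _ (lleg M) (fcomp tw_functor (lleg (copies X t i))) (fun s => idm (lleg M s)) tw_l_law.
Lemma tw_r_law (s u : M) (f : hom s u) :
  fmap (rleg M) f ;; invm (hpm u).1 = invm (hpm s).1 ;; fmap (fcomp tw_functor (rleg (copies X t i))) f.
Proof.
have e : (hpm s).1 ;; (arr2 f).1 = fmap (rleg (X i)) (arr1 f) ;; (hpm u).1 := congr1 fst (hphomP f).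
have L : (arr2 f).1 ;; invm (hpm u).1 = invm (hpm s).1 ;; fmap (rleg (X i)) (arr1 f) := cmp_flip e.
exact: L.
Qed.
Definition tw_r : natiso (rleg M) (fcomp tw_functor (rleg (copies X t i))) :=
  @Natiso _ _ (rleg M) (fcomp tw_functor (rleg (copies X t i))) (fun s => invm (hpm s).1) tw_r_law.
Lemma tw_s (s : M) : sgn M s (+) par (tw_r s) = par (tw_l s) (+) sgn (copies X t i) (tw_functor s).
Proof. by rewrite /= par1 /= /hcomp_sgn /= addbF parV addbK. Qed.
Definition tw : sequiv M (copies X t i) := @SEquiv _ _ M (copies X t i) tw_functor tw_equivalence tw_l tw_r tw_s.
End W.

Lemma tw_natP i j (a : hom i j) k (b : hom j k) (u : t k) :
  iact t (invm (invm a) ;; b) u = iact t a (iact t b u).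
Proof. by rewrite invmK iactM. Qed.

Definition counting_data : factor_data Y (copies X t).
Proof.
apply: (@build_factor_data I D _ _ Y (copies X t) counting tw
  (fun i j a x m n f h => (disc_arr (tw_natP a h.2 (projT2 n.2)),
     gm_eq (cact X a) (esym (cmpf1 f))))) =>
  [i j a x x' m m' n n' f h f' h' u v s euv evs e3 e4|i j a x m n f h|i j a x m n f h].
- apply: injective_projections; first exact: disc_hom_uniq.
  have E : gm (cact X a) euv ;; gm_eq (cact X a) (esym (cmpf1 f')) =
    gm_eq (cact X a) (esym (cmpf1 f)) ;; @gm _ _ _ _ _ _ (cact X a) _ _ _ _ _ _ u v e4.
    by rewrite !gmM; apply: gm_ext; rewrite ?cmp1f ?cmpf1.
  apply: etrans (etrans E _) => //.
  by congr (_ ;; _); congr (fmap _ _); apply: glue_ext.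
- have E := gm_eq_l (cact X a) (esym (cmpf1 f)).
  have L : eql (cact X a) (glue x m f) ;; idm _ ;; fmap (lleg (X i)) (gm_eq (cact X a) (esym (cmpf1 f)))
     = eql (cact X a) (glue x m (f ;; idm _)) by rewrite (cmpf1 (eql (cact X a) _)); exact: E.
  exact: L.
- have E := gm_eq_r (cact X a) (esym (cmpf1 f)).
  have L : invm (invm (eqr (cact X a) (glue x m f)) ;; h.1) ;; fmap (rleg (X i)) (gm_eq (cact X a) (esym (cmpf1 f)))
     = invm h.1 ;; eqr (cact X a) (glue x m (f ;; idm _)).
    by rewrite invM invmK -E -cmpA.
  exact: L.
Defined.

Lemma counting_nt2 i j (a : hom i j) (x : dmap D a) (m : Y j) (n : counting)
    (f : hom (rleg _ x) (lleg _ m)) (h : hom (rleg _ m) (lleg _ n))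
    (c : hom (rleg _ (gx (cact Y a) f)) (lleg _ n))
    (f' : hom (rleg _ x) (lleg _ (gx (fw counting_data j) h)))
    (e1 : eqr (cact Y a) (glue x m f) ;; c = h)
    (e2 : f ;; eql (fw counting_data j) (glue m n h) = f') (e2' : f = f') :
  (@nt I D _ _ Y (copies X t) counting_data i j a x m n f h c f' e1 e2).2 = gm_eq (cact X a) e2'.
Proof.
have Ec := cmpVE e1; move: e1 e2 e2'; subst c => e1 e2; subst f' => e2'.
by rewrite nt_strict; apply: gm_ext.
Qed.

(** First components agree by discreteness. The second components of the cells only replace f by f
    ;; id, so the law is an instance of [co_eq]. *)
Lemma counting_law : factor_law counting_data.
Proof.
apply/factor_lawP => i j k a b x y m n f g h f1 g1 h1 c1 c2 f1' g' g1' f2.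
move=> ef1 eg1 eh1 ec1 ec2 ef1' eg' eg1' ef2 eg1'' e1 e2.
apply: injective_projections; first exact: disc_hom_uniq.
have Ef1 : f1 = f1' by rewrite -ef1'; exact: esym (cmpf1 f1).
have Eg : g = g' by rewrite -eg'; exact: esym (cmpf1 g).
have Eg1 : g1 = g1' by rewrite -eg1'; exact: esym (cmpf1 g1).
have N1 := counting_nt2 ec1 ef1' Ef1; have N2 := counting_nt2 ec2 eg1' Eg1.
have Nb := counting_nt2 eh1 eg' Eg.
have e3 : f1 ;; fmap (lleg (X j)) (@nt I D _ _ Y (copies X t) counting_data _ _ _ _ _ _ _ _ _ _ eh1 eg').2 = fmap (rleg (dmap D a)) (idm x) ;; f2.
  by rewrite Ef1; exact: e2.
have E := @co_eq I D C X i j k a b _ (erefl (a ;; b)) x y m f g g' f1 f2 g1 g1' Eg Eg1 ef1 ef2 eg1 eg1''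
  (@nt I D _ _ Y (copies X t) counting_data _ _ _ _ _ _ _ _ _ _ eh1 eg').2 Nb e3.
have L1 : (gm (tw i) e1).2 = @co I D C X i j k a b _ _ x y m f g f1 g1 ef1 eg1 :=
  @graded_co I D C X i j k a b _ _ x y m f g f1 g1 ef1 eg1.
have L2 := copies_co2 ef2 eg1''.
pose f1x : hom (rleg _ x) (lleg (X j) (gx (cact X b) g)) := f1'.
have e4 : f1 ;; fmap (lleg (X j)) (idm _) = fmap (rleg (dmap D a)) (idm x) ;; f1x.
  by rewrite !fmap1 cmpf1 cmp1f.
have e5 : f1x ;; fmap (lleg (X j)) (@nt I D _ _ Y (copies X t) counting_data _ _ _ _ _ _ _ _ _ _ eh1 eg').2
    = fmap (rleg _) (idm x) ;; f2 := e2.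
have L3 : gm_eq (cact X a) (Ef1 : f1 = f1x) ;; (gm (cact (copies X t) a) e2).2 = gm (cact X a) e3.
  have -> : gm_eq (cact X a) (Ef1 : f1 = f1x) = gm (cact X a) e4 by apply: gm_ext.
  have -> : (gm (cact (copies X t) a) e2).2 = gm (cact X a) e5.
    by congr (fmap _ _); apply: glue_ext.
  by rewrite gmM; apply: gm_ext; rewrite cmp1f.
apply: etrans (etrans (esym E) _).
  by congr (_ ;; _); [exact: L1 | exact: N2].
rewrite -L3; apply: etrans (congr1 (fun q => _ ;; q) (esym L2)) _.
apply: (congr1 (fun q => q ;; _)).
apply: (congr1 (fun q => q ;; _)).
exact: esym N1.
Qed.
Definition counting_factor : factor Y (copies X t) := Factor counting_law.
End Counting.

Definition one_iset (I : gpd) : iset I :=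
  @ISet I (fun _ => unit : finType) (fun _ _ _ u => u) (fun _ _ => erefl) (fun _ _ _ _ _ _ => erefl).

Section IdFactor.
Variables (I : gpd) (C : pgpd).
Variables (D : diagram I) (X : cocone D C).
Let Y := X.
Let t := one_iset I.
Let iid := span_id C.
Section W.
Variable i : I.
Let M := Y i ** iid.
(** The target is the one-point multiple of X rather than X itself, so that the identity and the
    composite of Phi with counting factor literally the same cocone. *)
Definition iw_ob (s : M) : copies X t i := (tt, hp1 s).
Definition iw_map (s u : M) (f : hom s u) : hom (iw_ob s) (iw_ob u) :=
  (disc_arr (erefl tt), arr1 f).
Lemma iw_map1 s : iw_map (idm s) = idm (iw_ob s).
Proof. by congr (_, _); exact: disc_hom_uniq. Qed.
Lemma iw_mapM s u v (f : hom s u) (g : hom u v) : iw_map (f ;; g) = iw_map f ;; iw_map g.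
Proof. by congr (_, _); exact: disc_hom_uniq. Qed.
Definition iw_functor : functor M (copies X t i) := Functor iw_map1 iw_mapM.
Lemma iw_equivalence : equivalence iw_functor.
Proof.
split=> [s u f g e|s u g|[v x]].
- have e1 : arr1 f = arr1 g := congr1 (fun q : hom (iw_ob s) (iw_ob u) => q.2) e.
  apply: glue_ext => //; apply: (@cmpI _ _ _ _ (hpm s)).
  by apply: etrans (hphomP f) _; rewrite e1; exact: esym (hphomP g).
- pose q : hom (hp2 s) (hp2 u) := invm (hpm s) ;; (fmap (rleg (X i)) g.2 ;; hpm u).
  have e : hpm s ;; fmap (lleg iid) q = fmap (rleg (X i)) g.2 ;; hpm u by exact: cmpKV.
  exists (garr s u g.2 q e); apply: injective_projections => //; exact: disc_hom_uniq.
- exists (@glue _ _ _ (Y i) iid x (rleg (X i) x) (idm (rleg (Y i) x))); split.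
  by case: v; exact: (disc_arr (erefl tt), idm x).
Qed.
Lemma iw_l_law (s u : M) (f : hom s u) :
  fmap (lleg M) f ;; idm (lleg M u) = idm (lleg M s) ;; fmap (fcomp iw_functor (lleg (copies X t i))) f.
Proof. by rewrite cmp1f cmpf1. Qed.
Definition iw_l : natiso (lleg M) (fcomp iw_functor (lleg (copies X t i))) :=
  @Natiso _ _ (lleg M) (fcomp iw_functor (lleg (copies X t i))) (fun s => idm (lleg M s)) iw_l_law.
Lemma iw_r_law (s u : M) (f : hom s u) :
  fmap (rleg M) f ;; invm (hpm u) = invm (hpm s) ;; fmap (fcomp iw_functor (rleg (copies X t i))) f.
Proof.
have e : hpm s ;; arr2 f = fmap (rleg (X i)) (arr1 f) ;; hpm u := hphomP f.
have L : arr2 f ;; invm (hpm u) = invm (hpm s) ;; fmap (rleg (X i)) (arr1 f) := cmp_flip e.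
exact: L.
Qed.
Definition iw_r : natiso (rleg M) (fcomp iw_functor (rleg (copies X t i))) :=
  @Natiso _ _ (rleg M) (fcomp iw_functor (rleg (copies X t i))) (fun s => invm (hpm s)) iw_r_law.
Lemma iw_s (s : M) : sgn M s (+) par (iw_r s) = par (iw_l s) (+) sgn (copies X t i) (iw_functor s).
Proof. by rewrite /= par1 /= /hcomp_sgn /= addbF parV addbK. Qed.
Definition iw : sequiv M (copies X t i) := @SEquiv _ _ M (copies X t i) iw_functor iw_equivalence iw_l iw_r iw_s.
End W.

Definition id_data : factor_data Y (copies X t).
Proof.
apply: (@build_factor_data I D _ _ Y (copies X t) iid iw
  (fun i j a x m n f h => (disc_arr (erefl tt),
     gm_eq (cact X a) (esym (cmpf1 f))))) =>
  [i j a x x' m m' n n' f h f' h' u v s euv evs e3 e4|i j a x m n f h|i j a x m n f h].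
- apply: injective_projections; first exact: disc_hom_uniq.
  have E : gm (cact X a) euv ;; gm_eq (cact X a) (esym (cmpf1 f')) =
    gm_eq (cact X a) (esym (cmpf1 f)) ;; @gm _ _ _ _ _ _ (cact X a) _ _ _ _ _ _ u v e4.
    by rewrite !gmM; apply: gm_ext; rewrite ?cmp1f ?cmpf1.
  apply: etrans (etrans E _) => //.
  by congr (_ ;; _); congr (fmap _ _); apply: glue_ext.
- have E := gm_eq_l (cact X a) (esym (cmpf1 f)).
  have L : eql (cact X a) (glue x m f) ;; idm _ ;; fmap (lleg (X i)) (gm_eq (cact X a) (esym (cmpf1 f)))
     = eql (cact X a) (glue x m (f ;; idm _)) by rewrite (cmpf1 (eql (cact X a) _)); exact: E.
  exact: L.
- have E := gm_eq_r (cact X a) (esym (cmpf1 f)).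
  have L : invm (invm (eqr (cact X a) (glue x m f)) ;; h) ;; fmap (rleg (X i)) (gm_eq (cact X a) (esym (cmpf1 f)))
     = invm h ;; eqr (cact X a) (glue x m (f ;; idm _)).
    by rewrite invM invmK -E -cmpA.
  exact: L.
Defined.

Lemma id_nt2 i j (a : hom i j) (x : dmap D a) (m : Y j) (n : iid)
    (f : hom (rleg _ x) (lleg _ m)) (h : hom (rleg _ m) (lleg _ n))
    (c : hom (rleg _ (gx (cact Y a) f)) (lleg _ n))
    (f' : hom (rleg _ x) (lleg _ (gx (fw id_data j) h)))
    (e1 : eqr (cact Y a) (glue x m f) ;; c = h)
    (e2 : f ;; eql (fw id_data j) (glue m n h) = f') (e2' : f = f') :
  (@nt I D _ _ Y (copies X t) id_data i j a x m n f h c f' e1 e2).2 = gm_eq (cact X a) e2'.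
Proof.
have Ec := cmpVE e1; move: e1 e2 e2'; subst c => e1 e2; subst f' => e2'.
by rewrite nt_strict; apply: gm_ext.
Qed.

Lemma id_law : factor_law id_data.
Proof.
apply/factor_lawP => i j k a b x y m n f g h f1 g1 h1 c1 c2 f1' g' g1' f2.
move=> ef1 eg1 eh1 ec1 ec2 ef1' eg' eg1' ef2 eg1'' e1 e2.
apply: injective_projections; first exact: disc_hom_uniq.
have Ef1 : f1 = f1' by rewrite -ef1'; exact: esym (cmpf1 f1).
have Eg : g = g' by rewrite -eg'; exact: esym (cmpf1 g).
have Eg1 : g1 = g1' by rewrite -eg1'; exact: esym (cmpf1 g1).
have N1 := id_nt2 ec1 ef1' Ef1; have N2 := id_nt2 ec2 eg1' Eg1.
have Nb := id_nt2 eh1 eg' Eg.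
have e3 : f1 ;; fmap (lleg (X j)) (@nt I D _ _ Y (copies X t) id_data _ _ _ _ _ _ _ _ _ _ eh1 eg').2 = fmap (rleg (dmap D a)) (idm x) ;; f2.
  by rewrite Ef1; exact: e2.
have E := @co_eq I D C X i j k a b _ (erefl (a ;; b)) x y m f g g' f1 f2 g1 g1' Eg Eg1 ef1 ef2 eg1 eg1''
  (@nt I D _ _ Y (copies X t) id_data _ _ _ _ _ _ _ _ _ _ eh1 eg').2 Nb e3.
have L2 := copies_co2 ef2 eg1''.
pose f1x : hom (rleg _ x) (lleg (X j) (gx (cact X b) g)) := f1'.
have e4 : f1 ;; fmap (lleg (X j)) (idm _) = fmap (rleg (dmap D a)) (idm x) ;; f1x.
  by rewrite !fmap1 cmpf1 cmp1f.
have e5 : f1x ;; fmap (lleg (X j)) (@nt I D _ _ Y (copies X t) id_data _ _ _ _ _ _ _ _ _ _ eh1 eg').2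
    = fmap (rleg _) (idm x) ;; f2 := e2.
have L3 : gm_eq (cact X a) (Ef1 : f1 = f1x) ;; (gm (cact (copies X t) a) e2).2 = gm (cact X a) e3.
  have -> : gm_eq (cact X a) (Ef1 : f1 = f1x) = gm (cact X a) e4 by apply: gm_ext.
  have -> : (gm (cact (copies X t) a) e2).2 = gm (cact X a) e5.
    by congr (fmap _ _); apply: glue_ext.
  by rewrite gmM; apply: gm_ext; rewrite cmp1f.
apply: etrans (etrans (esym E) _).
  by congr (_ ;; _); exact: N2.
rewrite -L3; apply: etrans (congr1 (fun q => _ ;; q) (esym L2)) _.
apply: (congr1 (fun q => q ;; _)).
apply: (congr1 (fun q => q ;; _)).
exact: esym N1.
Qed.
Definition id_factor : factor Y (copies X t) := Factor id_law.
End IdFactor.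

(** * Left legs of invertible spans *)

Lemma equivalence_natiso (G H : gpd) (F F' : functor G H) :
  natiso F F' -> equivalence F' -> equivalence F.
Proof.
move=> a [fa fu es]; have nat x y (f : hom x y) : fmap F' f = invm (a x) ;; (fmap F f ;; a y).
  by rewrite nat_law cmpVK.
split=> [x y f g e|x y g|y].
- by apply: fa; rewrite !nat e.
- have [f ef] := fu _ _ (invm (a x) ;; (g ;; a y)); exists f.
  apply: (@cmpIr _ _ _ _ (a y)); rewrite nat_law ef; exact: cmpKV.
- by have [x [f]] := es y; exists x; split; exact: (a x ;; f).
Qed.

Definition natiso_inv (G H : gpd) (F F' : functor G H) (a : natiso F F') : natiso F' F :=
  @Natiso _ _ F' F (fun x => invm (a x)) (fun x y f => esym (natV a f)).

Lemma equivalence_cancel (G H K : gpd) (F : functor G H) (F' : functor H K) :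
  equivalence F -> equivalence (fcomp F F') -> equivalence F'.
Proof.
move=> [_ fu es] [fa' fu' es'].
split=> [x y f g e|x y g|z].
- have [s [p]] := es x; have [t [q]] := es y.
  have [h eh] := fu _ _ (p ;; f ;; invm q); have [k ek] := fu _ _ (p ;; g ;; invm q).
  have hk : h = k by apply: fa'; rewrite /= eh ek !fmapM e.
  by move: eh; rewrite hk ek => /cmpIr /cmpI.
- have [s [p]] := es x; have [t [q]] := es y.
  have [h eh] := fu' _ _ (fmap F' p ;; g ;; invm (fmap F' q)).
  by exists (invm p ;; fmap F h ;; q); rewrite !fmapM fmapV [X in _ ;; X ;; _]eh -!cmpA cmpVK cmpVf cmpf1.
- by have [x h] := es' z; exists (F x).
Qed.

Lemma cmp_square (G : gpd) (u v w x y z : G) (A : hom u v) (p : hom v w) (k : hom u x) (A' : hom x w)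
    (q : hom w y) (B' : hom x y) (q0 : hom v z) (B : hom u z) (r : hom z y) :
  A ;; p = k ;; A' -> A' ;; q = B' -> A ;; q0 = B -> B ;; r = k ;; B' -> p ;; q = q0 ;; r.
Proof.
move=> e1 e2 e3 e4; apply: (@cmpI _ _ _ _ A).
by rewrite !cmpA e1 e3 e4 -e2 cmpA.
Qed.

Section LeftLeg.
Variables (S T : pgpd) (M : span S T) (N : span T S).
Hypotheses (MN : equivalence (lleg (M ** N))) (NM : equivalence (lleg (N ** M))).

Lemma lleg_esurj (y : S) : exists x : M, inhabited (hom (lleg M x) y).
Proof. by have [t h] := eq_esurj MN y; exists (hp1 t). Qed.

(** The lift is strict: only the second coordinate and the gluing arrow are chosen, from a point of
    N over rleg x. *)
Lemma lleg_lift (x : M) : exists t : M ** N, hp1 t = x.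
Proof.
have [t [h]] := eq_esurj NM (rleg M x).
by exists (@glue _ _ _ M N x (hp1 t) (invm h)).
Qed.

Lemma lleg_full (x y : M) (g : hom (lleg M x) (lleg M y)) : exists f, fmap (lleg M) f = g.
Proof.
have [s es] := lleg_lift x; have [t et] := lleg_lift y.
move: g; rewrite -es -et => g; have [f ef] := eq_full MN (x := s) (y := t) g.
by exists (arr1 f).
Qed.
End LeftLeg.

(** The left leg of a composite factors through the projection to M. Points and arrows of M lift
    along this projection, so fullness and faithfulness of the composite leg pass to lleg M. *)
Lemma lleg_equivalence (S T : pgpd) (M : span S T) (N : span T S) :
  equivalence (lleg (M ** N)) -> equivalence (lleg (N ** M)) -> equivalence (lleg M).
Proof.
move=> MN NM; split; [|exact: lleg_full MN NM|exact: lleg_esurj MN].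
move=> x y f g e; have [s es] := lleg_lift NM x; have [t et] := lleg_lift NM y.
move: f g e; rewrite -es -et => f g e.
(* The second coordinate of the lift comes from fullness of lleg N, by the symmetric argument. *)
have lift h : exists h' : hom s t, arr1 h' = h.
  have [k ek] := lleg_full NM MN (invm (hpm s) ;; (fmap (rleg M) h ;; hpm t)).
  by rewrite -[k]/(k) in ek; exists (garr s t h k (etrans (congr1 (cmp _) ek) (cmpKV _ _))).
have [f' ef] := lift f; have [g' eg] := lift g.
rewrite -ef -eg; congr arr1; apply: (eq_faithful MN).
by rewrite /= ef eg.
Qed.

(** The spans of a and of its inverse compose, in both orders, to one equivalent to an identity
    span, whose left leg is an identity. *)
Lemma dmap_lleg_equivalence (I : gpd) (D : diagram I) (i j : I) (a : hom i j) :
  equivalence (lleg (dmap D a)).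
Proof.
have inv k l (b : hom k l) (c : hom l k) (e : b ;; c = idm k) : equivalence (lleg (dmap D b ** dmap D c)).
  apply: equivalence_natiso (eql (dcmp D e)) _; apply: equivalence_comp (eqFP _) _.
  apply: equivalence_cancel (eqFP (dunit D k)) _.
  apply: equivalence_natiso (natiso_inv (eql (dunit D k))) _; exact: fid_equivalence.
apply: (@lleg_equivalence _ _ _ (dmap D (invm a))); apply: inv; [exact: cmpfV | exact: cmpVf].
Qed.

(** Each cell has its left leg prescribed by [sil], so after the left leg both sides of the law are
    determined, and they agree by the [sil] of [dassoc]. *)
Lemma cocone_law_faithful (I : gpd) (D : diagram I) (T : pgpd) (X : cocone_data D T) :
  (forall i (x y : X i), injective (@fmap _ _ (lleg (X i)) x y)) -> cocone_law X.
Proof.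
move=> faithful; apply/cocone_lawP => i j k l a b c x y z m f g h; cbv zeta.
move=> g0 f0 g1 h1 h2 f3 h3 eg0 ef0 eg1 eg1' eh1 eh2 ef3 eh3 e1 e2.
apply: faithful; apply: (@cmpI _ _ _ _ (eql (cact X a) (glue x _ f0))).
have S : eql (dcmp D (erefl (a ;; b))) (glue x y f)
    ;; eql (dcmp D (erefl (a ;; b ;; c))) (glue (dcmp D (erefl (a ;; b)) (glue x y f)) z _)
    ;; fmap (lleg _) (dassoc D a b c (glue (glue x y f) z g)) =
  idm _ ;; (idm _ ;; eql (dcmp D (cmpA a b c)) (glue x _ _)) :=
  sil (dassoc D a b c) (glue (glue x y f) z g).
rewrite !cmp1f in S.
have R : eql (cact X a) (glue x _ f0) ;; fmap (lleg _) (gm (cact X a) e2) =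
    eql (cact X a) (glue x _ f3) by rewrite gm_l fmap1 cmp1f.
rewrite !fmapM !cmpA R co_l -(cmpA _ (eql (cact X (a ;; b)) _)) (co_l eg1' eh1) (co_l ef3 eh3).
by rewrite -S -!(@cmpA (D i)) gm_l.
Qed.

(* The sum over a : i -> i0 of the spans D a.  Its arrows (a, x) -> (b, y) are arrows
   lleg x -> lleg y with a = b, which makes the left leg faithful by construction,
   so that the cocone law follows from the compatibility with left legs; this is the
   sum because lleg (dmap D a) is an equivalence. *)
Section Represented.
Variables (I : gpd) (D : diagram I) (i0 : I).

Definition lft i (a : hom i i0) (x y : dmap D a) (k : hom (lleg _ x) (lleg _ y)) : hom x y :=
  lift (dmap_lleg_equivalence D a) k.
Lemma lftK i (a : hom i i0) (x y : dmap D a) (k : hom (lleg _ x) (lleg _ y)) :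
  fmap (lleg (dmap D a)) (lft k) = k.
Proof. exact: liftK. Qed.
Lemma lftE i (a : hom i i0) (x y : dmap D a) (f : hom x y) : lft (fmap (lleg (dmap D a)) f) = f.
Proof. by apply: (eq_faithful (dmap_lleg_equivalence D a)); exact: lftK. Qed.

(** Points joined by an arrow have indices that are equal only up to a proof, so the right leg is
    defined by transport. Equality on hom sets being decidable, the choice of proof does not
    matter. *)
Definition rlft i (a b : hom i i0) (e : a = b) : forall (x : dmap D a) (y : dmap D b),
    hom (lleg (dmap D a) x) (lleg (dmap D b) y) -> hom (rleg (dmap D a) x) (rleg (dmap D b) y) :=
  match e in _ = b return forall (x : dmap D a) (y : dmap D b),
    hom (lleg (dmap D a) x) (lleg (dmap D b) y) -> hom (rleg (dmap D a) x) (rleg (dmap D b) y) with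
  | erefl => fun x y k => fmap (rleg (dmap D a)) (lft k) end.

Lemma rlftE i (a : hom i i0) (e : a = a) (x y : dmap D a) (f : hom x y) :
  rlft e (fmap (lleg (dmap D a)) f) = fmap (rleg (dmap D a)) f.
Proof. by rewrite (eq_irrelevance e erefl) /= lftE. Qed.

Lemma rlftM i (a b c : hom i i0) (e : a = b) (e' : b = c) (e'' : a = c) (x : dmap D a) (y : dmap D b)
    (z : dmap D c) (k : hom (lleg _ x) (lleg _ y)) (l : hom (lleg _ y) (lleg _ z)) :
  rlft e'' (k ;; l) = rlft e k ;; rlft e' l.
Proof.
subst b c; rewrite (eq_irrelevance e'' erefl) /= -fmapM; congr (fmap _ _).
by rewrite -{1}(lftK k) -{1}(lftK l) -fmapM lftE.
Qed.

Lemma sgn_rlft i (a b : hom i i0) (e : a = b) (x : dmap D a) (y : dmap D b)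
    (k : hom (lleg _ x) (lleg _ y)) :
  par k (+) sgn (dmap D b) y = sgn (dmap D a) x (+) par (rlft e k).
Proof. by subst b; rewrite /= -{1}(lftK k); exact: sgn_law. Qed.

Section At.
Variable i : I.
Definition rp_ob : Type := {a : hom i i0 & dmap D a}.
Definition rp_pt (a : hom i i0) (x : dmap D a) : rp_ob := existT (fun a => dmap D a : Type) a x.
Definition rp_lleg (s : rp_ob) : D i := lleg (dmap D (projT1 s)) (projT2 s).
Definition rp_hom (s t : rp_ob) : finType :=
  {k : hom (rp_lleg s) (rp_lleg t) | projT1 s == projT1 t}.
Definition rp_arr (s t : rp_ob) (e : projT1 s = projT1 t) (k : hom (rp_lleg s) (rp_lleg t)) :
  rp_hom s t := exist _ k (introT eqP e).
Definition rp_eq (s t : rp_ob) (f : rp_hom s t) : projT1 s = projT1 t := eqP (valP f).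
Definition rp_cover : seq rp_ob :=
  flatten [seq [seq rp_pt x | x <- cover (dmap D a)] | a <- enum (hom i i0)].
Lemma rp_coverP (s : rp_ob) : has (fun t => 0 < #|rp_hom s t|)%N rp_cover.
Proof.
case: s => a x; rewrite has_flatten has_map; apply/hasP; exists a; first by rewrite mem_enum.
rewrite /= has_map; apply: sub_has (coverP x) => y /isoP[f] /=.
by apply/card_gt0P; exists (@rp_arr (rp_pt x) (rp_pt y) erefl (fmap (lleg _) f)).
Qed.
Definition rp_gpd : gpd.
Proof.
apply: (@Gpd rp_ob rp_hom (fun s => @rp_arr s s erefl (idm _))
  (fun s t u f g => @rp_arr s u (etrans (rp_eq f) (rp_eq g)) (val f ;; val g))
  (fun s t f => @rp_arr t s (esym (rp_eq f)) (invm (val f)))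
  _ _ _ _ _ _ rp_coverP) => [s t u v f g h|s t f|s t f|s t f|s t f]; apply: val_inj => /=.
- exact: cmpA.
- exact: cmp1f.
- exact: cmpf1.
- exact: cmpfV.
- exact: cmpVf.
Defined.
Definition rp_l : functor rp_gpd (D i) :=
  @Functor rp_gpd (D i) rp_lleg (fun s t f => val f) (fun _ => erefl) (fun _ _ _ _ _ => erefl).
Definition rp_r : functor rp_gpd (D i0).
Proof.
apply: (@Functor rp_gpd (D i0) (fun s => rleg (dmap D (projT1 s)) (projT2 s))
  (fun s t f => rlft (rp_eq f) (val f))) => [[a x]|s t u f g].
  have E := fmap1 (lleg (dmap D a)) x.
  have -> : val (idm (rp_pt x : rp_gpd)) = fmap (lleg (dmap D a)) (idm x) by rewrite fmap1.
  by rewrite rlftE fmap1.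
exact: rlftM.
Defined.
Definition rp : span (D i) (D i0) :=
  @Span (D i) (D i0) rp_gpd rp_l rp_r (fun s => sgn (dmap D (projT1 s)) (projT2 s))
    (fun s t f => sgn_rlft (rp_eq f) (val f)).
End At.

Section Act.
Variables (i j : I) (a : hom i j).

Lemma rlft_dcmp (b b' : hom j i0) (e : b = b') (e' : a ;; b = a ;; b') (x x' : dmap D a)
    (y : dmap D b) (y' : dmap D b') (f : hom (rleg _ x) (lleg _ y)) (f' : hom (rleg _ x') (lleg _ y'))
    (u : hom x x') (k : hom (lleg _ y) (lleg _ y')) :
  f ;; k = fmap (rleg _) u ;; f' ->
  rlft e k ;; eqr (dcmp D (erefl (a ;; b'))) (glue x' y' f') =
  eqr (dcmp D (erefl (a ;; b))) (glue x y f) ;;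
  rlft e' (invm (eql (dcmp D (erefl (a ;; b))) (glue x y f)) ;; fmap (lleg _) u
            ;; eql (dcmp D (erefl (a ;; b'))) (glue x' y' f')).
Proof.
move: e'; subst b'; rewrite -(lftK k) => e' sq.
have <- : fmap (lleg _) (gm (dcmp D (erefl (a ;; b))) sq) =
    invm (eql (dcmp D (erefl (a ;; b))) (glue x y f)) ;; fmap (lleg _) u
            ;; eql (dcmp D (erefl (a ;; b))) (glue x' y' f').
  by apply: (@cmpI _ _ _ _ (eql (dcmp D (erefl (a ;; b))) (glue x y f))); rewrite gm_l !cmpA cmpfV cmp1f.
by rewrite !rlftE gm_r.
Qed.

Let M := dmap D a ** rp j.
Definition rp_drop (t : M) : dmap D a ** dmap D (projT1 (hp2 t)) := glue (hp1 t) (projT2 (hp2 t)) (hpm t).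
Definition rp_act_ob (t : M) : rp i := rp_pt (dcmp D (erefl (a ;; projT1 (hp2 t))) (rp_drop t)).
Definition rp_el (t : M) : hom (lleg M t) (lleg (rp i) (rp_act_ob t)) := eql (dcmp D _) (rp_drop t).
Definition rp_er (t : M) : hom (rleg M t) (rleg (rp i) (rp_act_ob t)) := eqr (dcmp D _) (rp_drop t).
Definition rp_act_map (s t : M) (f : hom s t) : hom (rp_act_ob s) (rp_act_ob t) :=
  @rp_arr i (rp_act_ob s) (rp_act_ob t) (congr1 (cmp a) (rp_eq (arr2 f)))
    (invm (rp_el s) ;; fmap (lleg _) (arr1 f) ;; rp_el t).
Lemma rp_act_map1 s : rp_act_map (idm s) = idm (rp_act_ob s).
Proof.
apply: val_inj; have L : invm (rp_el s) ;; fmap (lleg _) (idm _) ;; rp_el s = idm _.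
  by rewrite fmap1 cmpf1 cmpVf.
exact: L.
Qed.
Lemma rp_act_mapM r s t (f : hom r s) (g : hom s t) :
  rp_act_map (f ;; g) = rp_act_map f ;; rp_act_map g.
Proof.
apply: val_inj; have L : invm (rp_el r) ;; fmap (lleg _) (arr1 f ;; arr1 g) ;; rp_el t =
  invm (rp_el r) ;; fmap (lleg _) (arr1 f) ;; rp_el s ;; (invm (rp_el s) ;; fmap (lleg _) (arr1 g) ;; rp_el t).
  by rewrite fmapM -!cmpA cmpKV.
exact: L.
Qed.
Definition rp_act_functor : functor M (rp i) := Functor rp_act_map1 rp_act_mapM.
Lemma rp_act_equivalence : equivalence rp_act_functor.
Proof.
have [fa fu es] := dmap_lleg_equivalence D a.
split=> [s t f g e|s t g|[c z]].
- have e1 : arr1 f = arr1 g.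
    by apply: fa; exact: cmpI (cmpIr (congr1 (fun q : hom (rp_act_ob s) (rp_act_ob t) => val q) e)).
  apply: glue_ext => //; apply: val_inj; apply: (@cmpI _ _ _ _ (hpm s)).
  by apply: etrans (hphomP f) _; rewrite e1; exact: esym (hphomP g).
- have [u eu] := fu _ _ (rp_el s ;; val g ;; invm (rp_el t)).
  have eb : projT1 (hp2 s) = projT1 (hp2 t) by apply: (@cmpI _ _ _ _ a); exact: rp_eq g.
  have e : hpm s ;; fmap (lleg (rp j)) (rp_arr eb (invm (hpm s) ;; (fmap (rleg _) u ;; hpm t)))
    = fmap (rleg _) u ;; hpm t by exact: cmpKV.
  exists (garr s t u (rp_arr eb (invm (hpm s) ;; (fmap (rleg _) u ;; hpm t))) e); apply: val_inj.
  have L : invm (rp_el s) ;; fmap (lleg _) u ;; rp_el t = val g.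
    by rewrite eu -!cmpA cmpVf cmpf1 cmpVK.
  exact: L.
(* The index b solves a ;; b = c, and z is reached through [dcmp D e]. Arrows into z are given by
   left legs alone, so this cell need not be compared with the one for [erefl]. *)
- pose b := invm a ;; c; have e : a ;; b = c by rewrite cmpKV.
  have [t [f]] := eq_esurj (eqFP (dcmp D e)) z.
  exists (@glue _ _ _ (dmap D a) (rp j) (hp1 t) (rp_pt (hp2 t)) (hpm t)); split.
  case: t f => x y h f; apply: (@rp_arr i (rp_pt _) (rp_pt _) e).
  exact: (invm (eql (dcmp D (erefl (a ;; b))) (glue x y h)) ;; eql (dcmp D e) (glue x y h)
          ;; fmap (lleg _) f).
Qed.
Lemma rp_l_law (s t : M) (f : hom s t) :
  fmap (lleg M) f ;; rp_el t = rp_el s ;; fmap (fcomp rp_act_functor (lleg (rp i))) f.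
Proof.
have L : rp_el s ;; (invm (rp_el s) ;; fmap (lleg _) (arr1 f) ;; rp_el t) =
  fmap (lleg _) (arr1 f) ;; rp_el t by rewrite -!cmpA cmpKV.
exact: esym L.
Qed.
Definition rp_act_l : natiso (lleg M) (fcomp rp_act_functor (lleg (rp i))) :=
  @Natiso _ _ (lleg M) (fcomp rp_act_functor (lleg (rp i))) rp_el rp_l_law.
Lemma rp_r_law (s t : M) (f : hom s t) :
  fmap (rleg M) f ;; rp_er t = rp_er s ;; fmap (fcomp rp_act_functor (rleg (rp i))) f.
Proof. exact: (rlft_dcmp (rp_eq (arr2 f)) (rp_eq (rp_act_map f)) (hphomP f)). Qed.
Definition rp_act_r : natiso (rleg M) (fcomp rp_act_functor (rleg (rp i))) :=
  @Natiso _ _ (rleg M) (fcomp rp_act_functor (rleg (rp i))) rp_er rp_r_law.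
Definition rp_act : sequiv M (rp i) :=
  @SEquiv _ _ M (rp i) rp_act_functor rp_act_equivalence rp_act_l rp_act_r
    (fun t => eqs (dcmp D _) (rp_drop t)).
End Act.

Lemma rp_faithful i (s t : rp i) : injective (@fmap _ _ (lleg (rp i)) s t).
Proof. by move=> f g e; apply: val_inj. Qed.

(** The proof of the triangle may sit in [rlft] or in [dcmp]: reindexing along one amounts to using
    the cell of the other. *)
Lemma rlft_triangle i j (a : hom i j) (b : hom j i0) (c : hom i i0) (e e' : a ;; b = c)
    (t : dmap D a ** dmap D b) (w : dmap D c) (q : hom (lleg _ t) (lleg _ w)) :
  eqr (dcmp D (erefl (a ;; b))) t ;; rlft e (invm (eql (dcmp D (erefl (a ;; b))) t) ;; q) =
  eqr (dcmp D e') t ;; rlft (erefl c) (invm (eql (dcmp D e') t) ;; q).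
Proof. by case: c / e e' w q => e' w q; rewrite (eq_irrelevance e' erefl). Qed.

Section Coh.
Variables (i j k : I) (a : hom i j) (b : hom j k) (c : hom i k) (e : a ;; b = c).
Variables (x : dmap D a) (y : dmap D b) (m : rp k) (f : hom (rleg _ x) (lleg _ y))
    (g : hom (rleg _ y) (lleg (rp k) m)).
Let s : rp i := gx (rp_act a) (f ;; eql (rp_act b) (glue y m g)).
Let t : rp i := gx (rp_act c) (invm (eqr (dcmp D e) (glue x y f)) ;; g).
(** The left-leg equation leaves no choice: it is solved for this arrow. *)
Definition rp_coh : hom s t :=
  @rp_arr i s t (etrans (cmpA a b (projT1 m)) (congr1 (fun c => c ;; projT1 m) e))
    (invm (eql (rp_act a) (glue x _ (f ;; eql (rp_act b) (glue y m g))))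
     ;; (eql (dcmp D e) (glue x y f) ;; eql (rp_act c) (glue _ m (invm (eqr (dcmp D e) (glue x y f)) ;; g)))).
Lemma rp_coh_l :
  eql (rp_act a) (glue x _ (f ;; eql (rp_act b) (glue y m g))) ;; fmap (lleg _) rp_coh =
  eql (dcmp D e) (glue x y f) ;; eql (rp_act c) (glue _ m (invm (eqr (dcmp D e) (glue x y f)) ;; g)).
Proof. exact: cmpKV. Qed.
End Coh.

(** After a ;; (b ;; d) has been exchanged for a ;; b ;; d, the cell has the left leg of the inverse
    of [dassoc], by [sil]. Left legs determine arrows here, so the right leg is read off from
    [sir]. *)
Lemma rp_coh_r i j k (a : hom i j) (b : hom j k) (c : hom i k) (e : a ;; b = c)
    (x : dmap D a) (y : dmap D b) (m : rp k) (f : hom (rleg _ x) (lleg _ y))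
    (g : hom (rleg _ y) (lleg (rp k) m)) :
  eqr (rp_act b) (glue y m g) ;; eqr (rp_act a) (glue x _ (f ;; eql (rp_act b) (glue y m g)))
    ;; fmap (rleg _) (rp_coh e f g) =
  eqr (rp_act c) (glue _ m (invm (eqr (dcmp D e) (glue x y f)) ;; g)).
Proof.
subst c; case: m g => d z g0; pose g : hom (rleg _ y) (lleg (dmap D d) z) := g0.
pose xy := dcmp D (erefl (a ;; b)) (glue x y f).
pose yz := dcmp D (erefl (b ;; d)) (glue y z g).
pose f2 : hom (rleg _ x) (lleg _ yz) := f ;; eql (dcmp D (erefl (b ;; d))) (glue y z g).
pose g2 : hom (rleg _ xy) (lleg _ z) := invm (eqr (dcmp D (erefl (a ;; b))) (glue x y f)) ;; g.
pose w := dcmp D (erefl (a ;; b ;; d)) (glue xy z g2).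
have S : idm _ ;; (idm _ ;; eql (dcmp D (cmpA a b d)) (glue x yz f2)) =
   eql (dcmp D (erefl (a ;; b))) (glue x y f) ;; eql (dcmp D (erefl (a ;; b ;; d))) (glue xy z g2)
    ;; fmap (lleg _) (dassoc D a b d (glue (glue x y f) z g)) :=
  esym (sil (dassoc D a b d) (glue (glue x y f) z g)).
have R : idm _ ;; eqr (dcmp D (erefl (a ;; b ;; d))) (glue xy z g2)
    ;; fmap (rleg _) (dassoc D a b d (glue (glue x y f) z g)) =
   idm _ ;; (eqr (dcmp D (erefl (b ;; d))) (glue y z g) ;; eqr (dcmp D (cmpA a b d)) (glue x yz f2)) :=
  sir (dassoc D a b d) (glue (glue x y f) z g).
rewrite !cmp1f in S; rewrite !cmp1f in R.
pose E : a ;; (b ;; d) = a ;; b ;; d := rp_eq (rp_coh (erefl (a ;; b)) f (g : hom _ (lleg (rp k) (rp_pt z)))).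
pose q := eql (dcmp D (erefl (a ;; b))) (glue x y f) ;; eql (dcmp D (erefl (a ;; b ;; d))) (glue xy z g2).
have Q : invm (eql (dcmp D (cmpA a b d)) (glue x yz f2)) ;; q =
    fmap (lleg _) (invm (dassoc D a b d (glue (glue x y f) z g))).
  by rewrite S fmapV; apply: (@cmpI _ _ _ _ (q ;; fmap (lleg _) (dassoc D a b d (glue (glue x y f) z g))));
     rewrite cmpKV cmpK.
have L : eqr (dcmp D (erefl (b ;; d))) (glue y z g) ;;
    eqr (dcmp D (erefl (a ;; (b ;; d)))) (glue x yz f2) ;;
    rlft E (invm (eql (dcmp D (erefl (a ;; (b ;; d)))) (glue x yz f2)) ;; q) =
    eqr (dcmp D (erefl (a ;; b ;; d))) (glue xy z g2).
  rewrite -(@cmpA (D i0)) (@rlft_triangle _ _ a (b ;; d) _ E (cmpA a b d) (glue x yz f2) w q) Q.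
  by rewrite rlftE fmapV (@cmpA (D i0)) -R cmpK.
exact: L.
Qed.

Definition rp_data : cocone_data D (D i0).
Proof.
apply: (@build_cocone_data I D (D i0) rp rp_act rp_coh _ _ rp_coh_r) =>
  [i j k a b c e x x' y y' m m' f f' g g' u v w euv evw e3 e4|]; last exact: rp_coh_l.
apply: rp_faithful; apply: etrans (fmapM (lleg (rp i)) _ _) (etrans _ (esym (fmapM (lleg (rp i)) _ _))).
apply: (cmp_square (gm_l (rp_act a) e3) (rp_coh_l e f' g') (rp_coh_l e f g)).
by rewrite -cmpA (gm_l (rp_act c) e4) !cmpA (gm_l (dcmp D e) euv).
Defined.

Definition represented : cocone D (D i0) := Cocone (cocone_law_faithful (X := rp_data) rp_faithful).
End Represented.

Definition hom_iset (I : gpd) (i0 : I) : iset I :=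
  @ISet I (fun i => hom i i0) (fun i j a b => a ;; b) (fun _ b => cmp1f b)
    (fun _ _ _ a b c => esym (cmpA a b c)).

Lemma cmp_square_inv (G : gpd) (p q r s t : G) (A : hom p q) (P : hom q r) (B : hom p s) (E : hom s r)
    (c2 : hom q t) (h : hom p t) (h1 : hom s t) :
  A ;; P = B ;; E -> A ;; c2 = h -> B ;; h1 = h -> c2 ;; idm t = P ;; (invm E ;; h1).
Proof.
move=> e1 e2 e3; rewrite cmpf1; apply: (@cmpI _ _ _ _ A).
by rewrite e2 cmpA e1 -cmpA cmpKV.
Qed.

Lemma cmp_hexagon (G : gpd) (p q r s t u : G) (C : hom p q) (P : hom q r) (A : hom r s)
    (B : hom p t) (R : hom t s) (Q : hom t u) (H : hom u r) (A' : hom s r) (B' : hom t p) :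
  Q ;; H = R ;; A' -> C ;; P ;; A = B ;; R -> A ;; A' = idm r -> B ;; B' = idm p ->
  H ;; invm P = invm Q ;; B' ;; C.
Proof.
move=> e1 e2 eA eB; have -> : B' = invm B by rewrite (cmpVE eB) cmpf1.
have eR : R = invm B ;; (C ;; P ;; A) by rewrite e2 cmpVK.
rewrite (cmpVE e1) eR -!cmpA; congr (_ ;; (_ ;; _)).
by rewrite (cmpA A) eA cmp1f cmpfV cmpf1.
Qed.

Lemma gm_cancel (S T U : pgpd) (M : span S T) (N : span T U) (H : gpd) (Q : functor (M ** N) H)
    m m' n n' (f : hom (rleg M m) (lleg N n)) (f' : hom (rleg M m') (lleg N n'))
    (u : hom m m') (v : hom n n') (u' : hom m' m) (v' : hom n' n)
    (e : f ;; fmap (lleg N) v = fmap (rleg M) u ;; f')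
    (e' : f' ;; fmap (lleg N) v' = fmap (rleg M) u' ;; f) :
  u ;; u' = idm m -> v ;; v' = idm n -> gm Q e ;; gm Q e' = idm (gx Q f).
Proof. by move=> eu ev; rewrite gmM -(gm1 Q (gm_eqP (erefl f))); apply: gm_ext. Qed.

Section HomFactor.
Variables (I : gpd) (D : diagram I) (C : pgpd) (X : cocone D C) (i0 : I).
Let Y := represented D i0.
Let Z := copies X (hom_iset i0).

(** The effect of [cact X] on arrows of the represented cocone: once the indices are identified, the
    arrow of left legs is lifted to D a. *)
Definition hwm i (a b : hom i i0) (e : a = b) : forall (x : dmap D a) (y : dmap D b)
    (k : hom (lleg _ x) (lleg _ y)) (n n' : X i0) (v : hom n n')
    (h : hom (rleg _ x) (lleg _ n)) (h' : hom (rleg _ y) (lleg _ n')),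
    h ;; fmap (lleg _) v = rlft e k ;; h' -> hom (gx (cact X a) h) (gx (cact X b) h') :=
  match e in _ = b return forall (x : dmap D a) (y : dmap D b)
    (k : hom (lleg _ x) (lleg _ y)) (n n' : X i0) (v : hom n n')
    (h : hom (rleg _ x) (lleg _ n)) (h' : hom (rleg _ y) (lleg _ n')),
    h ;; fmap (lleg _) v = rlft e k ;; h' -> hom (gx (cact X a) h) (gx (cact X b) h') with
  | erefl => fun x y k n n' v h h' sq => @gm _ _ _ _ _ _ (cact X a) x y n n' h h' (lft k) v sq end.

Lemma hwmE i (a : hom i i0) (e : a = a) (x y : dmap D a) (k : hom (lleg _ x) (lleg _ y))
    (u : hom x y) (n n' : X i0) (v : hom n n') (h : hom (rleg _ x) (lleg _ n))
    (h' : hom (rleg _ y) (lleg _ n')) (sq : h ;; fmap (lleg _) v = rlft e k ;; h')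
    (sq' : h ;; fmap (lleg _) v = fmap (rleg _) u ;; h') :
  k = fmap (lleg _) u -> hwm sq = gm (cact X a) sq'.
Proof.
move=> ek; move: sq; rewrite (eq_irrelevance e erefl) => sq.
by apply: gm_ext => //; rewrite ek lftE.
Qed.

Lemma hwm_l i (a b : hom i i0) (e : a = b) (x : dmap D a) (y : dmap D b)
    (k : hom (lleg _ x) (lleg _ y)) (n n' : X i0) (v : hom n n')
    (h : hom (rleg _ x) (lleg _ n)) (h' : hom (rleg _ y) (lleg _ n'))
    (sq : h ;; fmap (lleg _) v = rlft e k ;; h') :
  eql (cact X a) (glue x n h) ;; fmap (lleg _) (hwm sq) = k ;; eql (cact X b) (glue y n' h').
Proof. by move: sq; subst b => sq; rewrite /= gm_l lftK. Qed.

Lemma hwm_r i (a b : hom i i0) (e : a = b) (x : dmap D a) (y : dmap D b)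
    (k : hom (lleg _ x) (lleg _ y)) (n n' : X i0) (v : hom n n')
    (h : hom (rleg _ x) (lleg _ n)) (h' : hom (rleg _ y) (lleg _ n'))
    (sq : h ;; fmap (lleg _) v = rlft e k ;; h') :
  eqr (cact X a) (glue x n h) ;; fmap (rleg _) (hwm sq) =
  fmap (rleg _) v ;; eqr (cact X b) (glue y n' h').
Proof. by move: sq; subst b => sq; rewrite /= gm_r. Qed.

Lemma hwmM i (a b c : hom i i0) (e1 : a = b) (e2 : b = c) (e3 : a = c) (x : dmap D a) (y : dmap D b)
    (z : dmap D c) (k : hom (lleg _ x) (lleg _ y)) (l : hom (lleg _ y) (lleg _ z))
    (n n' n'' : X i0) (v : hom n n') (v' : hom n' n'')
    (h : hom (rleg _ x) (lleg _ n)) (h' : hom (rleg _ y) (lleg _ n')) (h'' : hom (rleg _ z) (lleg _ n''))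
    (sq : h ;; fmap (lleg _) v = rlft e1 k ;; h') (sq' : h' ;; fmap (lleg _) v' = rlft e2 l ;; h'')
    (sq'' : h ;; fmap (lleg _) (v ;; v') = rlft e3 (k ;; l) ;; h'') :
  hwm sq'' = hwm sq ;; hwm sq'.
Proof.
move: sq sq' sq''; subst b c; rewrite (eq_irrelevance e3 erefl) => sq sq' sq''.
rewrite /= gmM; apply: gm_ext => //; apply: (eq_faithful (dmap_lleg_equivalence D a)).
by rewrite fmapM !lftK.
Qed.

Lemma hwm_inj i (a b : hom i i0) (e e' : a = b) (x : dmap D a) (y : dmap D b)
    (k k' : hom (lleg _ x) (lleg _ y)) (n n' : X i0) (v v' : hom n n')
    (h : hom (rleg _ x) (lleg _ n)) (h' : hom (rleg _ y) (lleg _ n'))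
    (sq : h ;; fmap (lleg _) v = rlft e k ;; h') (sq' : h ;; fmap (lleg _) v' = rlft e' k' ;; h') :
  hwm sq = hwm sq' -> k = k' /\ v = v'.
Proof.
move: sq sq'; subst b; rewrite (eq_irrelevance e' erefl) => sq sq' E.
have {}E := eq_faithful (eqFP (cact X a)) E.
split; last exact: (congr1 (fun q : hom (glue x n h : dmap D a ** X i0) (glue y n' h') => arr2 q) E).
rewrite -[k]lftK -[k']lftK; congr (fmap _ _).
exact: (congr1 (fun q : hom (glue x n h : dmap D a ** X i0) (glue y n' h') => arr1 q) E).
Qed.

Lemma hwm_full i (a b : hom i i0) (e : a = b) (x : dmap D a) (y : dmap D b) (n n' : X i0)
    (h : hom (rleg _ x) (lleg _ n)) (h' : hom (rleg _ y) (lleg _ n'))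
    (q : hom (gx (cact X a) h) (gx (cact X b) h')) :
  exists (k : hom (lleg _ x) (lleg _ y)) (v : hom n n'),
  exists sq : h ;; fmap (lleg _) v = rlft e k ;; h', hwm sq = q.
Proof.
subst b; have [f ef] := eq_full (eqFP (cact X a)) q.
have sq : h ;; fmap (lleg _) (arr2 f) = fmap (rleg _) (arr1 f) ;; h' := hphomP f.
have sq' : h ;; fmap (lleg _) (arr2 f) = rlft (erefl a) (fmap (lleg _) (arr1 f)) ;; h'.
  by rewrite /= lftE.
exists (fmap (lleg _) (arr1 f)), (arr2 f), sq'; rewrite -ef.
by congr (fmap _ _); apply: glue_ext => //=; rewrite lftE.
Qed.

Lemma hwm_irr i (a b : hom i i0) (e e' : a = b) (x : dmap D a) (y : dmap D b)
    (k : hom (lleg _ x) (lleg _ y)) (n n' : X i0) (v : hom n n')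
    (h : hom (rleg _ x) (lleg _ n)) (h' : hom (rleg _ y) (lleg _ n'))
    (sq : h ;; fmap (lleg _) v = rlft e k ;; h') (sq' : h ;; fmap (lleg _) v = rlft e' k ;; h') :
  hwm sq = hwm sq'.
Proof.
by move: sq sq'; rewrite (eq_irrelevance e' e) => sq sq'; rewrite (eq_irrelevance sq' sq).
Qed.

Section W.
Variable i : I.
Let M := Y i ** X i0.
(** For each a : i -> i0, [cact X a] identifies D a glued to X i0 with X i; summing over a gives one
    copy of X i for each element of hom(i, i0). *)
Definition hw_ob (s : M) : Z i := (projT1 (hp1 s), @gx _ _ _ _ _ _ (cact X (projT1 (hp1 s))) (projT2 (hp1 s)) (hp2 s) (hpm s)).
Definition hw_map (s t : M) (f : hom s t) : hom (hw_ob s) (hw_ob t) :=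
  (disc_arr (rp_eq (arr1 f)), hwm (e := rp_eq (arr1 f)) (k := val (arr1 f)) (hphomP f)).
Lemma hw_map1 s : hw_map (idm s) = idm (hw_ob s).
Proof.
congr (_, _); first exact: disc_hom_uniq.
have L : idm (lleg (Y i) (hp1 s)) = fmap (lleg (dmap D _)) (idm (projT2 (hp1 s))) by rewrite fmap1.
have sq : hpm s ;; fmap (lleg _) (idm _) = fmap (rleg (dmap D _)) (idm (projT2 (hp1 s))) ;; hpm s.
  by rewrite !fmap1 cmpf1 cmp1f.
by rewrite (hwmE _ sq L); exact: gm1.
Qed.
Lemma hw_mapM r s t (f : hom r s) (g : hom s t) : hw_map (f ;; g) = hw_map f ;; hw_map g.
Proof. by congr (_, _); [exact: disc_hom_uniq | exact: hwmM]. Qed.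
Definition hw_functor : functor M (Z i) := Functor hw_map1 hw_mapM.
Lemma hw_faithful (s t : M) : injective (@hw_map s t).
Proof.
move=> f g e.
have E : hwm (e := rp_eq (arr1 f)) (k := val (arr1 f)) (v := arr2 f) (hphomP f) =
  hwm (e := rp_eq (arr1 g)) (k := val (arr1 g)) (v := arr2 g) (hphomP g) := congr1 snd e.
have [e1 e2] := hwm_inj E; by apply: glue_ext => //; apply: val_inj.
Qed.
Lemma hw_full_at (a b : hom i i0) (e : a = b) (x : dmap D a) (y : dmap D b) (n n' : X i0)
    (h : hom (rleg _ x) (lleg _ n)) (h' : hom (rleg _ y) (lleg _ n'))
    (s := @glue _ _ _ (Y i) (X i0) (rp_pt x) n h) (t := @glue _ _ _ (Y i) (X i0) (rp_pt y) n' h')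
    (g1 : disc_hom a b) (q : hom (gx (cact X a) h) (gx (cact X b) h')) :
  exists f : hom s t, hw_map f = (g1, q).
Proof.
have [k [v [sq eq]]] := hwm_full e q.
pose f1 : rp_hom (rp_pt x) (rp_pt y) := @rp_arr _ _ _ _ (rp_pt x) (rp_pt y) e k.
have sq' : h ;; fmap (lleg (X i0)) v = rlft (rp_eq f1) k ;; h'.
  by rewrite sq (eq_irrelevance (rp_eq f1) e).
exists (@garr _ _ _ (Y i) (X i0) s t f1 v sq').
by congr (_, _); [exact: disc_hom_uniq | rewrite -eq; exact: hwm_irr].
Qed.
Lemma hw_full (s t : M) (g : hom (hw_ob s) (hw_ob t)) : exists f : hom s t, hw_map f = g.
Proof.
case: s t g => [[a x] n h] [[b y] n' h'] [g1 q].
exact: (@hw_full_at a b (disc_homP g1) x y n n' h h' g1 q).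
Qed.
Lemma hw_esurj (y : Z i) : exists s : M, inhabited (hom (hw_ob s) y).
Proof.
case: y => a z; have [t [f]] := eq_esurj (eqFP (cact X a)) z.
exists (@glue _ _ _ (Y i) (X i0) (rp_pt (hp1 t)) (hp2 t) (hpm t)); split.
by case: t f => x y h f; exact: (disc_arr (erefl a), f).
Qed.
Lemma hw_equivalence : equivalence hw_functor.
Proof. by split; [exact: hw_faithful | exact: hw_full | exact: hw_esurj]. Qed.
Definition hw_el (s : M) : hom (lleg M s) (lleg (Z i) (hw_ob s)) :=
  eql (cact X (projT1 (hp1 s))) (@glue _ _ _ (dmap D _) (X i0) (projT2 (hp1 s)) (hp2 s) (hpm s)).
Definition hw_er (s : M) : hom (rleg M s) (rleg (Z i) (hw_ob s)) :=
  eqr (cact X (projT1 (hp1 s))) (@glue _ _ _ (dmap D _) (X i0) (projT2 (hp1 s)) (hp2 s) (hpm s)).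
Lemma hw_l_law (s t : M) (f : hom s t) :
  fmap (lleg M) f ;; hw_el t = hw_el s ;; fmap (fcomp hw_functor (lleg (Z i))) f.
Proof. exact: esym (hwm_l (e := rp_eq (arr1 f)) (k := val (arr1 f)) (hphomP f)). Qed.
Lemma hw_r_law (s t : M) (f : hom s t) :
  fmap (rleg M) f ;; hw_er t = hw_er s ;; fmap (fcomp hw_functor (rleg (Z i))) f.
Proof. exact: esym (hwm_r (e := rp_eq (arr1 f)) (k := val (arr1 f)) (hphomP f)). Qed.
Definition hw_l : natiso (lleg M) (fcomp hw_functor (lleg (Z i))) :=
  @Natiso _ _ (lleg M) (fcomp hw_functor (lleg (Z i))) hw_el hw_l_law.
Definition hw_r : natiso (rleg M) (fcomp hw_functor (rleg (Z i))) :=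
  @Natiso _ _ (rleg M) (fcomp hw_functor (rleg (Z i))) hw_er hw_r_law.
Definition hw : sequiv M (Z i) :=
  @SEquiv _ _ M (Z i) hw_functor hw_equivalence hw_l hw_r
    (fun s => eqs (cact X (projT1 (hp1 s))) (@glue _ _ _ (dmap D _) (X i0) (projT2 (hp1 s)) (hp2 s) (hpm s))).
End W.

Lemma inv_natural (G : gpd) (p q r s : G) (A : hom p q) (B : hom q s) (B' : hom p r) (A' : hom r s) :
  A ;; B = B' ;; A' -> A' ;; invm B = invm B' ;; A.
Proof. by move=> /cmpEV ->; rewrite -cmpA cmpVK. Qed.

Definition hc i j (a : hom i j) (b : hom j i0) (x : dmap D a) (y : dmap D b) (n : X i0)
    (f : hom (rleg _ x) (lleg _ y)) (h : hom (rleg _ y) (lleg _ n)) :=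
  ccoh X (erefl (a ;; b)) (glue (glue x y f) n h).

Lemma hom_natural i j (a : hom i j) (b b' : hom j i0) (x x' : dmap D a) (y : dmap D b) (y' : dmap D b')
    (n n' : X i0) (f : hom (rleg _ x) (lleg _ y)) (f' : hom (rleg _ x') (lleg _ y'))
    (h : hom (rleg _ y) (lleg _ n)) (h' : hom (rleg _ y') (lleg _ n'))
    (u : hom x x') (e : b = b') (e' : a ;; b = a ;; b') (k : hom (lleg _ y) (lleg _ y')) (s : hom n n')
    (p : hom (lleg _ (dcmp D (erefl (a ;; b)) (glue x y f)))
             (lleg _ (dcmp D (erefl (a ;; b')) (glue x' y' f'))))
    (ep0 : p = invm (eql (dcmp D (erefl (a ;; b))) (glue x y f)) ;; fmap (lleg _) u
            ;; eql (dcmp D (erefl (a ;; b'))) (glue x' y' f'))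
    (euv : f ;; k = fmap (rleg _) u ;; f')
    (evs : h ;; fmap (lleg _) s = rlft e k ;; h')
    (e3 : invm (eqr (dcmp D (erefl (a ;; b))) (glue x y f)) ;; h ;; fmap (lleg _) s =
      rlft e' p ;; (invm (eqr (dcmp D (erefl (a ;; b'))) (glue x' y' f')) ;; h'))
    (e4 : f ;; eql (cact X b) (glue y n h) ;; fmap (lleg _) (hwm evs) =
          fmap (rleg _) u ;; (f' ;; eql (cact X b') (glue y' n' h'))) :
  hwm e3 ;; invm (hc f' h') = invm (hc f h) ;; gm (cact X a) e4.
Proof.
move: e' p ep0 euv evs e3 e4; subst b' => e' p ep0 euv.
have euv' : f ;; fmap (lleg _) (lft k) = fmap (rleg _) u ;; f' by rewrite lftK.
have ep : p = fmap (lleg _) (gm (dcmp D (erefl (a ;; b))) euv').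
  apply: (@cmpI _ _ _ _ (eql (dcmp D (erefl (a ;; b))) (glue x y f))).
  by rewrite gm_l ep0 -cmpA cmpKV.
move=> evs e3 e4.
have e3' : invm (eqr (dcmp D (erefl (a ;; b))) (glue x y f)) ;; h ;; fmap (lleg _) s =
      fmap (rleg _) (gm (dcmp D (erefl (a ;; b))) euv') ;;
      (invm (eqr (dcmp D (erefl (a ;; b))) (glue x' y' f')) ;; h').
  by rewrite e3 ep rlftE.
rewrite (hwmE e3 e3' ep).
have := @co_natural_sq I D C X i j i0 a b _ (erefl (a ;; b)) x x' y y' n n' f f' h h' _ _ _ _
  (erefl _) (erefl _) (cmpKV _ h) (cmpKV _ h') u (lft k) s euv' evs e4 e3'.
by rewrite !co_strict => /inv_natural; apply.
Qed.

Lemma hc_l i j (a : hom i j) (b : hom j i0) (x : dmap D a) (y : dmap D b) (n : X i0)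
    (f : hom (rleg _ x) (lleg _ y)) (h : hom (rleg _ y) (lleg _ n)) :
  eql (dcmp D (erefl (a ;; b))) (glue x y f)
    ;; eql (cact X (a ;; b)) (glue _ n (invm (eqr (dcmp D (erefl (a ;; b))) (glue x y f)) ;; h))
    ;; fmap (lleg _) (invm (hc f h)) =
  eql (cact X a) (glue x _ (f ;; eql (cact X b) (glue y n h))).
Proof.
have := co_l (X := X) (erefl _) (cmpKV (eqr (dcmp D (erefl (a ;; b))) (glue x y f)) h).
by rewrite co_strict fmapV => /cmpEV.
Qed.

Lemma hc_r i j (a : hom i j) (b : hom j i0) (x : dmap D a) (y : dmap D b) (n : X i0)
    (f : hom (rleg _ x) (lleg _ y)) (h : hom (rleg _ y) (lleg _ n)) :
  eqr (cact X (a ;; b)) (glue _ n (invm (eqr (dcmp D (erefl (a ;; b))) (glue x y f)) ;; h))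
    ;; fmap (rleg _) (invm (hc f h)) =
  eqr (cact X b) (glue y n h) ;; eqr (cact X a) (glue x _ (f ;; eql (cact X b) (glue y n h))).
Proof.
have := co_r (X := X) (erefl _) (cmpKV (eqr (dcmp D (erefl (a ;; b))) (glue x y f)) h).
by rewrite co_strict fmapV => /cmpEV.
Qed.

Definition hom_data : factor_data Y Z.
Proof.
apply: (@build_factor_data I D _ _ Y Z (X i0) hw
  (fun i j a x m n f h => (disc_arr (erefl (a ;; projT1 m)),
    invm (@hc i j a (projT1 m) x (projT2 m) n f h)))) =>
  [i j a x x' m m' n n' f h f' h' u v s euv evs e3 e4|i j a x m n f h|i j a x m n f h].
- apply: injective_projections; first exact: disc_hom_uniq.
  have L0 : (gm (hw j) evs).2 = hwm (e := rp_eq v) (k := val v) evs := hwm_irr _ _.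
  have e4' : f ;; eql (cact X (projT1 m)) (@glue _ _ _ (dmap D _) (X i0) (projT2 m) n h)
      ;; fmap (lleg (X j)) (hwm (e := rp_eq v) (k := val v) evs) =
    fmap (rleg _) u ;; (f' ;; eql (cact X (projT1 m')) (@glue _ _ _ (dmap D _) (X i0) (projT2 m') n' h')).
    by rewrite -L0; exact: e4.
  have L1 : (gm (hw i) e3).2 = hwm (e := rp_eq (gm (rp_act D i0 a) euv))
    (k := val (gm (rp_act D i0 a) euv)) e3 := hwm_irr _ _.
  have L2 : (gm (cact Z a) e4).2 = gm (cact X a) e4'.
    by congr (fmap _ _); apply: glue_ext => //; exact: L0.
  have E := @hom_natural i j a _ _ x x' (projT2 m) (projT2 m') n n' f f' h h' u (rp_eq v)
    (rp_eq (gm (rp_act D i0 a) euv)) (val v) s _ erefl euv evs e3 e4'.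
  by rewrite -L1 -L2 in E; exact: E.
- exact: (@hc_l i j a _ x (projT2 m) n f h).
- exact: (@hc_r i j a _ x (projT2 m) n f h).
Defined.

Lemma hom_nt2 i j (a : hom i j) (x : dmap D a) (m : Y j) (n : X i0)
    (f : hom (rleg _ x) (lleg _ m)) (h : hom (rleg _ m) (lleg _ n))
    (c : hom (rleg _ (gx (cact Y a) f)) (lleg _ n))
    (f' : hom (rleg _ x) (lleg _ (gx (fw hom_data j) h)))
    (e1 : eqr (cact Y a) (glue x m f) ;; c = h)
    (e2 : f ;; eql (fw hom_data j) (glue m n h) = f') :
  (@nt I D _ _ Y Z hom_data i j a x m n f h c f' e1 e2).2 =
  invm (@co I D C X i j i0 a (projT1 m) _ erefl x (projT2 m) n f h f' c e2 e1).
Proof.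
have Ec := cmpVE e1; move: e1 e2; subst c => e1 e2; subst f'.
by rewrite (co_strict (X := X)) nt_strict.
Qed.

(** A reindexing along e after the strict cell can be traded for the cell along e'. In [hom_law]
    this settles the mismatch between a ;; (b ;; d) and a ;; b ;; d. *)
Lemma hwm_triangle i j (a : hom i j) (b : hom j i0) (c : hom i i0) (e e' : a ;; b = c)
    (x : dmap D a) (y : dmap D b) (n n' : X i0) (f : hom (rleg _ x) (lleg _ y))
    (h : hom (rleg _ y) (lleg _ n)) (f1 : hom (rleg _ x) (lleg _ (gx (cact X b) h)))
    (c1 : hom (rleg _ (dcmp D (erefl (a ;; b)) (glue x y f))) (lleg _ n))
    (c2 : hom (rleg _ (dcmp D e' (glue x y f))) (lleg _ n))
    (e1 : f ;; eql (cact X b) (glue y n h) = f1)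
    (ec1 : eqr (dcmp D (erefl (a ;; b))) (glue x y f) ;; c1 = h)
    (ec2 : eqr (dcmp D e') (glue x y f) ;; c2 = h)
    (w : dmap D c) (h' : hom (rleg _ w) (lleg _ n')) (v : hom n n')
    (q : hom (lleg _ x) (lleg _ w))
    (k1 : hom (lleg _ (dcmp D (erefl (a ;; b)) (glue x y f))) (lleg _ w))
    (k2 : hom (lleg _ (dcmp D e' (glue x y f))) (lleg _ w))
    (ek1 : eql (dcmp D (erefl (a ;; b))) (glue x y f) ;; k1 = q)
    (ek2 : eql (dcmp D e') (glue x y f) ;; k2 = q)
    (sq1 : c1 ;; fmap (lleg _) v = rlft e k1 ;; h')
    (sq2 : c2 ;; fmap (lleg _) v = rlft erefl k2 ;; h') :
  co e1 ec1 ;; hwm sq1 = co e1 ec2 ;; hwm sq2.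
Proof.
case: c / e e' c2 ec2 w h' q k1 k2 ek1 ek2 sq1 sq2 => e'; rewrite (eq_irrelevance e' erefl).
move=> c2 ec2 w h' q k1 k2 ek1 ek2.
have Ec : c2 = c1 by rewrite (cmpVE ec2) (cmpVE ec1).
have Ek : k2 = k1 by rewrite (cmpVE ek2) (cmpVE ek1).
move: ec2 {ek2}; subst c2 k2 => ec2 sq1 sq2.
by rewrite (eq_irrelevance ec2 ec1) (eq_irrelevance sq2 sq1).
Qed.

(** The second components of the cells are inverses of coherence cells of X. The law is thus the
    cocone law of X for a, b and the index d of m, solved for these inverses by [cmp_hexagon]. *)
Lemma hom_law : factor_law hom_data.
Proof.
apply/factor_lawP => i j k a b x y m n f g h f1 g1 h1 c1 c2 f1' g' g1' f2.
move=> ef1 eg1 eh1 ec1 ec2 ef1' eg' eg1' ef2 eg1'' e1 e2.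
apply: injective_projections; first exact: disc_hom_uniq.
have Eg1 := cmpVE eg1.
move: ef1 eg1 eh1 ec1 ec2 ef1' eg' eg1' ef2 eg1'' e1 e2; subst g1 => ef1; subst f1.
move=> eg1 eh1 ec1 ec2 ef1' eg' eg1' ef2 eg1'' e1 e2.
pose d := projT1 m; pose z : dmap D d := projT2 m.
pose gz : hom (rleg _ y) (lleg (dmap D d) z) := g.
pose hz : hom (rleg (dmap D d) z) (lleg (X i0) n) := h.
pose xy := dcmp D (erefl (a ;; b)) (glue x y f).
pose yz := dcmp D (erefl (b ;; d)) (glue y z gz).
pose f3 : hom (rleg _ x) (lleg _ yz) := f ;; eql (dcmp D (erefl (b ;; d))) (glue y z gz).
pose g3 : hom (rleg _ xy) (lleg _ z) := invm (eqr (dcmp D (erefl (a ;; b))) (glue x y f)) ;; gz.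
pose w := dcmp D (erefl (a ;; b ;; d)) (glue xy z g3).
pose p := dassoc D a b d (glue (glue x y f) z gz).
pose h3 : hom (rleg _ (dcmp D (cmpA a b d) (glue x yz f3))) (lleg (X i0) n) :=
  invm (eqr (dcmp D (cmpA a b d)) (glue x yz f3)) ;; h1.
have S : eql (dcmp D (erefl (a ;; b))) (glue x y f) ;; eql (dcmp D (erefl (a ;; b ;; d))) (glue xy z g3)
    ;; fmap (lleg _) p = eql (dcmp D (cmpA a b d)) (glue x yz f3).
  apply: etrans (sil (dassoc D a b d) (glue (glue x y f) z gz)) _.
  exact: etrans (cmp1f _) (cmp1f _).
have R : eqr (dcmp D (erefl (a ;; b ;; d))) (glue xy z g3) ;; fmap (rleg _) p =
   eqr (dcmp D (erefl (b ;; d))) (glue y z gz) ;; eqr (dcmp D (cmpA a b d)) (glue x yz f3).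
  have T : idm _ ;; eqr (dcmp D (erefl (a ;; b ;; d))) (glue xy z g3) ;; fmap (rleg _) p =
    idm _ ;; (eqr (dcmp D (erefl (b ;; d))) (glue y z gz) ;; eqr (dcmp D (cmpA a b d)) (glue x yz f3)).
    exact: (sir (dassoc D a b d) (glue (glue x y f) z gz)).
  by rewrite !cmp1f in T.
have q1 : c2 ;; fmap (lleg (X i0)) (idm n) = fmap (rleg _) p ;; h3.
  by rewrite fmap1; exact: (cmp_square_inv R ec2 eh1).
pose E : a ;; (b ;; d) = a ;; b ;; d := rp_eq (co (erefl (f ;; eql (cact Y b) (glue y m g))) eg1).
pose kk := val (co (erefl (f ;; eql (cact Y b) (glue y m g))) eg1).
pose f1 : hom (rleg _ x) (lleg (Y j) (gx (cact Y b) g)) := f ;; eql (cact Y b) (glue y m g).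
pose Cbd := @co I D C X j k i0 b d _ erefl y z n g h g' h1 eg' eh1.
pose Cabd := @co I D C X i k i0 (a ;; b) d _ erefl xy z n g3 h g1' c2 eg1' ec2.
pose Ca_bd := @co I D C X i j i0 a (b ;; d) _ erefl x yz n f1 h1 f1' c1 ef1' ec1.
have N1 : (nt ec1 ef1').2 = invm Ca_bd := hom_nt2 ec1 ef1'.
have N2 : (nt ec2 eg1').2 = invm Cabd := hom_nt2 ec2 eg1'.
have Nb : (nt eh1 eg').2 = invm Cbd := hom_nt2 eh1 eg'.
have sq : c1 ;; fmap (lleg _) (idm n) = rlft E kk ;; c2 := e1.
have L1 : (gm (hw i) e1).2 = hwm sq := hwm_irr _ _.
pose f1x : hom (rleg _ x) (lleg (X j) (gx (cact X (b ;; d)) h1)) := f1'.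
pose f2x : hom (rleg _ x) (lleg (X j) (gx (cact X b) g')) := f2.
have e2b : f1x ;; fmap (lleg (X j)) (invm Cbd) = fmap (rleg _) (idm x) ;; f2x.
  by rewrite -Nb; exact: e2.
have e2' : f2x ;; fmap (lleg (X j)) Cbd = fmap (rleg _) (idm x) ;; f1x.
  by have := e2b; rewrite fmap1 !cmp1f => <-; rewrite fmapV cmpKr.
have L3 : (gm (cact Z a) e2).2 = gm (cact X a) e2b.
  by congr (fmap _ _); apply: glue_ext => //; exact: Nb.
pose Cab := @co I D C X i j k a b _ erefl x y _ f g' f2 g1' ef2 eg1''.
have L2 : _ = Cab := copies_co2 ef2 eg1''.
have eh3 : eqr (dcmp D (cmpA a b d)) (glue x yz f3) ;; h3 = h1 := cmpKV _ _.
pose CE := @co I D C X i j i0 a (b ;; d) _ (cmpA a b d) x yz n f3 h1 f1x h3 ef1' eh3.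
have LX : Cab ;; Cabd ;; gm (cact X (a ;; b ;; d)) q1 = gm (cact X a) e2' ;; CE :=
  (cocone_lawP X).1 (@claw _ _ _ X) i j k i0 a b d x y z n f gz hz g' f2x g1' c2 h1 f1x h3
    eg' ef2 eg1'' eg1' ec2 eh1 ef1' eh3 q1 e2'.
have k1 : eql (dcmp D (erefl (a ;; (b ;; d)))) (glue x yz f3) ;; kk =
    eql (dcmp D (erefl (a ;; b))) (glue x y f) ;; eql (dcmp D (erefl (a ;; b ;; d))) (glue xy z g3).
  exact: co_l (erefl (f ;; eql (cact Y b) (glue y m g))) eg1.
have k2 : eql (dcmp D (cmpA a b d)) (glue x yz f3) ;; fmap (lleg _) (invm p) =
    eql (dcmp D (erefl (a ;; b))) (glue x y f) ;; eql (dcmp D (erefl (a ;; b ;; d))) (glue xy z g3).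
  by rewrite fmapV -S cmpK.
have q2 : h3 ;; fmap (lleg _) (idm n) = fmap (rleg _) (invm p) ;; c2.
  by have := q1; rewrite !fmap1 !cmpf1 => ->; rewrite fmapV cmpVK.
have q3 : h3 ;; fmap (lleg _) (idm n) = rlft erefl (fmap (lleg _) (invm p)) ;; c2.
  by rewrite rlftE.
(* The reassociation inside the represented cocone becomes the cell of X along [cmpA a b d],
   corrected by the inverse of [dassoc]. *)
have T : Ca_bd ;; hwm sq = CE ;; gm (cact X (a ;; b ;; d)) q2.
  apply: etrans (@hwm_triangle i j a (b ;; d) _ E (cmpA a b d) x yz n n f3 h1 f1x c1 h3 ef1' ec1 eh3 w
    c2 (idm n) _ kk (fmap (lleg _) (invm p)) k1 k2 sq q3) _.
  by congr (_ ;; _); exact: hwmE.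
(* The cocone law contains the images of p and of [Cbd], the identity to be shown those of their
   inverses; these are mutually inverse. *)
have A1 := @gm_cancel _ _ _ _ _ _ (cact X (a ;; b ;; d)) _ _ _ _ _ _ p (idm n) (invm p) (idm n) q1 q2
  (cmpfV p) (cmp1f (idm n)).
have B1 := @gm_cancel _ _ _ _ _ _ (cact X a) _ _ _ _ _ _ (idm x) Cbd (idm x) (invm Cbd) e2' e2b
  (cmp1f (idm x)) (cmpfV Cbd).
have H := cmp_hexagon T LX A1 B1.
by rewrite -L1 -N2 -N1 -L3 in H; apply: etrans H _; exact: (congr1 (cmp _) (esym L2)).
Qed.
Definition hom_factor : factor Y Z := Factor hom_law.
End HomFactor.

(** * Preservation of homotopy sums *)

Lemma gsum_prod (G H : gpd) (w : gprod G H -> rat) : invariant w ->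
  gsum w = gsum (fun x : G => gsum (fun y : H => w (x, y))).
Proof.
move=> winv; apply/esym.
apply: (@gsum_uniq (gprod G H) (fun w => gsum (fun x : G => gsum (fun y : H => w (x, y))))) => //.
- by move=> v v' e; apply: eq_gsum => x; apply: eq_gsum => y.
- move=> L c v; under eq_gsum => x do rewrite gsum_sum.
  rewrite gsum_sum; apply: eq_bigr => s _; rewrite -gsumZ; apply: eq_gsum => x.
  exact: gsumZ.
case=> x0 y0; rewrite -[RHS](gsum_card_hom x0); apply: eq_gsum => x.
transitivity (gsum (fun y : H => #|hom x0 x|%:R * #|hom y0 y|%:R : rat)).
  by apply: eq_gsum => y; rewrite card_prod natrM.
by rewrite gsumZ gsum_card_hom mulr1.
Qed.

(** An arrow b : j -> projT1 u is an arrow of the category of elements out of (j, v) for exactly one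
    v, so the integral is a sum over v of integrals equal to 1. *)
Lemma gsum_elts (I : gpd) (t : iset I) (j : I) :
  gsum (fun u : elts t => #|hom j (projT1 u)|%:R) = #|t j|%:R.
Proof.
transitivity (gsum (fun u : elts t => \sum_(v : t j) #|hom (existT (fun j => t j : Type) j v : elts t) u|%:R)).
  apply: eq_gsum => u; rewrite -natr_sum; congr (_%:R).
  rewrite -sum1_card (partition_big (fun b : hom j (projT1 u) => iact t b (projT2 u)) xpredT) //=.
  by apply: eq_bigr => v _; rewrite sum1_card card_sig.
rewrite gsum_sum; under eq_bigr do rewrite gsum_card_hom.
by rewrite sumr_const.
Qed.

Lemma entry_counting (I : gpd) (t : iset I) (C : pgpd) (s : prodp C I) (c : C) :
  entry (counting t C) s c = #|t s.2|%:R * entry (span_id C) s.1 c.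
Proof.
rewrite {1}/entry gsum_prod; last exact: (@entry_at_invariant _ _ (counting t C)).
rewrite /entry -gsumZ; apply: eq_gsum => x.
rewrite -gsum_elts -gsumZr; apply: eq_gsum => u.
rewrite /entry_at /= -(pair_bigA _ (fun (a : hom s.1 x) (_ : hom s.2 (projT1 u)) =>
  \sum_(b : hom x c) (-1) ^+ (par a (+) false (+) par b))) /=.
rewrite mulr_sumr; apply: eq_bigr => a _.
by rewrite sumr_const mulr_natl.
Qed.

(** No arrow joins points with different indices, so the apex splits as a sum over a; within a
    summand [lft] identifies the hom sets with those of D a. *)
Lemma gsum_rp (I : gpd) (D : diagram I) (i0 i : I) (w : rp D i0 i -> rat) : invariant w ->
  gsum w = \sum_(a : hom i i0) gsum (fun x : dmap D a => w (rp_pt x)).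
Proof.
move=> winv; apply/esym.
apply: (@gsum_uniq (rp D i0 i) (fun w => \sum_(a : hom i i0) gsum (fun x : dmap D a => w (rp_pt x)))) => //.
- by move=> v v' e; apply: eq_bigr => a _; apply: eq_gsum => x.
- move=> L c v; under eq_bigr => a _ do rewrite gsum_sum.
  rewrite exchange_big; apply: eq_bigr => s _; rewrite mulr_sumr; apply: eq_bigr => a _.
  exact: gsumZ.
case=> b y; rewrite (bigD1 b) //= big1 ?addr0 => [|a ab].
  rewrite -[RHS](gsum_card_hom y); apply: eq_gsum => x; congr (_%:R).
  rewrite card_sig /= eqxx; apply/esym.
  apply: (@bij_eq_card _ _ (@fmap _ _ (lleg (dmap D b)) y x)).
  by exists (@lft _ _ _ _ _ _ _); [exact: lftE | exact: lftK].
rewrite -[RHS](mul0r (gsum (fun _ : dmap D a => 0))) -gsumZ; apply: eq_gsum => x.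
rewrite mul0r card_sig eq_card0 // => k; rewrite !inE /=.
by rewrite eq_sym (negbTE ab).
Qed.

Lemma entry_rp (I : gpd) (D : diagram I) (i0 i : I) s t :
  entry (rp D i0 i) s t = \sum_(a : hom i i0) entry (dmap D a) s t.
Proof. by rewrite {1}/entry gsum_rp //; exact: entry_at_invariant. Qed.

Lemma cardinality_sum (S T : pgpd) (M : span S T) (J : Type) (r : seq J) (P : pred J)
    (c : J -> rat) (N : J -> span S T) :
  (forall s t, entry M s t = \sum_(j <- r | P j) c j * entry (N j) s t) ->
  vmap cardinality M = \sum_(j <- r | P j) c j *: vmap cardinality (N j).
Proof.
move=> MN; have E : card_mx M = \sum_(j <- r | P j) c j *: card_mx (N j).
  apply/matrixP=> k l; rewrite summxE card_mxE MN mulr_suml; apply: eq_bigr => j _.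
  by rewrite mxE card_mxE mulrA.
apply/lfunP=> v; rewrite sum_lfunE lfunE /= E mulmx_sumr; apply: eq_bigr => j _.
by rewrite scale_lfunE lfunE /= scalemxAr.
Qed.

Section Preserves.
Variables (I : gpd) (D : diagram I) (C : pgpd) (X : cocone D C).
Hypothesis colim : is_hocolim X.
Notation card := (vmap cardinality).

(** The two clauses say that the [P i0], averaged over I, are inverse to the [X i] after
    cardinality; they yield existence and uniqueness of the induced map respectively. *)
Lemma hocolim_decomposition :
  exists2 P : forall i0, span C (D i0),
    forall i i0, card (X i ** P i0) = \sum_(a : hom i i0) card (dmap D a)
    & \sum_(i0 <- skeleton I) #|hom i0 i0|%:R^-1 *: card (P i0 ** X i0) = \1%VF.
Proof.
have fC := functorial_cardinality.
have [[Phi] _ _] := colim (graded X).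
have inhP i0 : inhabited (factor X (represented D i0)) by have [] := colim (represented D i0).
pose P i0 := ClassicalEpsilon.epsilon (inhP i0) (fun _ => True).
have same T (Y : cocone D T) (F G : factor X Y) : card F = card G.
  by have [_ /(_ F G)[m] _] := colim Y; exact: (vmap_equiv fC (fmu m)).
exists (fun i0 => fmed (P i0)) => [i i0|].
  rewrite (vmap_equiv fC (fw (P i0) i)).
  under [RHS]eq_bigr do rewrite -[card _]scale1r.
  apply: cardinality_sum => s t; rewrite entry_rp.
  by apply: eq_bigr => a _; rewrite mul1r.
(* With the identity and every P i0 ** X i0 rewritten through Phi, the common factor Phi splits off
   and only the counting spans remain to be compared. *)
rewrite -(vmap_id fC); rewrite -(same _ _ (comp_factor Phi (counting_factor (one_iset I) X)) (id_factor X)).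
rewrite [RHS](vmap_comp fC).
under eq_bigr => i0 _.
  rewrite (same _ _ (comp_factor (P i0) (hom_factor X i0)) (comp_factor Phi (counting_factor (hom_iset i0) X))).
  rewrite (vmap_comp fC) comp_lfunZl; over.
rewrite -comp_lfun_suml; congr (_ \o _)%VF; apply/esym.
apply: cardinality_sum => s c; rewrite entry_counting card_unit mul1r.
under eq_bigr do rewrite entry_counting mulrA.
rewrite -mulr_suml.
(* The groupoid of arrows out of the index s.2 is contractible, so its cardinality is 1. *)
transitivity (gsum (fun i0 => #|hom s.2 i0|%:R) * entry (span_id C) s.1 c).
  by rewrite gsum_card_hom mul1r.
by congr (_ * _); apply: eq_bigr => i0 _; rewrite mulrC.
Qed.
End Preserves.

Lemma preserves_cardinality : preserves_hosums cardinality.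
Proof.
move=> I D C X colim W g gD; have fC := functorial_cardinality.
have [P XP PX] := hocolim_decomposition colim.
exists (\sum_(i0 <- skeleton I) #|hom i0 i0|%:R^-1 *: (g i0 \o vmap cardinality (P i0))%VF).
split=> [i|h hX].
  (* By compatibility each a : i -> i0 contributes g i, so i0 contributes |hom i i0| / |Aut i0|
     times g i, and these weights sum to 1. *)
  rewrite comp_lfun_suml -[RHS](@skeleton_sum I _ (fun _ => g i) i) //.
  apply: eq_bigr => i0 _; rewrite -comp_lfunZl -comp_lfunA -(vmap_comp fC) XP comp_lfun_sumr.
  under eq_bigr do rewrite gD.
  by rewrite sumr_const -scaler_nat scalerA mulrC card_hom_sym.
(* Inserting the decomposition of the identity expresses h through its composites with the X i0,
   which are the g i0. *)
rewrite -[h]comp_lfun1r -PX comp_lfun_sumr; apply: eq_bigr => i0 _.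
by rewrite -comp_lfunZr (vmap_comp fC) comp_lfunA hX.
Qed.

Theorem proposition3p4p1 :
  [/\ functorial cardinality,
      preserves_hosums cardinality,
      triangle cardinality
    & forall F : prefunctor,
        functorial F -> preserves_hosums F -> triangle F ->
        naturally_isomorphic F cardinality].
Proof.
split; [exact: functorial_cardinality | exact: preserves_cardinality | exact: triangle_cardinality |].
move=> F fF pF tF; exact: good_naturally_isomorphic fF pF tF functorial_cardinality
  preserves_cardinality triangle_cardinality.
Qed.
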